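(* Let $T>0$, let $X_0=(\zeta_0,U_0,H_0,\bar r_0)\in\mathbf{E}$, and let $X\in\mathbf{C}([0,T],\mathbf{E})$ be the solution of the continuous Lagrangian 2CH system (C) with initial datum $X_0$. Suppose that for a sequence of grid steps $\Delta\xi\to0$ there are discrete initial data $Y_{\Delta\xi,0}\in\mathbf{E}_{\Delta\xi}$, which together with their associated kernels belong to $\mathcal{B}$, such that their interpolations $X_{\Delta,0}$ satisfy $$\lim_{\Delta\xi\to0}\|X_{\Delta,0}-X_0\|_{\mathbf{E}}=0.$$ Let $Y_{\Delta\xi}(t)=(\zeta,U,H,\bar r)(t)$, $t\in[0,T]$, be the corresponding components of the global solution of the semi-discrete system (S) with initial data $Y_{\Delta\xi,0}$, and let $X_\Delta\in\mathbf{C}([0,T],\mathbf{E})$ be the interpolation of $Y_{\Delta\xi}$. Then $X_\Delta$ converges to $X$ in $\mathbf{C}([0,T],\mathbf{E})$ as $\Delta\xi\to0$.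
   Context: Fix $\rho_\infty\ge0$. Continuous system (C). $\mathbf{V}=\{f\in\mathbf{C}_{\rm b}(\mathbb{R}):f_\xi\in\mathbf{L}^2(\mathbb{R})\}$ with $\|f\|_{\mathbf{V}}=\|f\|_{\mathbf{L}^\infty}+\|f_\xi\|_{\mathbf{L}^2}$; $\mathbf{E}=\mathbf{V}\times\mathbf{H}^1\times\mathbf{V}\times\mathbf{L}^2$ with $\|(\zeta,U,H,\bar r)\|_{\mathbf{E}}=\|\zeta\|_{\mathbf{V}}+\|U\|_{\mathbf{H}^1}+\|H\|_{\mathbf{V}}+\|\bar r\|_{\mathbf{L}^2}$. With $y(t,\xi)=\xi+\zeta(t,\xi)$ nondecreasing in $\xi$ and $r=\bar r+\rho_\infty y_\xi$, the system is $$y_t=U,\quad U_t=-Q,\quad H_t=-UR,\quad r_t=0$$ (equivalently $\zeta_t=U$, $\bar r_t=-\rho_\infty U_\xi$), where, with $g(\eta,\xi)=\frac12e^{-|y(\xi)-y(\eta)|}$ and $\kappa(\eta,\xi)=-\mathrm{sgn}(\xi-\eta)g(\eta,\xi)$, $$R(\xi)=\int_{\mathbb{R}}\kappa(\eta,\xi)UU_\xi(\eta)\,d\eta+\int_{\mathbb{R}}g(\eta,\xi)(H_\xi+\rho_\infty\bar r)(\eta)\,d\eta,\quad Q(\xi)=\int_{\mathbb{R}}g(\eta,\xi)UU_\xi(\eta)\,d\eta+\int_{\mathbb{R}}\kappa(\eta,\xi)(H_\xi+\rho_\infty\bar r)(\eta)\,d\eta.$$ Grid and discrete norms. For $\Delta\xi>0$,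 $\xi_j=j\Delta\xi$, $\mathrm{D}_\pm v_j=\pm(v_{j\pm1}-v_j)/\Delta\xi$ ($\mathrm{D}_{j\pm}$ acts on index $j$). $\|v\|_{\boldsymbol{\ell}^p}=(\Delta\xi\sum_j|v_j|^p)^{1/p}$, $\|v\|_{\boldsymbol{\ell}^\infty}=\sup_j|v_j|$, $\|v\|_{\mathbf{h}^1}^2=\|v\|_{\boldsymbol{\ell}^2}^2+\|\mathrm{D}_+v\|_{\boldsymbol{\ell}^2}^2$, $\mathbf{V}_{\Delta\xi}=\{v\in\boldsymbol{\ell}^\infty:\mathrm{D}_+v\in\boldsymbol{\ell}^2\}$, $\mathbf{E}_{\Delta\xi}=\mathbf{V}_{\Delta\xi}\times\mathbf{h}^1\times\mathbf{V}_{\Delta\xi}\times\boldsymbol{\ell}^2$. For kernels $\|g\|_{\boldsymbol{\ell}^p}=\sup_i(\Delta\xi\sum_j|g_{i,j}|^p)^{1/p}$, $\|g\|_{\boldsymbol{\ell}^\infty}=\sup_{i,j}|g_{i,j}|$, $\boldsymbol{\ell}^*=\boldsymbol{\ell}^1\cap\boldsymbol{\ell}^\infty$. Semi-discrete system (S). With $y_j=\xi_j+\zeta_j$, $h_j=\mathrm{D}_+H_j$, $$R_j=\Delta\xi\sum_i\gamma_{i,j}U_i(\mathrm{D}_+U_i)+\Delta\xi\sum_ik_{i,j}(h_i+\rho_\infty\bar r_i),\qquad Q_j=\Delta\xi\sum_ig_{i,j}U_i(\mathrm{D}_+U_i)+\Delta\xi\sum_i\kappa_{i,j}(h_i+\rho_\infty\bar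 r_i),$$ $$\dot\zeta_j=U_j,\quad \dot U_j=-Q_j,\quad \dot H_j=-U_jR_{j-1},\quad \dot{\bar r}_j=-\rho_\infty\mathrm{D}_+U_j,$$ $$\dot g_{i,j}=-\Delta\xi\sum_m(\mathrm{D}_+U_m)(g_{i,m}g_{m,j}+\gamma_{i,m}\kappa_{m,j}),\qquad \dot k_{i,j}=-\Delta\xi\sum_m(\mathrm{D}_+U_m)(k_{i,m}k_{m,j}+\kappa_{i,m}\gamma_{m,j}),$$ $$\dot\gamma_{i,j}=-\Delta\xi\sum_m(\mathrm{D}_+U_m)(\gamma_{i,m}k_{m,j}+g_{i,m}\gamma_{m,j}),\qquad \dot\kappa_{i,j}=-\Delta\xi\sum_m(\mathrm{D}_+U_m)(\kappa_{i,m}g_{m,j}+k_{i,m}\kappa_{m,j}).$$ Set $\mathcal{B}$: all $(\zeta,U,H,\bar r,g,k,\gamma,\kappa)\in\mathbf{E}_{\Delta\xi}\times(\boldsymbol{\ell}^* )^4$ such that (a) for all $i,j$: $(\mathrm{D}_+y_j)g_{i,j}-\mathrm{D}_{j-}\gamma_{i,j}=\delta_{i,j}/\Delta\xi$, $\ \mathrm{D}_{j+}g_{i,j}=(\mathrm{D}_+y_j)\gamma_{i,j}$, $\ (\mathrm{D}_+y_j)k_{i,j}-\mathrm{D}_{j+}\kappa_{i,j}=\delta_{i,j}/\Delta\xi$, $\ \mathrm{D}_{j-}k_{i,j}=(\mathrm{D}_+y_j)\kappa_{i,j}$, and $g_{j,i}=g_{i,j}$, $k_{j,i}=k_{i,j}$,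 $\gamma_{j,i}=-\kappa_{i,j}$; (b) $\mathrm{D}_+y,\mathrm{D}_+U,\mathrm{D}_+H,\bar r\in\boldsymbol{\ell}^\infty$; (c) $2(\mathrm{D}_+y_j)(\mathrm{D}_+H_j)=U_j^2(\mathrm{D}_+y_j)^2+(\mathrm{D}_+U_j)^2+\bar r_j^2$ for all $j$; (d) $\mathrm{D}_+y_j\ge0$, $\mathrm{D}_+H_j\ge0$, $\mathrm{D}_+y_j+\mathrm{D}_+H_j>0$ for all $j$. The kernels associated with $Y_{\Delta\xi,0}$ are the ones in $\boldsymbol{\ell}^*$ determined by (a). Convention: $H_j=\Delta\xi\sum_{i=-\infty}^{j-1}h_i$. For initial data in $\mathcal{B}$ the system (S) has a unique global solution, which stays in $\mathcal{B}$. Interpolation. With $\chi_j$ the indicator function of $[\xi_j,\xi_{j+1})$, for $V\in\{\zeta,U,H\}$ set $V_\Delta(t,\xi)=\sum_j[V_j(t)+(\xi-\xi_j)\mathrm{D}_+V_j(t)]\chi_j(\xi)$, and $\bar r_\Delta(t,\xi)=\sum_j\bar r_j(t)\chi_j(\xi)$. The interpolation of $(\zeta,U,H,\bar r)$ is $(\zeta_\Delta,U_\Delta,H_\Delta,\bar r_\Delta)$. *)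

(* Defs.v *)
From HB Require Import structures.
From mathcomp Require Import all_boot all_order all_algebra.
From mathcomp Require Import all_classical all_reals all_analysis.

Set Implicit Arguments.
Unset Strict Implicit.
Unset Printing Implicit Defensive.

Import Order.TTheory GRing.Theory Num.Theory.
Import numFieldNormedType.Exports.

Local Open Scope classical_set_scope.
Local Open Scope ring_scope.

(* Quadruples (zeta, U, H, rbar) of functions, over the line (I = R) or over
   the grid (I = int), and quadruples of kernels (g, k, gamma, kappa). Both are
   plain products, so they carry the pointwise R-module structure. *)
Notation state I R := ((I -> R) * (I -> R) * (I -> R) * (I -> R))%type.
Notation kernels R :=
  ((int -> int -> R) * (int -> int -> R) *
   (int -> int -> R) * (int -> int -> R))%type.

Section projections.
Context {I : Type} {R : realType}.
Implicit Types (X : state I R) (K : kernels R).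

Definition zeta_of X : I -> R := X.1.1.1.
Definition U_of X : I -> R := X.1.1.2.
Definition H_of X : I -> R := X.1.2.
Definition rbar_of X : I -> R := X.2.

Definition g_of K : int -> int -> R := K.1.1.1.
Definition k_of K : int -> int -> R := K.1.1.2.
Definition gamma_of K : int -> int -> R := K.1.2.
Definition kappa_of K : int -> int -> R := K.2.

End projections.

(* Continuity and differentiability of curves in a space whose norm N is given
   as an extended-real valued function, along the part I of the time axis
   (hence one-sided at an endpoint of I that belongs to I). *)
Section curves.
Context {R : realType} {V : lmodType R}.
Variables (N : V -> \bar R) (I : set R) (X : R -> V).

Definition curve_continuous : Prop :=
  forall t, I t -> N (X s - X t) @[s --> within I (nbhs t)] --> 0%E.

Definition curve_derivative (t : R) (D : V) : Prop :=
  N ((s - t)^-1 *: (X s - X t) - D) @[s --> within I t^'] --> 0%E.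

End curves.

Section line_spaces.
Context {R : realType}.
Implicit Types f g phi : R -> R.

Notation mu := (@lebesgue_measure R).

(* Weak derivatives are tested against C^1 functions of compact support. *)
Definition test_function phi : Prop :=
  [/\ forall x, derivable phi x 1, continuous (derive1 phi) &
      compact (closure [set x | phi x != 0])].

Definition is_weak_derivative f g : Prop :=
  [/\ locally_integrable [set: R] f, locally_integrable [set: R] g &
      forall phi, test_function phi ->
        \int[mu]_x (f x * derive1 phi x) = - \int[mu]_x (g x * phi x)].

(* A representative of the weak derivative f_xi: it is unique up to almost
   everywhere equality, and is 0 by default if f has no weak derivative. *)
Definition wderiv f : R -> R := xget (cst 0) [set g | is_weak_derivative f g].

Definition in_L2 f : Prop :=
  measurable_fun [set: R] f /\ ('N[mu]_2%:E[EFin \o f] < +oo)%E.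

Definition weakly_derivable_L2 f : Prop :=
  exists2 g, is_weak_derivative f g & in_L2 g.

Definition in_V f : Prop :=
  [/\ continuous f, bounded_fun f & weakly_derivable_L2 f].

Definition in_H1 f : Prop := in_L2 f /\ weakly_derivable_L2 f.

Definition Vnorm f : \bar R :=
  ('N[mu]_+oo[EFin \o f] + 'N[mu]_2%:E[EFin \o wderiv f])%E.

Definition H1norm f : \bar R :=
  (('N[mu]_2%:E[EFin \o f] `^ 2 + 'N[mu]_2%:E[EFin \o wderiv f] `^ 2) `^ 2^-1)%E.

Implicit Types X : state R R.

Definition in_E X : Prop :=
  [/\ in_V (zeta_of X), in_H1 (U_of X), in_V (H_of X) & in_L2 (rbar_of X)].

(* Only meaningful on E, because of the default value of wderiv. Being made of
   Lebesgue norms, it does not see the choice of the representatives. *)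
Definition Enorm X : \bar R :=
  (Vnorm (zeta_of X) + H1norm (U_of X) + Vnorm (H_of X)
   + 'N[mu]_2%:E[EFin \o rbar_of X])%E.

Definition in_CE (T : R) (X : R -> state R R) : Prop :=
  (forall t, `[0, T]%classic t -> in_E (X t)) /\
  curve_continuous Enorm `[0, T] X.

End line_spaces.

Section continuous_system.
Context {R : realType}.
Variable rho : R.
Implicit Types (X : state R R) (eta xi : R).

Notation mu := (@lebesgue_measure R).

Definition y_of X xi : R := xi + zeta_of X xi.

Definition g_line X eta xi : R := 2^-1 * expR (- `|y_of X xi - y_of X eta|).

Definition kappa_line X eta xi : R := - Num.sg (xi - eta) * g_line X eta xi.

Definition R_line X xi : R :=
  \int[mu]_eta (kappa_line X eta xi * (U_of X eta * wderiv (U_of X) eta))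
  + \int[mu]_eta (g_line X eta xi *
                  (wderiv (H_of X) eta + rho * rbar_of X eta)).

Definition Q_line X xi : R :=
  \int[mu]_eta (g_line X eta xi * (U_of X eta * wderiv (U_of X) eta))
  + \int[mu]_eta (kappa_line X eta xi *
                  (wderiv (H_of X) eta + rho * rbar_of X eta)).

(* r_t = 0 with r = rbar + rho y_xi, written for rbar. *)
Definition line_field X : state R R :=
  (U_of X, fun xi => - Q_line X xi, fun xi => - (U_of X xi * R_line X xi),
   fun xi => - (rho * wderiv (U_of X) xi)).

(* The evolution equation holds in E. Elements of L^2 being defined almost
   everywhere, the initial condition is an equality in E. Asking line_field to
   be in E selects the continuous representative of U. *)
Definition line_solution (T : R) X0 (X : R -> state R R) : Prop :=
  [/\ in_CE T X,
      forall t, `[0, T]%classic t -> {homo y_of (X t) : a b / a <= b},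
      Enorm (X 0 - X0) = 0%E &
      forall t, `[0, T]%classic t ->
        in_E (line_field (X t)) /\
        curve_derivative Enorm `[0, T] X t (line_field (X t))].

End continuous_system.

Section grid.
Context {R : realType}.
Variable dx : R.
Implicit Types (v : int -> R) (Y : state int R).

Definition gridpt (j : int) : R := j%:~R * dx.

Definition Dp v (j : int) : R := (v (j + 1) - v j) / dx.

Definition Dm v (j : int) : R := (v j - v (j - 1)) / dx.

(* Unconditional sum over int, meant for absolutely summable families. *)
Definition zsum v : R :=
  fine (\esum_(j in [set: int]) (EFin \o v)^\+ j
        - \esum_(j in [set: int]) (EFin \o v)^\- j)%E.

Definition lnorm (p : R) v : \bar R :=
  ((dx%:E * \esum_(j in [set: int]) (`|v j| `^ p)%:E) `^ p^-1)%E.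

Definition lnormoo v : \bar R :=
  ereal_sup [set `|v j|%:E | j in [set: int]].

Definition h1norm v : \bar R :=
  ((lnorm 2 v `^ 2 + lnorm 2 (Dp v) `^ 2) `^ 2^-1)%E.

Definition Vdnorm v : \bar R := (lnormoo v + lnorm 2 (Dp v))%E.

Definition Ednorm Y : \bar R :=
  (Vdnorm (zeta_of Y) + h1norm (U_of Y) + Vdnorm (H_of Y)
   + lnorm 2 (rbar_of Y))%E.

Definition in_Ed Y : Prop := (Ednorm Y < +oo)%E.

Definition knorm (p : R) (a : int -> int -> R) : \bar R :=
  ereal_sup [set lnorm p (a i) | i in [set: int]].

Definition knormoo (a : int -> int -> R) : \bar R :=
  ereal_sup [set lnormoo (a i) | i in [set: int]].

Definition lstarnorm (a : int -> int -> R) : \bar R :=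
  (knorm 1 a + knormoo a)%E.

Definition Kdnorm (K : kernels R) : \bar R :=
  (lstarnorm (g_of K) + lstarnorm (k_of K)
   + lstarnorm (gamma_of K) + lstarnorm (kappa_of K))%E.

Definition in_Kd (K : kernels R) : Prop := (Kdnorm K < +oo)%E.

Definition fullnorm (Z : state int R * kernels R) : \bar R :=
  (Ednorm Z.1 + Kdnorm Z.2)%E.

End grid.

Section semidiscrete_system.
Context {R : realType}.
Variables rho dx : R.
Implicit Types (Y : state int R) (K : kernels R)
  (Z : state int R * kernels R) (i j m : int).

Definition yd_of Y j : R := gridpt dx j + zeta_of Y j.

Definition R_grid Z j : R :=
  let: (Y, K) := Z in
  dx * zsum (fun i => gamma_of K i j * (U_of Y i * Dp dx (U_of Y) i))
  + dx * zsum (fun i => k_of K i j * (Dp dx (H_of Y) i + rho * rbar_of Y i)).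

Definition Q_grid Z j : R :=
  let: (Y, K) := Z in
  dx * zsum (fun i => g_of K i j * (U_of Y i * Dp dx (U_of Y) i))
  + dx * zsum (fun i => kappa_of K i j *
                        (Dp dx (H_of Y) i + rho * rbar_of Y i)).

(* - dx sum_m (D_+ U_m) (a_{i,m} b_{m,j} + c_{i,m} d_{m,j}) *)
Definition kernel_rate (U : int -> R) (a b c d : int -> int -> R) i j : R :=
  - (dx * zsum (fun m => Dp dx U m * (a i m * b m j + c i m * d m j))).

Definition grid_field Z : state int R * kernels R :=
  let: (Y, K) := Z in
  let: (g, k, gamma, kappa) := K in
  ((U_of Y,
    fun j => - Q_grid Z j,
    fun j => - (U_of Y j * R_grid Z (j - 1)),
    fun j => - (rho * Dp dx (U_of Y) j)),
   (kernel_rate (U_of Y) g g gamma kappa,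
    kernel_rate (U_of Y) k k kappa gamma,
    kernel_rate (U_of Y) gamma k g gamma,
    kernel_rate (U_of Y) kappa g k kappa)).

(* Global solutions: the equation holds in the norm of the Banach space
   E_dx x (l^* )^4, for all t >= 0. *)
Definition grid_solution Z0 (Z : R -> state int R * kernels R) : Prop :=
  let I := `[0, +oo[%classic : set R in
  [/\ forall t, I t -> in_Ed dx (Z t).1 /\ in_Kd dx (Z t).2,
      curve_continuous (fullnorm dx) I Z,
      Z 0 = Z0 &
      forall t, I t -> curve_derivative (fullnorm dx) I Z t (grid_field (Z t))].

Definition kernel_relations Y K : Prop :=
  let: (g, k, gamma, kappa) := K in
  forall i j,
    [/\ Dp dx (yd_of Y) j * g i j - Dm dx (gamma i) j = (i == j)%:R / dx,
        Dp dx (g i) j = Dp dx (yd_of Y) j * gamma i j,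
        Dp dx (yd_of Y) j * k i j - Dp dx (kappa i) j = (i == j)%:R / dx &
        Dm dx (k i) j = Dp dx (yd_of Y) j * kappa i j] /\
    [/\ g j i = g i j, k j i = k i j & gamma j i = - kappa i j].

Definition in_B Z : Prop :=
  let: (Y, K) := Z in
  [/\ in_Ed dx Y /\ in_Kd dx K,
      kernel_relations Y K,
      [/\ (lnormoo (Dp dx (yd_of Y)) < +oo)%E,
          (lnormoo (Dp dx (U_of Y)) < +oo)%E,
          (lnormoo (Dp dx (H_of Y)) < +oo)%E &
          (lnormoo (rbar_of Y) < +oo)%E],
      forall j, 2 * Dp dx (yd_of Y) j * Dp dx (H_of Y) j
                = U_of Y j ^+ 2 * Dp dx (yd_of Y) j ^+ 2
                  + Dp dx (U_of Y) j ^+ 2 + rbar_of Y j ^+ 2 &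
      forall j, [/\ 0 <= Dp dx (yd_of Y) j, 0 <= Dp dx (H_of Y) j &
                    0 < Dp dx (yd_of Y) j + Dp dx (H_of Y) j]].

(* H_j = dx sum_{i < j} h_i with h = D_+ H: the additive constant in H is
   fixed by H_j -> 0 as j -> -oo. *)
Definition H_normalized Y : Prop :=
  forall j, H_of Y j =
    dx * zsum (fun i => if (i < j)%R then Dp dx (H_of Y) i else 0).

End semidiscrete_system.

Section interpolation.
Context {R : realType}.
Variable dx : R.
Implicit Types (v : int -> R) (xi : R).

Definition cell (j : int) : set R := `[gridpt dx j, gridpt dx (j + 1)[.

Definition interp_affine v xi : R :=
  zsum (fun j => (v j + (xi - gridpt dx j) * Dp dx v j) * \1_(cell j) xi).

Definition interp_const v xi : R := zsum (fun j => v j * \1_(cell j) xi).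

Definition interp (Y : state int R) : state R R :=
  (interp_affine (zeta_of Y), interp_affine (U_of Y), interp_affine (H_of Y),
   interp_const (rbar_of Y)).

End interpolation.

(* Main.v *)
(* The error e(t) = || X_Delta(t) - X(t) ||_E satisfies the Dini inequality
   D^+ e <= L (e + sqrt dx) as long as e <= 1, so a continuity and Gronwall argument
   gives e(t) <= (e(0) + L sqrt dx + eta) exp((L + 1) T) for every eta > 0.

   The inequality amounts to comparing the two vector fields.  The relations (a) and
   D_+ y >= 0 persist in time.  For fixed i the relations are a discrete Sturm-Liouville problem
   whose decaying solution is within O(max_j dx D_+ y_j) of exp(- |y_j - y_i|) / 2, and
   dx D_+ y_j = O(sqrt dx) because D_+ zeta is bounded in l^2.  Hence the discrete Q
   and R are close to the continuous ones in L^2 and in L^infinity.  Their derivatives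
   need no separate kernel estimate, since Q' = y' R - (H' + rho r) and
   R' = y' Q - U U' hold both on the line and on the grid. *)

Require Import Defs.
From mathcomp Require Import all_boot all_order all_algebra.
From mathcomp Require Import all_classical all_reals all_analysis.
From mathcomp Require Import measurable_realfun ess_sup_inf.
From mathcomp Require Import ring lra zify.

Set Implicit Arguments.
Unset Strict Implicit.
Unset Printing Implicit Defensive.

Import Order.TTheory GRing.Theory Num.Theory.
Import numFieldNormedType.Exports.

Local Open Scope classical_set_scope.
Local Open Scope ring_scope.

(** * The space L^2 of the line *)

Section L2.
Context {R : realType}.
Implicit Types (f g h : R -> R) (a b c : R).
Notation mu := (@lebesgue_measure R).

(** All constants must be uniform in the grid step, yet no uniform bound on the discrete solution is
    known beforehand: on a fixed grid one only gets bounds that may blow up as dx tends to 0.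
    Uniformity comes from the limit instead. Compactness of [0, T] gives one M with ||X(t)|| <= M,
    and as long as e <= 1 the discrete solution inherits the bound M + 1. The coarse bounds at fixed
    dx serve only to justify sums, derivatives in time and the invariants. As y is merely absolutely
    continuous and may be constant on intervals, the kernels are not differentiated pointwise; f' =
    p is encoded as an integral identity and proved from local estimates. The kernels with a sign
    jump across the diagonal, where discrete and continuous signs may disagree inside one cell. This
    costs O(sqrt dx) from L^2 to L^oo and O(dx) on L^2. A grid solution is only known to be a
    differentiable curve in a Banach space, so the relations (a) and the sign of D_+ y at later
    times are derived from the equations, one grid value at a time. *)

Definition L1 f := mu.-integrable [set: R] (EFin \o f).
(** Real-valued so that [lra] and [ring] apply; it is the norm only for [in_L2] functions, since
    [fine] sends an infinite norm to 0. *)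
Definition n2 f : R := fine ('N[mu]_2%:E[EFin \o f])%E.

Lemma n2_ge0 f : 0 <= n2 f.
Proof. by rewrite fine_ge0 ?Lnorm_ge0. Qed.

Lemma L2_fin f : in_L2 f -> ('N[mu]_2%:E[EFin \o f] = (n2 f)%:E)%E.
Proof.
move=> [_ fin]; rewrite fineK// ge0_fin_numE ?Lnorm_ge0//.
Qed.

Lemma Lnorm2_sq f : (('N[mu]_2%:E[EFin \o f]) `^ 2 =
  \int[mu]_x ((f x) ^+ 2)%:E)%E.
Proof.
rewrite poweR_Lnorm ?pnatr_eq0//; apply: eq_integral => x _ /=.
by rewrite powR_mulrn// real_normK// num_real.
Qed.

Lemma L2_sq f : in_L2 f -> (\int[mu]_x ((f x) ^+ 2)%:E = ((n2 f) ^+ 2)%:E)%E.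
Proof.
move=> f2; rewrite -Lnorm2_sq (L2_fin f2) poweR_EFin.
by rewrite powR_mulrn ?n2_ge0.
Qed.

Lemma L2P f : measurable_fun setT f ->
  (\int[mu]_x ((f x) ^+ 2)%:E < +oo)%E -> in_L2 f.
Proof.
move=> mf; rewrite -Lnorm2_sq => fin; split=> //.
rewrite ltey; apply/eqP => E; move: fin; rewrite E.
by rewrite poweRyr// pnatr_eq0.
Qed.

Lemma L2_measurable f : in_L2 f -> measurable_fun setT f.
Proof. by case. Qed.

Lemma L2D f g : in_L2 f -> in_L2 g -> in_L2 (f \+ g).
Proof.
move=> f2 g2; split; first by apply: measurable_funD; [case: f2|case: g2].
apply: le_lt_trans (minkowski_EFin _ _ _ _) _.
- by case: f2. - by case: g2. - by rewrite ler1n.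
by rewrite (L2_fin f2) (L2_fin g2) -EFinD ltey.
Qed.

Lemma n2D f g : in_L2 f -> in_L2 g -> n2 (f \+ g) <= n2 f + n2 g.
Proof.
move=> f2 g2; rewrite -lee_fin EFinD -!L2_fin//; last exact: L2D.
by apply: minkowski_EFin; [case: f2|case: g2|rewrite ler1n].
Qed.

Lemma L2_le f g : measurable_fun setT f -> in_L2 g ->
  (forall x, `|f x| <= `|g x|) -> in_L2 f.
Proof.
move=> mf g2 fg; apply: L2P => //.
apply: le_lt_trans (_ : \int[mu]_x ((g x) ^+ 2)%:E < +oo)%E; last first.
  by rewrite L2_sq// ltey.
apply: ge0_le_integral => //= [x _|||x _].
- by rewrite lee_fin sqr_ge0.
- by apply/measurable_EFinP; apply: measurable_funX.
- by apply/measurable_EFinP; apply: measurable_funX; case: g2.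
- by rewrite lee_fin -real_normK ?num_real// -[leRHS]real_normK ?num_real// lerXn2r.
Qed.

Lemma n2_le f g : measurable_fun setT f -> in_L2 g ->
  (forall x, `|f x| <= `|g x|) -> n2 f <= n2 g.
Proof.
move=> mf g2 fg; have f2 := L2_le mf g2 fg.
rewrite -(@ler_pXn2r _ 2) ?nnegrE ?n2_ge0// -lee_fin -!L2_sq//.
apply: ge0_le_integral => //= [x _|||x _].
- by rewrite lee_fin sqr_ge0.
- by apply/measurable_EFinP; apply: measurable_funX.
- by apply/measurable_EFinP; apply: measurable_funX; case: g2.
- by rewrite lee_fin -real_normK ?num_real// -[leRHS]real_normK ?num_real// lerXn2r.
Qed.

(** Used to pass between two representatives of a weak derivative. *)
Lemma ae_L2 f g : measurable_fun setT f -> in_L2 g ->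
  (\forall x \ae mu, f x = g x) -> in_L2 f /\ n2 f = n2 g.
Proof.
move=> mf g2 fg.
have E : (\int[mu]_x ((f x) ^+ 2)%:E = \int[mu]_x ((g x) ^+ 2)%:E)%E.
  apply: ae_eq_integral => //.
  - by apply/measurable_EFinP; apply: measurable_funX.
  - by apply/measurable_EFinP; apply: measurable_funX; case: g2.
  - by apply: (@filterS _ _ (ae_filter_ringOfSetsType mu) _ _ _ fg) => x ->.
have f2 : in_L2 f by apply: L2P => //; rewrite E L2_sq// ltey.
split=> //; apply/eqP; rewrite -(@eqrXn2 _ 2) ?n2_ge0//; apply/eqP.
by apply: EFin_inj; rewrite -!L2_sq.
Qed.

Lemma L2Z a f : in_L2 f -> in_L2 (fun x => a * f x).
Proof.
move=> f2; apply: L2P; first by apply: measurable_funM => //; case: f2.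
under eq_integral do rewrite exprMn EFinM.
rewrite ge0_integralZl//=.
- by rewrite L2_sq// -EFinM ltey.
- by apply/measurable_EFinP; apply: measurable_funX; case: f2.
- by move=> x _; rewrite lee_fin sqr_ge0.
- by rewrite lee_fin sqr_ge0.
Qed.

Lemma n2Z a f : in_L2 f -> n2 (fun x => a * f x) = `|a| * n2 f.
Proof.
move=> f2; apply/eqP; rewrite -(@eqrXn2 _ 2) ?mulr_ge0 ?n2_ge0//; apply/eqP.
apply: EFin_inj; rewrite -!L2_sq//; last exact: L2Z.
under eq_integral do rewrite exprMn EFinM.
rewrite ge0_integralZl//=.
- by rewrite L2_sq// -EFinM exprMn real_normK ?num_real.
- by apply/measurable_EFinP; apply: measurable_funX; case: f2.
- by move=> x _; rewrite lee_fin sqr_ge0.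
- by rewrite lee_fin sqr_ge0.
Qed.

Lemma L2_eq f g : in_L2 f -> f =1 g -> in_L2 g.
Proof. by move=> + /funext <-. Qed.

Lemma L2N f : in_L2 f -> in_L2 (\- f).
Proof. by move=> /(L2Z (-1)) /L2_eq; apply => x; rewrite mulN1r. Qed.

Lemma L2B f g : in_L2 f -> in_L2 g -> in_L2 (f \- g).
Proof. by move=> f2 g2; apply: L2D => //; exact: L2N. Qed.

Lemma L2_abs f : in_L2 f -> in_L2 (fun x => `|f x|).
Proof.
move=> f2; apply: (L2_le _ f2); last by move=> x; rewrite normr_id.
by apply: measurableT_comp => //; case: f2.
Qed.

Lemma n2_abs f : in_L2 f -> n2 (fun x => `|f x|) = n2 f.
Proof.
move=> f2; apply/le_anti/andP; split; apply: n2_le => //.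
- by case: (L2_abs f2). - by move=> x; rewrite normr_id.
- by case: f2. - exact: L2_abs. - by move=> x; rewrite normr_id.
Qed.

Lemma L2_bmul c f g : measurable_fun setT g -> (forall x, `|g x| <= c) ->
  in_L2 f -> in_L2 (g \* f) /\ n2 (g \* f) <= c * n2 f.
Proof.
move=> mg gc f2; have c0 : 0 <= c := le_trans (normr_ge0 _) (gc 0).
have m : measurable_fun setT (g \* f) by apply: measurable_funM => //; case: f2.
have H x : `|(g \* f) x| <= `|c * f x|.
  by rewrite /= !normrM (ger0_norm c0) ler_wpM2r.
split; first exact: L2_le m (L2Z c f2) H.
by have := n2_le m (L2Z c f2) H; rewrite n2Z// ger0_norm.
Qed.

Lemma CS f g : in_L2 f -> in_L2 g ->
  L1 (f \* g) /\ \int[mu]_x `|f x * g x| <= n2 f * n2 g.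
Proof.
move=> f2 g2.
have H : (\int[mu]_x `|(f x * g x)%:E| <= (n2 f * n2 g)%:E)%E.
  have := @hoelder _ _ _ mu f g 2 2 (L2_measurable f2) (L2_measurable g2).
  rewrite Lnorm1 EFinM -!L2_fin//; apply=> //.
  by lra.
have l1 : L1 (f \* g).
  apply/integrableP; split; last exact: le_lt_trans H (ltey _).
  by apply/measurable_EFinP; apply: measurable_funM; [case: f2|case: g2].
split => //; rewrite -lee_fin; apply: le_trans H.
rewrite /Rintegral fineK//.
by apply: integrable_fin_num => //; apply: integrable_norm.
Qed.

Lemma CS_le f g : in_L2 f -> in_L2 g ->
  `|\int[mu]_x (f x * g x)| <= n2 f * n2 g.
Proof.
move=> f2 g2; have [l1 H] := CS f2 g2.
by apply: le_trans H; exact: le_normr_Rintegral.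
Qed.

Lemma L1_le f g : measurable_fun setT f -> L1 g ->
  (forall x, `|f x| <= `|g x|) -> L1 f.
Proof.
move=> mf g1 fg; apply: (@le_integrable _ _ _ mu setT measurableT _ (EFin \o g)) => //; first exact/measurable_EFinP.
by move=> x _ /=; rewrite lee_fin; exact: fg.
Qed.

End L2.

(** * Absolutely continuous functions and weak derivatives *)

Section AC.
Context {R : realType}.
Implicit Types (f g h p q : R -> R) (a b c s t x : R).
Notation mu := (@lebesgue_measure R).

(** Not oriented: the value is 0 when [b <= a], hence the assumptions [a <= b] below. *)
Definition J a b f : R := \int[mu]_(x in `[a, b]) f x.
(** Local integrability tested on segments, which suits [J]; it is equivalent to
    [locally_integrable] on the line. *)
Definition loc1 f :=
  measurable_fun [set: R] f /\ forall a b, mu.-integrable `[a, b] (EFin \o f).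

Lemma intgD D f g : measurable D -> mu.-integrable D (EFin \o f) ->
  mu.-integrable D (EFin \o g) -> mu.-integrable D (EFin \o (fun x => f x + g x)).
Proof. by move=> mD fi gi; have := integrableD mD fi gi; apply: eq_integrable. Qed.

Lemma intgB D f g : measurable D -> mu.-integrable D (EFin \o f) ->
  mu.-integrable D (EFin \o g) -> mu.-integrable D (EFin \o (fun x => f x - g x)).
Proof. by move=> mD fi gi; have := integrableB mD fi gi; apply: eq_integrable. Qed.

Lemma intgZ D f c : measurable D -> mu.-integrable D (EFin \o f) ->
  mu.-integrable D (EFin \o (fun x => c * f x)).
Proof. by move=> mD fi; have := integrableZl mD c fi; apply: eq_integrable. Qed.

Lemma J_ge a b f : b <= a -> J a b f = 0.
Proof.
rewrite le_eqVlt /J => /predU1P[->|ba]; first by rewrite set_itv1 Rintegral_set1.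
by rewrite set_itv_ge ?Rintegral_set0// bnd_simp -ltNge.
Qed.

Lemma J_chasles f a b c : loc1 f -> a <= b -> b <= c ->
  J a c f = J a b f + J b c f.
Proof.
move=> [mf fi] ab bc; apply/eqP; rewrite addrC -subr_eq; apply/eqP.
rewrite /J Rintegral_itvB ?bnd_simp//.
apply: Rintegral_itv_obnd_cbnd; apply: integrableS (fi b c) => //.
by apply: subset_itvr; rewrite bnd_simp.
Qed.

Lemma J_D f g a b : loc1 f -> loc1 g ->
  J a b (fun x => f x + g x) = J a b f + J a b g.
Proof. by move=> [_ fi] [_ gi]; rewrite /J RintegralD. Qed.

Lemma J_B f g a b : loc1 f -> loc1 g ->
  J a b (fun x => f x - g x) = J a b f - J a b g.
Proof. by move=> [_ fi] [_ gi]; rewrite /J RintegralB. Qed.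

Lemma J_Z f a b c : loc1 f -> J a b (fun x => c * f x) = c * J a b f.
Proof. by move=> [_ fi]; rewrite /J RintegralZl. Qed.

Lemma mu_itv a b : a <= b -> mu `[a, b] = (b - a)%:E.
Proof.
rewrite lebesgue_measure_itv/= lte_fin le_eqVlt => /predU1P[->|->]; last by rewrite -EFinB.
by rewrite ltxx subrr.
Qed.

Lemma J_cst a b c : a <= b -> J a b (fun=> c) = c * (b - a).
Proof.
by move=> ab; rewrite /J Rintegral_cst//= mu_itv.
Qed.

Lemma J_le f g a b : loc1 f -> loc1 g ->
  (forall x, a <= x <= b -> f x <= g x) -> J a b f <= J a b g.
Proof.
move=> [_ fi] [_ gi] fg; exact: le_Rintegral.
Qed.

Lemma loc1_abs f : loc1 f -> loc1 (fun x => `|f x|).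
Proof.
by move=> [mf fi]; split=> [|a b]; [exact: measurableT_comp|exact: integrable_norm].
Qed.

Lemma loc1D f g : loc1 f -> loc1 g -> loc1 (fun x => f x + g x).
Proof.
move=> [mf fi] [mg gi]; split=> [|a b]; first exact: measurable_funD.
exact: intgD.
Qed.

Lemma loc1Z f c : loc1 f -> loc1 (fun x => c * f x).
Proof.
move=> [mf fi]; split=> [|a b]; first exact: measurable_funM.
exact: intgZ.
Qed.

Lemma loc1_cst c : loc1 (fun=> c).
Proof.
split=> // a b; apply: measurable_bounded_integrable => //.
  by rewrite /= lebesgue_measure_itv/=; case: ifP => // _; rewrite -EFinB ltey.
by exists `|c|; split; rewrite ?num_real// => y cy z _ /=; apply: ltW.
Qed.

Lemma loc1B f g : loc1 f -> loc1 g -> loc1 (fun x => f x - g x).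
Proof.
move=> [mf fi] [mg gi]; split=> [|a b]; first exact: measurable_funB.
exact: intgB.
Qed.

Lemma loc1_le f g : measurable_fun setT f -> loc1 g ->
  (forall x, `|f x| <= g x) -> loc1 f.
Proof.
move=> mf [mg gi] fg; split=> // a b.
apply: (@le_integrable _ _ _ mu _ _ _ (EFin \o g)) => //=.
  by apply/measurable_EFinP; exact: measurable_funS mf.
by move=> x _; rewrite lee_fin (le_trans (fg x)) ?ler_norm.
Qed.

Lemma J_abs f a b : loc1 f -> `|J a b f| <= J a b (fun x => `|f x|).
Proof. by move=> [_ fi]; exact: le_normr_Rintegral. Qed.

Lemma J_ge0 f a b : (forall x, 0 <= f x) -> 0 <= J a b f.
Proof. by move=> f0; exact: Rintegral_ge0. Qed.

Lemma J_indic f a b : J a b f = \int[mu]_x (\1_`[a, b] x * f x).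
Proof.
rewrite /J Rintegral_mkcond; apply: eq_Rintegral => x _.
by rewrite patchE indicE; case: ifPn; rewrite ?mul1r ?mul0r.
Qed.

Lemma n2_indic a b : a <= b ->
  in_L2 (\1_`[a, b] : R -> R) /\ n2 (\1_`[a, b] : R -> R) = Num.sqrt (b - a).
Proof.
move=> ab.
have E : (\int[mu]_x ((\1_`[a, b] x : R) ^+ 2)%:E = (b - a)%:E)%E.
  under eq_integral do rewrite indicE -natrX.
  rewrite (_ : (fun=> _) = (fun x => (\1_(`[a, b]%classic) x)%:E)); last first.
    by apply/funext => x; rewrite indicE; case: (x \in _).
  by rewrite integral_indic// setIT; exact: mu_itv.
have m : measurable_fun setT (\1_`[a, b] : R -> R) by exact: measurable_indic.
have l2 : in_L2 (\1_`[a, b] : R -> R) by apply: L2P => //; rewrite E ltey.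
have E2 := EFin_inj (etrans (esym E) (L2_sq l2)); split=> //.
by rewrite E2 sqrtr_sqr ger0_norm ?n2_ge0.
Qed.

Lemma L2_loc1 f : in_L2 f -> loc1 f.
Proof.
move=> f2; split=> [|a b]; first by case: f2.
have [ab|ba] := leP a b; last first.
  by rewrite set_itv_ge ?bnd_simp -?ltNge//; exact: integrable_set0.
apply/(integrable_mkcond _ _).2 => //.
have [l1 _] := CS (n2_indic ab).1 f2.
apply: eq_integrable l1 => // x _ /=.
by rewrite patchE indicE; case: ifPn; rewrite ?mul1r ?mul0r.
Qed.

Lemma J_n2 f a b : in_L2 f -> a <= b ->
  J a b (fun x => `|f x|) <= Num.sqrt (b - a) * n2 f.
Proof.
move=> f2 ab; rewrite J_indic -(n2_indic ab).2 -(n2_abs f2).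
apply: le_trans (CS_le (n2_indic ab).1 (L2_abs f2)).
exact: ler_norm.
Qed.

(** Compactness of the segment in Cousin's form: a transitive relation on intervals that holds near
    every point holds globally, because the supremum of the points reachable from [a] can be passed
    until it is [b]. It later glues local identities, local errors and local bounds. *)
Lemma cousin (P : R -> R -> Prop) a b : a <= b ->
  (forall s m t, a <= s -> s <= m -> m <= t -> t <= b -> P s m -> P m t -> P s t) ->
  (forall x, a <= x <= b -> exists2 d, 0 < d &
     forall s t, a <= s -> s <= x -> x <= t -> t <= b ->
       x - d < s -> t < x + d -> P s t) ->
  P a b.
Proof.
move=> ab tr loc.
pose A := [set x | a <= x <= b /\ P a x].
have Aa : A a.
  split; first by rewrite lexx.
  have [|d d0] := loc a; first by rewrite lexx.
  by apply=> //; rewrite ?ltrBlDr ltrDl.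
have hA : has_sup A by split; [exists a|exists b => x [/andP[]]].
pose c := sup A.
have ac : a <= c by apply: sup_upper_bound.
have cb : c <= b by apply: ge_sup => [|x [/andP[]]//]; exists a.
have [|d d0 H] := loc c; first by rewrite ac.
have [s [/andP[as_ sb] Ps] cs] := sup_adherent d0 hA.
have sc : s <= c by apply: sup_upper_bound => //; split=> //; rewrite as_.
have step t : c <= t -> t <= b -> t < c + d -> P a t.
  move=> ct tb tc; apply: (tr a s t) => //; first exact: le_trans ct.
  exact: H.
have [bc|] := leP b (c + d / 2).
  apply: step => //; apply: le_lt_trans bc _.
  by rewrite ltrD2l gtr_pMr// invf_lt1// ltr1n.
move=> cb'; suff : c + d / 2 <= c by rewrite gerDl leNgt divr_gt0.
apply: sup_upper_bound => //; split.
  by rewrite (ltW cb') andbT (le_trans ac)// lerDl ltW// divr_gt0.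
apply: step => //; [by rewrite lerDl ltW// divr_gt0|exact: ltW|].
by rewrite ltrD2l gtr_pMr// invf_lt1// ltr1n.
Qed.

(* A sewing lemma: local errors that are small compared with an additive
   function add up to an arbitrarily small global error. *)
Lemma sewing f p q a b : loc1 p -> loc1 q -> (forall x, 0 <= q x) ->
  (forall x e, a <= x <= b -> 0 < e -> exists2 d, 0 < d &
    forall s t, a <= s -> s <= x -> x <= t -> t <= b ->
      x - d < s -> t < x + d ->
      `|f t - f s - J s t p| <= e * J s t q) ->
  a <= b -> f b - f a = J a b p.
Proof.
move=> pl ql q0 H ab.
have main e : 0 < e -> `|f b - f a - J a b p| <= e * J a b q.
  move=> e0; apply: (cousin (P := fun s t => `|f t - f s - J s t p| <= e * J s t q)) => //.
    move=> s m t _ sm mt _ H1 H2.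
    rewrite (J_chasles pl sm mt) (J_chasles ql sm mt) mulrDr.
    rewrite (_ : _ - _ = (f m - f s - J s m p) + (f t - f m - J m t p)); last by ring.
    by apply: le_trans (ler_normD _ _) _; exact: lerD.
  by move=> x xab; exact: H.
apply/eqP; rewrite -subr_eq0 -normr_le0; apply/ler_addgt0Pl => e e0.
have K0 : 0 < J a b q + 1 by rewrite ltr_wpDl// J_ge0.
rewrite addr0; apply: le_trans (main (e / (J a b q + 1)) _) _; first by rewrite divr_gt0.
by rewrite mulrAC ler_pdivrMr// ler_wpM2l ?lerDl// ltW.
Qed.

Lemma continuous_bounded_itv f a b : continuous f ->
  exists2 M, 0 < M & forall x, a <= x <= b -> `|f x| <= M.
Proof.
move=> cf.
have cpt : compact (f @` `[a, b]).
  apply: continuous_compact; last exact: segment_compact.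
  exact: continuous_subspaceT.
have [M [_ H]] := compact_bounded cpt.
exists (`|M| + 1) => [|x xab]; first by rewrite ltr_wpDl.
apply: (H (`|M| + 1)); first by rewrite ltr_pwDr// ler_norm.
by exists x => //; rewrite /= in_itv.
Qed.

Lemma loc1Mc p g : loc1 p -> continuous g -> loc1 (fun x => p x * g x).
Proof.
move=> [mp pi] cg; have mg := continuous_measurable_fun cg.
split=> [|a b]; first exact: measurable_funM.
have [M M0 HM] := continuous_bounded_itv a b cg.
have := @integrableMl _ _ _ mu _ (measurable_itv `[a, b]) (EFin \o p) g (pi a b).
move=> K; apply: (K _ _).
- exact: measurable_funS mg.
- exists M; split; rewrite ?num_real// => y My x /=; rewrite in_itv/= => xab.
  exact: le_trans (HM x xab) (ltW My).
Qed.

Lemma continuous_loc1 f : continuous f -> loc1 f.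
Proof.
move=> cf; have := loc1Mc (loc1_cst 1) cf.
by rewrite (_ : (fun _ => _) = f)//; apply/funext => x; rewrite mul1r.
Qed.

(** Absolute continuity of [f] with density [p]. This replaces weak derivatives in the computations,
    because it can be proved by local estimates through [cousin] and [sewing]. *)
Definition is_primitive f p := loc1 p /\ forall a b, a <= b -> f b - f a = J a b p.

Lemma isP_cont f p : is_primitive f p -> continuous f.
Proof.
move=> [pl H] x.
have xx : x - 1 < x + 1 by lra.
have := parameterized_integral_continuous (ltW xx) (pl.2 (x - 1) (x + 1)).
move=> /(within_continuous_continuous xx) => /(_ x); rewrite in_itv/=.
have -> : x - 1 < x < x + 1 by apply/andP; split; lra.
move=> /(_ isT) cP.
have E y : x - 1 <= y -> f y = f (x - 1) + J (x - 1) y p.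
  by move=> xy; rewrite -H// addrC subrK.
apply/cvgrPdist_lt => e e0.
move/cvgrPdist_lt: cP => /(_ e e0) cP.
near=> y; rewrite E; last by lra.
rewrite [in X in _ - X]E; last first.
  near: y; exists 1 => //= z /=; rewrite ltr_distlC => /andP[? _]; exact: ltW.
rewrite opprD addrACA subrr add0r; near: y; exact: cP.
Unshelve. all: by end_near. Qed.

Lemma nearP x (P : R -> Prop) : (\forall y \near x, P y) ->
  exists2 d, 0 < d & forall y, x - d < y < x + d -> P y.
Proof.
move=> /nbhs_ballP[d d0 H]; exists d => // y /andP[y1 y2]; apply: H.
by rewrite /ball/= ltr_distlC y1.
Qed.

(** Leibniz rule for absolutely continuous functions. On a short interval around [x] the error is
    the integral of [p y * (g t - g y) + (f s - f y) * q y], small relative to the integral of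
    [|p| + |q|], so [sewing] applies. *)
Lemma isP_mul f p g q : is_primitive f p -> is_primitive g q ->
  is_primitive (fun x => f x * g x) (fun x => p x * g x + f x * q x).
Proof.
move=> fp gq; have cf := isP_cont fp; have cg := isP_cont gq.
case: fp gq => pl Hf [ql Hg].
have l1 := loc1Mc pl cg.
have l2 : loc1 (fun x => f x * q x).
  have := loc1Mc ql cf; congr loc1; apply/funext => x; exact: mulrC.
split=> [|a b ab]; first exact: loc1D.
apply: (sewing (q := fun x => `|p x| + `|q x|) (f := fun x => f x * g x)) => //.
- exact: loc1D.
- by apply: loc1D; exact: loc1_abs.
move=> x e xab e0.
have e2 : 0 < e / 2 by rewrite divr_gt0.
have [d1 d10 H1] := nearP ((cvgrPdist_lt _ _).1 (cf x) _ e2).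
have [d2 d20 H2] := nearP ((cvgrPdist_lt _ _).1 (cg x) _ e2).
exists (Num.min d1 d2); first by rewrite lt_min d10.
move=> s t as_ sx xt tb xs tx.
have st := le_trans sx xt.
have D (h : R -> R) d y z : 0 < d -> Num.min d1 d2 <= d ->
   (forall y, x - d < y < x + d -> `|h x - h y| < e / 2) ->
   s <= y <= t -> s <= z <= t -> `|h y - h z| <= e.
  move=> d0 dd Hh /andP[sy yt] /andP[sz zt].
  have Hy : `|h x - h y| < e / 2 by apply: Hh; apply/andP; split; lra.
  have Hz : `|h x - h z| < e / 2 by apply: Hh; apply/andP; split; lra.
  rewrite (_ : h y - h z = (h x - h z) - (h x - h y)); last by ring.
  by apply: le_trans (ler_normB _ _) _; lra.
(* Uses [f t * g t - f s * g s = g t * (f t - f s) + f s * (g t - g s)] to write the error as a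
   single integral. *)
have -> : f t * g t - f s * g s - J s t (fun y => p y * g y + f y * q y) =
   J s t (fun y => (g t * p y + f s * q y) - (p y * g y + f y * q y)).
  rewrite [RHS]J_B//; [congr (_ - _)|by apply: loc1D; exact: loc1Z|exact: loc1D].
  rewrite J_D ?J_Z//; try exact: loc1Z.
  by rewrite -Hf// -Hg//; ring.
apply: le_trans (J_abs _ _ _) _.
  by apply: loc1B; apply: loc1D => //; exact: loc1Z.
rewrite -J_Z; last by apply: loc1D; exact: loc1_abs.
apply: J_le => [||y syt].
- by apply/loc1_abs/loc1B; apply: loc1D => //; exact: loc1Z.
- by apply/loc1Z/loc1D; exact: loc1_abs.
rewrite (_ : _ - _ = p y * (g t - g y) + (f s - f y) * q y); last by ring.
apply: le_trans (ler_normD _ _) _; rewrite !normrM mulrDr (mulrC `|p y|).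
by apply: lerD; apply: ler_wpM2r => //;
  [apply: (D g d2)|apply: (D f d1)] => //; rewrite ?ge_min ?lexx ?orbT// ?st ?andbT.
Qed.

Lemma C1_isP f g : (forall x, derivable f x 1) -> continuous g ->
  (forall x, 'D_1 f x = g x) -> is_primitive f g.
Proof.
move=> df cg fg; split=> [|a b]; first exact: continuous_loc1.
rewrite le_eqVlt => /predU1P[->|ab]; first by rewrite J_ge// subrr.
have cf : continuous f.
  by move=> x; apply: differentiable_continuous; exact/derivable1_diffP.
rewrite /J /Rintegral (@continuous_FTC2 _ _ f)//.
- exact: continuous_subspaceT.
- split=> [x _||]; first exact: df.
  + exact: cvg_at_right_filter (cf a).
  + exact: cvg_at_left_filter (cf b).
- by move=> x _; rewrite derive1E fg.
Qed.

Lemma J_supp f a b : (forall x, ~~ (a <= x <= b) -> f x = 0) ->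
  \int[mu]_x f x = J a b f.
Proof.
move=> H; rewrite J_indic; apply: eq_Rintegral => x _; rewrite indicE.
case: (boolP (x \in _)) => [|xn]; first by rewrite mul1r.
rewrite mul0r; apply: H; apply: contra xn => xab.
by rewrite inE/= in_itv.
Qed.

Lemma derive_quad f x (L C : R) : (forall h : R, `|f (x + h) - f x - L * h| <= C * h ^+ 2) ->
  is_derive x 1 f L.
Proof.
move=> H; suff K : h^-1 *: ((f \o shift x) (h *: 1) - f x) @[h --> 0^'] --> L.
  by apply: DeriveDef; [apply/cvg_ex; exists L|exact/cvg_lim].
apply/cvgrPdist_lt => e e0.
have C0 : 0 < `|C| + 1 by rewrite ltr_wpDl.
near=> h.
have h0 : h != 0 by near: h; exact: nbhs_dnbhs_neq.
rewrite /= scaler1 [h^-1 *: _]mulrC (addrC h).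
rewrite (_ : L - _ = - ((f (x + h) - f x - L * h) / h)); last by field.
rewrite normrN normrM normfV ltr_pdivrMr ?normr_gt0//.
apply: le_lt_trans (H h) _.
apply: le_lt_trans (_ : (`|C| + 1) * (`|h| * `|h|) < _).
  by rewrite -normrM -expr2 ger0_norm ?sqr_ge0// ler_wpM2r ?sqr_ge0// (le_trans (ler_norm _))// lerDl.
rewrite mulrA ltr_pM2r ?normr_gt0// mulrC -ltr_pdivlMr//.
near: h; apply: dnbhs0_lt; exact: divr_gt0.
Unshelve. all: by end_near. Qed.

Definition pos x : R := Num.max 0 x.

Lemma pos_le0 x : x <= 0 -> pos x = 0.
Proof. by rewrite /pos; case: ltP => // + /le_gtF ->. Qed.
Lemma posE x : 0 <= x -> pos x = x.
Proof. by rewrite /pos; case: ltP => // h1 h2; apply/le_anti; rewrite h1 h2. Qed.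

Lemma pos_sqr_derive a x : is_derive x 1 (fun y => pos (y + a) ^+ 2) (2 * pos (x + a)).
Proof.
apply: (@derive_quad _ _ _ 1) => h.
rewrite mul1r ler_norml.
have [h1|h1] := leP 0 (x + a); have [h2|h2] := leP 0 (x + h + a);
  rewrite ?(posE h1) ?(posE h2) ?(pos_le0 (ltW h1)) ?(pos_le0 (ltW h2)); apply/andP; split; nra.
Qed.

(* [hat c e] is the tent of height [e] over [[c - e, c + e]] and [bump c e] its
   primitive, which equals [e ^+ 2] beyond [c + e]. *)
Definition hat c e x : R := pos (x + (e - c)) - 2 * pos (x - c) + pos (x + (- e - c)).
Definition bump c e x : R :=
  (pos (x + (e - c)) ^+ 2 - 2 * pos (x - c) ^+ 2 + pos (x + (- e - c)) ^+ 2) / 2.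

Lemma bump_derive c e x : is_derive x 1 (bump c e) (hat c e x).
Proof.
have D1 := pos_sqr_derive (e - c) x.
have D2 := pos_sqr_derive (- c) x.
have D3 := pos_sqr_derive (- e - c) x.
have -> : bump c e = (fun y => 2^-1 * ((pos (y + (e - c)) ^+ 2 + pos (y + (- e - c)) ^+ 2) + (- 2) * (pos (y - c) ^+ 2))).
  by apply/funext => y; rewrite /bump; field.
apply: is_derive_eq; rewrite /hat /GRing.scale/=; field => //.
Qed.

Lemma pos_cont : continuous pos.
Proof.
move=> x; apply: continuous_max; [exact: cst_continuous|exact: cvg_id].
Qed.

Lemma hat_cont c e : continuous (hat c e).
Proof.
have P a : continuous (fun x => pos (x + a)).
  move=> x; apply: (@continuous_comp _ _ _ (fun x => x + a) pos); last exact: pos_cont.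
  by apply: cvgD; [exact: cvg_id|exact: cvg_cst].
move=> x; apply: cvgD; last exact: P.
by apply: cvgB; [exact: P|apply: cvgM; [exact: cvg_cst|exact: P]].
Qed.

Lemma bump_isP c e : is_primitive (bump c e) (hat c e).
Proof.
apply: C1_isP => [x||x]; [|exact: hat_cont|].
- by have [] := bump_derive c e x.
- by have [_] := bump_derive c e x.
Qed.

Lemma bump_left c e x : 0 <= e -> x <= c - e -> bump c e x = 0.
Proof.
move=> e0 xc; rewrite /bump !pos_le0; first by rewrite expr0n/= mulr0 subr0 addr0 mul0r.
all: lra.
Qed.

Lemma bump_right c e x : 0 <= e -> c + e <= x -> bump c e x = e ^+ 2.
Proof.
move=> e0 xc; rewrite /bump !posE; first by field.
all: lra.
Qed.

Lemma hat_out c e x : 0 <= e -> ~~ (c - e <= x <= c + e) -> hat c e x = 0.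
Proof.
move=> e0; rewrite negb_and -!ltNge /hat => /orP[h|h].
- by rewrite !pos_le0; lra.
- by rewrite !posE; lra.
Qed.

Lemma hat_ge0 c e x : 0 <= e -> 0 <= hat c e x.
Proof.
move=> e0; rewrite /hat.
have [h1|h1] := leP 0 (x + (e - c)); have [h2|h2] := leP 0 (x - c);
 have [h3|h3] := leP 0 (x + (- e - c));
  rewrite ?(posE h1) ?(posE h2) ?(posE h3) ?(pos_le0 (ltW h1)) ?(pos_le0 (ltW h2)) ?(pos_le0 (ltW h3)); lra.
Qed.

Lemma hat_J c e lo hi : 0 <= e -> lo <= c - e -> c + e <= hi ->
  J lo hi (hat c e) = e ^+ 2.
Proof.
move=> e0 h1 h2; rewrite -(bump_isP c e).2; last by lra.
by rewrite bump_right// bump_left// subr0.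
Qed.

(* The fundamental lemma of the calculus of variations, tested with
   differences of two bumps. *)
Lemma bump_test c1 c2 e : 0 < e -> test_function (fun x => bump c1 e x - bump c2 e x)
  /\ (derive1 (fun x => bump c1 e x - bump c2 e x) = fun x => hat c1 e x - hat c2 e x).
Proof.
move=> e0; have e0' := ltW e0.
have D x : is_derive x 1 (fun x => bump c1 e x - bump c2 e x) (hat c1 e x - hat c2 e x).
  by have D1 := bump_derive c1 e x; have D2 := bump_derive c2 e x; exact: is_deriveB.
have E : derive1 (fun x => bump c1 e x - bump c2 e x) = fun x => hat c1 e x - hat c2 e x.
  by apply/funext => x; rewrite derive1E; have [_ ->] := D x.
split=> //; split=> [x||]; first by have [] := D x.
- by rewrite E => x; apply: cvgB; exact: hat_cont.
- pose lo := Num.min c1 c2 - e; pose hi := Num.max c1 c2 + e.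
  apply: (@subclosed_compact _ _ `[lo, hi]%classic); first exact: closed_closure.
    exact: segment_compact.
  have -> : `[lo, hi]%classic = closure `[lo, hi]%classic.
    by apply/closure_id; exact: interval_closed.
  apply: closureS => x /= /eqP xn; rewrite in_itv/=; apply/negPn/negP => xout.
  have lc1 : lo <= c1 - e by rewrite /lo lerB// ge_min lexx.
  have lc2 : lo <= c2 - e by rewrite /lo lerB// ge_min lexx orbT.
  have hc1 : c1 + e <= hi by rewrite /hi lerD// le_max lexx.
  have hc2 : c2 + e <= hi by rewrite /hi lerD// le_max lexx orbT.
  apply: xn; move: xout; rewrite negb_and -!ltNge => /orP[h|h].
    by rewrite !bump_left// ?subrr//; lra.
  by rewrite !bump_right// ?subrr//; lra.
Qed.

(** Divided by its mass [e ^+ 2], [hat c e] is an approximate identity at [c]; the hypothesis says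
    that the averages of [F] near [a] and near [b] coincide for every small [e]. *)
Lemma flat_const (F : R -> R) a b : continuous F -> a < b ->
  (forall e : R, 0 < e -> e < 1 -> J (a - 1) (b + 1) (fun x => F x * (hat a e x - hat b e x)) = 0) ->
  F a = F b.
Proof.
move=> cF ab H; apply/eqP; rewrite -subr_eq0 -normr_le0; apply/ler_addgt0Pl => w w0.
rewrite addr0.
have w2 : 0 < w / 2 by rewrite divr_gt0.
have [d1 d10 H1] := nearP ((cvgrPdist_lt _ _).1 (cF a) _ w2).
have [d2 d20 H2] := nearP ((cvgrPdist_lt _ _).1 (cF b) _ w2).
pose e := Num.min (Num.min d1 d2) 1 / 2.
have e0 : 0 < e by rewrite divr_gt0// !lt_min d10 d20/=.
have ed1 : e < d1 by rewrite /e; have : Num.min (Num.min d1 d2) 1 <= d1; [rewrite !ge_min lexx|lra].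
have ed2 : e < d2 by rewrite /e; have : Num.min (Num.min d1 d2) 1 <= d2; [rewrite !ge_min lexx orbT|lra].
have e1 : e < 1 by rewrite /e; have : Num.min (Num.min d1 d2) 1 <= 1; [rewrite !ge_min lexx orbT|lra].
have lh c : loc1 (hat c e) by apply: continuous_loc1; exact: hat_cont.
have lFh c : loc1 (fun x => F x * hat c e x).
  by apply: continuous_loc1 => x; apply: cvgM; [exact: cF|exact: hat_cont].
have K c d : e < d -> (forall y, c - d < y < c + d -> `|F c - F y| < w / 2) ->
    a <= c <= b ->
   `|J (a - 1) (b + 1) (fun x => F x * hat c e x) - F c * e ^+ 2| <= w / 2 * e ^+ 2.
  move=> ed HF acb.
  rewrite -(@hat_J c e (a - 1) (b + 1)); try lra.
  rewrite -J_Z// -J_B//; last exact: loc1Z.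
  apply: le_trans (J_abs _ _ _) _; first by apply: loc1B => //; exact: loc1Z.
  rewrite -J_Z//; apply: J_le => [||x xab].
  - by apply/loc1_abs/loc1B => //; exact: loc1Z.
  - exact: loc1Z.
  rewrite -mulrBl normrM (ger0_norm (hat_ge0 _ _ (ltW e0))).
  have [xc|xc] := boolP (c - e <= x <= c + e); last by rewrite hat_out ?mulr0// ltW.
  apply: ler_wpM2r; first exact/hat_ge0/ltW.
  by rewrite distrC ltW// HF//; lra.
have := K a _ ed1 H1; have := K b _ ed2 H2.
have := H e e0 e1.
rewrite (_ : (fun _ => _) = (fun x => F x * hat a e x - F x * hat b e x)); last first.
  by apply/funext => x; rewrite mulrBr.
rewrite J_B// => /eqP; rewrite subr_eq0 => /eqP ->.
set I := J _ _ _ => Kb Ka.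
have {}Kb := Kb _; have {}Ka := Ka _.
have L : `|F a - F b| * e ^+ 2 <= w * e ^+ 2.
  rewrite -[e ^+ 2 in leLHS]ger0_norm ?sqr_ge0// -normrM.
  rewrite (_ : _ * _ = (I - F b * e ^+ 2) - (I - F a * e ^+ 2)); last by ring.
  apply: le_trans (ler_normB _ _) _.
  apply: le_trans (lerD (Kb _) (Ka _)) _; rewrite ?lexx ?(ltW ab)//.
  by rewrite -mulrDl -splitr.
by rewrite -(ler_pM2r (exprn_gt0 2 e0)).
Qed.

Lemma test_support phi : test_function phi ->
  exists2 M, 0 < M & forall x, M < `|x| -> phi x = 0 /\ derive1 phi x = 0.
Proof.
move=> [_ _ /compact_bounded[M [_ HM]]].
exists (`|M| + 1) => [|x xM]; first by rewrite ltr_wpDl.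
have Z y : `|M| + 1 < `|y| -> phi y = 0.
  move=> yM; apply/eqP/negPn/negP => py; move: yM; rewrite ltNge => /negP; apply.
  apply: (HM (`|M| + 1)); first by rewrite ltr_pwDr// ler_norm.
  exact: subset_closure.
split; first exact: Z.
rewrite derive1E (@near_eq_derive _ _ _ _ (cst 0)) ?derive_cst//.
near=> y; apply: Z; near: y.
have := @norm_continuous _ _ x; move/cvgrPdist_lt => /(_ (`|x| - (`|M| + 1))).
rewrite subr_gt0 => /(_ xM); apply: filterS => y /=.
by rewrite ltr_distlC => /andP[]; lra.
Unshelve. all: by end_near. Qed.

Lemma test_isP phi : test_function phi -> is_primitive phi (derive1 phi).
Proof. by move=> [d c _]; exact: (C1_isP d c (fun x => esym (derive1E phi x))). Qed.

Lemma loc1_locally_integrable f : loc1 f -> locally_integrable [set: R] f.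
Proof.
move=> [mf fi]; split=> //; first exact: openT.
move=> K _ cK; have [M [_ HM]] := compact_bounded cK.
have /integrableP[_] := fi (- (`|M| + 1)) (`|M| + 1).
apply: le_lt_trans; apply: ge0_subset_integral => //=.
- exact: compact_measurable.
- by do 2 apply: measurableT_comp => //; exact: measurable_funS mf.
move=> x Kx; rewrite /= in_itv/= -ler_norml.
by apply: (HM (`|M| + 1)) => //; rewrite ltr_pwDr// ler_norm.
Qed.

Lemma locally_integrable_loc1 f : locally_integrable [set: R] f -> loc1 f.
Proof.
move=> [mf _ H]; split=> // a b; apply/integrableP; split.
  by apply/measurable_EFinP; exact: measurable_funS mf.
by apply: (H `[a, b]%classic) => //; exact: segment_compact.
Qed.

Lemma weak_test f p phi M : loc1 f -> loc1 p -> test_function phi ->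
  (forall x, M < `|x| -> phi x = 0 /\ derive1 phi x = 0) ->
  (\int[mu]_x (f x * derive1 phi x) = J (- M) M (fun x => f x * derive1 phi x)) /\
  (\int[mu]_x (p x * phi x) = J (- M) M (fun x => p x * phi x)).
Proof.
move=> _ _ _ HM.
by split; apply: J_supp => x; rewrite -ler_norml -ltNge => /HM[h1 h2];
  rewrite ?h1 ?h2 mulr0.
Qed.

Lemma isP_weak f p : is_primitive f p -> is_weak_derivative f p.
Proof.
move=> fp; have cf := isP_cont fp; have lf := continuous_loc1 cf.
have lp := fp.1; split; try exact: loc1_locally_integrable.
move=> phi tphi; have [M M0 HM] := test_support tphi.
have pp := test_isP tphi.
(* [HM] speaks of [M < |x|] only; enlarging the segment to [M + 1] makes both boundary terms
   vanish. *)
have HM1 x : M + 1 < `|x| -> phi x = 0 /\ derive1 phi x = 0 by move=> ?; apply: HM; lra.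
have [-> ->] := weak_test lf lp tphi HM1.
have := (isP_mul fp pp).2 (- (M + 1)) (M + 1).
have N1 : M < `|M + 1| by rewrite ger0_norm; lra.
rewrite (HM (M + 1) N1).1 (HM (- (M + 1)) _).1 ?normrN// !mulr0 subrr J_D.
- by move=> H; apply/eqP; rewrite -addr_eq0 addrC -H//; lra.
- by apply: loc1Mc => //; exact: isP_cont pp.
- have := loc1Mc pp.1 cf; congr loc1; apply/funext => x; exact: mulrC.
Qed.

Lemma primitive p : loc1 p -> exists G, is_primitive G p.
Proof.
(* Since [J] is not oriented, one of the two terms is 0 and the difference is the oriented integral
   from 0 to [x]. *)
move=> pl; exists (fun x => J 0 x p - J x 0 p); split=> // a b ab.
have [a0|a0] := leP 0 a; have [b0|b0] := leP 0 b.
- by rewrite (J_ge _ a0) (J_ge _ b0) (J_chasles pl a0 ab); ring.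
- lra.
- by rewrite (J_ge _ b0) (J_ge _ (ltW a0)) (J_chasles pl (ltW a0) b0); ring.
- by rewrite (J_ge _ (ltW a0)) (J_ge _ (ltW b0)) (J_chasles pl ab (ltW b0)); ring.
Qed.

(** Du Bois-Reymond's argument: [f] minus a primitive [G] of [p] is orthogonal to the derivatives of
    the test functions of [bump_test], hence constant by [flat_const]. *)
Lemma weak_isP f p : continuous f -> is_weak_derivative f p -> is_primitive f p.
Proof.
move=> cf [_ /locally_integrable_loc1 pl W]; split=> // a b.
rewrite le_eqVlt => /predU1P[->|ab]; first by rewrite subrr J_ge.
have [G GP] := primitive pl; have cG := isP_cont GP.
suff : f a - G a = f b - G b by rewrite -(GP.2 _ _ (ltW ab)); lra.
apply: (@flat_const (fun x => f x - G x)) => //.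
  by move=> x; apply: cvgB; [exact: cf|exact: cG].
move=> e e0 e1; have [tphi dphi] := bump_test a b e0.
set phi := fun x => _ in tphi dphi.
have pp := test_isP tphi.
have out x : ~~ (a - 1 <= x <= b + 1) -> phi x = 0 /\ derive1 phi x = 0.
  rewrite dphi => xab; rewrite !hat_out ?(ltW e0) ?subrr//;
    try by apply: contra xab => /andP[? ?]; apply/andP; split; lra.
  split=> //; move: xab; rewrite /phi negb_and -!ltNge => /orP[h|h].
    by rewrite !bump_left ?subrr//; lra.
  by rewrite !bump_right ?subrr//; lra.
have := W _ tphi.
rewrite !(@J_supp _ (a - 1) (b + 1)); try by move=> x /out[h1 h2]; rewrite ?h1 ?h2 mulr0.
have := (isP_mul GP pp).2 (a - 1) (b + 1).
have -> : phi (b + 1) = 0 by rewrite /phi !bump_right ?subrr//; lra.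
have -> : phi (a - 1) = 0 by rewrite /phi !bump_left ?subrr//; lra.
rewrite !mulr0 subrr.
have dphix x : hat a e x - hat b e x = derive1 phi x by rewrite dphi.
have cphi := isP_cont pp.
have cdphi : continuous (derive1 phi) by case: tphi.
have l1 h : continuous h -> loc1 (fun x => h x * derive1 phi x).
  by move=> ch; apply: loc1Mc => //; exact: continuous_loc1.
rewrite J_D; [|exact: loc1Mc|exact: l1].
move=> H1 H2.
rewrite (_ : (fun _ => _) = (fun x => f x * derive1 phi x - G x * derive1 phi x)); last first.
  by apply/funext => x; rewrite dphix mulrBl.
rewrite J_B ?H2; [|exact: l1..].
rewrite -opprD -H1 ?oppr0//; lra.
Qed.

(** On the half-line beyond [- n] the indefinite integral of [d] is constant while its derivative is
    [d] almost everywhere; countably many null sets are then put together. *)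
Lemma J0_ae d : loc1 d -> (forall a b, a <= b -> J a b d = 0) -> \forall x \ae mu, d x = 0.
Proof.
move=> dl H.
have K n : {ae mu, forall x, ((- n%:R)%:E < x%:E)%E -> d x = 0}.
  have := @FTC1 _ d (BLeft (- n%:R)) (fun y => dl.2 _ y) (loc1_locally_integrable dl).
  apply: (@filterS _ _ (ae_filter_ringOfSetsType mu)) => x /= Hx; rewrite lte_fin => nx.
  have /Hx[_ <-] : ((- n%:R)%:E < x%:E)%E by rewrite lte_fin.
  rewrite (_ : (fun _ => _) = cst 0) ?derive1_cst//; apply/funext => y.
  have [ny|ny] := leP (- n%:R) y; first exact: H.
  by apply: J_ge; exact: ltW.
have := @ae_foralln _ _ _ mu (fun n x => ((- n%:R)%:E < x%:E)%E -> d x = 0) K.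
apply: (@filterS _ _ (ae_filter_ringOfSetsType mu)) => x /= Hx.
apply: (Hx (Num.truncn `|x|).+1); rewrite lte_fin ltrNl.
by apply: le_lt_trans (truncnS_gt _); rewrite -normrN ler_norm.
Qed.

(** The difference is a weak derivative of the continuous function 0, so by [weak_isP] its integral
    over every segment vanishes. *)
Lemma weak_uniq f p1 p2 : is_weak_derivative f p1 -> is_weak_derivative f p2 ->
  \forall x \ae mu, p1 x = p2 x.
Proof.
move=> [_ /locally_integrable_loc1 l1 W1] [_ /locally_integrable_loc1 l2 W2].
have ld := loc1B l1 l2.
have : is_weak_derivative (fun=> 0) (fun x => p1 x - p2 x).
  split; try exact: loc1_locally_integrable; first exact/loc1_locally_integrable/loc1_cst.
  move=> phi tphi; have [M M0 HM] := test_support tphi.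
  have [-> _] := weak_test (loc1_cst 0) l1 tphi HM.
  have cphi := isP_cont (test_isP tphi).
  have [_ ->] := weak_test (loc1_cst 0) ld tphi HM.
  have [_ E1] := weak_test (loc1_cst 0) l1 tphi HM.
  have [_ E2] := weak_test (loc1_cst 0) l2 tphi HM.
  rewrite (_ : (fun x => (p1 x - p2 x) * _) = (fun x => p1 x * phi x - p2 x * phi x)); last first.
    by apply/funext => x; rewrite mulrBl.
  rewrite J_B; try exact: loc1Mc.
  rewrite -E1 -E2 -[in X in X - _](opprK (\int[mu]_x (p1 x * phi x))) -W1// W2//.
  rewrite opprK subrr oppr0 (_ : (fun _ => _) = fun=> 0); last by apply/funext => x; rewrite mul0r.
  by rewrite /J Rintegral_cst//= mul0r.
move=> /(weak_isP (@cst_continuous _ _ 0))[_ H].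
have := J0_ae ld; move=> K; have {K} := K _.
move=> K; have : \forall x \ae mu, p1 x - p2 x = 0 by apply: K => a b ab; rewrite -H// subrr.
by apply: (@filterS _ _ (ae_filter_ringOfSetsType mu)) => x /eqP; rewrite subr_eq0 => /eqP.
Qed.

End AC.

(** * The space E *)

Section E.
Context {R : realType}.
Implicit Types (f g h p q : R -> R) (a b c s t x : R) (X Y : state R R).
Notation mu := (@lebesgue_measure R).

Lemma weak_loc1 f p : is_weak_derivative f p -> loc1 f /\ loc1 p.
Proof. by move=> [? ? _]; split; exact: locally_integrable_loc1. Qed.

Lemma L1_test_mul f phi : loc1 f -> test_function phi ->
  L1 (fun x => f x * phi x) /\ L1 (fun x => f x * derive1 phi x).
Proof.
move=> lf tp; have [M M0 HM] := test_support tp.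
have cphi := isP_cont (test_isP tp).
have cd : continuous (derive1 phi) by case: tp.
have K g : continuous g -> (forall x, M < `|x| -> g x = 0) -> L1 (fun x => f x * g x).
  move=> cg Hg; have [_ /(_ (- M) M) H] := loc1Mc lf cg.
  have := (integrable_mkcond _ _).1 H => /(_ (measurable_itv _)); apply: eq_integrable => // x _ /=.
  rewrite patchE; case: ifPn => //; rewrite notin_setE/= in_itv/= -ler_norml => /negP.
  by rewrite -ltNge => /Hg ->; rewrite mulr0.
by split; apply: K => // x /HM[].
Qed.

Lemma weakD f g p q : is_weak_derivative f p -> is_weak_derivative g q ->
  is_weak_derivative (f \+ g) (p \+ q).
Proof.
move=> fp gq; have [lf lp] := weak_loc1 fp; have [lg lq] := weak_loc1 gq.
case: fp gq => _ _ Wf [_ _ Wg].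
split; [exact/loc1_locally_integrable/loc1D|exact/loc1_locally_integrable/loc1D|].
move=> phi tp.
under eq_Rintegral do rewrite /= mulrDl.
under [in RHS]eq_Rintegral do rewrite /= mulrDl.
rewrite !RintegralD ?Wf ?Wg ?opprD//; try exact: (L1_test_mul _ tp).1;
  exact: (L1_test_mul _ tp).2.
Qed.

Lemma weakZ f p a : is_weak_derivative f p ->
  is_weak_derivative (fun x => a * f x) (fun x => a * p x).
Proof.
move=> fp; have [lf lp] := weak_loc1 fp; case: fp => _ _ Wf.
split; [exact/loc1_locally_integrable/loc1Z|exact/loc1_locally_integrable/loc1Z|].
move=> phi tp.
under eq_Rintegral do rewrite /= -mulrA.
under [in RHS]eq_Rintegral do rewrite /= -mulrA.
rewrite !RintegralZl ?Wf ?mulrN//; first exact: (L1_test_mul lp tp).1.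
exact: (L1_test_mul lf tp).2.
Qed.

Lemma wderiv_weak f : weakly_derivable_L2 f -> is_weak_derivative f (wderiv f).
Proof.
move=> [g fg _]; rewrite /wderiv; case: xgetP => // H.
by have := H g fg.
Qed.

(** Lets any explicit weak derivative of [f] stand for the representative chosen by [wderiv]. *)
Lemma wderiv_n2 f p : is_weak_derivative f p -> in_L2 p ->
  in_L2 (wderiv f) /\ n2 (wderiv f) = n2 p.
Proof.
move=> fp p2; have wd := wderiv_weak (ex_intro2 _ _ p fp p2).
apply: ae_L2 => //; first by have [_ []] := weak_loc1 wd.
exact: weak_uniq wd fp.
Qed.

Lemma wderiv_L2 f : weakly_derivable_L2 f -> in_L2 (wderiv f).
Proof. by move=> [p fp p2]; exact: (wderiv_n2 fp p2).1. Qed.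

Lemma wdL2D f g : weakly_derivable_L2 f -> weakly_derivable_L2 g ->
  weakly_derivable_L2 (f \+ g).
Proof. by move=> [p fp p2] [q gq q2]; exists (p \+ q); [exact: weakD|exact: L2D]. Qed.

Lemma wdL2Z f a : weakly_derivable_L2 f -> weakly_derivable_L2 (fun x => a * f x).
Proof. by move=> [p fp p2]; exists (fun x => a * p x); [exact: weakZ|exact: L2Z]. Qed.

Lemma n2_wderivD f g : weakly_derivable_L2 f -> weakly_derivable_L2 g ->
  n2 (wderiv (f \+ g)) <= n2 (wderiv f) + n2 (wderiv g).
Proof.
move=> fd gd.
have [_ ->] := wderiv_n2 (weakD (wderiv_weak fd) (wderiv_weak gd))
  (L2D (wderiv_L2 fd) (wderiv_L2 gd)).
by apply: n2D; exact: wderiv_L2.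
Qed.

Lemma n2_wderivZ f a : weakly_derivable_L2 f ->
  n2 (wderiv (fun x => a * f x)) = `|a| * n2 (wderiv f).
Proof.
move=> fd; have [_ ->] := wderiv_n2 (weakZ a (wderiv_weak fd)) (L2Z a (wderiv_L2 fd)).
by rewrite n2Z//; exact: wderiv_L2.
Qed.

(** The norm of index [+oo] unfolds to an essential supremum only on a space of positive measure. *)
Let muT0 : (0 < mu [set: R])%E.
Proof.
have H : (mu (`[0%R, 1%R]%classic : set R) <= mu [set: R])%E by apply: le_measure; rewrite ?inE.
by apply: lt_le_trans H; rewrite mu_itv// subr0 lte_fin.
Qed.

Lemma Noo_le f c : (forall x, `|f x| <= c) -> ('N[mu]_+oo[EFin \o f] <= c%:E)%E.
Proof.
move=> fc; rewrite unlock muT0; apply/ess_supP; apply: aeW => x /=.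
by rewrite lee_fin.
Qed.

(** By continuity a strict violation at [x] would persist on the segment from [x] to [x + d / 2],
    which is not a null set. *)
Lemma ae_continuous_le f c : continuous f ->
  (\forall x \ae mu, `|f x| <= c) -> forall x, `|f x| <= c.
Proof.
move=> cf [N [mN N0 HN]] x; rewrite leNgt; apply/negP => cx.
have e0 : 0 < `|f x| - c by rewrite subr_gt0.
have [d d0 Hd] := nearP ((cvgrPdist_lt _ _).1 (cf x) _ e0).
suff : (mu (`[x, (x + d / 2)%R]%classic : set R) <= 0)%E.
  by rewrite mu_itv ?lee_fin; lra.
rewrite -N0; apply: le_measure; rewrite ?inE// => y /=; rewrite in_itv/= => /andP[xy yd].
apply: HN => /= fy; have {}Hd : `|f x - f y| < `|f x| - c by apply: Hd; apply/andP; split; lra.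
have : `|f x| <= `|f x - f y| + `|f y| by rewrite -{1}(subrK (f y) (f x)) ler_normD.
by move: fy e0 Hd; lra.
Qed.

Lemma le_Noo f c : continuous f -> ('N[mu]_+oo[EFin \o f] <= c%:E)%E ->
  forall x, `|f x| <= c.
Proof.
move=> cf; rewrite unlock muT0 => /ess_supP H; exact: ae_continuous_le.
Qed.

Lemma NooZ f a : ('N[mu]_+oo[EFin \o (fun x => a * f x)%R] = `|a|%:E * 'N[mu]_+oo[EFin \o f])%E.
Proof.
rewrite unlock muT0 -(@ess_supZl _ _ _ mu _ _ muT0 (normr_ge0 a)); congr (ess_sup _ _).
by apply/funext => x /=; rewrite normrM EFinM.
Qed.

Definition noo f : R := fine 'N[mu]_+oo[EFin \o f].

Lemma noo_ge0 f : 0 <= noo f. Proof. by rewrite fine_ge0// Lnorm_ge0. Qed.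

Lemma in_V_Noo f : in_V f -> ('N[mu]_+oo[EFin \o f] = (noo f)%:E)%E.
Proof.
move=> [cf [M [_ HM]] _]; rewrite /noo fineK// ge0_fin_numE ?Lnorm_ge0//.
apply: le_lt_trans (_ : (`|M| + 1)%:E < +oo)%E; last exact: ltey.
by apply: Noo_le => x; apply: HM => //; rewrite ltr_pwDr// ler_norm.
Qed.

Definition nV f := noo f + n2 (wderiv f).
Definition nH f := Num.sqrt (n2 f ^+ 2 + n2 (wderiv f) ^+ 2).
(** Coincides with [Enorm] on E by [EnormE]; the membership conditions below keep the argument where
    the two agree. *)
Definition En X := nV (zeta_of X) + nH (U_of X) + nV (H_of X) + n2 (rbar_of X).

Lemma VnormE f : in_V f -> Vnorm f = (nV f)%:E.
Proof.
move=> fV; rewrite /Vnorm in_V_Noo// L2_fin//.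
by apply: wderiv_L2; case: fV.
Qed.

Lemma H1normE f : in_H1 f -> H1norm f = (nH f)%:E.
Proof.
move=> [f2 fd]; rewrite /H1norm !L2_fin//; last exact: wderiv_L2.
rewrite -!EFinD /= /nH; congr (_%:E).
rewrite !powR_mulrn ?n2_ge0// powR12_sqrt//.
by rewrite addr_ge0// sqr_ge0.
Qed.

Lemma EnormE X : in_E X -> Enorm X = (En X)%:E.
Proof. by move=> [h1 h2 h3 h4]; rewrite /Enorm !VnormE// H1normE// L2_fin. Qed.

Lemma nV_ge0 f : 0 <= nV f. Proof. by rewrite addr_ge0 ?noo_ge0 ?n2_ge0. Qed.
Lemma nH_ge0 f : 0 <= nH f. Proof. exact: sqrtr_ge0. Qed.
Lemma En_ge0 X : 0 <= En X.
Proof. by apply: addr_ge0 (n2_ge0 _); apply: addr_ge0 (nV_ge0 _); apply: addr_ge0 (nV_ge0 _) (nH_ge0 _). Qed.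

Lemma in_VD f g : in_V f -> in_V g -> in_V (f \+ g).
Proof.
move=> [cf bf df] [cg bg dg]; split; last exact: wdL2D.
  by move=> x; apply: cvgD; [exact: cf|exact: cg].
case: bf bg => M [_ HM] [N [_ HN]]; exists (`|M| + 1 + (`|N| + 1)); split; first exact: num_real.
move=> y yM x _ /=; apply: le_trans (ler_normD _ _) _; apply: ltW; apply: le_lt_trans yM.
by apply: lerD; [apply: HM|apply: HN] => //; rewrite ltr_pwDr// ler_norm.
Qed.

Lemma in_VZ f a : in_V f -> in_V (fun x => a * f x).
Proof.
move=> [cf [M [_ HM]] df]; split; last exact: wdL2Z.
  by move=> x; apply: cvgM; [exact: cvg_cst|exact: cf].
exists (`|a| * (`|M| + 1)); split; first exact: num_real.
move=> y yM x _ /=; rewrite normrM; apply: ltW; apply: le_lt_trans yM.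
by rewrite ler_wpM2l//; apply: HM => //; rewrite ltr_pwDr// ler_norm.
Qed.

Lemma in_H1D f g : in_H1 f -> in_H1 g -> in_H1 (f \+ g).
Proof. by move=> [f2 df] [g2' dg]; split; [exact: L2D|exact: wdL2D]. Qed.

Lemma in_H1Z f a : in_H1 f -> in_H1 (fun x => a * f x).
Proof. by move=> [f2 df]; split; [exact: L2Z|exact: wdL2Z]. Qed.

Lemma in_ED X Y : in_E X -> in_E Y -> in_E (X + Y).
Proof.
by move=> [x1 x2 x3 x4] [y1 y2 y3 y4]; split; [exact: (in_VD x1 y1)|exact: (in_H1D x2 y2)|exact: (in_VD x3 y3)|exact: (L2D x4 y4)].
Qed.

Lemma in_EZ X a : in_E X -> in_E (a *: X).
Proof.
by move=> [x1 x2 x3 x4]; split; [exact: (in_VZ a x1)|exact: (in_H1Z a x2)|exact: (in_VZ a x3)|exact: (L2Z a x4)].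
Qed.

Lemma in_EN X : in_E X -> in_E (- X).
Proof. by rewrite -scaleN1r; exact: in_EZ. Qed.

Lemma in_EB X Y : in_E X -> in_E Y -> in_E (X - Y).
Proof. by move=> XE YE; apply: in_ED => //; exact: in_EN. Qed.

Lemma nVD f g : in_V f -> in_V g -> nV (f \+ g) <= nV f + nV g.
Proof.
move=> fV gV; rewrite /nV addrACA; apply: lerD; last first.
  by case: fV gV => _ _ df [_ _ dg]; exact: n2_wderivD.
rewrite -lee_fin EFinD -!in_V_Noo//; last exact: in_VD.
apply: eminkowski; last exact: leey.
- by apply: continuous_measurable_fun; case: fV.
- by apply: continuous_measurable_fun; case: gV.
Qed.

Lemma nVZ f a : in_V f -> nV (fun x => a * f x) = `|a| * nV f.
Proof.
move=> fV; rewrite /nV n2_wderivZ; last by case: fV.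
rewrite mulrDr; congr (_ + _); apply: EFin_inj; rewrite EFinM -!in_V_Noo//; last exact: in_VZ.
exact: NooZ.
Qed.

(** Triangle inequality of the Euclidean plane; Cauchy-Schwarz comes from
    [0 <= (a * d - b * c) ^+ 2]. *)
Lemma sqrt2D a b c d : 0 <= a -> 0 <= b -> 0 <= c -> 0 <= d ->
  Num.sqrt ((a + b) ^+ 2 + (c + d) ^+ 2) <=
  Num.sqrt (a ^+ 2 + c ^+ 2) + Num.sqrt (b ^+ 2 + d ^+ 2).
Proof.
move=> a0 b0 c0 d0.
set u := Num.sqrt (a ^+ 2 + c ^+ 2); set v := Num.sqrt (b ^+ 2 + d ^+ 2).
have u0 : 0 <= u by exact: sqrtr_ge0.
have v0 : 0 <= v by exact: sqrtr_ge0.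
have u2 : u ^+ 2 = a ^+ 2 + c ^+ 2 by rewrite sqr_sqrtr// addr_ge0// sqr_ge0.
have v2 : v ^+ 2 = b ^+ 2 + d ^+ 2 by rewrite sqr_sqrtr// addr_ge0// sqr_ge0.
have H : a * b + c * d <= u * v.
  rewrite -(@ler_pXn2r _ 2) ?nnegrE//; [|by rewrite addr_ge0// mulr_ge0|by rewrite mulr_ge0].
  by rewrite exprMn u2 v2; have := sqr_ge0 (a * d - b * c); nra.
rewrite -(ger0_norm (addr_ge0 u0 v0)) -sqrtr_sqr ler_wsqrtr//.
by rewrite !sqrrD u2 v2; lra.
Qed.

Lemma nHD f g : in_H1 f -> in_H1 g -> nH (f \+ g) <= nH f + nH g.
Proof.
move=> [f2 df] [g2' dg]; rewrite /nH.
apply: le_trans (sqrt2D _ _ _ _); try exact: n2_ge0.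
apply: ler_wsqrtr; apply: lerD; rewrite ler_pXn2r ?nnegrE ?addr_ge0 ?n2_ge0//.
  exact: n2D.
exact: n2_wderivD.
Qed.

Lemma nHZ f a : in_H1 f -> nH (fun x => a * f x) = `|a| * nH f.
Proof.
move=> [f2 df]; rewrite /nH n2Z// n2_wderivZ// !exprMn -mulrDr sqrtrM ?sqr_ge0//.
by rewrite sqrtr_sqr normr_id.
Qed.

Lemma EnD X Y : in_E X -> in_E Y -> En (X + Y) <= En X + En Y.
Proof.
move=> [x1 x2 x3 x4] [y1 y2 y3 y4].
have -> : En (X + Y) = nV (zeta_of X \+ zeta_of Y) + nH (U_of X \+ U_of Y) +
  nV (H_of X \+ H_of Y) + n2 (rbar_of X \+ rbar_of Y) by [].
apply: le_trans (lerD (lerD (lerD (nVD x1 y1) (nHD x2 y2)) (nVD x3 y3)) (n2D x4 y4)) _.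
have E (a b c d a' b' c' d' : R) :
  (a + a') + (b + b') + (c + c') + (d + d') = (a + b + c + d) + (a' + b' + c' + d') by ring.
by rewrite E.
Qed.

Lemma EnZ X a : in_E X -> En (a *: X) = `|a| * En X.
Proof.
move=> [x1 x2 x3 x4].
have -> : En (a *: X) = nV (fun x => a * zeta_of X x) + nH (fun x => a * U_of X x) +
  nV (fun x => a * H_of X x) + n2 (fun x => a * rbar_of X x) by [].
by rewrite nVZ// nHZ// nVZ// n2Z// -!mulrDr.
Qed.

Lemma EnB X Y : in_E X -> in_E Y -> En (X - Y) <= En X + En Y.
Proof.
move=> XE YE; apply: le_trans (EnD XE (in_EN YE)) _.
by rewrite -scaleN1r EnZ// normrN1 mul1r.
Qed.

Definition is_L2_primitive f p := is_primitive f p /\ in_L2 p.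

Lemma isD_weak f p : is_L2_primitive f p -> is_weak_derivative f p.
Proof. by move=> [/isP_weak]. Qed.

Lemma isD_wdL2 f p : is_L2_primitive f p -> weakly_derivable_L2 f.
Proof. by move=> fp; exists p; [exact: isD_weak|case: fp]. Qed.

Lemma isD_wderiv f : continuous f -> weakly_derivable_L2 f -> is_L2_primitive f (wderiv f).
Proof.
move=> cf fd; split; last exact: wderiv_L2.
by apply: weak_isP => //; exact: wderiv_weak.
Qed.

Lemma isD_V f p c : is_L2_primitive f p -> (forall x, `|f x| <= c) -> in_V f /\ nV f <= c + n2 p.
Proof.
move=> fp fc; have fV : in_V f.
  split; [by apply: isP_cont fp.1| |exact: isD_wdL2 fp].
  by exists c; split; rewrite ?num_real// => y cy x _; apply: le_trans (fc x) (ltW cy).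
split=> //; apply: lerD; first by rewrite -lee_fin -in_V_Noo// Noo_le.
by rewrite (wderiv_n2 (isD_weak fp) fp.2).2.
Qed.

Lemma isD_H f p : is_L2_primitive f p -> in_L2 f -> in_H1 f /\ nH f <= n2 f + n2 p.
Proof.
move=> fp f2; split; first by split=> //; exact: isD_wdL2 fp.
rewrite /nH (wderiv_n2 (isD_weak fp) fp.2).2.
rewrite -(ger0_norm (addr_ge0 (n2_ge0 f) (n2_ge0 p))) -sqrtr_sqr ler_wsqrtr//.
by rewrite sqrrD; have := mulr_ge0 (n2_ge0 f) (n2_ge0 p); lra.
Qed.

Lemma V_sup f x : in_V f -> `|f x| <= nV f.
Proof.
move=> fV; apply: le_trans (_ : noo f <= _); last by rewrite lerDl n2_ge0.
by apply: le_Noo; [case: fV|rewrite in_V_Noo].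
Qed.

Lemma V_n2 f p : in_V f -> is_L2_primitive f p -> n2 p <= nV f.
Proof.
by move=> fV fp; rewrite /nV (wderiv_n2 (isD_weak fp) fp.2).2 lerDr noo_ge0.
Qed.

Lemma H_n2 f : n2 f <= nH f.
Proof.
rewrite -[leLHS]ger0_norm ?n2_ge0// -sqrtr_sqr ler_wsqrtr// lerDl.
exact: sqr_ge0.
Qed.

Lemma H_n2d f p : is_L2_primitive f p -> n2 p <= nH f.
Proof.
move=> fp; rewrite /nH (wderiv_n2 (isD_weak fp) fp.2).2.
by rewrite -[leLHS]ger0_norm ?n2_ge0// -sqrtr_sqr ler_wsqrtr// lerDr sqr_ge0.
Qed.

Lemma isD_hold f p s t : is_L2_primitive f p -> `|f t - f s| <= Num.sqrt `|t - s| * n2 p.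
Proof.
move=> [[pl H] p2]; wlog st : s t / s <= t.
  by move=> W; have [/W//|/ltW/W] := leP s t; rewrite distrC (distrC t).
rewrite H// (ger0_norm (_ : 0 <= t - s)) ?subr_ge0//.
by apply: le_trans (J_abs _ _ pl) _; exact: J_n2.
Qed.

(** The mean of [|f|] over the unit interval to the right of [x] is at most [n2 f], and [f] deviates
    from [f x] there by at most [n2 p], by [isD_hold]. *)
Lemma sobolev f p x : is_L2_primitive f p -> in_L2 f -> `|f x| <= n2 f + n2 p.
Proof.
move=> fp f2; have lf := L2_loc1 f2.
have x1 : x <= x + 1 by rewrite lerDl.
have -> : `|f x| = J x (x + 1) (fun=> `|f x|) by rewrite J_cst// addrC addKr mulr1.
apply: le_trans (_ : J x (x + 1) (fun y => `|f y| + n2 p) <= _).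
  apply: J_le; [exact: loc1_cst|by apply: loc1D; [exact: loc1_abs|exact: loc1_cst]|].
  move=> y /andP[xy yx].
  rewrite -{1}(subrK (f y) (f x)) addrC; apply: le_trans (ler_normD _ _) _; rewrite lerD2l.
  apply: le_trans (isD_hold _ _ fp) _; rewrite ler_piMl ?n2_ge0//.
  by rewrite -[leRHS]sqrtr1 ler_wsqrtr// ler_norml; apply/andP; split; lra.
rewrite J_D; [|exact: loc1_abs|exact: loc1_cst].
rewrite J_cst// (addrC x) addrK mulr1 lerD2r.
by have := J_n2 f2 x1; rewrite (addrC x) addrK sqrtr1 mul1r.
Qed.

End E.

(** * Integral operators with a Schur kernel *)

Section schur.
Context {R : realType}.
Notation mu := (@lebesgue_measure R).
Implicit Types (f g : R -> R) (x eta : R).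

(** By symmetry one integral bound [A] serves both variables in Schur's test; together with the
    pointwise bound [B] it gives the estimate from L^2 to L^oo. *)
Record schur_kernel (W : R -> R -> R) (A B : R) : Prop := SchurKernel {
  sk_meas : measurable_fun [set: R * R] (fun z => W z.1 z.2);
  sk_ge0 : forall x eta, 0 <= W x eta;
  sk_le : forall x eta, W x eta <= B;
  sk_int : forall x, (\int[mu]_eta (W x eta)%:E <= A%:E)%E;
  sk_sym : forall x eta, W x eta = W eta x }.

(** The absolute value is inside because these operators only serve as majorants. *)
Definition kconv (W : R -> R -> R) f x : R := \int[mu]_eta (W x eta * `|f eta|).

Variables (W : R -> R -> R) (A B : R).
Hypothesis K : schur_kernel W A B.

Lemma sk_measx x : measurable_fun setT (W x).
Proof.
have := measurableT_comp (sk_meas K) (pair1_measurable x); exact.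
Qed.

Lemma sk_A0 : 0 <= A.
Proof.
rewrite -lee_fin; apply: le_trans (sk_int K 0).
by apply: integral_ge0 => y _; rewrite lee_fin (sk_ge0 K).
Qed.

Lemma sk_B0 : 0 <= B.
Proof. exact: le_trans (sk_ge0 K 0 0) (sk_le K 0 0). Qed.

(** From [W ^+ 2 <= B * W]. *)
Lemma sk_L2 x : in_L2 (W x) /\ n2 (W x) <= Num.sqrt (A * B).
Proof.
have H : (\int[mu]_eta ((W x eta) ^+ 2)%:E <= (A * B)%:E)%E.
  apply: le_trans (_ : \int[mu]_eta (B%:E * (W x eta)%:E) <= _)%E.
    apply: ge0_le_integral => //= [y _|||y _].
    - by rewrite lee_fin sqr_ge0.
    - by apply/measurable_EFinP; apply: measurable_funX; exact: sk_measx.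
    - by apply/measurable_EFinP; apply: measurable_funM => //; exact: sk_measx.
    - by rewrite -EFinM lee_fin expr2 ler_wpM2r ?(sk_ge0 K) ?(sk_le K).
  rewrite ge0_integralZl//=.
  - by rewrite mulrC EFinM lee_wpmul2l ?lee_fin ?sk_B0// (sk_int K).
  - by apply/measurable_EFinP; exact: sk_measx.
  - by move=> y _; rewrite lee_fin (sk_ge0 K).
  - by rewrite lee_fin sk_B0.
have l2 : in_L2 (W x) by apply: L2P; [exact: sk_measx|exact: le_lt_trans H (ltey _)].
split=> //; move: H; rewrite L2_sq// lee_fin => H.
by rewrite -(ger0_norm (n2_ge0 _)) -sqrtr_sqr ler_wsqrtr.
Qed.

Lemma conv_L1 f x : in_L2 f -> L1 (fun eta => W x eta * `|f eta|).
Proof. by move=> f2; have [] := CS (sk_L2 x).1 (L2_abs f2). Qed.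

Lemma conv_ge0 f x : 0 <= kconv W f x.
Proof. by apply: Rintegral_ge0 => y _; rewrite mulr_ge0// (sk_ge0 K). Qed.

Lemma conv_sup f x : in_L2 f -> kconv W f x <= Num.sqrt (A * B) * n2 f.
Proof.
move=> f2; have [w2 wn] := sk_L2 x.
apply: le_trans (ler_norm _) _; apply: le_trans (CS_le w2 (L2_abs f2)) _.
by rewrite n2_abs// ler_wpM2r// n2_ge0.
Qed.

Lemma convE f x : in_L2 f -> ((kconv W f x)%:E = \int[mu]_eta (W x eta * `|f eta|)%:E)%E.
Proof.
move=> f2; rewrite /kconv /Rintegral fineK//.
by apply: integrable_fin_num => //; exact: conv_L1.
Qed.

Lemma measurable_conv f : in_L2 f -> measurable_fun setT (kconv W f).
Proof.
move=> f2; apply/measurable_EFinP.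
have -> : EFin \o kconv W f = fubini_F mu (fun z : R * R => (W z.1 z.2 * `|f z.2|)%:E).
  by apply/funext => x /=; rewrite convE.
apply: measurable_fun_fubini_tonelli_F => /= [|z].
  apply/measurable_EFinP; apply: measurable_funM; first exact: sk_meas K.
  apply: measurableT_comp => //; apply: measurableT_comp => //.
  by case: f2.
by rewrite lee_fin mulr_ge0// (sk_ge0 K).
Qed.

(** Cauchy-Schwarz with the splitting of [W |f|] into [sqrt W] times [sqrt W |f|]; the first factor
    has squared norm at most [A]. *)
Lemma conv_sq f x : in_L2 f ->
  ((kconv W f x ^+ 2)%:E <= A%:E * \int[mu]_eta (W x eta * f eta ^+ 2)%:E)%E.
Proof.
move=> f2.
have ms : measurable_fun setT (fun eta => Num.sqrt (W x eta)).
  have m : measurable_fun [set: R] (@Num.sqrt R).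
    by apply: continuous_measurable_fun; exact: sqrt_continuous.
  exact: (measurableT_comp m (sk_measx x)).
have sW eta : Num.sqrt (W x eta) ^+ 2 = W x eta by rewrite sqr_sqrtr// (sk_ge0 K).
have I : (\int[mu]_eta (Num.sqrt (W x eta) ^+ 2)%:E <= A%:E)%E.
  under eq_integral do rewrite sW.
  exact: (sk_int K).
have s2 : in_L2 (fun eta => Num.sqrt (W x eta)).
  by apply: L2P => //; exact: le_lt_trans I (ltey _).
have I2 : (\int[mu]_eta ((Num.sqrt (W x eta) * f eta) ^+ 2)%:E =
  \int[mu]_eta (W x eta * f eta ^+ 2)%:E)%E.
  by apply: eq_integral => eta _; rewrite exprMn sW.
have g2 : in_L2 (fun eta => Num.sqrt (W x eta) * f eta).
  apply: (L2_le _ (L2Z (Num.sqrt B) f2)).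
    by apply: measurable_funM => //; case: f2.
  move=> eta; rewrite !normrM ler_wpM2r// !ger0_norm ?sqrtr_ge0//.
  by rewrite ler_wsqrtr// (sk_le K).
rewrite -I2 L2_sq// -EFinM lee_fin.
have C : kconv W f x <= n2 (fun eta => Num.sqrt (W x eta)) *
    n2 (fun eta => Num.sqrt (W x eta) * f eta).
  apply: le_trans (CS s2 g2).2.
  rewrite le_eqVlt; apply/orP; left; apply/eqP; rewrite /kconv.
  apply: eq_Rintegral => eta _.
  by rewrite mulrA -expr2 sW normrM ger0_norm// (sk_ge0 K).
apply: le_trans (_ : (n2 (fun eta => Num.sqrt (W x eta)) *
    n2 (fun eta => Num.sqrt (W x eta) * f eta)) ^+ 2 <= _).
  by rewrite ler_pXn2r ?nnegrE ?conv_ge0// mulr_ge0// n2_ge0.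
rewrite exprMn ler_wpM2r ?sqr_ge0//.
by rewrite -lee_fin -L2_sq.
Qed.

(** Schur's test: integrate [conv_sq] in [x], exchange the integrals by Tonelli, and use symmetry to
    bound the inner integral of [W] by [A] again. *)
Lemma conv_L2 f : in_L2 f -> in_L2 (kconv W f) /\ n2 (kconv W f) <= A * n2 f.
Proof.
move=> f2.
have mf : measurable_fun setT f by case: f2.
have mWf : measurable_fun setT (fun z : R * R => (W z.1 z.2 * f z.2 ^+ 2)%:E).
  apply/measurable_EFinP; apply: measurable_funM; first exact: sk_meas K.
  by apply: measurable_funX; exact: measurableT_comp.
have Wf0 (z : R * R) : (0 <= (W z.1 z.2 * f z.2 ^+ 2)%:E)%E.
  by rewrite lee_fin mulr_ge0 ?sqr_ge0 ?(sk_ge0 K).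
have H : (\int[mu]_x (kconv W f x ^+ 2)%:E <= ((A * n2 f) ^+ 2)%:E)%E.
  apply: le_trans (_ : \int[mu]_x (A%:E * \int[mu]_eta (W x eta * f eta ^+ 2)%:E) <= _)%E.
    apply: ge0_le_integral => //= [x _|||x _].
    - by rewrite lee_fin sqr_ge0.
    - by apply/measurable_EFinP; apply: measurable_funX; exact: measurable_conv.
    - apply: measurable_funeM.
      exact: (@measurable_fun_fubini_tonelli_F _ _ _ _ _ mu _ mWf Wf0).
    - exact: conv_sq.
  rewrite ge0_integralZl//=; last first.
  - by rewrite lee_fin sk_A0.
  - by move=> x _; apply: integral_ge0 => y _; exact: (Wf0 (x, y)).
  - exact: (@measurable_fun_fubini_tonelli_F _ _ _ _ _ mu _ mWf Wf0).
  have -> : (\int[mu]_x \int[mu]_eta (W x eta * f eta ^+ 2)%:E =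
     \int[mu]_eta \int[mu]_x (W x eta * f eta ^+ 2)%:E)%E.
    exact: (@fubini_tonelli _ _ _ _ _ mu mu _ mWf Wf0).
  rewrite exprMn expr2 -mulrA EFinM lee_wpmul2l ?lee_fin ?sk_A0// EFinM -L2_sq//.
  rewrite -ge0_integralZl//=.
  - apply: ge0_le_integral => //= [x _|||x _].
    + by apply: integral_ge0 => y _; exact: (Wf0 (y, x)).
    + exact: (@measurable_fun_fubini_tonelli_G _ _ _ _ _ mu _ mWf Wf0).
    + by apply: measurable_funeM; apply/measurable_EFinP; exact: measurable_funX.
    + under eq_integral do rewrite mulrC EFinM (sk_sym K).
      rewrite ge0_integralZl//=.
      * by rewrite muleC lee_wpmul2r ?lee_fin ?sqr_ge0// (sk_int K).
      * by apply/measurable_EFinP; exact: sk_measx.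
      * by move=> y _; rewrite lee_fin (sk_ge0 K).
      * by rewrite lee_fin sqr_ge0.
  - by apply/measurable_EFinP; exact: measurable_funX.
  - by move=> y _; rewrite lee_fin sqr_ge0.
  - by rewrite lee_fin sk_A0.
have l2 : in_L2 (kconv W f).
  by apply: L2P; [exact: measurable_conv|exact: le_lt_trans H (ltey _)].
split=> //; move: H; rewrite L2_sq// lee_fin ler_pXn2r ?nnegrE ?n2_ge0//.
by rewrite mulr_ge0 ?n2_ge0// sk_A0.
Qed.

End schur.

(** * Two majorant kernels: exponential decay and a band around the diagonal *)

Section kernels.
Context {R : realType}.
Notation mu := (@lebesgue_measure R).

(* The difference of a discrete and a continuous kernel is dominated by a small
   multiple of [wexp], plus, for the kernels carrying a sign, [wind dx]: the two signs
   may disagree only when both points lie in the same cell. *)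
Definition wexp (x eta : R) : R := expR (- (`|x - eta| / 2)).
Definition wind (d x eta : R) : R := (`|x - eta| <= d)%R%:R.

Let m12 : measurable_fun [set: R * R] (fun z => `|z.1 - z.2|).
Proof. by apply: measurableT_comp => //; apply: measurable_funB. Qed.

(** The constant 4 is the integral of [exp (- |z| / 2)] over the line, computed by translation,
    parity and the primitive [- 2 exp (- z / 2)]. *)
Lemma wexp_schur : schur_kernel wexp 4 1.
Proof.
split.
- apply: (@measurableT_comp _ _ _ _ _ _ (@expR R)) => //.
  apply: (@measurableT_comp _ _ _ _ _ _ (fun x : R => - (x / 2))); last exact: m12.
  by apply: continuous_measurable_fun => x; apply: cvgN; apply: cvgM; [exact: cvg_id|exact: cvg_cst].
- by move=> x eta; exact: expR_ge0.
- by move=> x eta; rewrite -[leRHS]expR0 ler_expR oppr_le0 divr_ge0.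
- move=> x.
  pose G (z : R) := expR (- (`|z| / 2)).
  have cG : continuous G.
    move=> z; apply: continuous_comp => /=; last exact: continuous_expR.
    by apply: cvgN; apply: cvgM; [exact: norm_continuous|exact: cvg_cst].
  have G0 z : 0 <= G z by exact: expR_ge0.
  have DF (z : R) : is_derive z 1 (fun eta => eta - x) 1.
    by apply: is_derive_eq; rewrite subr0.
  have EF : derive1 (fun eta => eta - x) = cst 1.
    by apply/funext => z; rewrite derive1E; have [_ ->] := DF z.
  have -> : (\int[mu]_eta (wexp x eta)%:E = \int[mu]_z (G z)%:E)%E.
    rewrite (@increasing_ge0_integration_by_substitutionT _ (fun eta => eta - x) G)//.
    + by apply: eq_integral => eta _; rewrite EF /= mulr1 /wexp distrC.
    + by move=> a b ab; rewrite ltrD2r.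
    + by rewrite EF; exact: cst_continuous.
    + by rewrite EF; exact: is_cvg_cst.
    + by rewrite EF; exact: is_cvg_cst.
    + exact: cvg_addrr_Ny.
    + exact: cvg_addrr.
  rewrite ge0_symfun_integralT//; last by move=> z; rewrite /G /= normrN.
  pose F (z : R) := - 2 * expR (- (2^-1 * z)).
  have DG (z : R) : is_derive z 1 F (expR (- (z / 2))).
    by rewrite /F (mulrC z); apply: is_derive_eq; rewrite /GRing.scale/= ?mulr0 ?scaler0; field => //.
  have cF : continuous F.
    by move=> z; apply: differentiable_continuous; apply/derivable1_diffP; have [] := DG z.
  rewrite -set_itvcy (@ge0_continuous_FTC2y _ G F 0 0)//.
  + by rewrite /F mulr0 oppr0 expR0 mulr1 -EFinB -EFinM lee_fin; lra.
  + exact: continuous_subspaceT.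
  + rewrite [X in _ --> X](_ : 0 = - 2 * 0); last by rewrite mulr0.
    apply: cvgM; first exact: cvg_cst.
    apply: (@cvg_comp _ _ _ (fun z : R => 2^-1 * z) (fun z => expR (- z)) _ (+oo%R : set_system R)); last exact: cvgr_expR.
    by apply: gt0_cvgMry; [rewrite invr_gt0|exact: cvg_id].
  + exact: cvg_at_right_filter (cF 0).
  + move=> z; rewrite in_itv/= andbT => z0; rewrite derive1E; have [_ ->] := DG z.
    by rewrite /G gtr0_norm.
- by move=> x eta; rewrite /wexp distrC.
Qed.

Lemma wind_schur d : 0 <= d -> schur_kernel (wind d) (2 * d) 1.
Proof.
move=> d0; split.
- rewrite (_ : (fun z => _) = \1_[set z : R * R | `|z.1 - z.2| <= d]); last first.
    by apply/funext => z; rewrite indicE /wind; congr (_%:R); apply/esym; rewrite mem_setE.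
  apply: measurable_indic.
  have := m12 measurableT (measurable_itv `]-oo, d]); rewrite setTI.
  by congr measurable; apply/seteqP; split => z /=; rewrite in_itv.
- by move=> x eta; rewrite /wind.
- by move=> x eta; rewrite /wind; case: (`|_| <= _); rewrite ?lexx ?ler01.
- move=> x.
  have -> : (\int[mu]_eta (wind d x eta)%:E = \int[mu]_eta (\1_(`[x - d, x + d]%classic : set R) eta)%:E)%E.
    apply: eq_integral => eta _; rewrite indicE /wind; congr (_%:R%:E).
    by rewrite mem_setE /= in_itv/= ler_distlC.
  rewrite integral_indic// setIT.
  have xd : x - d <= x + d by lra.
  rewrite [leLHS](_ : _ = (2 * d)%:E)//; apply: etrans (mu_itv xd) _.
  by congr (_%:E); ring.
- by move=> x eta; rewrite /wind distrC.
Qed.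

End kernels.

(** * Discrete kernels: solutions of the relations (a) *)

Section int_induction.
Implicit Types (P : int -> Prop) (i j : int).

Lemma int_up_ind P i : P i -> (forall j, i <= j -> P j -> P (j + 1)) ->
  forall j, i <= j -> P j.
Proof.
move=> Pi Ps j ij.
have [n ->] : exists n : nat, j = i + n%:Z by exists `|j - i|%N; lia.
elim: n => [|n IH]; first by rewrite addr0.
by rewrite -addn1 PoszD addrA; apply: Ps => //; lia.
Qed.

Lemma int_down_ind P i : P i -> (forall j, j <= i -> P j -> P (j - 1)) ->
  forall j, j <= i -> P j.
Proof.
move=> Pi Ps j ij.
have [n ->] : exists n : nat, j = i - n%:Z by exists `|j - i|%N; lia.
elim: n => [|n IH]; first by rewrite subr0.
by rewrite -addn1 PoszD opprD addrA; apply: Ps => //; lia.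
Qed.

End int_induction.

(** * Real inequalities for one step of the kernel recurrence *)

Section kernel_algebra.
Context {R : realType}.
Implicit Types (x y z u b eps : R).

(** Right of the source: [z], [x] stand for [g j], [g (j + 1)], [y] for [gam j] and [b] for [a j].
    The conditions on [x * y] and [y ^+ 2 - x ^+ 2] are those on the flux and the first integral at
    [j + 1] in the next section; they exclude a sign change of [g] and force [gam] to be close to
    [- g]. *)
Lemma right_alg x y z b eps : 0 <= eps -> 0 <= b -> 0 < z -> x = z + b * y ->
  x * y <= 0 -> 0 <= y ^+ 2 - x ^+ 2 -> y ^+ 2 - x ^+ 2 <= - eps * (x * y) ->
  [/\ 0 < x, x <= - y & - y <= (1 + eps) * x].
Proof.
move=> e0 b0 z0 E h1 h2 h3.
have x0 : 0 < x.
  rewrite ltNge; apply/negP => xle.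
  have y0 : y < 0.
    by rewrite ltNge; apply/negP => y0; have := mulr_ge0 b0 y0; lra.
  have xy : 0 <= x * y by exact: mulr_le0 xle (ltW y0).
  have {}xy : x * y = 0 by lra.
  have x0 : x = 0 by move/eqP: xy; rewrite mulf_eq0 (lt_eqF y0) orbF => /eqP.
  move: h3; rewrite x0 mul0r mulr0 expr0n/= subr0 => h3.
  by have := exprn_even_gt0 y (isT : ~~ odd 2); rewrite (lt_eqF y0) /= => H; lra.
have y0 : y <= 0 by rewrite -(pmulr_rle0 _ x0).
have yx : x <= - y.
  by rewrite -(@ler_pXn2r _ 2) ?nnegrE ?sqrrN ?(ltW x0)//; lra.
split=> //; rewrite leNgt; apply/negP => H.
have : (1 + eps) * x * x < (- y) * (- y - eps * x).
  apply: lt_le_trans (_ : (- y) * x <= _); first by rewrite ltr_pM2r.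
  by rewrite ler_wpM2l; lra.
have : 0 <= eps * x * x by rewrite !mulr_ge0// ltW.
lra.
Qed.

(** Left of the source: [z], [x] stand for [g j], [g (j - 1)] and [u] for [gam (j - 1)]. Here the
    step subtracts [b * u], so positivity of [x] rests on the smallness of [eps]. *)
Lemma left_alg x u z b eps : 0 <= eps -> 8 * eps <= 1 -> 0 <= b -> b <= eps ->
  0 < z -> x = z - b * u -> 0 <= z * u -> u ^+ 2 - z ^+ 2 <= 0 ->
  - eps * (z * u) <= u ^+ 2 - z ^+ 2 ->
  [/\ 0 < x, (1 - eps) * z <= u & u <= z].
Proof.
move=> e0 e8 b0 be z0 E h1 h2 h3.
have u0 : 0 <= u by rewrite -(pmulr_rge0 _ z0).
have uz : u <= z by rewrite -(@ler_pXn2r _ 2) ?nnegrE ?(ltW z0)//; lra.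
split=> //.
  by have : b * u <= eps * z; [exact: ler_pM|]; have := ler_wpM2r (ltW z0) e8; lra.
rewrite leNgt; apply/negP => H.
have : u * (u + eps * z) < z * z; last by lra.
apply: le_lt_trans (_ : u * z < _); first by rewrite ler_wpM2l//; lra.
by rewrite ltr_pM2r//; have := mulr_ge0 e0 (ltW z0); lra.
Qed.

(** At the source, with [z], [x] for [g i], [g (i + 1)] and [u], [y] for [gam (i - 1)], [gam i]. If
    [z <= 0], the signs on the left give [u <= 0], so the unit jump makes [y < 0]; then [x * y <= 0]
    and [x = z + b * y] force [x = 0], and the upper bound on [y ^+ 2 - x ^+ 2] gives
    [y ^+ 2 <= 0]. *)
Lemma jump_alg x y u z b eps : 0 <= eps -> 0 <= b -> 0 <= z * u ->
  u ^+ 2 - z ^+ 2 <= 0 -> x * y <= 0 -> 0 <= y ^+ 2 - x ^+ 2 ->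
  y ^+ 2 - x ^+ 2 <= - eps * (x * y) -> y - u = b * z - 1 -> x = z + b * y -> 0 < z.
Proof.
move=> e0 b0 l1 l2 r1 r2 r3 Hi E; rewrite ltNge; apply/negP => z0.
have bz : b * z <= 0 by exact: mulr_ge0_le0.
have u0 : u <= 0.
  rewrite leNgt; apply/negP => u0.
  have : 0 <= z by rewrite -(pmulr_lge0 _ u0).
  move=> z0'; have {}z0 : z = 0 by lra.
  by move: l2; rewrite z0 expr0n/= subr0; have := exprn_gt0 2 u0; lra.
have y0 : y < 0 by lra.
have x0 : 0 <= x by rewrite -(nmulr_lle0 _ y0).
have y2 : 0 < y ^+ 2 by rewrite exprn_even_gt0//= lt_eqF.
have by0 := mulr_ge0_le0 b0 (ltW y0).
have x00 : x = 0 by lra.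
by move: r3; rewrite x00 mul0r mulr0 expr0n/= subr0; lra.
Qed.

(** To leading order [y = - z] and [u = z], so the unit jump [y - u = b * z - 1] reads
    [2 * z = 1]. *)
Lemma near_alg x y u z b eps : 0 <= eps -> 8 * eps <= 1 -> 0 <= b -> b <= eps ->
  0 < x -> x <= - y -> - y <= (1 + eps) * x -> (1 - eps) * z <= u -> u <= z ->
  y - u = b * z - 1 -> 0 < z -> x = z + b * y -> `|z - 2^-1| <= 2 * eps.
Proof.
move=> e0 e8 b0 be x0 xy yx lu ul Hi z0 E.
have by0 : 0 <= b * (- y) by apply: mulr_ge0 => //; lra.
have xz : x <= z by lra.
have bz : b * z <= eps * z by rewrite ler_wpM2r// ltW.
have bz0 : 0 <= b * z by rewrite mulr_ge0// ltW.
have e2 : eps * eps <= eps / 8.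
  by have := ler_wpM2l e0 e8; lra.
have by2 : b * (- y) <= 2 * eps * x.
  apply: le_trans (_ : eps * ((1 + eps) * x) <= _).
    by apply: ler_pM => //; lra.
  have := ler_wpM2r (ltW x0) e2; lra.
have ex : eps * x <= eps * z by rewrite ler_wpM2l.
have zx : z <= x + 2 * eps * z by lra.
have z1 : z <= 1.
  by have := ler_wpM2r (ltW z0) e8; lra.
have ez : eps * z <= eps by rewrite ler_piMr.
rewrite ler_norml; apply/andP; split; lra.
Qed.

End kernel_algebra.

(** * Decaying solutions of the recurrence along one row *)

Section kernel_estimate.
Context {R : realType}.
Implicit Types (v w F : int -> R) (i j m : int).

Definition tend0 v := forall d : R, 0 < d -> exists N : int,
  forall j, (N <= j) || (j <= - N) -> `|v j| <= d.

Lemma tend0M v w : tend0 v -> tend0 w -> tend0 (fun j => v j * w j).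
Proof.
move=> v0 w0 d d0.
have [N HN] := v0 d d0; have [M HM] := w0 1 ltr01.
exists (Num.max N M) => j jNM; rewrite normrM -[leRHS]mulr1.
by apply: ler_pM => //; [apply: HN|apply: HM]; move: jNM; lia.
Qed.

Lemma tend0D v w : tend0 v -> tend0 w -> tend0 (fun j => v j + w j).
Proof.
move=> v0 w0 d d0; have d2 : 0 < d / 2 by lra.
have [N HN] := v0 _ d2; have [M HM] := w0 _ d2.
exists (Num.max N M) => j jNM; apply: le_trans (ler_normD _ _) _.
by rewrite (splitr d); apply: lerD; [apply: HN|apply: HM]; move: jNM; lia.
Qed.

Lemma tend0Z (c : R) v : tend0 v -> tend0 (fun j => c * v j).
Proof.
move=> v0 d d0; have c0 : 0 < `|c| + 1 by rewrite ltr_wpDl.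
have [N HN] := v0 _ (divr_gt0 d0 c0); exists N => j jN.
rewrite normrM; apply: le_trans (_ : (`|c| + 1) * (d / (`|c| + 1)) <= _).
  by apply: ler_pM => //; [rewrite lerDl|exact: HN].
by rewrite mulrC divfK// gt_eqF.
Qed.

Lemma tend0_shift v : tend0 v -> tend0 (fun j => v (j - 1)).
Proof.
move=> v0 d d0; have [N HN] := v0 d d0; exists (`|N| + 1) => j jN.
by apply: HN; lia.
Qed.

Lemma decr_to0_right F m : tend0 F -> (forall j, m <= j -> F (j + 1) <= F j) ->
  forall j, m <= j -> 0 <= F j.
Proof.
move=> F0 dF j mj; rewrite leNgt; apply/negP => Fj.
have d0 : 0 < - F j / 2 by lra.
have [N HN] := F0 _ d0.
have D k : j <= k -> F k <= F j.
  by move: k; apply: int_up_ind => // k jk; apply: le_trans; apply: dF; lia.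
have h1 : F (Num.max N j) <= F j by apply: D; lia.
have h2 : `|F (Num.max N j)| <= - F j / 2 by apply: HN; lia.
by have := ler_norm (- F (Num.max N j)); rewrite normrN; lra.
Qed.

Lemma decr_to0_left F m : tend0 F -> (forall j, j < m -> F (j + 1) <= F j) ->
  forall j, j <= m -> F j <= 0.
Proof.
move=> F0 dF j mj; rewrite leNgt; apply/negP => Fj.
have d0 : 0 < F j / 2 by lra.
have [N HN] := F0 _ d0.
have D k : k <= j -> F j <= F k.
  move: k; apply: int_down_ind => // k jk H; apply: le_trans H _.
  by have := dF (k - 1); rewrite subrK; apply; lia.
have h1 : F j <= F (Num.min (- N) j) by apply: D; lia.
have h2 : `|F (Num.min (- N) j)| <= F j / 2 by apply: HN; lia.
by have := ler_norm (F (Num.min (- N) j)); lra.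
Qed.

Variables (a g gam : int -> R) (i : int) (eps : R).
Hypothesis a0 : forall j, 0 <= a j.
Hypothesis aeps : forall j, a j <= eps.
Hypothesis eps8 : 8 * eps <= 1.
Hypothesis Hg : forall j, g (j + 1) = g j + a j * gam j.
Hypothesis Hgam : forall j, gam j - gam (j - 1) = a j * g j - (j == i)%:R.
Hypothesis g0 : tend0 g.
Hypothesis gam0 : tend0 gam.

Let eps0 : 0 <= eps. Proof. exact: le_trans (a0 0) (aeps 0). Qed.

(* [P j] is the discrete flux, [F j] the discrete first integral of the
   Sturm-Liouville recurrence; both vanish at infinity. *)
Let P j := g j * gam (j - 1).
Let F j := gam (j - 1) ^+ 2 - g j ^+ 2.

Let P0 : tend0 P. Proof. exact/tend0M/tend0_shift. Qed.
Let F0 : tend0 F.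
Proof.
have := tend0D (tend0M (tend0_shift gam0) (tend0_shift gam0)) (tend0Z (-1) (tend0M g0 g0)).
by congr tend0; apply/funext => j; rewrite /F !expr2 mulN1r.
Qed.

Let P_step j : j != i -> P (j + 1) - P j = a j * (g j ^+ 2 + gam j ^+ 2).
Proof.
move=> ji; have := Hgam j; rewrite (negbTE ji) subr0 => H.
rewrite /P addrK Hg (_ : gam (j - 1) = gam j - a j * g j); first by ring.
by rewrite -H; ring.
Qed.

(** Second order in [a], since this quantity is conserved by the limiting differential equations.
    Compared with [P_step] it yields [|F| <= eps * |P|]. *)
Let F_step j : j != i -> F (j + 1) - F j = - a j ^+ 2 * (g j ^+ 2 + gam j ^+ 2).
Proof.
move=> ji; have := Hgam j; rewrite (negbTE ji) subr0 => H.
rewrite /F addrK Hg (_ : gam (j - 1) = gam j - a j * g j); first by ring.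
by rewrite -H; ring.
Qed.

Let sq_le j : a j ^+ 2 * (g j ^+ 2 + gam j ^+ 2) <= eps * (a j * (g j ^+ 2 + gam j ^+ 2)).
Proof.
rewrite expr2 -mulrA ler_wpM2r//.
by rewrite mulr_ge0// addr_ge0// sqr_ge0.
Qed.

Let sq_ge0 j : 0 <= a j * (g j ^+ 2 + gam j ^+ 2).
Proof. by rewrite mulr_ge0// addr_ge0// sqr_ge0. Qed.

Let sq2_ge0 j : 0 <= a j ^+ 2 * (g j ^+ 2 + gam j ^+ 2).
Proof. by rewrite mulr_ge0 ?sqr_ge0// addr_ge0// sqr_ge0. Qed.

(** [P], [F] and [- eps * P - F] are monotone beyond the source and tend to 0, which fixes their
    signs. *)
Let right j : i < j -> [/\ P j <= 0, 0 <= F j & F j <= - eps * P j].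
Proof.
move=> ij.
have T1 : tend0 (fun j => - 1 * P j) by exact: tend0Z.
have T2 : tend0 (fun j => - eps * P j + (- 1) * F j).
  by apply: tend0D; exact: tend0Z.
split.
- have := decr_to0_right T1 (m := i + 1) => H.
  have : 0 <= -1 * P j; last by lra.
  apply: H; last by lia.
  move=> k ik; have ki : k != i by apply/eqP; lia.
  by have := P_step ki; have := sq_ge0 k; lra.
- apply: (decr_to0_right F0 (m := i + 1)); last by lia.
  move=> k ik; have ki : k != i by apply/eqP; lia.
  by have := F_step ki; have := sq2_ge0 k; rewrite mulNr; lra.
- have := decr_to0_right T2 (m := i + 1) => H.
  have : 0 <= - eps * P j + (- 1) * F j; last by lra.
  apply: H; last by lia.
  move=> k ik; have ki : k != i by apply/eqP; lia.
  have -> : P (k + 1) = P k + a k * (g k ^+ 2 + gam k ^+ 2) by rewrite -P_step//; ring.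
  have -> : F (k + 1) = F k - a k ^+ 2 * (g k ^+ 2 + gam k ^+ 2).
    by rewrite -mulNr -F_step//; ring.
  by have := sq_le k; lra.
Qed.

(** As [P j] and [F j] involve [gam (j - 1)], the source acts between the indices [i] and [i + 1];
    the index [i] itself still belongs to the left side. *)
Let left j : j <= i -> [/\ 0 <= P j, F j <= 0 & - eps * P j <= F j].
Proof.
move=> ij.
have T1 : tend0 (fun j => - 1 * P j) by exact: tend0Z.
have T2 : tend0 (fun j => - eps * P j + (- 1) * F j).
  by apply: tend0D; exact: tend0Z.
split.
- have : -1 * P j <= 0; last by lra.
  apply: (decr_to0_left T1 (m := i)) => // k ik; have ki : k != i by apply/eqP; lia.
  by have := P_step ki; have := sq_ge0 k; lra.
- apply: (decr_to0_left F0 (m := i)) => // k ik; have ki : k != i by apply/eqP; lia.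
  by have := F_step ki; have := sq2_ge0 k; rewrite mulNr; lra.
- have : - eps * P j + (- 1) * F j <= 0; last by lra.
  apply: (decr_to0_left T2 (m := i)) => // k ik; have ki : k != i by apply/eqP; lia.
  have -> : P (k + 1) = P k + a k * (g k ^+ 2 + gam k ^+ 2) by rewrite -P_step//; ring.
  have -> : F (k + 1) = F k - a k ^+ 2 * (g k ^+ 2 + gam k ^+ 2).
    by rewrite -mulNr -F_step//; ring.
  by have := sq_le k; lra.
Qed.

Let right_step j : i <= j -> 0 < g j ->
  [/\ 0 < g (j + 1), g (j + 1) <= - gam j & - gam j <= (1 + eps) * g (j + 1)].
Proof.
move=> ij gj; have [] := right (j := j + 1); first by lia.
rewrite /P /F addrK => h1 h2 h3.
exact: (right_alg eps0 (a0 j) gj (Hg j)).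
Qed.

Let left_step j : j <= i -> 0 < g j ->
  [/\ 0 < g (j - 1), (1 - eps) * g j <= gam (j - 1) & gam (j - 1) <= g j].
Proof.
move=> ij gj; have [] := left ij; rewrite /P /F => h1 h2 h3.
have E : g (j - 1) = g j - a (j - 1) * gam (j - 1).
  by have := Hg (j - 1); rewrite subrK => ->; ring.
exact: (left_alg eps0 eps8 (a0 (j - 1)) (aeps (j - 1)) gj E).
Qed.

Let gi_gt0 : 0 < g i.
Proof.
have [] := left (lexx i); rewrite /P /F => l1 l2 l3.
have [] := right (j := i + 1); first by lia.
rewrite /P /F addrK => r1 r2 r3.
have := Hgam i; rewrite eqxx /= => Hi.
exact: (jump_alg eps0 (a0 i) l1 l2 r1 r2 r3 Hi (Hg i)).
Qed.

Let g_gt0 j : 0 < g j.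
Proof.
have [ij|ji] := leP i j.
  move: j ij; apply: int_up_ind; first exact: gi_gt0.
  by move=> j ij /(right_step ij)[].
move: j {ji}(ltW ji); apply: int_down_ind; first exact: gi_gt0.
by move=> j ij /(left_step ij)[].
Qed.

Let gi_near : `|g i - 2^-1| <= 2 * eps.
Proof.
have [x0 xy yx] := right_step (lexx i) (g_gt0 i).
have [_ lu ul] := left_step (lexx i) (g_gt0 i).
have := Hgam i; rewrite eqxx /= => Hi.
exact: (near_alg eps0 eps8 (a0 i) (aeps i) x0 xy yx lu ul Hi gi_gt0 (Hg i)).
Qed.

Variable Y : int -> R.
Hypothesis HY : forall j, Y (j + 1) = Y j + a j.

Let Y_right j : i <= j -> Y i <= Y j.
Proof. by move: j; apply: int_up_ind => // j _; rewrite HY; have := a0 j; lra. Qed.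

Let Y_left j : j <= i -> Y j <= Y i.
Proof.
move: j; apply: int_down_ind => // j _.
by have := HY (j - 1); rewrite subrK => ->; have := a0 (j - 1); lra.
Qed.

(** Passing to inverses turns the lower bound [1 + x <= expR x] into an upper bound for [expR]. *)
Let exp_lo (b : R) : 0 <= b -> b <= eps -> expR ((1 - eps) * b) <= 1 + b.
Proof.
move=> b0 be.
rewrite -[leRHS]invrK -[leLHS]invrK lef_pV2 ?posrE ?invr_gt0 ?expR_gt0//; last by lra.
rewrite -expRN.
apply: le_trans (_ : 1 - b / (1 + b) <= _).
  by rewrite le_eqVlt; apply/orP; left; apply/eqP; field; lra.
apply: le_trans (expR_ge1Dx (- (b / (1 + b)))) _.
rewrite ler_expR lerN2 ler_pdivlMr; last by lra.
by nra.
Qed.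

Let exp_lo2 (b : R) : 0 <= b -> b <= eps -> expR (- ((1 + 2 * eps) * b)) <= 1 - b.
Proof.
have := eps8; move=> e8 b0 be; rewrite expRN -[leRHS]invrK lef_pV2 ?posrE ?invr_gt0 ?expR_gt0//; last by lra.
apply: le_trans (expR_ge1Dx _).
apply: le_trans (_ : 1 + b / (1 - b) <= _).
  by rewrite le_eqVlt; apply/orP; left; apply/eqP; field; lra.
by rewrite lerD2l ler_pdivrMr; [nra|lra].
Qed.

(** Each step away from the source multiplies [g] by a factor between [exp (- (1 + 2 eps) a)] and
    [exp (- (1 - 2 eps) a)]; in the exponent the steps [a] add up to the distance of the values of
    [Y]. *)
Let g_exp j : g i * expR (- ((1 + 2 * eps) * `|Y j - Y i|)) <= g j /\
  g j <= g i * expR (- ((1 - 2 * eps) * `|Y j - Y i|)).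
Proof.
have [ij|ji] := leP i j.
  have : g i * expR (- ((1 + 2 * eps) * (Y j - Y i))) <= g j /\
    g j <= g i * expR (- ((1 - 2 * eps) * (Y j - Y i))); last first.
    by rewrite ger0_norm ?subr_ge0 ?Y_right.
  move: j ij; apply: int_up_ind; first by rewrite subrr !mulr0 oppr0 expR0 mulr1.
  move=> j ij [H1 H2]; have [x0 xy yx] := right_step ij (g_gt0 j).
  have := Hg j; have := a0 j; have := aeps j; have := g_gt0 j => z0 be b0 E.
  have Eg : g j = g (j + 1) + a j * (- gam j) by rewrite E; ring.
  rewrite HY; split.
    rewrite (_ : - _ = - ((1 + 2 * eps) * (Y j - Y i)) + - ((1 + 2 * eps) * a j)); last by ring.
    rewrite expRD mulrA; apply: le_trans (ler_wpM2r (expR_ge0 _) H1) _.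
    rewrite expRN ler_pdivrMr ?expR_gt0//.
    apply: le_trans (_ : g (j + 1) * (1 + (1 + 2 * eps) * a j) <= _); last first.
      by rewrite ler_wpM2l ?expR_ge1Dx// ltW.
    by rewrite Eg; nra.
  rewrite (_ : - _ = - ((1 - 2 * eps) * (Y j - Y i)) + - ((1 - 2 * eps) * a j)); last by ring.
  rewrite expRD mulrA; apply: le_trans (ler_wpM2r (expR_ge0 _) H2).
  rewrite expRN ler_pdivlMr ?expR_gt0//.
  apply: le_trans (_ : g (j + 1) * (1 + a j) <= _); last by rewrite Eg; nra.
  rewrite ler_wpM2l ?(ltW x0)//; apply: le_trans (exp_lo b0 be).
  by rewrite ler_expR; nra.
have : g i * expR (- ((1 + 2 * eps) * (Y i - Y j))) <= g j /\
    g j <= g i * expR (- ((1 - 2 * eps) * (Y i - Y j))); last first.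
  by rewrite distrC ger0_norm ?subr_ge0 ?Y_left// ltW.
move: j {ji}(ltW ji); apply: int_down_ind; first by rewrite subrr !mulr0 oppr0 expR0 mulr1.
move=> j ij [H1 H2]; have [x0 lu ul] := left_step ij (g_gt0 j).
have := a0 (j - 1); have := aeps (j - 1); have := g_gt0 j => z0 be b0.
have Eg : g (j - 1) = g j - a (j - 1) * gam (j - 1).
  by have := Hg (j - 1); rewrite subrK => ->; ring.
have EY : Y j = Y (j - 1) + a (j - 1) by rewrite -HY subrK.
split.
  rewrite (_ : - _ = - ((1 + 2 * eps) * (Y i - Y j)) + - ((1 + 2 * eps) * a (j - 1))); last by rewrite EY; ring.
  rewrite expRD mulrA; apply: le_trans (ler_wpM2r (expR_ge0 _) H1) _.
  apply: le_trans (_ : g j * (1 - a (j - 1)) <= _).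
    by rewrite ler_wpM2l ?(ltW z0)//; exact: exp_lo2.
  by rewrite Eg; nra.
rewrite (_ : - _ = - ((1 - 2 * eps) * (Y i - Y j)) + - ((1 - 2 * eps) * a (j - 1))); last by rewrite EY; ring.
rewrite expRD mulrA; apply: le_trans (ler_wpM2r (expR_ge0 _) H2).
apply: le_trans (_ : g j * (1 - (1 - 2 * eps) * a (j - 1)) <= _); last first.
  by rewrite ler_wpM2l ?(ltW z0)//; apply: le_trans (expR_ge1Dx _).
by rewrite Eg; nra.
Qed.

Let g_le j : g j <= expR (- (`|Y j - Y i| / 2)).
Proof.
apply: le_trans (g_exp j).2 _; rewrite -[leRHS]mul1r; apply: ler_pM.
- exact/ltW/g_gt0.
- exact: expR_ge0.
- by have := gi_near; rewrite ler_norml => /andP[_]; have := eps8; lra.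
- rewrite ler_expR; move: (normr_ge0 (Y j - Y i)) eps8; move: (`|_|) => N N0 e8.
  by have := ler_wpM2r N0 e8; lra.
Qed.

(** The error [2 eps D] in the exponent produces a factor [D], paid with half of the decay: hence
    the rate [D / 2] on the right, which [wexp] retains. The prefactor [g i] is within [2 eps] of
    one half. *)
Lemma kernel_g j : `|g j - 2^-1 * expR (- `|Y j - Y i|)| <= 12 * eps * expR (- (`|Y j - Y i| / 2)).
Proof.
have [H1 H2] := g_exp j; have := gi_near; rewrite ler_norml => /andP[n1 n2].
set D := `|Y j - Y i| in H1 H2 *; have D0 : 0 <= D by exact: normr_ge0.
have z0 := gi_gt0.
set e1 := expR (- D); set e2 := expR (- (D / 2)).
have e12 : e1 <= e2 by rewrite ler_expR; lra.
have e1p : 0 < e1 by exact: expR_gt0.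
have up : expR (- ((1 - 2 * eps) * D)) - e1 <= 8 * eps * e2.
  rewrite (_ : - _ = - D + 2 * eps * D); last by ring.
  rewrite expRD -/e1 -{2}(mulr1 e1) -mulrBr.
  have x0 : 0 <= 2 * eps * D by rewrite !mulr_ge0.
  have ex : expR (2 * eps * D) - 1 <= 2 * eps * D * expR (2 * eps * D).
    have := expR_ge1Dx (- (2 * eps * D)).
    rewrite expRN -(ler_pM2r (expR_gt0 (2 * eps * D))) mulVf ?gt_eqF ?expR_gt0//.
    by rewrite mulrDl mul1r; lra.
  (* The spare factor [exp (D / 2)] is split in two equal factors: one absorbs [exp (2 eps D)], the
     other absorbs [D]. *)
  have ex4 : expR (2 * eps * D) <= expR (D / 4) by rewrite ler_expR; have := ler_wpM2r D0 eps8; lra.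
  have D4 : D <= 4 * expR (D / 4) by have := expR_ge1Dx (D / 4); lra.
  have E2 : e1 * (expR (D / 4) * expR (D / 4)) = e2.
    by rewrite /e1 /e2 -!expRD; congr expR; field.
  rewrite -E2; apply: le_trans (ler_wpM2l (ltW e1p) ex) _.
  rewrite (_ : 8 * eps * _ = e1 * (2 * eps * (4 * expR (D / 4)) * expR (D / 4))); last by ring.
  rewrite ler_wpM2l ?(ltW e1p)//; apply: ler_pM; [by []|exact: expR_ge0| |by []].
  by rewrite ler_wpM2l// mulr_ge0.
have lo : e1 - expR (- ((1 + 2 * eps) * D)) <= 8 * eps * e2.
  have -> : expR (- ((1 + 2 * eps) * D)) = e1 * expR (- (2 * eps * D)).
    by rewrite /e1 -expRD; congr expR; ring.
  rewrite -{1}(mulr1 e1) -mulrBr.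
  have x0 : 1 - expR (- (2 * eps * D)) <= 2 * eps * D by have := expR_ge1Dx (- (2 * eps * D)); lra.
  have D4 : D * e1 <= 2 * e2.
    have -> : e1 = e2 * e2 by rewrite /e1 /e2 -expRD; congr expR; field.
    have e20 : 0 < e2 by exact: expR_gt0.
    have := expR_ge1Dx (D / 2); rewrite -(ler_pM2l e20).
    by rewrite {2}/e2 -expRD addNr expR0; nra.
  apply: le_trans (ler_wpM2l (ltW e1p) x0) _.
  have : 2 * eps * (D * e1) <= 2 * eps * (2 * e2) by rewrite ler_wpM2l// mulr_ge0.
  have : 0 <= eps * e2 by rewrite mulr_ge0// expR_ge0.
  lra.
have e20 : 0 <= eps * e2 by rewrite mulr_ge0// expR_ge0.
have zz : g i <= 1 by have := eps8; lra.
have m1 := ler_wpM2r (ltW e1p) n1; have m2 := ler_wpM2r (ltW e1p) n2.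
have m3 : eps * e1 <= eps * e2 by rewrite ler_wpM2l.
have K t : t <= 8 * eps * e2 -> g i * t <= 8 * eps * e2.
  move=> te; apply: le_trans (ler_wpM2l (ltW z0) te) _.
  by rewrite ler_piMl// -mulrA mulr_ge0.
have k1 := K _ lo; have k2 := K _ up.
rewrite ler_norml; apply/andP; split; lra.
Qed.

(** [gam j] is [g j] up to sign and a relative error [2 eps], with the sign changing at the source;
    so 14 is 12 + 2. *)
Lemma kernel_gam j : `|gam j - (if i <= j then -1 else 1) * (2^-1 * expR (- `|Y j - Y i|))| <=
  14 * eps * expR (- (`|Y j - Y i| / 2)).
Proof.
have := kernel_g j; have := g_le j; have gj := g_gt0 j.
set e1 := 2^-1 * _; set e2 := expR _ => gle; rewrite ler_norml => /andP[h1 h2].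
have K : `|gam j - (if i <= j then -1 else 1) * g j| <= 2 * eps * g j.
  have b0 := a0 j; have be := aeps j.
  have [ij|ji'] := leP i j.
    have [x0 xy yx] := right_step ij gj; have E := Hg j.
    by rewrite ler_norml; apply/andP; split; nra.
  have ji : j + 1 <= i by rewrite lezD1.
  have [_ lu ul] := left_step ji (g_gt0 _); have E := Hg j; move: lu ul; rewrite addrK => lu ul.
  have z0 := g_gt0 (j + 1).
  have u0 : 0 <= gam j.
    by apply: le_trans lu; rewrite mulr_ge0 ?(ltW z0)//; have := eps8; lra.
  have au : a j * gam j <= eps * g (j + 1) by exact: ler_pM.
  have au0 : 0 <= a j * gam j by rewrite mulr_ge0.
  have e8 := ler_wpM2r (ltW z0) eps8.
  have : eps * g (j + 1) <= eps * (2 * g j) by rewrite ler_wpM2l//; lra.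
  by move=> ?; rewrite mul1r ler_norml; apply/andP; split; lra.
move: K; have : eps * g j <= eps * e2 by rewrite ler_wpM2l.
by case: ifP => _; rewrite !ler_norml => ? /andP[? ?]; apply/andP; split; lra.
Qed.

End kernel_estimate.

(** * Grid functions and their interpolations *)

Section enum_int.

(** An enumeration of the grid, because countable additivity of the integral is used along the
    naturals. *)
Definition nat_to_int (n : nat) : int := if odd n then Negz n./2 else Posz n./2.

Lemma nat_to_int_bij : set_bij [set: nat] [set: int] nat_to_int.
Proof.
split=> // [n m _ _|[k|k] _].
- rewrite /nat_to_int; case: ifP => on; case: ifP => om //= -[E];
  by rewrite -(odd_double_half n) -(odd_double_half m) on om E.
- by exists k.*2 => //; rewrite /nat_to_int odd_double half_double.
- by exists k.*2.+1 => //; rewrite /nat_to_int /= odd_double /= uphalf_double.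
Qed.

End enum_int.

Section grid.
Context {R : realType}.
Variable dx : R.
Hypothesis dx0 : 0 < dx.
Notation mu := (@lebesgue_measure R).
Implicit Types (v w : int -> R) (x xi : R) (i j : int) (Y : state int R).

Definition idx (x : R) : int := Num.floor (x / dx).
(* The piecewise constant function with the grid values of [v]: [dx]-weighted sums
   over the grid become Lebesgue integrals, and discrete convolutions become integral
   operators comparable with those on the line. *)
Definition st v x : R := v (idx x).

Lemma idxP x j : (idx x == j) = (gridpt dx j <= x < gridpt dx (j + 1)).
Proof.
rewrite /gridpt -ler_pdivlMr// -ltr_pdivrMr//.
apply/eqP/idP => [<-|]; first exact: floor_itv.
exact: floor_def.
Qed.

Lemma idx_itv x : gridpt dx (idx x) <= x < gridpt dx (idx x + 1).
Proof. by rewrite -idxP. Qed.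

Lemma gridptS j : gridpt dx (j + 1) = gridpt dx j + dx.
Proof. by rewrite /gridpt rmorphD/= mulrDl mul1r. Qed.

Lemma idx_gridpt j : idx (gridpt dx j) = j.
Proof. by apply/eqP; rewrite idxP gridptS lexx ltrDl. Qed.

Lemma cellE j x : cell dx j x <-> idx x = j.
Proof.
rewrite /cell/= in_itv/= -idxP; split => [/eqP//|->]; exact: eqxx.
Qed.

Lemma measurable_cell j : measurable (cell dx j : set R).
Proof. exact: measurable_itv. Qed.

Lemma mu_cell j : mu (cell dx j : set R) = dx%:E.
Proof.
rewrite /cell lebesgue_measure_itv/= lte_fin gridptS ltrDl dx0 -EFinB.
by rewrite addrC addKr.
Qed.

Lemma cells_cover : \bigcup_k (cell dx (nat_to_int k) : set R) = setT.
Proof.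
apply/seteqP; split => // x _.
case: nat_to_int_bij => _ _ sj; have [k _ kx] := sj (idx x) I.
by exists k => //; apply/cellE; rewrite kx.
Qed.

Lemma cells_triv : trivIset setT (fun k => cell dx (nat_to_int k) : set R).
Proof.
move=> k l _ _ [x [/cellE h1 /cellE h2]].
by apply: (set_bij_inj nat_to_int_bij); rewrite ?inE// -h1 -h2.
Qed.

Lemma measurable_st v : measurable_fun setT (st v).
Proof.
move=> _ B mB; rewrite setTI.
have -> : st v @^-1` B = \bigcup_k (if v (nat_to_int k) \in B then cell dx (nat_to_int k) else set0 : set R).
  apply/seteqP; split => x /=.
    have := cells_cover; move/seteqP => [_ /(_ x I)[k _ xk]] vB.
    exists k => //; case: ifPn => //; move/cellE: xk => xk.
    by rewrite notin_setE -xk.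
  move=> [k _]; case: ifPn => // kB /cellE xk; rewrite /st xk.
  by move: kB; rewrite inE.
by apply: bigcup_measurable => k _; case: ifP => // _; exact: measurable_cell.
Qed.

Lemma integral_cell v j :
  (\int[mu]_(x in cell dx j) (st v x)%:E = dx%:E * (v j)%:E)%E.
Proof.
transitivity (\int[mu]_(x in cell dx j) (cst (v j)%:E x))%E.
  by apply: eq_integral => x; rewrite inE => /cellE xj; rewrite /= /st xj.
rewrite integral_cst; last exact: measurable_cell.
by rewrite muleC; congr (_ * _)%E; exact: mu_cell.
Qed.

Lemma integral_st v : (forall j, 0 <= v j) ->
  (\int[mu]_x (st v x)%:E = dx%:E * \esum_(j in [set: int]) (v j)%:E)%E.
Proof.
move=> v0.
have mf : measurable_fun setT (fun x => (st v x)%:E).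
  by apply/measurable_EFinP; exact: measurable_st.
have H := @ge0_integral_bigcup _ _ _ mu (fun k => cell dx (nat_to_int k) : set R) (fun x => (st v x)%:E)
  (fun k => measurable_cell (nat_to_int k)).
have {}H := H _ _ cells_triv.
rewrite cells_cover in H; rewrite H => [|//|x _]; last by rewrite lee_fin /st.
have -> : (\esum_(j in [set: int]) (v j)%:E = \sum_(k <oo) (v (nat_to_int k))%:E)%E.
  rewrite nneseries_esumT; last by move=> n; rewrite lee_fin.
  exact: (@reindex_esum R nat int setT setT nat_to_int (fun j => (v j)%:E) nat_to_int_bij).
rewrite -nneseriesZl; last by move=> n _; rewrite lee_fin.
by apply: eq_eseriesr => k _; rewrite integral_cell.
Qed.

Lemma lnorm2E v : lnorm dx 2 v = ('N[mu]_2%:E[EFin \o st v])%E.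
Proof.
rewrite unlock /lnorm; congr (_ `^ _)%E.
have := @integral_st (fun j => `|v j| `^ 2) (fun j => powR_ge0 _ _) => <-.
by apply: eq_integral.
Qed.

Lemma lnorm1E v : lnorm dx 1 v = (\int[mu]_x `|st v x|%:E)%E.
Proof.
rewrite /lnorm invr1 poweRe1; last first.
  rewrite mule_ge0 ?lee_fin ?(ltW dx0)//; apply: esum_ge0 => j _.
  by rewrite lee_fin powR_ge0.
have := @integral_st (fun j => `|v j|) (fun j => normr_ge0 _) => ->.
by congr (_ * _)%E; apply: eq_esum => j _; rewrite powRr1.
Qed.

(** Holds for every grid function: when one of the two sums is infinite, both sides are 0 by the
    convention of [fine]. *)
Lemma zsum_st v : dx * zsum v = \int[mu]_x st v x.
Proof.
have P w : (\int[mu]_x ((EFin \o st w)^\+ x) =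
    dx%:E * \esum_(j in [set: int]) (EFin \o w)^\+ j)%E.
  have := @integral_st (fun j => Num.max (w j) 0) (fun j => _) => H.
  transitivity (\int[mu]_x (st (fun j => Num.max (w j) 0)%R x)%:E)%E.
    by apply: eq_integral; move=> x _; rewrite funeposE /st /= EFin_max.
  rewrite H => [|j]; last by rewrite le_max lexx orbT.
  by congr (_ * _)%E; apply: eq_esum => j _; rewrite funeposE /= EFin_max.
have N w : (\int[mu]_x ((EFin \o st w)^\- x) =
    dx%:E * \esum_(j in [set: int]) (EFin \o w)^\- j)%E.
  transitivity (\int[mu]_x ((EFin \o st (fun j => - w j)%R)^\+ x))%E.
    by apply: eq_integral; move=> x _; rewrite funenegE funeposE /st /= EFinN.
  by rewrite P; congr (_ * _)%E; apply: eq_esum => j _; rewrite funenegE funeposE /= EFinN.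
rewrite /zsum /Rintegral integralE P N.
have A0 : (0 <= \esum_(j in [set: int]) (EFin \o v)^\+ j)%E by apply: esum_ge0 => j _; exact: funepos_ge0.
have B0 : (0 <= \esum_(j in [set: int]) (EFin \o v)^\- j)%E by apply: esum_ge0 => j _; exact: funeneg_ge0.
move: A0 B0; move: (esum _ _) (esum _ _) => [a| |] [b| |] //= _ _.
- by rewrite mulrBr.
- by rewrite gt0_muley ?lte_fin// mulr0.
- by rewrite gt0_muley ?lte_fin// mulr0.
- by rewrite gt0_muley ?lte_fin// mulr0.
Qed.

Lemma zsum_single v j0 : (forall j, j != j0 -> v j = 0) -> zsum v = v j0.
Proof.
move=> v0.
apply: (mulfI (lt0r_neq0 dx0)); rewrite zsum_st.
rewrite (_ : (fun x => st v x) = (fun x => v j0 * \1_(cell dx j0) x)); last first.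
  apply/funext => x; rewrite indicE /st.
  have [xj|xj] := eqVneq (idx x) j0.
    by rewrite mem_set ?mulr1 ?xj//; exact/cellE.
  rewrite memNset ?mulr0 ?v0// => /cellE h; by rewrite h eqxx in xj.
have mc : measurable (cell dx j0 : set R) := measurable_cell j0.
have I : mu.-integrable [set: R] (fun x => (\1_(cell dx j0) x)%:E).
  apply/integrableP; split; first by apply/measurable_EFinP; exact: (measurable_indic mc).
  under eq_integral do rewrite gee0_abs ?lee_fin//.
  rewrite integral_indic//= setIT.
  by rewrite [X in (X < _)%E](_ : _ = dx%:E) ?ltey//; exact: mu_cell.
rewrite RintegralZl// mulrC; congr (_ * _).
rewrite /Rintegral integral_indic//= setIT.
by rewrite [X in fine X](_ : _ = dx%:E)//; exact: mu_cell.
Qed.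

Lemma interp_constE v : interp_const dx v = st v.
Proof.
apply/funext => x; rewrite /interp_const (@zsum_single _ (idx x)).
  by rewrite indicE mem_set ?mulr1//; exact/cellE.
by move=> j jx; rewrite indicE memNset ?mulr0// => /cellE h; rewrite h eqxx in jx.
Qed.

Lemma interp_affineE v x :
  interp_affine dx v x = v (idx x) + (x - gridpt dx (idx x)) * Dp dx v (idx x).
Proof.
rewrite /interp_affine (@zsum_single _ (idx x)).
  by rewrite indicE mem_set ?mulr1//; exact/cellE.
by move=> j jx; rewrite indicE memNset ?mulr0// => /cellE h; rewrite h eqxx in jx.
Qed.

Lemma DpE v j : v (j + 1) = v j + dx * Dp dx v j.
Proof. by rewrite /Dp; field; exact: lt0r_neq0. Qed.

(** The right end point lies in the next half-open cell; the two affine formulas agree there. *)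
Lemma interp_affine_closed v x j : gridpt dx j <= x <= gridpt dx (j + 1) ->
  interp_affine dx v x = v j + (x - gridpt dx j) * Dp dx v j.
Proof.
move=> /andP[jx]; rewrite le_eqVlt => /predU1P[->|xj].
  by rewrite interp_affineE idx_gridpt subrr mul0r addr0 gridptS (addrC _ dx) addrK DpE.
by rewrite interp_affineE (_ : idx x = j)//; apply/eqP; rewrite idxP jx.
Qed.

Lemma loc1_st v : loc1 (st v).
Proof.
split=> [|a b]; first exact: measurable_st.
have [ab|ba] := leP a b; last first.
  by rewrite set_itv_ge ?bnd_simp -?ltNge//; exact: integrable_set0.
have [M HM] : exists M, forall x, a <= x <= b -> `|st v x| <= M.
  have HB : forall n : nat, exists M, forall j, idx a <= j <= idx a + n%:Z -> `|v j| <= M.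
    elim=> [|n [M HM]].
      by exists `|v (idx a)| => j /andP[h1 h2]; rewrite (_ : j = idx a)//; lia.
    exists (Num.max M `|v (idx a + n.+1%:Z)|) => j /andP[h1 h2].
    have [->|h3] := eqVneq j (idx a + n.+1%:Z); first by rewrite le_max lexx orbT.
    by rewrite le_max HM//; apply/andP; split; lia.
  have mono x y : x <= y -> idx x <= idx y.
    by move=> xy; apply: le_floor; rewrite ler_pM2r ?invr_gt0.
  have [M HM] := HB `|idx b - idx a|%N; exists M => x /andP[ax xb].
  by apply: HM; have := mono _ _ ax; have := mono _ _ xb; lia.
apply: measurable_bounded_integrable => //.
- by rewrite [X in (X < _)%E](_ : _ = (b - a)%:E) ?ltey//; exact: mu_itv.
- by apply: measurable_funS (measurable_st v).
- exists M; split; rewrite ?num_real// => y My x /=; rewrite in_itv/= => xab.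
  exact: le_trans (HM x xab) (ltW My).
Qed.

Lemma J_cell v j s t : gridpt dx j <= s -> s <= t -> t <= gridpt dx (j + 1) ->
  J s t (st v) = v j * (t - s).
Proof.
move=> js st_ tj; rewrite -(J_cst _ st_) /J.
have I w : mu.-integrable `[s, t[ (EFin \o st w).
  by apply: integrableS ((loc1_st w).2 s t) => //; by move=> x /=; rewrite !in_itv/= => /andP[-> /ltW].
rewrite -Rintegral_itv_bndo_bndc// -Rintegral_itv_bndo_bndc//; last first.
  exact: (I (fun=> v j)).
apply: eq_Rintegral => x; rewrite inE/= in_itv/= => /andP[sx xt].
rewrite /st (_ : idx x = j)//; apply/eqP; rewrite idxP (le_trans js)//=.
exact: lt_le_trans tj.
Qed.

(** The identity is exact on each closed cell, and [cousin] chains the cells. *)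
Lemma interp_isP v : is_primitive (interp_affine dx v) (st (Dp dx v)).
Proof.
split=> [|a b ab]; first exact: loc1_st.
have lD := loc1_st (Dp dx v).
have C j s t : gridpt dx j <= s -> s <= t -> t <= gridpt dx (j + 1) ->
    interp_affine dx v t - interp_affine dx v s = J s t (st (Dp dx v)).
  move=> js st_ tj; rewrite (J_cell _ js)//.
  rewrite !(@interp_affine_closed v _ j) ?js ?tj ?(le_trans js) ?(le_trans st_)//.
  by ring.
apply: (cousin (P := fun s t => interp_affine dx v t - interp_affine dx v s = J s t (st (Dp dx v)))) => //.
  by move=> s m t _ sm mt _ H1 H2; rewrite (J_chasles lD sm mt) -H1 -H2; ring.
move=> x _; have /andP[x1 x2] := idx_itv x; set j := idx x in x1 x2.
(* At a grid point the left neighbourhood belongs to the previous cell. *)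
have [e e0 He] : exists2 e, 0 < e & forall s, s <= x -> x - e < s ->
    interp_affine dx v x - interp_affine dx v s = J s x (st (Dp dx v)).
  move: x1; rewrite le_eqVlt => /predU1P[xj|x1].
    exists dx => // s sx xs; apply: (@C (j - 1)) => //.
      by have := gridptS (j - 1); rewrite subrK; lra.
    by rewrite subrK xj.
  exists (x - gridpt dx j); first by rewrite subr_gt0.
  by move=> s sx xs; apply: (@C j) => //; [lra|exact: ltW].
exists (Num.min e (gridpt dx (j + 1) - x)); first by rewrite lt_min e0 subr_gt0.
move=> s t _ sx xt _ xs tx.
rewrite (J_chasles lD sx xt) -(He s)//; last first.
  by apply: le_lt_trans xs; rewrite lerB// ge_min lexx.
rewrite -(@C j x t) => //; first by ring.
have : Num.min e (gridpt dx (j + 1) - x) <= gridpt dx (j + 1) - x by rewrite ge_min lexx orbT.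
lra.
Qed.

Lemma interp_affine_le v c x : (forall j, `|v j| <= c) -> `|interp_affine dx v x| <= c.
Proof.
move=> vc; have /andP[x1 x2] := idx_itv x; rewrite interp_affineE.
move: x1 x2; rewrite gridptS; set j := idx x => x1 x2.
pose th := (x - gridpt dx j) / dx.
have th0 : 0 <= th by apply: divr_ge0; [lra|exact: ltW].
have th1 : th <= 1 by rewrite ler_pdivrMr// mul1r; lra.
have -> : v j + (x - gridpt dx j) * Dp dx v j = (1 - th) * v j + th * v (j + 1).
  by rewrite /Dp /th; field; exact: lt0r_neq0.
clearbody th.
apply: le_trans (ler_normD _ _) _; rewrite !normrM (ger0_norm th0) ger0_norm ?subr_ge0//.
have := ler_wpM2l th0 (vc (j + 1)); have h : 0 <= 1 - th by lra.
by have := ler_wpM2l h (vc j); lra.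
Qed.

Lemma interp_affine_st v x : `|interp_affine dx v x - st v x| <= `|dx * st (Dp dx v) x|.
Proof.
have /andP[x1 x2] := idx_itv x; rewrite interp_affineE /st addrC addKr !normrM.
rewrite ler_wpM2r//; move: x2; rewrite gridptS => x2.
by rewrite !ger0_norm ?(ltW dx0) ?subr_ge0//; lra.
Qed.

Lemma interp_L2 v : in_L2 (st v) -> in_L2 (st (Dp dx v)) ->
  in_L2 (interp_affine dx v) /\
  n2 (interp_affine dx v) <= n2 (st v) + dx * n2 (st (Dp dx v)).
Proof.
move=> v2 D2.
have mI : measurable_fun setT (interp_affine dx v).
  by apply: continuous_measurable_fun; apply: isP_cont (interp_isP v).
have mB := measurable_funB mI (measurable_st v).
have L := L2Z dx D2.
have B2 : in_L2 (interp_affine dx v \- st v).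
  by apply: L2_le L _ => // x; exact: interp_affine_st.
have nB : n2 (interp_affine dx v \- st v) <= dx * n2 (st (Dp dx v)).
  rewrite -[X in X * _](gtr0_norm dx0) -n2Z//.
  by apply: n2_le => // x; exact: interp_affine_st.
have E : interp_affine dx v = st v \+ (interp_affine dx v \- st v).
  by apply/funext => x /=; rewrite addrC subrK.
split; first by rewrite E; exact: L2D.
by rewrite {1}E; apply: le_trans (n2D v2 B2) _; rewrite lerD2l.
Qed.

End grid.

(** * Discrete norms as real bounds *)

Section discrete_norms.
Context {R : realType}.
Variable dx : R.
Hypothesis dx0 : 0 < dx.
Notation mu := (@lebesgue_measure R).
Notation st := (st dx).
Implicit Types (v w : int -> R) (x xi c : R) (i j : int) (Y : state int R).

Lemma lnormoo_le v c : (lnormoo v <= c%:E)%E -> forall j, `|v j| <= c.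
Proof.
move=> vc j; rewrite -lee_fin; apply: le_trans vc.
by apply: ereal_sup_ubound; exists j.
Qed.

Lemma lnormoo_ge0 v : (0 <= lnormoo v)%E.
Proof.
apply: le_trans (_ : `|v 0|%:E <= _)%E; first by rewrite lee_fin.
by apply: ereal_sup_ubound; exists 0.
Qed.

Lemma lnorm_ge0 p v : (0 <= lnorm dx p v)%E.
Proof. exact: poweR_ge0. Qed.

Lemma lnorm2_le v c : (lnorm dx 2 v <= c%:E)%E -> in_L2 (st v) /\ n2 (st v) <= c.
Proof.
rewrite lnorm2E// => H.
have L : in_L2 (st v) by split; [exact: measurable_st|exact: le_lt_trans H (ltey _)].
by split=> //; rewrite -lee_fin -L2_fin.
Qed.

Lemma h1norm_le v c : (h1norm dx v <= c%:E)%E ->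
  (lnorm dx 2 v <= c%:E)%E /\ (lnorm dx 2 (Dp dx v) <= c%:E)%E.
Proof.
rewrite /h1norm; have := lnorm_ge0 2 v; have := lnorm_ge0 2 (Dp dx v).
move: (lnorm _ _ _) (lnorm _ _ _) => [b| |] [a| |] //=; rewrite ?lee_fin.
- move=> b0 a0; rewrite !powR_mulrn// powR12_sqrt ?addr_ge0 ?sqr_ge0// => H.
  by split; apply: le_trans H; rewrite -[leLHS]ger0_norm// -sqrtr_sqr ler_wsqrtr//
    ?lerDl ?lerDr ?sqr_ge0.
all: by move=> _ _; rewrite pnatr_eq0 /= invr_eq0 pnatr_eq0.
Qed.

Definition l2_bound v c := in_L2 (st v) /\ n2 (st v) <= c.

(** Real componentwise bounds replace the extended real norm, so that estimates on the grid stay in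
    [R]. *)
Record Ed_bound Y c : Prop := EdBound {
  edb_z : forall j, `|zeta_of Y j| <= c;
  edb_dz : l2_bound (Dp dx (zeta_of Y)) c;
  edb_u : l2_bound (U_of Y) c;
  edb_du : l2_bound (Dp dx (U_of Y)) c;
  edb_h : forall j, `|H_of Y j| <= c;
  edb_dh : l2_bound (Dp dx (H_of Y)) c;
  edb_r : l2_bound (rbar_of Y) c }.

Lemma adde_le (a b : \bar R) c : (0 <= a)%E -> (0 <= b)%E -> (a + b <= c%:E)%E ->
  (a <= c%:E)%E /\ (b <= c%:E)%E.
Proof.
by move=> a0 b0 H; split; apply: le_trans H; [rewrite leeDl|rewrite leeDr].
Qed.

Lemma Vdnorm_ge0 v : (0 <= Vdnorm dx v)%E.
Proof. by rewrite adde_ge0// ?lnormoo_ge0 ?lnorm_ge0. Qed.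

Lemma h1norm_ge0 v : (0 <= h1norm dx v)%E.
Proof. exact: poweR_ge0. Qed.

Lemma Ednorm_bound Y c : (Ednorm dx Y <= c%:E)%E -> Ed_bound Y c.
Proof.
have V0 := Vdnorm_ge0; have h0 := h1norm_ge0; have l0 := lnorm_ge0.
move=> H; have [|//|{}H hr] := adde_le _ _ H; first by do 2 apply: adde_ge0 => //.
have [|//|{}H hH] := adde_le _ _ H; first exact: adde_ge0.
have [//|//|hZ hU] := adde_le _ _ H.
have [|//|z1 z2] := adde_le _ _ hZ; first exact: lnormoo_ge0.
have [|//|h1 h2] := adde_le _ _ hH; first exact: lnormoo_ge0.
have [u1 u2] := h1norm_le hU.
by split; solve [exact: lnormoo_le|exact: lnorm2_le].
Qed.

Lemma Ednorm_ge0 Y : (0 <= Ednorm dx Y)%E.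
Proof.
have V0 := Vdnorm_ge0; have h0 := h1norm_ge0; have l0 := lnorm_ge0.
by do 3 apply: adde_ge0 => //.
Qed.

Lemma Ed_bound_ge0 Y c : Ed_bound Y c -> 0 <= c.
Proof. by case=> + _ _ _ _ _ _ => /(_ 0); apply: le_trans. Qed.

(** The integral of [|v|] over one cell is [dx * |v j|], at most [Num.sqrt dx] times the L^2 norm.
    For fixed [dx] this bounds the grid values; multiplied by [dx] it makes increments of order
    [Num.sqrt dx]. *)
Lemma l2_bound_pointwise v c j : l2_bound v c -> `|v j| <= c / Num.sqrt dx.
Proof.
move=> [v2 vc].
have s0 : 0 < Num.sqrt dx by rewrite sqrtr_gt0.
rewrite ler_pdivlMr//.
have H := J_n2 v2 (_ : gridpt dx j <= gridpt dx (j + 1)).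
have {}H := H _; rewrite gridptS in H; have {}H := H ltac:(by rewrite lerDl ltW).
have E : J (gridpt dx j) (gridpt dx j + dx) (fun x => `|st v x|) = `|v j| * dx.
  rewrite (_ : (fun x => _) = st (fun j => `|v j|))// (@J_cell _ _ dx0 _ j) ?gridptS//.
    by rewrite (addrC _ dx) addrK.
  by rewrite lerDl ltW.
rewrite E (addrC _ dx) addrK in H.
rewrite -(ler_pM2l s0); apply: le_trans (_ : `|v j| * dx <= _).
  by rewrite mulrCA -expr2 sqr_sqrtr// ltW.
by apply: le_trans H _; rewrite ler_wpM2l// ltW.
Qed.

(** Boundedness of the interpolation from the grid space to E, which carries derivatives in time
    from the grid to the line. The components contribute 2, 2 + dx, 2 and 1, so the constant has
    room. *)
Lemma interp_E Y c : Ed_bound Y c -> in_E (interp dx Y) /\ En (interp dx Y) <= (9 + dx) * c.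
Proof.
move=> B; have c0 := Ed_bound_ge0 B.
case: B => hz [dz2 dzc] [u2 uc] [du2 duc] hh [dh2 dhc] [r2 rc].
have V v : (forall j, `|v j| <= c) -> in_L2 (st (Dp dx v)) -> n2 (st (Dp dx v)) <= c ->
    in_V (interp_affine dx v) /\ nV (interp_affine dx v) <= c + c.
  move=> vc D2 Dc; have D : is_L2_primitive (interp_affine dx v) (st (Dp dx v)).
    by split=> //; exact: interp_isP.
  have [h1 h2] := isD_V D (fun x => interp_affine_le dx0 x vc).
  by split=> //; apply: le_trans h2 _; rewrite lerD2l.
have [z1 z2] := V _ hz dz2 dzc; have [h1 h2] := V _ hh dh2 dhc.
have Du : is_L2_primitive (interp_affine dx (U_of Y)) (st (Dp dx (U_of Y))).
  by split=> //; exact: interp_isP.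
have [i2 in2] := interp_L2 dx0 u2 du2.
have [u1 un] := isD_H Du i2.
have E : rbar_of (interp dx Y) = st (rbar_of Y) by exact: interp_constE.
split; first by split=> //; rewrite E.
have -> : En (interp dx Y) = nV (interp_affine dx (zeta_of Y)) +
  nH (interp_affine dx (U_of Y)) + nV (interp_affine dx (H_of Y)) + n2 (st (rbar_of Y)).
  by rewrite /En E.
have k : dx * n2 (st (Dp dx (U_of Y))) <= dx * c by rewrite ler_wpM2l// ltW.
move: z2 h2 un in2 k duc uc rc c0.
move: (nV _) (nV _) (nH _) (n2 _) (n2 _) (n2 _) (n2 _) => a1 a2 a3 a4 a5 a6 a7.
by lra.
Qed.

Lemma DpD v w : Dp dx (fun j => v j + w j) = fun j => Dp dx v j + Dp dx w j.
Proof. by apply/funext => j; rewrite /Dp; ring. Qed.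

Lemma DpZ c v : Dp dx (fun j => c * v j) = fun j => c * Dp dx v j.
Proof. by apply/funext => j; rewrite /Dp; ring. Qed.

Lemma interp_affineD v w : interp_affine dx (fun j => v j + w j) =
  fun x => interp_affine dx v x + interp_affine dx w x.
Proof. by apply/funext => x; rewrite !interp_affineE// DpD; ring. Qed.

Lemma interp_affineZ c v : interp_affine dx (fun j => c * v j) =
  fun x => c * interp_affine dx v x.
Proof. by apply/funext => x; rewrite !interp_affineE// DpZ; ring. Qed.

Lemma interpD Y1 Y2 : interp dx (Y1 + Y2) = interp dx Y1 + interp dx Y2.
Proof.
case: Y1 Y2 => [[[z1 u1] h1] r1] [[[z2 u2] h2] r2].
transitivity (interp_affine dx (fun j => z1 j + z2 j), interp_affine dx (fun j => u1 j + u2 j),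
  interp_affine dx (fun j => h1 j + h2 j), interp_const dx (fun j => r1 j + r2 j)); first by [].
rewrite !interp_affineD interp_constE//.
have E r : interp_const dx r = st r by exact: interp_constE.
by rewrite /interp /= !E.
Qed.

Lemma interpZ c Y : interp dx (c *: Y) = c *: interp dx Y.
Proof.
case: Y => [[[z1 u1] h1] r1].
transitivity (interp_affine dx (fun j => c * z1 j), interp_affine dx (fun j => c * u1 j),
  interp_affine dx (fun j => c * h1 j), interp_const dx (fun j => c * r1 j)); first by [].
rewrite !interp_affineZ interp_constE//.
have E r : interp_const dx r = st r by exact: interp_constE.
by rewrite /interp /= !E.
Qed.

Lemma interpB Y1 Y2 : interp dx (Y1 - Y2) = interp dx Y1 - interp dx Y2.
Proof. by rewrite -scaleN1r interpD interpZ scaleN1r. Qed.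

Implicit Types (a : int -> int -> R) (K : kernels R).

Record lstar_bound a c : Prop := LstarBound {
  lsb_oo : forall i j, `|a i j| <= c;
  lsb_1 : forall i, L1 (st (a i)) /\ \int[mu]_x `|st (a i) x| <= c }.

Lemma knormoo_ge0 a : (0 <= knormoo a)%E.
Proof.
apply: le_trans (lnormoo_ge0 (a 0)) _.
by apply: ereal_sup_ubound; exists 0.
Qed.

Lemma knorm_ge0 p a : (0 <= knorm dx p a)%E.
Proof.
apply: le_trans (lnorm_ge0 p (a 0)) _.
by apply: ereal_sup_ubound; exists 0.
Qed.

Lemma lstarnorm_bound a c : (lstarnorm dx a <= c%:E)%E -> lstar_bound a c.
Proof.
move=> /adde_le[||h1 hoo]; rewrite ?knormoo_ge0 ?knorm_ge0//; split=> i.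
  apply: lnormoo_le; apply: le_trans hoo.
  by apply: ereal_sup_ubound; exists i.
have H : (\int[mu]_x `|st (a i) x|%:E <= c%:E)%E.
  rewrite -lnorm1E//; apply: le_trans h1.
  by apply: ereal_sup_ubound; exists i.
have L : L1 (st (a i)).
  apply/integrableP; split; last exact: le_lt_trans H (ltey _).
  by apply/measurable_EFinP; exact: measurable_st.
split=> //; rewrite -lee_fin; apply: le_trans H; rewrite /Rintegral fineK//.
by apply: integrable_fin_num => //; exact: integrable_norm.
Qed.

Lemma lstarnorm_ge0 a : (0 <= lstarnorm dx a)%E.
Proof. by rewrite adde_ge0 ?knormoo_ge0 ?knorm_ge0. Qed.

Lemma Kdnorm_bound K c : (Kdnorm dx K <= c%:E)%E ->
  [/\ lstar_bound (g_of K) c, lstar_bound (k_of K) c, lstar_bound (gamma_of K) c & lstar_bound (kappa_of K) c].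
Proof.
have V0 := lstarnorm_ge0.
move=> H; have [|//|{}H h4] := adde_le _ _ H; first by do 2 apply: adde_ge0 => //.
have [|//|{}H h3] := adde_le _ _ H; first exact: adde_ge0.
have [//|//|h1 h2] := adde_le _ _ H.
by split; exact: lstarnorm_bound.
Qed.

Lemma Kdnorm_ge0 K : (0 <= Kdnorm dx K)%E.
Proof. by have := lstarnorm_ge0 => h; do 3 apply: adde_ge0 => //. Qed.

Lemma fullnorm_le (Z : state int R * kernels R) c : (fullnorm dx Z <= c%:E)%E ->
  Ed_bound Z.1 c /\ [/\ lstar_bound (g_of Z.2) c, lstar_bound (k_of Z.2) c, lstar_bound (gamma_of Z.2) c & lstar_bound (kappa_of Z.2) c].
Proof.
by move=> /adde_le[||h1 h2]; rewrite ?Ednorm_ge0 ?Kdnorm_ge0//; split;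
  [exact: Ednorm_bound|exact: Kdnorm_bound].
Qed.

End discrete_norms.

(** * Curves and differential inequalities *)

Section ereal_cvg0.
Context {R : realType} {T : Type} (F : set_system T) {FF : Filter F}.
Implicit Type f : T -> \bar R.

Lemma cvg0_le f (e : R) : f x @[x --> F] --> 0%E -> 0 < e ->
  \forall x \near F, (f x <= e%:E)%E.
Proof.
move=> f0 e0; have : nbhs (0%E : \bar R) [set x | (x < e%:E)%E].
  by apply: open_nbhs_nbhs; split; [exact: open_ereal_lt_ereal|rewrite /= lte_fin].
by move=> /f0; apply: (@filterS _ F FF (f @^-1` [set x | (x < e%:E)%E])) => x /= /ltW.
Qed.

Lemma le_cvg0 f : (forall x, (0 <= f x)%E) ->
  (forall e : R, 0 < e -> \forall x \near F, (f x <= e%:E)%E) ->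
  f x @[x --> F] --> 0%E.
Proof.
move=> f0 H.
have fin : \forall x \near F, f x \is a fin_num.
  by apply: filterS (H 1 ltr01) => x fx; rewrite ge0_fin_numE// (le_lt_trans fx)// ltey.
apply/fine_cvgP; split=> //.
apply/cvgrPdist_le => e e0.
apply: filterS2 fin (H e e0) => x fx fe.
by rewrite sub0r normrN ger0_norm ?fine_ge0// -lee_fin fineK.
Qed.

End ereal_cvg0.

Section curves_eps.
Context {R : realType} {V : lmodType R}.
Variables (N : V -> \bar R) (I : set R) (X : R -> V).
Hypothesis N0 : forall x, (0 <= N x)%E.

Lemma within_near (P : R -> Prop) t : (\forall s \near within I (nbhs t), P s) <->
  exists2 d, 0 < d & forall s, I s -> `|s - t| < d -> P s.
Proof.
split.
  move=> /nbhs_ballP[d d0 H]; exists d => // s Is st.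
  by apply: H => //; rewrite /ball/= distrC.
move=> [d d0 H]; apply/nbhs_ballP; exists d => // s; rewrite /ball/= => st Is.
by apply: H => //; rewrite distrC.
Qed.

Lemma curve_continuousP : curve_continuous N I X <->
  forall t, I t -> forall e, 0 < e -> exists2 d, 0 < d &
    forall s, I s -> `|s - t| < d -> (N (X s - X t) <= e%:E)%E.
Proof.
split=> H t It.
  by move=> e e0; apply/within_near; apply: cvg0_le => //; exact: H.
by apply: le_cvg0 => // e e0; apply/within_near; exact: H.
Qed.

Lemma curve_derivativeP t D : curve_derivative N I X t D ->
  forall e, 0 < e -> exists2 d, 0 < d &
    forall s, I s -> s != t -> `|s - t| < d -> (N ((s - t)^-1 *: (X s - X t) - D) <= e%:E)%E.
Proof.
move=> H e e0; have FF : Filter (within I t^') by exact: within_filter.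
have := @cvg0_le R R (within I t^') FF _ e H e0.
move=> /nbhs_ballP[d d0 {}H]; exists d => // s Is st sd.
by apply: H => //; rewrite /ball/= distrC.
Qed.

End curves_eps.

(** * Differential inequalities *)

Section gronwall.
Context {R : realType}.
Implicit Types (f g e : R -> R) (t s T L : R).

Lemma deriv_mono f f' a b : a <= b -> continuous f ->
  (forall t, a < t < b -> is_derive t 1 f (f' t)) ->
  (forall t, a < t < b -> 0 <= f' t) -> f a <= f b.
Proof.
move=> ab cf df f0; move: (ab); rewrite le_eqVlt => /predU1P[->//|{}ab].
have D x : x \in `]a, b[%R -> is_derive x 1 f (f' x) by rewrite in_itv/=; exact: df.
have C : {within `[a, b], continuous f} by exact: continuous_subspaceT.
have [c' c'ab E] := @MVT R f f' a b ab D C.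
rewrite -subr_ge0 E mulr_ge0 ?subr_ge0 ?(ltW ab)//.
by apply: f0; move: c'ab; rewrite in_itv.
Qed.

Lemma is_derive_expZ (c L t : R) : is_derive t 1 (fun s => c * expR (L * s)) (c * (L * expR (L * t))).
Proof. by apply: is_derive_eq; rewrite /GRing.scale/= ?mulr0 ?scaler0; ring. Qed.

Lemma continuous_expZ (c L : R) : continuous (fun s : R => c * expR (L * s)).
Proof.
move=> t; apply: differentiable_continuous; apply/derivable1_diffP.
by have [] := is_derive_expZ c L t.
Qed.

Lemma deriv0_const f T : continuous f -> (forall t, 0 < t < T -> is_derive t 1 f 0) ->
  forall t, 0 <= t <= T -> f t = f 0.
Proof.
move=> cf df t /andP[t0 tT].
have D x : 0 < x < t -> is_derive x 1 f 0.
  by move=> /andP[x0 xt]; apply: df; rewrite x0 (lt_le_trans xt).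
have h1 : f 0 <= f t by exact: (deriv_mono t0 cf D).
have cN : continuous (fun x => - f x) by move=> x; apply: cvgN; exact: cf.
have DN x : 0 < x < t -> is_derive x 1 (fun x => - f x) (- 0).
  by move=> /D ?; exact: is_deriveN.
have h2 : - f 0 <= - f t by apply: (deriv_mono t0 cN DN) => x _; rewrite oppr0.
by apply/le_anti; rewrite h1 -lerN2 h2.
Qed.

(* A linear system with bounded coefficients propagates zero data: the
   weighted bound M e^(2Lt) is halved by each integration. *)
Lemma family_zero (A : Type) (f f' : A -> R -> R) (L M T : R) : 0 <= L -> 0 <= M ->
  (forall a, continuous (f a)) -> (forall a, f a 0 = 0) ->
  (forall a t, 0 < t < T -> is_derive t 1 (f a) (f' a t)) ->
  (forall a t, 0 <= t <= T -> `|f a t| <= M) ->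
  (forall t B, 0 < t < T -> (forall a, `|f a t| <= B) -> forall a, `|f' a t| <= L * B) ->
  forall a t, 0 <= t <= T -> f a t = 0.
Proof.
move=> L0 M0 cf f0 df bf lf.
have main k a t : 0 <= t <= T -> `|f a t| <= M / 2 ^+ k * expR (2 * L * t).
  elim: k a t => [|k IH] a t tT.
    rewrite expr0 divr1; apply: le_trans (bf _ _ tT) _.
    rewrite ler_peMr// -[leLHS]expR0 ler_expR.
    by case/andP: tT => t0 _; rewrite !mulr_ge0.
  pose c := M / 2 ^+ k.+1; pose g s := c * expR (2 * L * s).
  have c0 : 0 <= c by rewrite divr_ge0// exprn_ge0.
  have dg s : is_derive s 1 g (c * (2 * L * expR (2 * L * s))) by exact: is_derive_expZ.
  have cg : continuous g by exact: continuous_expZ.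
  case/andP: (tT) => t0 tT'.
  have key s : 0 < s < t -> `|f' a s| <= c * (2 * L * expR (2 * L * s)).
    move=> /andP[s0 st_].
    apply: le_trans (lf s (M / 2 ^+ k * expR (2 * L * s)) _ _ a) _.
    - by rewrite s0 (lt_le_trans st_).
    - by move=> b; apply: IH; rewrite (ltW s0) (le_trans (ltW st_)).
    have -> : M / 2 ^+ k = 2 * c.
      rewrite /c exprS; have : (2 : R) ^+ k != 0 by rewrite expf_neq0.
      by move: (_ ^+ k) => z z0; field.
    suff -> : forall u E : R, L * (2 * u * E) = u * (2 * L * E) by [].
    by move=> u E; ring.
  have dfs s : 0 < s < t -> is_derive s 1 (f a) (f' a s).
    by move=> /andP[s0 st_]; apply: df; rewrite s0 (lt_le_trans st_).
  have g0 : 0 <= g 0 by rewrite mulr_ge0// expR_ge0.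
  have -> : M / 2 ^+ k.+1 * expR (2 * L * t) = g t by [].
  pose g' s := c * (2 * L * expR (2 * L * s)).
  have dg' s : is_derive s 1 g (g' s) by exact: dg.
  have key' s : 0 < s < t -> `|f' a s| <= g' s by exact: key.
  clearbody g g'.
  have h1 : g 0 - f a 0 <= g t - f a t.
    have C1 : continuous (fun s => g s - f a s).
      by move=> s; apply: cvgB; [exact: cg|exact: cf].
    have D1 s : 0 < s < t -> is_derive s 1 (fun s => g s - f a s) (g' s - f' a s).
      by move=> st_; have := dg' s; have := dfs s st_ => ? ?; exact: is_deriveB.
    have P1 s : 0 < s < t -> 0 <= g' s - f' a s.
      by move=> /key'; rewrite ler_norml subr_ge0 => /andP[].
    exact: (deriv_mono t0 C1 D1 P1).
  have h2 : g 0 + f a 0 <= g t + f a t.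
    have C2 : continuous (fun s => g s + f a s).
      by move=> s; apply: cvgD; [exact: cg|exact: cf].
    have D2 s : 0 < s < t -> is_derive s 1 (fun s => g s + f a s) (g' s + f' a s).
      by move=> st_; have := dg' s; have := dfs s st_ => ? ?; exact: is_deriveD.
    have P2 s : 0 < s < t -> 0 <= g' s + f' a s.
      by move=> /key'; rewrite ler_norml => /andP[h _]; lra.
    exact: (deriv_mono t0 C2 D2 P2).
  move: h1 h2; rewrite f0 ler_norml; move: g0; move: (g t) (g 0) (f a t) => x y z.
  by move=> ? ? ?; apply/andP; split; lra.
move=> a t tT; apply/eqP; rewrite -normr_le0; apply/ler_addgt0Pl => e e0.
rewrite addr0; pose K := M * expR (2 * L * t).
have K0 : 0 <= K by rewrite mulr_ge0// expR_ge0.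
pose k := (Num.truncn (K / e)).+1.
apply: (le_trans (main k a t tT)).
rewrite (_ : M / 2 ^+ k * expR (2 * L * t) = K / 2 ^+ k); last by rewrite /K mulrAC.
have k2 : k%:R <= 2 ^+ k :> R by rewrite -natrX ler_nat ltnW// ltn_expl.
rewrite ler_pdivrMr ?exprn_gt0// mulrC -ler_pdivrMr//.
by apply: le_trans k2; apply/ltW/truncnS_gt.
Qed.

(** Integrating factor: the product [f t * expR (L * t)] is nondecreasing. *)
Lemma positive_persist f f' L T : continuous f -> 0 < f 0 ->
  (forall t, 0 < t < T -> is_derive t 1 f (f' t)) ->
  (forall t, 0 < t < T -> - (L * f t) <= f' t) ->
  forall t, 0 <= t <= T -> 0 < f t.
Proof.
move=> cf f0 df lf t /andP[t0 tT].
have : f 0 * (1 * expR (L * 0)) <= f t * (1 * expR (L * t)).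
  apply: (@deriv_mono (fun s => f s * (1 * expR (L * s)))
    (fun s => f s * (1 * (L * expR (L * s))) + (1 * expR (L * s)) * f' s)) => //.
  - by move=> s; apply: cvgM; [exact: cf|exact: continuous_expZ].
  - move=> s /andP[s0 st_]; have d1 := is_derive_expZ 1 L s.
    have d2 : is_derive s 1 f (f' s) by apply: df; rewrite s0 (lt_le_trans st_).
    exact: is_deriveM.
  - move=> s /andP[s0 st_]; have := lf s; rewrite s0 (lt_le_trans st_)// => /(_ isT) H.
    rewrite (_ : _ + _ = (f' s + L * f s) * expR (L * s)); last by ring.
    by rewrite mulr_ge0 ?expR_ge0//; lra.
rewrite !mul1r mulr0 expR0 mulr1 => H.
by rewrite -(pmulr_lgt0 _ (expR_gt0 (L * t))); exact: lt_le_trans H.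
Qed.

Lemma euler_step (L eps eta ec bc u : R) : 0 <= L -> eps + eta <= bc -> ec <= bc ->
  0 <= u -> ec + u * (L * ec + eps + eta) <= bc * (1 + (L + 1) * u).
Proof.
move=> L0 h1 h2 u0.
have h3 : L * ec <= L * bc by rewrite ler_wpM2l.
have := ler_wpM2l u0 (_ : L * ec + eps + eta <= L * bc + bc).
by move=> /(_ ltac:(lra)); lra.
Qed.

(** The barrier [b t = (e 0 + eps + eta) * expR ((L + 1) * t)] is not crossed: from a time [c] with
    [e c <= b c] the inequality gives at most [b c * (1 + (L + 1) * (s - c))], which is below [b s].
    The last assumption keeps the barrier below 1 up to [T], so the inequality, known only where
    [e <= 1], is always available. *)
Lemma dini_gronwall e T L eps eta : 0 <= T -> 0 <= L -> 0 <= eps -> 0 < eta -> 0 <= e 0 ->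
  (forall t x, 0 <= t <= T -> 0 < x -> exists2 d, 0 < d &
     forall s, 0 <= s <= T -> `|s - t| < d -> `|e s - e t| <= x) ->
  (forall t x, 0 <= t < T -> e t <= 1 -> 0 < x -> exists2 d, 0 < d &
     forall s, t < s -> s <= T -> s < t + d ->
       e s <= e t + (s - t) * (L * e t + eps + x)) ->
  (e 0 + eps + eta) * expR ((L + 1) * T) <= 1 ->
  forall t, 0 <= t <= T -> e t <= (e 0 + eps + eta) * expR ((L + 1) * T).
Proof.
move=> T0 L0 eps0 eta0 e00 ce de d1.
set C := e 0 + eps + eta.
have C0 : 0 < C by rewrite /C; lra.
pose b t := C * expR ((L + 1) * t).
have bmono s t : s <= t -> b s <= b t.
  by move=> st; rewrite /b ler_wpM2l ?(ltW C0)// ler_expR ler_wpM2l//; lra.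
have bC t : 0 <= t -> C <= b t.
  by move=> t0; have := bmono 0 t t0; rewrite {1}/b mulr0 expR0 mulr1.
have cb : continuous b by exact: continuous_expZ.
suff H : forall t, 0 <= t <= T -> e t <= b t.
  by move=> t tT; apply: le_trans (H t tT) _; apply: bmono; case/andP: tT.
(* The times up to which [e] stays below the barrier. The supremum belongs to the set by continuity
   and cannot be less than [T]. *)
pose A := [set t | 0 <= t <= T /\ forall s, 0 <= s <= t -> e s <= b s].
have A0 : A 0.
  split; first by rewrite lexx.
  move=> s s0; have -> : s = 0 by apply/le_anti; rewrite andbC.
  by apply: le_trans (bC 0 (lexx 0)); rewrite /C; lra.
have hA : has_sup A by split; [exists 0|exists T => x [/andP[]]].
pose c := sup A.
have c0 : 0 <= c by apply: sup_upper_bound.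
have cT : c <= T by apply: ge_sup => [|x [/andP[]]//]; exists 0.
have below s : 0 <= s -> s < c -> e s <= b s.
  move=> s0 sc; have cs : 0 < c - s by rewrite subr_gt0.
  have [t [_ Ht] ct] := sup_adherent cs hA.
  by apply: Ht; rewrite s0/=; move: ct; rewrite /c; lra.
have ec : e c <= b c.
  apply/ler_addgt0Pl => x x0.
  have [->|cn0] := eqVneq c 0.
    by have [_ /(_ 0)] := A0; rewrite lexx => /(_ isT); lra.
  have cp : 0 < c by rewrite lt_neqAle eq_sym cn0.
  have [|d d0 Hd] := ce c x _ x0; first by rewrite c0.
  pose s := Num.max 0 (c - d / 2).
  have sc : s < c by rewrite /s gt_max cp/=; lra.
  have s0 : 0 <= s by rewrite /s le_max lexx.
  have sd : `|s - c| < d.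
    by rewrite distrC ger0_norm ?subr_ge0 ?ltW//; have : c - d / 2 <= s by [rewrite /s le_max lexx orbT]; lra.
  have := Hd s; rewrite s0 (le_trans (ltW sc) cT) => /(_ isT sd).
  by have := below s s0 sc; have := bmono _ _ (ltW sc); rewrite ler_norml; lra.
have Ac : A c.
  split; first by rewrite c0.
  move=> s /andP[s0]; rewrite le_eqVlt => /predU1P[->//|]; exact: below.
move=> t /andP[t0 tT]; have [tc|ct] := leP t c.
  by case: Ac => _; apply; rewrite t0.
have cT' : c < T by exact: lt_le_trans tT.
have ec1 : e c <= 1 by apply: le_trans ec _; apply: le_trans (bmono _ _ cT) d1.
have [|d d0 Hd] := de c eta _ ec1 eta0; first by rewrite c0.
pose s := Num.min t (c + d / 2).
have cs : c < s by rewrite /s lt_min ct/=; lra.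
suff : s <= c by rewrite leNgt cs.
apply: sup_upper_bound => //; have sT : s <= T by rewrite /s ge_min tT.
split; first by rewrite (le_trans c0 (ltW cs)).
move=> u /andP[u0 us]; have [uc|cu] := leP u c.
  by case: Ac => _; apply; rewrite u0.
have sd : s <= c + d / 2 by rewrite /s ge_min lexx orbT.
have ud : u < c + d by clear -us sd d0; lra.
apply: le_trans (Hd u cu (le_trans us sT) ud) _.
have -> : b u = b c * expR ((L + 1) * (u - c)).
  rewrite /b -[RHS]mulrA -expRD; congr (_ * expR _).
  by rewrite -mulrDr [c + _]addrC subrK.
have bc := bC c c0.
apply: le_trans (_ : b c * (1 + (L + 1) * (u - c)) <= _); last first.
  by rewrite ler_wpM2l ?expR_ge1Dx// (le_trans (ltW C0)).
apply: euler_step => //; last by rewrite subr_ge0 ltW.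
by apply: le_trans bc; rewrite /C -addrA lerDr.
Qed.

End gronwall.

(** * Invariants of the semi-discrete system *)

Section grid_sums.
Context {R : realType}.
Variable dx : R.
Hypothesis dx0 : 0 < dx.
Notation mu := (@lebesgue_measure R).
Notation st := (st dx).
Implicit Types (v w : int -> R) (a b : int -> int -> R) (i j m : int) (c : R).

Definition L1s v := L1 (st v).
Definition gsum v := dx * zsum v.

Lemma gsumE v : gsum v = \int[mu]_x st v x.
Proof. exact: zsum_st. Qed.

Lemma L1s_le v w : L1s w -> (forall m, `|v m| <= `|w m|) -> L1s v.
Proof.
move=> lw vw; apply: L1_le lw _; first exact: measurable_st.
by move=> x; exact: vw.
Qed.

Lemma L1sD v w : L1s v -> L1s w -> L1s (fun m => v m + w m).
Proof. by move=> lv lw; exact: (intgD measurableT lv lw). Qed.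

Lemma L1sZ c v : L1s v -> L1s (fun m => c * v m).
Proof. by move=> lv; exact: (intgZ c measurableT lv). Qed.

Lemma gsumD v w : L1s v -> L1s w -> gsum (fun m => v m + w m) = gsum v + gsum w.
Proof. by move=> lv lw; rewrite !gsumE -RintegralD. Qed.

Lemma gsumZ c v : L1s v -> gsum (fun m => c * v m) = c * gsum v.
Proof. by move=> lv; rewrite !gsumE -RintegralZl. Qed.

Lemma gsum_single v j : (forall m, m != j -> v m = 0) -> gsum v = dx * v j.
Proof. by move=> v0; rewrite /gsum (zsum_single dx0 v0). Qed.

Lemma L1s_single v j : (forall m, m != j -> v m = 0) -> L1s v.
Proof.
move=> v0; have mc : measurable (cell dx j : set R) := measurable_cell dx j.
have I : mu.-integrable [set: R] (EFin \o (fun x : R => \1_(cell dx j) x : R)).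
  apply/integrableP; split; first by apply/measurable_EFinP; exact: (measurable_indic mc).
  under eq_integral do rewrite gee0_abs ?lee_fin//.
  rewrite integral_indic//= setIT.
  by rewrite [X in (X < _)%E](_ : _ = dx%:E) ?ltey//; exact: mu_cell.
have := intgZ (v j) measurableT I; apply: eq_integrable => // x _ /=.
rewrite /st indicE; have [xj|xj] := eqVneq (idx dx x) j.
  by rewrite mem_set ?mulr1 ?xj//; exact/cellE.
by rewrite memNset ?mulr0 ?v0// => /cellE h; rewrite h// eqxx in xj.
Qed.

Lemma row_L1s a c w C i : lstar_bound dx a c -> (forall m, `|w m| <= C) ->
  L1s (fun m => a i m * w m) /\ `|gsum (fun m => a i m * w m)| <= C * c.
Proof.
move=> [_ /(_ i)[la ac]] wC; have C0 : 0 <= C := le_trans (normr_ge0 _) (wC 0).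
have H m : `|a i m * w m| <= `|C * a i m|.
  by rewrite !normrM (ger0_norm C0) mulrC ler_wpM2r.
have L := L1s_le (L1sZ C la) H; split=> //.
rewrite gsumE; apply: le_trans (le_normr_Rintegral measurableT L) _.
apply: le_trans (_ : \int[mu]_x (C * `|st (a i) x|) <= _).
  apply: le_Rintegral => //; first exact: integrable_norm.
    by apply: (intgZ C measurableT); exact: integrable_norm.
  by move=> x _; rewrite /= /st; have := H (idx dx x); rewrite [X in _ <= X]normrM (ger0_norm C0).
rewrite RintegralZl//; first by rewrite ler_wpM2l.
exact: integrable_norm.
Qed.

(** If [d < |a i j|] held for indices arbitrarily far out, [n] of them would give [d * n * dx <= I]
    for every [n], where [I] is the l^1 norm of the row. *)
Lemma row_tend0 a c i : lstar_bound dx a c -> tend0 (a i).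
Proof.
move=> [_ /(_ i)[la _]] d d0; apply: contrapT => H.
have {}H N : exists j, ((N <= j) || (j <= - N)) /\ d < `|a i j|.
  apply: contrapT => H'; apply: H; exists N => j jN; rewrite leNgt; apply/negP => dj.
  by apply: H'; exists j.
have la' : mu.-integrable setT (EFin \o (fun x => `|st (a i) x|)) by exact: integrable_norm.
pose I := \int[mu]_x `|st (a i) x|.
(* A finite set of large entries as a boolean predicate with bounded support: the bound leaves room
   for one more index, and the integral counts the indices with weight [dx]. *)
have key (n : nat) : exists S : int -> bool, [/\ exists M, forall j, S j -> `|j| <= M,
    forall j, S j -> d < `|a i j| & n%:R * dx <= \int[mu]_x (S (idx dx x))%:R].
  elim: n => [|n [S [[M HM] HS Hn]]].
    exists (fun=> false); split=> //; first by exists 0.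
    by rewrite mul0r Rintegral_ge0.
  have [j [jM dj]] := H (M + 1).
  have SjF : S j = false by apply/negP => /HM; move: jM; lia.
  exists (fun m => S m || (m == j)); split.
  - exists (Num.max M `|j|) => m /orP[/HM|/eqP->]; lia.
  - by move=> m /orP[/HS//|/eqP->].
  have LS : L1s (fun m => (S m)%:R).
    apply: L1s_le (L1sZ d^-1 la) _ => m; case Sm : (S m); last by rewrite normr0.
    rewrite normr1 normrM gtr0_norm ?invr_gt0// mulrC ler_pdivlMr// mul1r ltW//.
    exact: HS.
  have Lj : L1s (fun m => (m == j)%:R) by apply: (L1s_single (j := j)) => m /negbTE ->.
  have -> : (fun x => (S (idx dx x) || (idx dx x == j))%:R) =
      st (fun m => (S m)%:R + (m == j)%:R) :> (R -> R).
    apply/funext => x; rewrite /st; have [->|mj] := eqVneq (idx dx x) j.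
      by rewrite SjF /= add0r.
    by rewrite orbF addr0.
  have := gsumE (fun m => (S m)%:R + (m == j)%:R) => <-.
  rewrite gsumD// [X in _ + X](gsum_single (j := j)) ?eqxx ?mulr1; last by move=> m /negbTE ->.
  by rewrite gsumE -natr1 mulrDl mul1r lerD2r.
have [S [_ HS Hn]] := key (Num.truncn (I / (d * dx))).+1.
have LS : L1s (fun m => (S m)%:R).
  apply: L1s_le (L1sZ d^-1 la) _ => m; case Sm : (S m); last by rewrite normr0.
  rewrite normr1 normrM gtr0_norm ?invr_gt0// mulrC ler_pdivlMr// mul1r ltW//.
  exact: HS.
have : \int[mu]_x (d * (S (idx dx x))%:R) <= I.
  apply: le_Rintegral => //; first exact: (intgZ d measurableT LS).
  move=> x _; rewrite /st; case Sm : (S _); last by rewrite mulr0.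
  by rewrite mulr1 ltW// HS.
rewrite (RintegralZl d measurableT LS).
apply/negP; rewrite -ltNge; apply: lt_le_trans (_ : d * ((Num.truncn (I / (d * dx))).+1%:R * dx) <= _); last first.
  by rewrite ler_wpM2l// ltW.
by rewrite mulrCA -ltr_pdivrMr ?mulr_gt0//; exact: truncnS_gt.
Qed.

End grid_sums.

Section telescoping.
Context {R : realType}.
Implicit Types (T : int -> R) (p q : R) (i l : int).

(** The increments sum to 0 because [T] vanishes at both ends. Rather than summing, the two jumps
    are removed by step functions, and the resulting constant [W] is compared at [M] and [- M]. *)
Lemma telescope T p q i l : tend0 T ->
  (forall j, T (j + 1) - T j = p * (j == l)%:R - q * (j == i)%:R) -> p = q.
Proof.
move=> T0 HT.
pose W j := T j - p * ((l < j)%R)%:R + q * ((i < j)%R)%:R.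
have WS j : W (j + 1) = W j.
  have E k : (k < j + 1)%R = ((k < j)%R || (j == k)) by lia.
  have E2 (k : int) : ((k < j)%R || (j == k))%:R = ((k < j)%R)%:R + (j == k)%:R :> R.
    by have [->|jk] := eqVneq j k; rewrite ?ltxx ?add0r ?orbF ?addr0.
  rewrite /W !E !E2 (_ : T (j + 1) = T j + (p * (j == l)%:R - q * (j == i)%:R)); first by ring.
  by rewrite -HT; ring.
have W0 j : W j = W 0.
  have [j0|j0] := leP 0 j.
    by move: j j0; apply: int_up_ind => // j _; rewrite WS.
  move: j {j0}(ltW j0); apply: int_down_ind => // j _ <-.
  by rewrite -[in RHS](subrK 1 j) WS.
apply/eqP; rewrite -subr_eq0 -normr_le0; apply/ler_addgt0Pl => e e0.
have e2 : 0 < e / 2 by lra.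
have [N HN] := T0 _ e2.
pose M := `|N| + `|i| + `|l| + 1.
have h1 : `|T M| <= e / 2 by apply: HN; rewrite /M; lia.
have h2 : `|T (- M)| <= e / 2 by apply: HN; rewrite /M; lia.
have : W M = W (- M) by rewrite !W0.
rewrite /W (_ : l < M); last by rewrite /M; lia.
rewrite (_ : i < M); last by rewrite /M; lia.
rewrite (_ : (l < - M) = false); last by rewrite /M; lia.
rewrite (_ : (i < - M) = false); last by rewrite /M; lia.
move: h1 h2; rewrite !ler_norml !mulr1 !mulr0 addr0 => /andP[? ?] /andP[? ?] ?.
by apply/andP; split; lra.
Qed.

End telescoping.

Section sources.
Context {R : realType}.
Variables (dx rho c : R) (Y : state int R).
Hypothesis dx0 : 0 < dx.
Hypothesis YB : Ed_bound dx Y c.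
Implicit Type m : int.

Let cs := c / Num.sqrt dx.
Let cs0 : 0 <= cs. Proof. by rewrite divr_ge0 ?sqrtr_ge0// (Ed_bound_ge0 YB). Qed.

(** For a given [c] this grows like [1 / dx]; it is used at fixed [dx] only, to make sums converge
    and coefficients bounded. *)
Definition source_bound := cs * cs + (cs + `|rho| * cs).

Lemma source_bound_ge0 : 0 <= source_bound.
Proof. by apply: addr_ge0; [exact: mulr_ge0|apply: addr_ge0 => //; exact: mulr_ge0]. Qed.

Lemma sources_bounded : (forall m, `|U_of Y m * Dp dx (U_of Y) m| <= source_bound) /\
  (forall m, `|Dp dx (H_of Y) m + rho * rbar_of Y m| <= source_bound).
Proof.
split=> m.
  rewrite normrM; apply: le_trans (ler_pM _ _ (l2_bound_pointwise dx0 m (edb_u YB)) (l2_bound_pointwise dx0 m (edb_du YB))) _ => //.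
  by rewrite lerDl; apply: addr_ge0 => //; exact: mulr_ge0.
apply: le_trans (ler_normD _ _) _; apply: le_trans (lerD (l2_bound_pointwise dx0 m (edb_dh YB)) _) _.
- by rewrite normrM; exact: ler_wpM2l (l2_bound_pointwise dx0 m (edb_r YB)).
- by rewrite lerDr mulr_ge0.
Qed.

End sources.

(** * Consequences of the relations (a) at a fixed time *)

Section one_time.
Context {R : realType}.
Variables (dx rho : R).
Hypothesis dx0 : 0 < dx.
Notation gsum := (gsum dx).
Notation L1s := (L1s dx).
Implicit Types (i j m l : int).

Lemma Dp_yd (Y : state int R) j : Dp dx (yd_of dx Y) j = 1 + Dp dx (zeta_of Y) j.
Proof. by rewrite /Dp /yd_of gridptS; field; exact: lt0r_neq0. Qed.

Variables (Y : state int R) (g k gam kap : int -> int -> R) (c : R).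
Hypothesis gb : lstar_bound dx g c.
Hypothesis kb : lstar_bound dx k c.
Hypothesis gamb : lstar_bound dx gam c.
Hypothesis kapb : lstar_bound dx kap c.
Let a j := dx * Dp dx (yd_of dx Y) j.
Let y' := Dp dx (yd_of dx Y).

(** The recurrences are what is propagated in time; the symmetries in (a) are then recovered at each
    time through [g_sym], [k_sym] and [gam_kap]. *)
Definition four_relations :=
  [/\ forall i j, y' j * g i j - Dm dx (gam i) j = (i == j)%:R / dx,
      forall i j, Dp dx (g i) j = y' j * gam i j,
      forall i j, y' j * k i j - Dp dx (kap i) j = (i == j)%:R / dx &
      forall i j, Dm dx (k i) j = y' j * kap i j].

Hypothesis rel : four_relations.

Let dxn : dx != 0. Proof. exact: lt0r_neq0. Qed.

Lemma rel_g i j : g i (j + 1) = g i j + a j * gam i j.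
Proof.
have [_ H _ _] := rel; have := H i j; rewrite /Dp => E.
by rewrite /a -mulrA -/y' -E; field.
Qed.

Lemma rel_gam i j : gam i j - gam i (j - 1) = a j * g i j - (j == i)%:R.
Proof.
have [H _ _ _] := rel; have := H i j; rewrite /Dm eq_sym => E.
have -> : (j == i)%:R = dx * ((j == i)%:R / dx) by rewrite mulrC divfK.
by rewrite -E /a -/y'; field.
Qed.

Lemma rel_kap i j : kap i (j + 1) - kap i j = a j * k i j - (j == i)%:R.
Proof.
have [_ _ H _] := rel; have := H i j; rewrite /Dp eq_sym => E.
have -> : (j == i)%:R = dx * ((j == i)%:R / dx) by rewrite mulrC divfK.
by rewrite -E /a -/y'; field.
Qed.

Lemma rel_k i j : k i j - k i (j - 1) = a j * kap i j.
Proof.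
have [_ _ _ H] := rel; have := H i j; rewrite /Dm => E.
by rewrite /a -mulrA -/y' -E; field.
Qed.

Let tg i : tend0 (g i). Proof. exact: row_tend0 gb. Qed.
Let tk i : tend0 (k i). Proof. exact: row_tend0 kb. Qed.
Let tgam i : tend0 (gam i). Proof. exact: row_tend0 gamb. Qed.
Let tkap i : tend0 (kap i). Proof. exact: row_tend0 kapb. Qed.

Let tend0B (v w : int -> R) : tend0 v -> tend0 w -> tend0 (fun j => v j - w j).
Proof.
move=> v0 w0; have := tend0D v0 (tend0Z (-1) w0).
by congr tend0; apply/funext => j; rewrite mulN1r.
Qed.

(** Green's identity: the discrete Wronskian of the rows [l] and [i] vanishes at infinity and jumps
    only at the two sources. [k_sym] and [gam_kap] follow from analogous pairings. *)
Lemma g_sym i l : g l i = g i l.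
Proof.
apply/esym; apply: (@telescope _ (fun j => g l j * gam i (j - 1) - g i j * gam l (j - 1)) _ _ i l).
  by apply: tend0B; apply: tend0M => //; exact: tend0_shift.
move=> j; rewrite !addrK !rel_g.
have E n : gam n (j - 1) = gam n j - a j * g n j + (j == n)%:R.
  by have := rel_gam n j; lra.
rewrite !E; have [->|jl] := eqVneq j l; have [ji|ji] := eqVneq _ i; rewrite ?ji /=; try ring.
Qed.

Lemma k_sym i l : k l i = k i l.
Proof.
apply: (@telescope _ (fun j => k i (j - 1) * kap l j - k l (j - 1) * kap i j) _ _ l i).
  by apply: tend0B; apply: tend0M => //; exact: tend0_shift.
move=> j; rewrite !addrK.
have E n : kap n (j + 1) = kap n j + (a j * k n j - (j == n)%:R).
  by have := rel_kap n j; lra.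
have E' n : k n (j - 1) = k n j - a j * kap n j by have := rel_k n j; lra.
rewrite !E !E'; have [->|jl] := eqVneq j l; have [ji|ji] := eqVneq _ i; rewrite ?ji /=; try ring.
Qed.

Lemma gam_kap i l : gam l i = - kap i l.
Proof.
apply: (@telescope _ (fun j => g l j * k i (j - 1) - gam l (j - 1) * kap i j) _ _ l i).
  by apply: tend0B; apply: tend0M => //; exact: tend0_shift.
move=> j; rewrite !addrK rel_g.
have E : kap i (j + 1) = kap i j + (a j * k i j - (j == i)%:R).
  by have := rel_kap i j; lra.
have E' : k i (j - 1) = k i j - a j * kap i j by have := rel_k i j; lra.
have E2 : gam l (j - 1) = gam l j - a j * g l j + (j == l)%:R.
  by have := rel_gam l j; lra.
rewrite E E' E2; have [->|jl] := eqVneq j l; have [ji|ji] := eqVneq _ i; rewrite ?ji /=; try ring.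
Qed.

Variable B : R.
Hypothesis ub : forall m, `|U_of Y m * Dp dx (U_of Y) m| <= B.
Hypothesis hb : forall m, `|Dp dx (H_of Y) m + rho * rbar_of Y m| <= B.

Let Z := (Y, (g, k, gam, kap)).
Let f m := U_of Y m * Dp dx (U_of Y) m.
Let h m := Dp dx (H_of Y) m + rho * rbar_of Y m.

(** The sums run over the first index whereas [lstar_bound] controls rows; the symmetries turn
    columns into rows. *)
Let Lg j : L1s (fun i => g i j * f i) /\ `|gsum (fun i => g i j * f i)| <= B * c.
Proof.
rewrite (_ : (fun i => _) = fun i => g j i * f i); last by apply/funext => i; rewrite g_sym.
exact: row_L1s gb ub.
Qed.
Let Lgam j : L1s (fun i => gam i j * f i) /\ `|gsum (fun i => gam i j * f i)| <= B * c.
Proof.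
rewrite (_ : (fun i => _) = fun i => kap j i * (- f i)); last first.
  by apply/funext => i; rewrite gam_kap; ring.
by apply: row_L1s kapb _ => // m; rewrite normrN; exact: ub.
Qed.
Let Lk j : L1s (fun i => k i j * h i) /\ `|gsum (fun i => k i j * h i)| <= B * c.
Proof.
rewrite (_ : (fun i => _) = fun i => k j i * h i); last by apply/funext => i; rewrite k_sym.
exact: row_L1s kb hb.
Qed.
Let Lkap j : L1s (fun i => kap i j * h i) /\ `|gsum (fun i => kap i j * h i)| <= B * c.
Proof.
rewrite (_ : (fun i => _) = fun i => gam j i * (- h i)); last first.
  by apply/funext => i; rewrite gam_kap; ring.
by apply: row_L1s gamb _ => // m; rewrite normrN; exact: hb.
Qed.

Lemma Q_grid_bound j : `|Q_grid rho dx Z j| <= B * c + B * c.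
Proof. by apply: le_trans (ler_normD _ _) _; apply: lerD; [exact: (Lg j).2|exact: (Lkap j).2]. Qed.

Lemma R_grid_bound j : `|R_grid rho dx Z j| <= B * c + B * c.
Proof. by apply: le_trans (ler_normD _ _) _; apply: lerD; [exact: (Lgam j).2|exact: (Lk j).2]. Qed.

(** The relations act on the second index, over which [Q] is not summed, so they apply under the
    sum; the Kronecker delta leaves the local term [h j]. *)
Lemma Dp_Q j : Dp dx (Q_grid rho dx Z) j = y' j * R_grid rho dx Z j - h j.
Proof.
have E1 : gsum (fun i => g i (j + 1) * f i) =
    gsum (fun i => g i j * f i) + a j * gsum (fun i => gam i j * f i).
  rewrite -gsumZ ?(Lgam j).1// -gsumD ?(Lg j).1//; last exact: L1sZ (Lgam j).1.
  by congr gsum; apply/funext => i; rewrite rel_g; ring.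
have E2 : gsum (fun i => kap i (j + 1) * h i) =
    gsum (fun i => kap i j * h i) + a j * gsum (fun i => k i j * h i) - dx * h j.
  have S m : m != j -> - (j == m)%:R * h m = 0.
    by rewrite eq_sym => /negbTE ->; rewrite oppr0 mul0r.
  rewrite -gsumZ ?(Lk j).1// -gsumD ?(Lkap j).1//; last exact: L1sZ (Lk j).1.
  have -> : - (dx * h j) = gsum (fun m => - (j == m)%:R * h m).
    by rewrite (gsum_single dx0 S) eqxx mulN1r mulrN.
  rewrite -gsumD//; last 2 first.
  - by apply: L1sD; [exact: (Lkap j).1|exact: L1sZ (Lk j).1].
  - exact: L1s_single S.
  congr gsum; apply/funext => i.
  have -> : kap i (j + 1) = kap i j + (a j * k i j - (j == i)%:R) by rewrite -rel_kap; ring.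
  by ring.
rewrite /Dp /Q_grid /= -!/(gsum _) E1 E2 /R_grid /= -!/(gsum _) /a -/y'; field.
exact: dxn.
Qed.

(** The relations provide backward differences of [gam] and [k], hence the backward difference of
    [R]. *)
Lemma Dm_R j : Dm dx (R_grid rho dx Z) j = y' j * Q_grid rho dx Z j - f j.
Proof.
have E1 : gsum (fun i => gam i j * f i) - gsum (fun i => gam i (j - 1) * f i) =
    a j * gsum (fun i => g i j * f i) - dx * f j.
  have S m : m != j -> (j == m)%:R * f m = 0.
    by rewrite eq_sym => /negbTE ->; rewrite mul0r.
  have -> : dx * f j = gsum (fun m => (j == m)%:R * f m).
    by rewrite (gsum_single dx0 S) eqxx mul1r.
  rewrite -gsumZ ?(Lg j).1//.
  apply/eqP; rewrite subr_eq addrAC eq_sym subr_eq; apply/eqP.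
  rewrite -!gsumD ?(Lgam _).1//; try exact: L1sZ (Lg j).1; try exact: L1s_single S.
  congr gsum; apply/funext => i.
  have -> : gam i j = gam i (j - 1) + (a j * g i j - (j == i)%:R) by rewrite -rel_gam; ring.
  by ring.
have E2 : gsum (fun i => k i j * h i) - gsum (fun i => k i (j - 1) * h i) =
    a j * gsum (fun i => kap i j * h i).
  rewrite -gsumZ ?(Lkap j).1//; apply/eqP; rewrite subr_eq addrC; apply/eqP.
  rewrite -gsumD ?(Lk _).1//; last exact: L1sZ (Lkap j).1.
  congr gsum; apply/funext => i.
  have -> : k i j = k i (j - 1) + a j * kap i j by rewrite -rel_k; ring.
  by ring.
rewrite /Dm /R_grid /= -!/(gsum _).
set x1 := gsum _ in E1 *; set x2 := gsum _ in E2 *; set x3 := gsum _ in E1 *; set x4 := gsum _ in E2 *.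
have -> : x1 + x2 - (x3 + x4) = (x1 - x3) + (x2 - x4) by ring.
rewrite E1 E2 /Q_grid /= -!/(gsum _) /a -/y'; field.
exact: dxn.
Qed.

End one_time.

Section bounds_add.
Context {R : realType}.
Variable dx : R.
Hypothesis dx0 : 0 < dx.
Notation mu := (@lebesgue_measure R).
Implicit Types (v w : int -> R) (a b : int -> int -> R) (c d : R) (Y : state int R)
  (W : state int R * kernels R).

Definition full_bound W c := Ed_bound dx W.1 c /\
  [/\ lstar_bound dx (g_of W.2) c, lstar_bound dx (k_of W.2) c, lstar_bound dx (gamma_of W.2) c & lstar_bound dx (kappa_of W.2) c].

Lemma l2_boundD v w c d : l2_bound dx v c -> l2_bound dx w d -> l2_bound dx (fun j => v j + w j) (c + d).
Proof.
move=> [v2 vc] [w2 wd]; split; first exact: (L2D v2 w2).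
by apply: le_trans (n2D v2 w2) _; exact: lerD.
Qed.

Lemma Ed_boundD Y1 Y2 c d : Ed_bound dx Y1 c -> Ed_bound dx Y2 d -> Ed_bound dx (Y1 + Y2) (c + d).
Proof.
have P v w c1 c2 : (forall j, `|v j| <= c1) -> (forall j, `|w j| <= c2) ->
    forall j : int, `|v j + w j| <= c1 + c2 :> R.
  by move=> h1 h2 j; apply: le_trans (ler_normD _ _) (lerD (h1 j) (h2 j)).
case=> z1 dz1 u1 du1 h1 dh1 r1 [z2 dz2 u2 du2 h2 dh2 r2]; split.
- exact: P.
- by have := l2_boundD dz1 dz2; rewrite -DpD.
- exact: l2_boundD.
- by have := l2_boundD du1 du2; rewrite -DpD.
- exact: P.
- by have := l2_boundD dh1 dh2; rewrite -DpD.
- exact: l2_boundD.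
Qed.

Lemma lstar_boundD a b c d : lstar_bound dx a c -> lstar_bound dx b d -> lstar_bound dx (fun i j => a i j + b i j) (c + d).
Proof.
move=> [a1 a2] [b1 b2]; split=> [i j|i].
  by apply: le_trans (ler_normD _ _) (lerD (a1 i j) (b1 i j)).
have [la ia] := a2 i; have [lb ib] := b2 i.
have L : L1 (st dx (fun j => a i j + b i j)) := intgD measurableT la lb.
have la' : mu.-integrable setT (EFin \o (fun x => `|st dx (a i) x|)) by exact: integrable_norm.
have lb' : mu.-integrable setT (EFin \o (fun x => `|st dx (b i) x|)) by exact: integrable_norm.
split=> //; apply: le_trans (lerD ia ib); rewrite -RintegralD//.
apply: le_Rintegral => //; [exact: integrable_norm|exact: (intgD measurableT la' lb')|].
by move=> x _; exact: ler_normD.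
Qed.

Lemma full_boundD W1 W2 c d : full_bound W1 c -> full_bound W2 d -> full_bound (W1 + W2) (c + d).
Proof.
move=> [e1 [g1 k1 a1 b1]] [e2 [g2 k2 a2 b2]]; split; first exact: Ed_boundD.
by split; [exact: (lstar_boundD g1 g2)|exact: (lstar_boundD k1 k2)|exact: (lstar_boundD a1 a2)|exact: (lstar_boundD b1 b2)].
Qed.

Lemma full_bound_le W c d : full_bound W c -> c <= d -> full_bound W d.
Proof.
move=> [e1 [k1 k2 k3 k4]] cd.
have P v : l2_bound dx v c -> l2_bound dx v d by case=> v2 vc; split=> //; exact: le_trans cd.
have Q v : (forall j : int, `|v j| <= c) -> forall j : int, `|v j| <= d.
  by move=> h j; exact: le_trans (h j) cd.
have S a : lstar_bound dx a c -> lstar_bound dx a d.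
  case=> h1 h2; split=> [i j|i]; first exact: le_trans (h1 i j) cd.
  by have [h3 h4] := h2 i; split=> //; exact: le_trans cd.
split; last by split; exact: S.
by case: e1 => *; split; solve [exact: P|exact: Q].
Qed.

End bounds_add.

(** * Grid values as differentiable functions of time *)

Section coordinates.
Context {R : realType}.
Variable dx : R.
Hypothesis dx0 : 0 < dx.
Notation full := (state int R * kernels R)%type.
Implicit Types (W : full) (phi : full -> R) (i j : int) (c d : R).

(** Bounded linear functionals on the space of the semi-discrete solution; applied to the derivative
    in norm they give ordinary derivatives of single grid values. *)
Definition coordinate phi := [/\ forall W1 W2, phi (W1 - W2) = phi W1 - phi W2,
  forall a W, phi (a *: W) = a * phi W &
  exists2 C, 0 <= C & forall W c, full_bound dx W c -> `|phi W| <= C * c].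

Let s0 : 0 <= (Num.sqrt dx)^-1. Proof. by rewrite invr_ge0 sqrtr_ge0. Qed.

Lemma coord_z j : coordinate (fun W => zeta_of W.1 j).
Proof. by split=> //; exists 1 => // W c [B _]; rewrite mul1r; exact: edb_z B j. Qed.

Lemma coord_h j : coordinate (fun W => H_of W.1 j).
Proof. by split=> //; exists 1 => // W c [B _]; rewrite mul1r; exact: edb_h B j. Qed.

Lemma coord_u j : coordinate (fun W => U_of W.1 j).
Proof.
split=> //; exists (Num.sqrt dx)^-1 => // W c [B _].
by rewrite mulrC; exact: l2_bound_pointwise (edb_u B).
Qed.

Lemma coord_r j : coordinate (fun W => rbar_of W.1 j).
Proof.
split=> //; exists (Num.sqrt dx)^-1 => // W c [B _].
by rewrite mulrC; exact: l2_bound_pointwise (edb_r B).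
Qed.

Lemma coord_g i j : coordinate (fun W => g_of W.2 i j).
Proof. by split=> //; exists 1 => // W c [_ [B _ _ _]]; rewrite mul1r; exact: lsb_oo B i j. Qed.

Lemma coord_k i j : coordinate (fun W => k_of W.2 i j).
Proof. by split=> //; exists 1 => // W c [_ [_ B _ _]]; rewrite mul1r; exact: lsb_oo B i j. Qed.

Lemma coord_gam i j : coordinate (fun W => gamma_of W.2 i j).
Proof. by split=> //; exists 1 => // W c [_ [_ _ B _]]; rewrite mul1r; exact: lsb_oo B i j. Qed.

Lemma coord_kap i j : coordinate (fun W => kappa_of W.2 i j).
Proof. by split=> //; exists 1 => // W c [_ [_ _ _ B]]; rewrite mul1r; exact: lsb_oo B i j. Qed.

Let I := `[0, +oo[%classic : set R.
Variables (Z : R -> full) (F : full -> full).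
Hypothesis Zfin : forall t, I t -> in_Ed dx (Z t).1 /\ in_Kd dx (Z t).2.
Hypothesis Zc : curve_continuous (fullnorm dx) I Z.
Hypothesis Zd : forall t, I t -> curve_derivative (fullnorm dx) I Z t (F (Z t)).

Lemma fullnorm_ge0 W : (0 <= fullnorm dx W)%E.
Proof. by rewrite adde_ge0 ?Ednorm_ge0 ?Kdnorm_ge0. Qed.

Lemma solution_bounded t : 0 <= t -> exists c, full_bound dx (Z t) c.
Proof.
move=> t0; have It : I t by rewrite /I/= in_itv/= t0.
have [h1 h2] := Zfin It.
exists (fine (fullnorm dx (Z t))); apply: fullnorm_le => //.
by rewrite fineK// ge0_fin_numE ?fullnorm_ge0// lte_add_pinfty.
Qed.

Let Ipos t : 0 <= t -> I t. Proof. by rewrite /I/= in_itv/= => ->. Qed.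

Lemma Z_near t e : 0 <= t -> 0 < e -> exists2 d, 0 < d &
  forall s, 0 <= s -> `|s - t| < d -> full_bound dx (Z s - Z t) e.
Proof.
move=> t0 e0.
have := (curve_continuousP I Z fullnorm_ge0).1 Zc t (Ipos t0) e e0.
by move=> [d d0 H]; exists d => // s ss st_; apply: (fullnorm_le dx0); apply: H => //; exact: Ipos.
Qed.

Lemma solution_bounded_on T : 0 <= T -> exists c, forall t, 0 <= t <= T -> full_bound dx (Z t) c.
Proof.
move=> T0; apply: (@cousin R (fun a b => exists c, forall t, a <= t <= b -> full_bound dx (Z t) c) 0 T) => //.
- move=> a b c _ _ _ _ [c1 H1] [c2 H2]; exists (Num.max c1 c2) => t /andP[at_ tc].
  have [tb|bt] := leP t b.
    by apply: full_bound_le (H1 t _) _; rewrite ?at_// le_max lexx.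
  by apply: full_bound_le (H2 t _) _; rewrite ?(ltW bt)// le_max lexx orbT.
move=> t /andP[t0 tT]; have [c Hc] := solution_bounded t0; have [d d0 Hd] := Z_near t0 ltr01.
exists d => // a b a0 at_ tb bT abd; exists (1 + c) => s /andP[as_ sb].
rewrite -(subrK (Z t) (Z s)); apply: full_boundD Hc; apply: Hd; first exact: le_trans as_.
by rewrite ltr_norml; apply/andP; split; lra.
Qed.

(** [Num.max 0 t] freezes the curve for negative times, so that continuity holds on the whole line
    as the calculus lemmas require. *)
Lemma coord_cont phi : coordinate phi -> continuous (fun t : R => phi (Z (Num.max 0 t))).
Proof.
move=> [pB _ [C C0 HC]] t; apply/cvgrPdist_le => e e0.
have t0 : 0 <= Num.max 0 t by rewrite le_max lexx.
have e1 : 0 < e / (C + 1) by rewrite divr_gt0//; lra.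
have [d d0 Hd] := Z_near t0 e1.
apply/nbhs_ballP; exists d => // s; rewrite /ball/= => ts.
rewrite distrC -pB; apply: le_trans (HC _ (e / (C + 1)) _) _.
  apply: Hd; first by rewrite le_max lexx.
  move: ts; rewrite !ltr_norml => /andP[? ?].
  by case: (leP 0 s) => ?; case: (leP 0 t) => ?; apply/andP; split; lra.
by rewrite mulrCA ger_pMr// ler_pdivrMr; lra.
Qed.

(** For [t > 0] the truncation at 0 is invisible near [t], so the derivative within the half-line is
    an ordinary one. *)
Lemma coord_der phi (t : R) : coordinate phi -> 0 < t ->
  is_derive t 1 (fun s : R => phi (Z (Num.max 0 s))) (phi (F (Z t))).
Proof.
move=> [pB pZ [C C0 HC]] t0.
have K : h^-1 *: (phi (Z (Num.max 0 (h *: 1 + t))) - phi (Z (Num.max 0 t))) @[h --> (0 : R)^'] -->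
    phi (F (Z t)).
  apply/cvgrPdist_le => e e0.
  have e1 : 0 < e / (C + 1) by rewrite divr_gt0//; lra.
  have [d d0 Hd] := curve_derivativeP (Zd (Ipos (ltW t0))) e1.
  apply/nbhs_ballP; exists (Num.min d t); first by rewrite /= lt_min d0 t0.
  move=> h; rewrite /ball/= sub0r normrN lt_min => /andP[hd ht] h0.
  have ht0 : 0 < h + t by move: ht; rewrite ltr_norml; lra.
  have -> : Num.max 0 (h *: 1 + t) = h + t :> R.
    by rewrite [h *: _]mulr1; apply/max_idPr/ltW.
  rewrite (max_idPr (ltW t0)) distrC [_ *: _](_ : _ = h^-1 * (phi (Z (h + t)) - phi (Z t)))//.
  rewrite -pB -pZ -pB.
  have -> : h^-1 = (h + t - t)^-1 by rewrite addrK.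
  apply: le_trans (HC _ (e / (C + 1)) _) _.
    apply: (fullnorm_le dx0); apply: Hd; rewrite ?addrK//; first exact/Ipos/ltW.
    by apply: contra_neq h0 => E; rewrite -(addrK t h) E subrr.
  by rewrite mulrCA ger_pMr// ler_pdivrMr; lra.
split; first by apply/cvg_ex; exists (phi (F (Z t))).
exact: cvg_lim K.
Qed.

End coordinates.

(** * Evolution of the residuals: algebra and derivatives *)

Section residual.
Context {R : realType}.
Variable dx : R.
Hypothesis dx0 : 0 < dx.
Notation gsum := (gsum dx).
Notation L1s := (L1s dx).
Implicit Types (i j m : int) (u p q : int -> R).

Lemma row_u a c i u B w C : lstar_bound dx a c -> (forall m, `|u m| <= B) -> (forall m, `|w m| <= C) ->
  L1s (fun m => u m * (a i m * w m)) /\ `|gsum (fun m => u m * (a i m * w m))| <= B * C * c.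
Proof.
move=> ab uB wC.
rewrite (_ : (fun m => u m * (a i m * w m)) = fun m => a i m * (u m * w m)).
  by apply: row_L1s ab _ => // m; rewrite normrM ler_pM.
by apply/funext => m; ring.
Qed.

(** Applying the operator of a relation to a sum of kernel products gives the same sum with
    residuals, plus a term at [m = j] from the Kronecker delta. That term cancels the contribution
    of the moving slope [D_+ y], see [rate_cancel]. In the applications [c1] and [c2] are 0 or 1 and
    tell which relation carries the delta. *)
Lemma residual_sum a b c u B C i j y c1 c2 (P1 P2 Q1 Q2 G1 G2 X1 X2 : int -> R) :
  lstar_bound dx a c -> lstar_bound dx b c -> (forall m, `|u m| <= B) ->
  (forall m, `|G1 m| <= C) -> (forall m, `|G2 m| <= C) ->
  (forall m, `|P1 m| <= C) -> (forall m, `|P2 m| <= C) ->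
  (forall m, `|Q1 m| <= C) -> (forall m, `|Q2 m| <= C) ->
  (forall m, X1 m = y * G1 m - (P1 m - Q1 m) / dx - c1 * ((m == j)%:R / dx)) ->
  (forall m, X2 m = y * G2 m - (P2 m - Q2 m) / dx - c2 * ((m == j)%:R / dx)) ->
  y * gsum (fun m => u m * (a i m * G1 m + b i m * G2 m))
  - (gsum (fun m => u m * (a i m * P1 m + b i m * P2 m))
     - gsum (fun m => u m * (a i m * Q1 m + b i m * Q2 m))) / dx =
  gsum (fun m => u m * (a i m * X1 m + b i m * X2 m)) + u j * (c1 * a i j + c2 * b i j).
Proof.
move=> ab bb uB hG1 hG2 hP1 hP2 hQ1 hQ2 eX1 eX2.
have L V1 V2 : (forall m, `|V1 m| <= C) -> (forall m, `|V2 m| <= C) ->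
    L1s (fun m => u m * (a i m * V1 m + b i m * V2 m)).
  move=> h1 h2; rewrite (_ : (fun m => _) =
      fun m => u m * (a i m * V1 m) + u m * (b i m * V2 m)).
    by apply: L1sD; [exact: (row_u i ab uB h1).1|exact: (row_u i bb uB h2).1].
  by apply/funext => m; ring.
have LG := L _ _ hG1 hG2; have LP := L _ _ hP1 hP2; have LQ := L _ _ hQ1 hQ2.
pose S m := (m == j)%:R * (u m * (c1 * a i m + c2 * b i m) / dx).
have S0 m : m != j -> - S m = 0 by rewrite /S => /negbTE ->; rewrite mul0r oppr0.
have -> : u j * (c1 * a i j + c2 * b i j) = - gsum (fun m => - S m).
  by rewrite (gsum_single dx0 S0) /S eqxx mul1r; field; exact: lt0r_neq0.
have LX : L1s (fun m => y * (u m * (a i m * G1 m + b i m * G2 m)) +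
   ((- dx^-1) * (u m * (a i m * P1 m + b i m * P2 m)) +
    dx^-1 * (u m * (a i m * Q1 m + b i m * Q2 m)))).
  by apply: L1sD; [exact: L1sZ|apply: L1sD; exact: L1sZ].
have -> : (fun m => u m * (a i m * X1 m + b i m * X2 m)) = fun m =>
   (y * (u m * (a i m * G1 m + b i m * G2 m)) +
   ((- dx^-1) * (u m * (a i m * P1 m + b i m * P2 m)) +
    dx^-1 * (u m * (a i m * Q1 m + b i m * Q2 m)))) + (- S m).
  by apply/funext => m; rewrite eX1 eX2 /S; ring.
rewrite gsumD//; last exact: L1s_single S0.
rewrite addrK (gsumD dx0 (L1sZ y LG) (L1sD (L1sZ _ LP) (L1sZ _ LQ))).
rewrite (gsumD dx0 (L1sZ _ LP) (L1sZ _ LQ)) (gsumZ dx0 _ LG) (gsumZ dx0 _ LP) (gsumZ dx0 _ LQ).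
by ring.
Qed.

End residual.

Section derivations.
Context {R : realType}.
Implicit Types (z v p q : R -> R) (t k dx : R).

Lemma res_der (z0 z1 : R -> R) v p q dz0 dz1 dv dp dq dx k t :
  is_derive t 1 z0 dz0 -> is_derive t 1 z1 dz1 -> is_derive t 1 v dv ->
  is_derive t 1 p dp -> is_derive t 1 q dq ->
  is_derive t 1 (fun s => (1 + (z1 s - z0 s) / dx) * v s - (p s - q s) / dx - k)
    ((dz1 - dz0) / dx * v t + (1 + (z1 t - z0 t) / dx) * dv - (dp - dq) / dx).
Proof.
move=> h1 h2 h3 h4 h5; apply: is_derive_eq.
by rewrite /GRing.scale/=; ring.
Qed.

Lemma continuous_res (z0 z1 : R -> R) v p q dx k : continuous z0 -> continuous z1 -> continuous v ->
  continuous p -> continuous q ->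
  continuous (fun s => (1 + (z1 s - z0 s) / dx) * v s - (p s - q s) / dx - k).
Proof.
move=> h1 h2 h3 h4 h5 t; apply: cvgB; last exact: cvg_cst.
apply: cvgB; last by apply: cvgM; [apply: cvgB; [exact: h4|exact: h5]|exact: cvg_cst].
apply: cvgM; last exact: h3.
by apply: cvgD; [exact: cvg_cst|apply: cvgM; [apply: cvgB; [exact: h2|exact: h1]|exact: cvg_cst]].
Qed.

Lemma continuous_slope (z0 z1 : R -> R) k dx : continuous z0 -> continuous z1 ->
  continuous (fun s => k + (z1 s - z0 s) / dx).
Proof.
move=> h1 h2 t; apply: cvgD; first exact: cvg_cst.
by apply: cvgM; [apply: cvgB; [exact: h2|exact: h1]|exact: cvg_cst].
Qed.

Lemma slope_der (z0 z1 : R -> R) dz0 dz1 k dx t : is_derive t 1 z0 dz0 -> is_derive t 1 z1 dz1 ->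
  is_derive t 1 (fun s => k + (z1 s - z0 s) / dx) ((dz1 - dz0) / dx).
Proof. by move=> h1 h2; apply: is_derive_eq; rewrite /GRing.scale/=; ring. Qed.

Lemma energy_der (a b u r U : R -> R) da db du dr dU t :
  is_derive t 1 a da -> is_derive t 1 b db -> is_derive t 1 u du ->
  is_derive t 1 r dr -> is_derive t 1 U dU ->
  is_derive t 1 (fun s => 2 * a s * b s - (U s * U s * (a s * a s) + u s * u s + r s * r s))
    (2 * (da * b t + a t * db) - (2 * U t * dU * (a t * a t) + 2 * (U t * U t) * (a t * da)
      + 2 * u t * du + 2 * r t * dr)).
Proof. by move=> ? ? ? ? ?; apply: is_derive_eq; rewrite /GRing.scale/=; ring. Qed.

Lemma square_der (a b u r : R -> R) da db du dr t :
  is_derive t 1 a da -> is_derive t 1 b db -> is_derive t 1 u du -> is_derive t 1 r dr ->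
  is_derive t 1 (fun s => a s * a s + b s * b s + u s * u s + r s * r s)
    (2 * a t * da + 2 * b t * db + 2 * u t * du + 2 * r t * dr).
Proof. by move=> ? ? ? ?; apply: is_derive_eq; rewrite /GRing.scale/=; ring. Qed.

(** The two terms with [rho] cancel; every other product is bounded by [2 |x y| <= x^2 + y^2], with
    coefficient 1, [K] or [K * K], each occurring twice. *)
Lemma square_rate (a b u r U Q S rho K : R) : 0 <= K -> `|U| <= K -> `|Q| <= K -> `|S| <= K ->
  - ((2 + 2 * K + 2 * (K * K)) * (a * a + b * b + u * u + r * r)) <=
  2 * a * u + 2 * b * - (u * S + U * (a * Q - U * u)) + 2 * u * - (a * S - (b + rho * r))
  + 2 * r * - (rho * u).
Proof.
move=> K0 hU hQ hS.
set n := a * a + b * b + u * u + r * r.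
have n0 : 0 <= n by rewrite /n -!expr2 !addr_ge0 ?sqr_ge0.
have P x y w C : 0 <= C -> `|w| <= C -> x * x + y * y <= n -> - (C * n) <= w * (2 * x * y).
  move=> C0 wC xy.
  have h1 : `|2 * x * y| <= n.
    apply: le_trans xy; rewrite ler_norml; apply/andP; split.
      by rewrite -subr_ge0 (_ : _ - _ = (x + y) ^+ 2) ?sqr_ge0//; ring.
    by rewrite -subr_ge0 (_ : _ - _ = (x - y) ^+ 2) ?sqr_ge0//; ring.
  have : `|w * (2 * x * y)| <= C * n by rewrite normrM ler_pM.
  by rewrite ler_norml => /andP[].
have a0 : 0 <= a * a by rewrite -expr2 sqr_ge0.
have b0 : 0 <= b * b by rewrite -expr2 sqr_ge0.
have u0 : 0 <= u * u by rewrite -expr2 sqr_ge0.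
have r0 : 0 <= r * r by rewrite -expr2 sqr_ge0.
have h1 := P a u 1 1 ltac:(lra) ltac:(by rewrite normr1) ltac:(by rewrite /n; lra).
have h2 := P b u (- S) K K0 ltac:(by rewrite normrN) ltac:(by rewrite /n; lra).
have h3 := P a b (- (U * Q)) (K * K) ltac:(exact: mulr_ge0) ltac:(by rewrite normrN normrM ler_pM)
  ltac:(by rewrite /n; lra).
have h4 := P b u (U * U) (K * K) ltac:(exact: mulr_ge0) ltac:(by rewrite normrM ler_pM)
  ltac:(by rewrite /n; lra).
have h5 := P a u (- S) K K0 ltac:(by rewrite normrN) ltac:(by rewrite /n; lra).
have h6 := P b u 1 1 ltac:(lra) ltac:(by rewrite normr1) ltac:(by rewrite /n; lra).
rewrite [X in _ <= X](_ : _ = 1 * (2 * a * u) + (- S) * (2 * b * u) + (- (U * Q)) * (2 * a * b)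
  + (U * U) * (2 * b * u) + (- S) * (2 * a * u) + 1 * (2 * b * u)); last by ring.
by move: h1 h2 h3 h4 h5 h6; rewrite (_ : (2 + 2 * K + 2 * (K * K)) * n =
  2 * (1 * n) + 2 * (K * n) + 2 * (K * K * n)); [lra|ring].
Qed.

Lemma rate_cancel (y SG SP SQ G u x dx : R) :
  y * SG - (SP - SQ) / dx = G + u * x ->
  u * x + y * (- SG) - (- SP - - SQ) / dx = - G.
Proof. by move=> S; rewrite -[G](addrK (u * x)) -S; ring. Qed.

End derivations.

(** * Persistence of the relations (a) and of the sign of the slopes *)

Section invariants.
Context {R : realType}.
Variables (dx rho T : R).
Hypothesis dx0 : 0 < dx.
Hypothesis T0 : 0 <= T.
Notation gsum := (gsum dx).
Notation L1s := (L1s dx).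
Notation full := (state int R * kernels R)%type.
Implicit Types (i j m : int) (W : full) (t s c : R).

Lemma fullE W : W = (W.1, (g_of W.2, k_of W.2, gamma_of W.2, kappa_of W.2)).
Proof. by case: W => ? [[[? ?] ?] ?]. Qed.

Lemma grid_fieldE W : grid_field rho dx W =
  ((U_of W.1, fun j => - Q_grid rho dx W j, fun j => - (U_of W.1 j * R_grid rho dx W (j - 1)),
    fun j => - (rho * Dp dx (U_of W.1) j)),
   (kernel_rate dx (U_of W.1) (g_of W.2) (g_of W.2) (gamma_of W.2) (kappa_of W.2),
    kernel_rate dx (U_of W.1) (k_of W.2) (k_of W.2) (kappa_of W.2) (gamma_of W.2),
    kernel_rate dx (U_of W.1) (gamma_of W.2) (k_of W.2) (g_of W.2) (gamma_of W.2),
    kernel_rate dx (U_of W.1) (kappa_of W.2) (g_of W.2) (k_of W.2) (kappa_of W.2))).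
Proof. by case: W => ? [[[? ?] ?] ?]. Qed.

Let y' W j := 1 + (zeta_of W.1 (j + 1) - zeta_of W.1 j) / dx.

(* The residuals of the relations (a) solve a homogeneous linear system along the
   evolution, hence stay zero. *)
Definition resA W i j := y' W j * g_of W.2 i j
  - (gamma_of W.2 i j - gamma_of W.2 i (j - 1)) / dx - (i == j)%:R / dx.
(** The term [- 0] gives the four residuals a common shape for [res_der]. *)
Definition resB W i j := y' W j * gamma_of W.2 i j
  - (g_of W.2 i (j + 1) - g_of W.2 i j) / dx - 0.
Definition resC W i j := y' W j * k_of W.2 i j
  - (kappa_of W.2 i (j + 1) - kappa_of W.2 i j) / dx - (i == j)%:R / dx.
Definition resE W i j := y' W j * kappa_of W.2 i j
  - (k_of W.2 i j - k_of W.2 i (j - 1)) / dx - 0.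

Lemma four_relationsP W : four_relations dx W.1 (g_of W.2) (k_of W.2) (gamma_of W.2) (kappa_of W.2) <->
  (forall i j, [/\ resA W i j = 0, resB W i j = 0, resC W i j = 0 & resE W i j = 0]).
Proof.
have Y j : Dp dx (yd_of dx W.1) j = y' W j by rewrite Dp_yd.
split=> [[hA hB hC hE] i j|H].
  have := hA i j; have := hB i j; have := hC i j; have := hE i j.
  rewrite Y /Dp /Dm => hE' hC' hB' hA'.
  by rewrite /resA /resB /resC /resE hA' hC' hB' hE' !subrr.
split=> i j; have [hA hB hC hE] := H i j; rewrite Y /Dp /Dm; apply/eqP; rewrite -subr_eq0; apply/eqP.
- exact: hA.
- by move: hB; rewrite /resB subr0 => /eqP; rewrite subr_eq0 => /eqP ->; rewrite subrr.
- exact: hC.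
- by move: hE; rewrite /resE subr0 => /eqP; rewrite subr_eq0 => /eqP ->; rewrite subrr.
Qed.

Variables (Y0 : state int R) (K0 : kernels R) (Z : R -> full).
Hypothesis HB : in_B dx (Y0, K0).
Hypothesis HZ : grid_solution rho dx (Y0, K0) Z.
Let Zt (t : R) := Z (Num.max 0 t).

Let cc phi : coordinate dx phi -> continuous (fun t => phi (Zt t)).
Proof. by case: HZ => _ Zc _ _; exact: coord_cont. Qed.

Let cd phi (t : R) : coordinate dx phi -> 0 < t ->
  is_derive t 1 (fun s => phi (Zt s)) (phi (grid_field rho dx (Z t))).
Proof. by case: HZ => _ _ _ Zd; exact: coord_der. Qed.

Let ZtE (t : R) : 0 <= t -> Zt t = Z t.
Proof. by move=> t0; rewrite /Zt; congr Z; apply/max_idPr. Qed.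

Let Z0 : Z 0 = (Y0, K0). Proof. by case: HZ. Qed.

Let cz j := coord_z dx j.
Let cu j := coord_u dx0 j.

Section rates.
Variables (t c : R).
Hypothesis t0 : 0 < t.
Hypothesis B : full_bound dx (Z t) c.
Let W := Z t.
Let u := Dp dx (U_of W.1).
Let g := g_of W.2.
Let k := k_of W.2.
Let gam := gamma_of W.2.
Let kap := kappa_of W.2.

Let WE : Zt t = W. Proof. exact: ZtE (ltW t0). Qed.

Let c1 := c / Num.sqrt dx.
Let ub m : `|u m| <= c1. Proof. by case: B => E _; exact: (l2_bound_pointwise dx0 m (edb_du E)). Qed.
Let gb : lstar_bound dx g c. Proof. by case: B => _ []. Qed.
Let kb : lstar_bound dx k c. Proof. by case: B => _ []. Qed.
Let gamb : lstar_bound dx gam c. Proof. by case: B => _ []. Qed.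
Let kapb : lstar_bound dx kap c. Proof. by case: B => _ []. Qed.

(** The residuals form a closed system: A is coupled with E, and B with C, always in the same column
    [j]. *)
Lemma der_A i j : is_derive t 1 (fun s => resA (Zt s) i j)
  (- gsum (fun m => u m * (g i m * resA W m j + gam i m * resE W m j))).
Proof.
have D := res_der dx ((i == j)%:R / dx) (cd (cz j) t0) (cd (cz (j + 1)) t0)
  (cd (coord_g dx i j) t0) (cd (coord_gam dx i j) t0) (cd (coord_gam dx i (j - 1)) t0).
rewrite grid_fieldE WE /= in D; apply: is_derive_eq; rewrite -/W.
have E j' : kernel_rate dx (U_of W.1) gam k g gam i j' =
    - gsum (fun m => u m * (g i m * gam m j' + gam i m * k m j')).
  by congr (- gsum _); apply/funext => m; rewrite addrC.
rewrite /g_of /gamma_of /= -/(gamma_of W.2) -/(g_of W.2) -/(k_of W.2) -/gam -/k -/g !E.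
have S := @residual_sum _ dx dx0 g gam c u c1 c i j (y' W j) 1 0
  (fun m => gam m j) (fun m => k m j) (fun m => gam m (j - 1)) (fun m => k m (j - 1))
  (fun m => g m j) (fun m => kap m j) (fun m => resA W m j) (fun m => resE W m j)
  gb gamb ub (fun m => lsb_oo gb m j) (fun m => lsb_oo kapb m j) (fun m => lsb_oo gamb m j)
  (fun m => lsb_oo kb m j) (fun m => lsb_oo gamb m (j - 1)) (fun m => lsb_oo kb m (j - 1)).
move: S; rewrite -/g.
move=> /(_ ltac:(by move=> m; rewrite mul1r)) /(_ ltac:(by move=> m; rewrite mul0r)).
by rewrite mul1r mul0r addr0; exact: rate_cancel.
Qed.

Lemma der_B i j : is_derive t 1 (fun s => resB (Zt s) i j)
  (- gsum (fun m => u m * (g i m * resB W m j + gam i m * resC W m j))).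
Proof.
have D := res_der dx 0 (cd (cz j) t0) (cd (cz (j + 1)) t0)
  (cd (coord_gam dx i j) t0) (cd (coord_g dx i (j + 1)) t0) (cd (coord_g dx i j) t0).
rewrite grid_fieldE WE /= in D; apply: is_derive_eq; rewrite -/W.
have E j' : kernel_rate dx (U_of W.1) gam k g gam i j' =
    - gsum (fun m => u m * (g i m * gam m j' + gam i m * k m j')).
  by congr (- gsum _); apply/funext => m; rewrite addrC.
rewrite /g_of /gamma_of /= -/(gamma_of W.2) -/(g_of W.2) -/(k_of W.2) -/gam -/k -/g !E.
have S := @residual_sum _ dx dx0 g gam c u c1 c i j (y' W j) 0 1
  (fun m => g m (j + 1)) (fun m => kap m (j + 1)) (fun m => g m j) (fun m => kap m j)
  (fun m => gam m j) (fun m => k m j) (fun m => resB W m j) (fun m => resC W m j)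
  gb gamb ub (fun m => lsb_oo gamb m j) (fun m => lsb_oo kb m j) (fun m => lsb_oo gb m (j + 1))
  (fun m => lsb_oo kapb m (j + 1)) (fun m => lsb_oo gb m j) (fun m => lsb_oo kapb m j).
move: S; rewrite -/g.
move=> /(_ ltac:(by move=> m; rewrite mul0r)) /(_ ltac:(by move=> m; rewrite mul1r)).
by rewrite mul1r mul0r add0r; exact: rate_cancel.
Qed.

Lemma der_C i j : is_derive t 1 (fun s => resC (Zt s) i j)
  (- gsum (fun m => u m * (k i m * resC W m j + kap i m * resB W m j))).
Proof.
have D := res_der dx ((i == j)%:R / dx) (cd (cz j) t0) (cd (cz (j + 1)) t0)
  (cd (coord_k dx i j) t0) (cd (coord_kap dx i (j + 1)) t0) (cd (coord_kap dx i j) t0).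
rewrite grid_fieldE WE /= in D; apply: is_derive_eq; rewrite -/W.
have E j' : kernel_rate dx (U_of W.1) kap g k kap i j' =
    - gsum (fun m => u m * (k i m * kap m j' + kap i m * g m j')).
  by congr (- gsum _); apply/funext => m; rewrite addrC.
rewrite /k_of /kappa_of /= -/(kappa_of W.2) -/(g_of W.2) -/(k_of W.2) -/kap -/k -/g !E.
have S := @residual_sum _ dx dx0 k kap c u c1 c i j (y' W j) 1 0
  (fun m => kap m (j + 1)) (fun m => g m (j + 1)) (fun m => kap m j) (fun m => g m j)
  (fun m => k m j) (fun m => gam m j) (fun m => resC W m j) (fun m => resB W m j)
  kb kapb ub (fun m => lsb_oo kb m j) (fun m => lsb_oo gamb m j) (fun m => lsb_oo kapb m (j + 1))
  (fun m => lsb_oo gb m (j + 1)) (fun m => lsb_oo kapb m j) (fun m => lsb_oo gb m j).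
move: S; rewrite -/g.
move=> /(_ ltac:(by move=> m; rewrite mul1r)) /(_ ltac:(by move=> m; rewrite mul0r)).
by rewrite mul1r mul0r addr0; exact: rate_cancel.
Qed.

Lemma der_E i j : is_derive t 1 (fun s => resE (Zt s) i j)
  (- gsum (fun m => u m * (k i m * resE W m j + kap i m * resA W m j))).
Proof.
have D := res_der dx 0 (cd (cz j) t0) (cd (cz (j + 1)) t0)
  (cd (coord_kap dx i j) t0) (cd (coord_k dx i j) t0) (cd (coord_k dx i (j - 1)) t0).
rewrite grid_fieldE WE /= in D; apply: is_derive_eq; rewrite -/W.
have E j' : kernel_rate dx (U_of W.1) kap g k kap i j' =
    - gsum (fun m => u m * (k i m * kap m j' + kap i m * g m j')).
  by congr (- gsum _); apply/funext => m; rewrite addrC.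
rewrite /k_of /kappa_of /= -/(kappa_of W.2) -/(g_of W.2) -/(k_of W.2) -/kap -/k -/g !E.
have S := @residual_sum _ dx dx0 k kap c u c1 c i j (y' W j) 0 1
  (fun m => k m j) (fun m => gam m j) (fun m => k m (j - 1)) (fun m => gam m (j - 1))
  (fun m => kap m j) (fun m => g m j) (fun m => resE W m j) (fun m => resA W m j)
  kb kapb ub (fun m => lsb_oo kapb m j) (fun m => lsb_oo gb m j) (fun m => lsb_oo kb m j)
  (fun m => lsb_oo gamb m j) (fun m => lsb_oo kb m (j - 1)) (fun m => lsb_oo gamb m (j - 1)).
move: S; rewrite -/g.
move=> /(_ ltac:(by move=> m; rewrite mul0r)) /(_ ltac:(by move=> m; rewrite mul1r)).
by rewrite mul1r mul0r add0r; exact: rate_cancel.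
Qed.

End rates.

(** A single index type for the four residuals, as [family_zero] treats one family; in [res']
    negating both booleans gives the coupled relation. *)
Definition res (a : bool * bool * int * int) W :=
  let: (b1, b2, i, j) := a in
  if b1 then if b2 then resA W i j else resB W i j
  else if b2 then resC W i j else resE W i j.

Definition res' (a : bool * bool * int * int) W :=
  let: (b1, b2, i, j) := a in
  let u := Dp dx (U_of W.1) in
  let r b1 b2 := gsum (fun m => u m *
      ((if b1 then g_of W.2 else k_of W.2) i m * res (b1, b2, m, j) W +
       (if b1 then gamma_of W.2 else kappa_of W.2) i m * res (~~ b1, ~~ b2, m, j) W)) in
  - r b1 b2.

Lemma residuals_vanish t : 0 <= t <= T ->
  four_relations dx (Z t).1 (g_of (Z t).2) (k_of (Z t).2) (gamma_of (Z t).2) (kappa_of (Z t).2).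
Proof.
move=> tT; apply/four_relationsP.
have [c Hc] : exists c, forall t, 0 <= t <= T -> full_bound dx (Z t) c.
  by case: HZ => h1 h2 _ _; exact: solution_bounded_on.
have c0 : 0 <= c by case: (Hc 0 _) => [|E _]; rewrite ?lexx//; exact: Ed_bound_ge0 E.
pose cs := c / Num.sqrt dx.
have cs0 : 0 <= cs by rewrite divr_ge0// sqrtr_ge0.
have dxi : 0 <= dx^-1 by rewrite invr_ge0 ltW.
pose M := (1 + (c + c) / dx) * c + (c + c) / dx + dx^-1.
have bnd z1 z0 v p q k : `|z1| <= c -> `|z0| <= c -> `|v| <= c -> `|p| <= c -> `|q| <= c ->
    `|k| <= dx^-1 -> `|(1 + (z1 - z0) / dx) * v - (p - q) / dx - k| <= M.
  move=> h1 h2 h3 h4 h5 h6.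
  have D x y : `|x| <= c -> `|y| <= c -> `|(x - y) / dx| <= (c + c) / dx.
    move=> hx hy; rewrite normrM (ger0_norm dxi) ler_wpM2r//.
    exact: le_trans (ler_normB _ _) (lerD hx hy).
  apply: le_trans (ler_normB _ _) (lerD _ h6).
  apply: le_trans (ler_normB _ _) (lerD _ (D _ _ h4 h5)).
  rewrite normrM ler_pM//; apply: le_trans (ler_normD _ _) _.
  by rewrite normr1 lerD2l; exact: D.
have dl i j : `|(i == j)%:R / dx| <= dx^-1.
  rewrite normrM (ger0_norm dxi) ger0_norm// ler_piMl//.
  by case: (i == j); rewrite ?ler01.
have z0 : `|0 : R| <= dx^-1 by rewrite normr0.
have H : forall a t, 0 <= t <= T -> res a (Zt t) = 0.
  apply: (@family_zero R _ (fun a t => res a (Zt t)) (fun a t => res' a (Z t))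
     (2 * (cs * c)) M T).
  - by rewrite !mulr_ge0.
  - by apply: le_trans (bnd 0 0 0 0 0 0 _ _ _ _ _ _); rewrite ?normr0.
  - move=> [[[[] []] i] j] /=.
    + exact: (continuous_res (cc (cz j)) (cc (cz (j + 1))) (cc (coord_g dx i j))
        (cc (coord_gam dx i j)) (cc (coord_gam dx i (j - 1)))).
    + exact: (continuous_res (cc (cz j)) (cc (cz (j + 1))) (cc (coord_gam dx i j))
        (cc (coord_g dx i (j + 1))) (cc (coord_g dx i j))).
    + exact: (continuous_res (cc (cz j)) (cc (cz (j + 1))) (cc (coord_k dx i j))
        (cc (coord_kap dx i (j + 1))) (cc (coord_kap dx i j))).
    + exact: (continuous_res (cc (cz j)) (cc (cz (j + 1))) (cc (coord_kap dx i j))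
        (cc (coord_k dx i j)) (cc (coord_k dx i (j - 1)))).
  - move=> a; rewrite ZtE// Z0; case: HB => _ rel _ _ _.
    have := (four_relationsP (Y0, K0)).1; case: K0 rel => [[[g k] gam] kap] /= rel.
    have R4 : four_relations dx Y0 g k gam kap by split=> i j; have [[? ? ? ?] _] := rel i j.
    by move=> /(_ R4); case: a => [[[[] []] i] j] /(_ i j)[].
  - move=> [[[[] []] i] j] s /andP[s0 sT]; have Bs := Hc s _.
    + by apply: der_A => //; apply: Bs; rewrite !ltW.
    + by apply: der_B => //; apply: Bs; rewrite !ltW.
    + by apply: der_C => //; apply: Bs; rewrite !ltW.
    + by apply: der_E => //; apply: Bs; rewrite !ltW.
  - move=> [[[b1 b2] i] j] s sT; have s0 : 0 <= s by case/andP: sT.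
    rewrite ZtE//; have [[z _ _ _ _ _ _] [G K GA KA]] := Hc s sT.
    by case: b1; case: b2; apply: bnd; solve [exact: z|exact: (lsb_oo G)|
      exact: (lsb_oo K)|exact: (lsb_oo GA)|exact: (lsb_oo KA)|exact: dl|exact: z0].
  - move=> s B /andP[s0 sT] HB' [[[b1 b2] i] j].
    have [E [G K GA KA]] := Hc s ltac:(by rewrite !ltW).
    have ub m : `|Dp dx (U_of (Z s).1) m| <= cs by exact: (l2_bound_pointwise dx0 m (edb_du E)).
    have hB a : `|res a (Z s)| <= B by rewrite -(ZtE (ltW s0)).
    rewrite /res' normrN.
    have P (p q : int -> int -> R) (v w : int -> R) : lstar_bound dx p c -> lstar_bound dx q c ->
        (forall m, `|v m| <= B) -> (forall m, `|w m| <= B) ->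
        `|gsum (fun m => Dp dx (U_of (Z s).1) m * (p i m * v m + q i m * w m))| <= 2 * (cs * c) * B.
      move=> pc qc vB wB.
      have [l1 b1'] := row_u dx0 i pc ub vB; have [l2 b2'] := row_u dx0 i qc ub wB.
      rewrite (_ : (fun m => _) = fun m => Dp dx (U_of (Z s).1) m * (p i m * v m) +
        Dp dx (U_of (Z s).1) m * (q i m * w m)); last by apply/funext => m; rewrite mulrDr.
      rewrite gsumD//; apply: le_trans (ler_normD _ _) _.
      by apply: le_trans (lerD b1' b2') _; rewrite le_eqVlt; apply/orP; left; apply/eqP; ring.
    by case: b1; apply: P => // m; exact: hB.
move=> i j; rewrite -ZtE; last by case/andP: tT.
split; [exact: (H (true, true, i, j) t tT)|exact: (H (true, false, i, j) t tT)|
  exact: (H (false, true, i, j) t tT)|exact: (H (false, false, i, j) t tT)].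
Qed.

(* The defect of (c) is constant, hence 0, and with a = D_+ y, b = D_+ H, u = D_+ U,
   r = rbar the sum of squares a^2 + b^2 + u^2 + r^2 stays positive.  Now (c) gives
   a b >= 0, while a + b = 0 would make all four vanish: so a + b keeps its sign. *)
Lemma slopes_ge0 t j : 0 <= t <= T -> 0 <= Dp dx (yd_of dx (Z t).1) j.
Proof.
move=> tT; rewrite Dp_yd//.
have [c Hc] : exists c, forall t, 0 <= t <= T -> full_bound dx (Z t) c.
  by case: HZ => h1 h2 _ _; exact: solution_bounded_on.
have c0 : 0 <= c by case: (Hc 0 _) => [|E _]; rewrite ?lexx//; exact: Ed_bound_ge0 E.
pose cs := c / Num.sqrt dx.
have cs0 : 0 <= cs by rewrite divr_ge0// sqrtr_ge0.
pose B := source_bound dx rho c.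
have B0 : 0 <= B by case: (Hc 0 _) => [|E _]; rewrite ?lexx//; exact: source_bound_ge0 E.
pose K := B * c + B * c + cs.
have Kp : 0 <= K by rewrite /K !addr_ge0 ?mulr_ge0.
pose fa W := 1 + (zeta_of W.1 (j + 1) - zeta_of W.1 j) / dx.
pose fh W := 0 + (H_of W.1 (j + 1) - H_of W.1 j) / dx.
pose fu W := 0 + (U_of W.1 (j + 1) - U_of W.1 j) / dx.
pose fr W := rbar_of W.1 j.
pose fU W := U_of W.1 j.
(* [Dp_Q] and [Dm_R] turn differences of the fields into local terms, so the four slopes at the
   index [j] obey a closed linear system whose coefficients are bounded. *)
have facts s : 0 < s < T -> exists Q S, [/\ `|fU (Z s)| <= K, `|Q| <= K, `|S| <= K &
    [/\ is_derive s 1 (fun t => fa (Zt t)) (fu (Z s)),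
        is_derive s 1 (fun t => fh (Zt t))
          (- (fu (Z s) * S + fU (Z s) * (fa (Z s) * Q - fU (Z s) * fu (Z s)))),
        is_derive s 1 (fun t => fu (Zt t)) (- (fa (Z s) * S - (fh (Z s) + rho * fr (Z s)))),
        is_derive s 1 (fun t => fr (Zt t)) (- (rho * fu (Z s))) &
        is_derive s 1 (fun t => fU (Zt t)) (- Q)]].
  move=> /andP[s0 sT]; have sT' : 0 <= s <= T by rewrite !ltW.
  have [E [G k GA KA]] := Hc s sT'; have rel := residuals_vanish sT'.
  set W := Z s in E G k GA KA rel *.
  have hU m : `|U_of W.1 m| <= cs by exact: (l2_bound_pointwise dx0 m (edb_u E)).
  have [bU bh] := sources_bounded rho dx0 E.
  have WE := fullE W.
  have bQ := Q_grid_bound dx0 G k GA KA rel bU bh j; rewrite -WE in bQ.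
  have bR := R_grid_bound dx0 G k GA KA rel bU bh j; rewrite -WE in bR.
  have dQ := Dp_Q dx0 G k GA KA rel bU bh j; rewrite -WE /= in dQ.
  have dR := Dm_R dx0 G k GA KA rel bU bh j; rewrite -WE /= in dR.
  have csK : B * c + B * c <= K by rewrite /K lerDl.
  exists (Q_grid rho dx W j), (R_grid rho dx W j); split.
  - by apply: le_trans (hU j) _; rewrite /K lerDr addr_ge0 ?mulr_ge0.
  - exact: le_trans bQ csK.
  - exact: le_trans bR csK.
  have Dz := slope_der 1 dx (cd (cz j) s0) (cd (cz (j + 1)) s0).
  have Dh := slope_der 0 dx (cd (coord_h dx j) s0) (cd (coord_h dx (j + 1)) s0).
  have Du := slope_der 0 dx (cd (cu j) s0) (cd (cu (j + 1)) s0).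
  have DU := cd (cu j) s0; have Dr := cd (coord_r dx0 j) s0.
  rewrite grid_fieldE -/W /= in Dz Dh Du DU Dr.
  move: dQ dR; rewrite Dp_yd// /Dp /Dm => dQ dR.
  split.
  - by apply: is_derive_eq Dz _; rewrite /fu add0r.
  - apply: is_derive_eq Dh _; rewrite /H_of /= addrK -/(H_of W.1) /fu /fU /fa !add0r -dR.
    by ring.
  - apply: is_derive_eq Du _; rewrite /U_of /= -/(U_of W.1) /fa /fh /fr !add0r -dQ.
    by ring.
  - by apply: is_derive_eq Dr _; rewrite /fu add0r.
  - exact: DU.
have ca : continuous (fun t => fa (Zt t)) by exact: continuous_slope (cc (cz j)) (cc (cz (j + 1))).
have ch : continuous (fun t => fh (Zt t)).
  exact: continuous_slope (cc (coord_h dx j)) (cc (coord_h dx (j + 1))).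
have cu' : continuous (fun t => fu (Zt t)) by exact: continuous_slope (cc (cu j)) (cc (cu (j + 1))).
have cr : continuous (fun t => fr (Zt t)) by exact: (cc (coord_r dx0 j)).
have cU : continuous (fun t => fU (Zt t)) by exact: (cc (cu j)).
have [_ _ _ e0 p0] := HB.
have E0 := e0 j; have [a0 h0 ah0] := p0 j.
rewrite Dp_yd// /Dp -/(fa (Y0, K0)) in E0 a0 ah0.
rewrite /Dp -(add0r (_ / dx)) -/(fh (Y0, K0)) in h0 ah0.
have Eh : (H_of Y0 (j + 1) - H_of Y0 j) / dx = fh (Y0, K0) by rewrite /fh add0r.
have Eu : (U_of Y0 (j + 1) - U_of Y0 j) / dx = fu (Y0, K0) by rewrite /fu add0r.
rewrite Eh Eu -/(fr (Y0, K0)) -/(fU (Y0, K0)) in E0.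
have Zt0 : Zt 0 = (Y0, K0) by rewrite ZtE.
pose f1 t := 2 * fa (Zt t) * fh (Zt t) - (fU (Zt t) * fU (Zt t) * (fa (Zt t) * fa (Zt t)) +
  fu (Zt t) * fu (Zt t) + fr (Zt t) * fr (Zt t)).
pose f2 t := fa (Zt t) * fa (Zt t) + fh (Zt t) * fh (Zt t) + fu (Zt t) * fu (Zt t) + fr (Zt t) * fr (Zt t).
have cf1 : continuous f1.
  move=> s; apply: cvgB; first by apply: cvgM; [apply: cvgM; [exact: cvg_cst|exact: ca]|exact: ch].
  apply: cvgD; last by apply: cvgM; exact: cr.
  apply: cvgD; last by apply: cvgM; exact: cu'.
  by apply: cvgM; apply: cvgM; [exact: cU..|exact: ca|exact: ca].
have cf2 : continuous f2.
  move=> s; apply: cvgD; last by apply: cvgM; exact: cr.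
  apply: cvgD; last by apply: cvgM; exact: cu'.
  by apply: cvgD; apply: cvgM; [exact: ca..|exact: ch|exact: ch].
(* The defect of (c) is conserved by an algebraic identity, whatever the values of [Q] and [S]. *)
have df1 s : 0 < s < T -> is_derive s 1 f1 0.
  move=> sT; have [Q [S [_ _ _ [Da Dh Du Dr DU]]]] := facts s sT.
  apply: is_derive_eq (energy_der Da Dh Du Dr DU) _.
  by rewrite ZtE; [ring|case/andP: sT => /ltW].
have f10 : f1 0 = 0.
  by rewrite /f1 Zt0 E0 !expr2 subrr.
have f1E s : 0 <= s <= T -> f1 s = 0.
  by move=> sT; rewrite (deriv0_const cf1 df1 sT).
have f2p : forall s, 0 <= s <= T -> 0 < f2 s.
  apply: (@positive_persist R f2 (fun s => derive1 f2 s) (2 + 2 * K + 2 * (K * K)) T) => //.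
  - have sq (x : R) : 0 <= x * x by rewrite -expr2 sqr_ge0.
    have [ap|an] := ltP 0 (fa (Y0, K0)); rewrite /f2 Zt0.
      by rewrite !ltr_pwDl// mulr_gt0.
    have hp : 0 < fh (Y0, K0) by lra.
    move: hp (sq (fa (Y0, K0))) (sq (fu (Y0, K0))) (sq (fr (Y0, K0))).
    move: (fa _) (fh _) (fu _) (fr _) => x y z w yp.
    by have := mulr_gt0 yp yp; lra.
  - move=> s sT; have [Q [S [_ _ _ [Da Dh Du Dr DU]]]] := facts s sT.
    have D := square_der Da Dh Du Dr.
    have [dD _] := D; rewrite derive1E; exact: (derivableP dD).
  - move=> s sT; have [Q [S [bU bQ bS [Da Dh Du Dr DU]]]] := facts s sT.
    have D := square_der Da Dh Du Dr; rewrite derive1E; have [_ ->] := D.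
    have s0 : 0 <= s by case/andP: sT => /ltW.
    rewrite /f2 ZtE//; exact: square_rate.
have main s : 0 <= s <= T -> fa (Zt s) + fh (Zt s) != 0 /\ 0 <= fa (Zt s) * fh (Zt s).
  move=> sT; have := f1E s sT; have := f2p s sT; rewrite /f1 /f2.
  move: (fa _) (fh _) (fu _) (fr _) (fU _) => a h u r U n0 E.
  have sq (x : R) : 0 <= x * x by rewrite -expr2 sqr_ge0.
  have q1 : 0 <= U * U * (a * a) by rewrite mulr_ge0.
  have q2 := sq u; have q3 := sq r; have q4 := sq a.
  have E' : a * h = h * a by rewrite mulrC.
  split; last by lra.
  apply/eqP => ah; have hE : h = - a by lra.
  by rewrite hE in n0 E; lra.
have tp : 0 < fa (Zt t) + fh (Zt t).
  rewrite ltNge; apply/negP => tn; have t0 : 0 <= t by case/andP: tT.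
  have cp : {within `[0, t], continuous (fun s => fa (Zt s) + fh (Zt s))}.
    by apply: continuous_subspaceT => s; apply: cvgD; [exact: ca|exact: ch].
  have p00 : 0 < fa (Zt 0) + fh (Zt 0) by rewrite Zt0.
  have [|s] := @IVT R _ 0 t 0 t0 cp; first by rewrite ge_min tn orbT le_max (ltW p00).
  rewrite in_itv/= => /andP[s0 st] ps.
  have [|] := main s; first by rewrite s0 (le_trans st)//; case/andP: tT.
  by rewrite ps eqxx.
have [_ pr] := main t tT.
have -> : 1 + Dp dx (zeta_of (Z t).1) j = fa (Zt t) by rewrite ZtE//; case/andP: tT.
rewrite leNgt; apply/negP => an.
have hp : 0 < fh (Zt t) by lra.
by move: pr; rewrite leNgt nmulr_rlt0// hp.
Qed.

End invariants.

(** * The line vector field *)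

Section exponential_steps.
Context {R : realType}.
Implicit Types a b D : R.

Lemma expRN_le D : 0 <= D -> 0 <= expR (- D) - 1 + D <= D ^+ 2.
Proof.
move=> D0; apply/andP; split; first by have := expR_ge1Dx (- D); lra.
rewrite expRN; have h : 1 + D <= expR D := expR_ge1Dx D.
have : (expR D)^-1 <= (1 + D)^-1 by rewrite lef_pV2 ?posrE ?expR_gt0//; lra.
have h2 : (1 + D)^-1 <= 1 - D + D ^+ 2.
  rewrite -[leLHS]mul1r ler_pdivrMr; last by lra.
  rewrite (_ : _ * _ = 1 + D ^+ 3); last by ring.
  by rewrite lerDl exprn_ge0.
by lra.
Qed.

Lemma expR_le D : 0 <= D -> D <= 2^-1 -> 0 <= expR D - 1 - D <= 2 * D ^+ 2.
Proof.
move=> D0 D1; apply/andP; split; first by have := expR_ge1Dx D; lra.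
have h : 1 - D <= expR (- D) := expR_ge1Dx (- D).
have : expR D <= (1 - D)^-1.
  rewrite -[leLHS]invrK -expRN lef_pV2 ?posrE ?expR_gt0//; lra.
have h2 : (1 - D)^-1 <= 1 + D + 2 * D ^+ 2.
  rewrite -[leLHS]mul1r ler_pdivrMr; last by lra.
  rewrite (_ : (1 + D + 2 * D ^+ 2) * (1 - D) = 1 + D ^+ 2 * (1 - 2 * D)); last by ring.
  by rewrite lerDl mulr_ge0 ?sqr_ge0//; lra.
by lra.
Qed.

Lemma expRN_itv D a : 0 <= a -> a <= D -> 1 - D <= expR (- a) <= 1.
Proof.
move=> a0 aD; rewrite -{2}expR0 ler_expR; apply/andP; split; last by lra.
by have := expR_ge1Dx (- a); lra.
Qed.

Lemma expR_diff a b m : m <= a -> m <= b ->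
  `|expR (- a) - expR (- b)| <= `|a - b| * expR (- m).
Proof.
have W x y : m <= x -> x <= y -> `|expR (- x) - expR (- y)| <= `|x - y| * expR (- m).
  move=> mx xy; have h : expR (- y) <= expR (- x) by rewrite ler_expR; lra.
  rewrite ger0_norm ?subr_ge0// distrC ger0_norm ?subr_ge0//.
  have -> : expR (- y) = expR (- x) * expR (- (y - x)) by rewrite -expRD; congr expR; ring.
  have h1 : expR (- x) <= expR (- m) by rewrite ler_expR; lra.
  have h2 := expR_ge1Dx (- (y - x)).
  rewrite -[X in X - _]mulr1 -mulrBr mulrC; apply: ler_pM; rewrite ?expR_ge0//; last by lra.
  by rewrite subr_ge0 -[leRHS]expR0 ler_expR; lra.
move=> ma mb; have [ab|ba] := leP a b; first exact: W.
by rewrite distrC (distrC a b); apply: W => //; exact: ltW.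
Qed.

End exponential_steps.

(** * Exponential kernels on the line and their derivatives *)

Section line_kernels.
Context {R : realType}.
Notation mu := (@lebesgue_measure R).
Variable y : R -> R.
Hypothesis y_mono : {homo y : a b / a <= b}.
Implicit Types (f : R -> R) (eta xi s t D : R).

Definition gk eta xi := 2^-1 * expR (- `|y xi - y eta|).
(* Unlike [Num.sg], [sgn] does not vanish on the diagonal: it matches the discrete
   kernels there, and the diagonal is negligible in the integrals. *)
Definition sgn eta xi : R := if eta <= xi then -1 else 1.
Definition kk eta xi := sgn eta xi * gk eta xi.
Definition ind s t eta : R := ((s < eta) && (eta <= t))%:R.

Lemma gk_ge0 eta xi : 0 <= gk eta xi.
Proof. by rewrite mulr_ge0 ?expR_ge0// invr_ge0. Qed.

Lemma kk_norm eta xi : `|kk eta xi| = gk eta xi.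
Proof.
rewrite normrM (ger0_norm (gk_ge0 _ _)) /sgn.
by case: ifP; rewrite ?normrN normr1 mul1r.
Qed.

(** First-order expansion in the increment [D] of [y]. For [eta] outside ]s, t] the kernels change
    by a factor [exp D] or [exp (- D)]; for [eta] inside, all values are within [D] of one half in
    modulus, and [kk] jumps by about -1, which [ind] records. *)
Lemma kernel_step eta s t : s <= t -> y t - y s <= 2^-1 ->
  let D := y t - y s in
  `|gk eta t - gk eta s - D * kk eta s| <= 2 * D ^+ 2 * gk eta s + 2 * D * ind s t eta /\
  `|kk eta t - kk eta s - D * gk eta s + ind s t eta| <= 2 * D ^+ 2 * gk eta s + 2 * D * ind s t eta.
Proof.
move=> st D1 D.
have D0 : 0 <= D by rewrite subr_ge0; exact: y_mono.
have g0 := gk_ge0 eta s; have D2 : 0 <= D ^+ 2 := sqr_ge0 D.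
rewrite /ind; have [es|se] := leP eta s.
  rewrite /= mulr0 addr0 /kk /sgn es (le_trans es st).
  have y1 := y_mono es.
  have -> : gk eta t = gk eta s * expR (- D).
    rewrite /gk !ger0_norm ?subr_ge0 ?(y_mono (le_trans es st))// -mulrA -expRD.
    by congr (_ * expR _); rewrite /D; ring.
  have /andP[e1 e2] := expRN_le D0.
  set G := gk eta s in g0 *.
  have -> : G * expR (- D) - G - D * (-1 * G) = G * (expR (- D) - 1 + D) by ring.
  have -> : -1 * (G * expR (- D)) - -1 * G - D * G + 0 = - (G * (expR (- D) - 1 + D)) by ring.
  rewrite normrN normrM !ger0_norm//.
  have : G * (expR (- D) - 1 + D) <= G * D ^+ 2 by rewrite ler_wpM2l.
  have := mulr_ge0 g0 D2; rewrite (mulrC _ G) (mulrCA G 2).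
  by move=> *; split; lra.
have [et|te] := leP eta t; last first.
  rewrite /= mulr0 addr0 /kk /sgn !(leNgt eta) se te /=.
  have y1 := y_mono (ltW te).
  have yst := y_mono st.
  have -> : gk eta t = gk eta s * expR D.
    rewrite /gk !ler0_norm ?subr_le0 ?(le_trans yst)// -mulrA -expRD.
    by congr (_ * expR _); rewrite /D; ring.
  have /andP[e1 e2] := expR_le D0 D1.
  set G := gk eta s in g0 *.
  have -> : G * expR D - G - D * (1 * G) = G * (expR D - 1 - D) by ring.
  have -> : 1 * (G * expR D) - 1 * G - D * G + 0 = G * (expR D - 1 - D) by ring.
  rewrite normrM !ger0_norm//.
  have : G * (expR D - 1 - D) <= G * (2 * D ^+ 2) by rewrite ler_wpM2l.
  by rewrite (mulrC (2 * _) G) => h; split.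
rewrite /= mulr1 /kk /sgn et (leNgt eta s) se /=.
have y1 := y_mono (ltW se); have y2 := y_mono et.
have /andP[a1 a2] := @expRN_itv _ D (y t - y eta) ltac:(by rewrite subr_ge0) ltac:(by rewrite /D; lra).
have /andP[b1 b2] := @expRN_itv _ D (y eta - y s) ltac:(by rewrite subr_ge0) ltac:(by rewrite /D; lra).
have P : 0 <= 2 * D ^+ 2 * gk eta s by rewrite !mulr_ge0.
have E1 : gk eta t = 2^-1 * expR (- (y t - y eta)) by rewrite /gk ger0_norm ?subr_ge0.
have E2 : gk eta s = 2^-1 * expR (- (y eta - y s)).
  by rewrite /gk ler0_norm ?subr_le0// opprB.
have g1 : gk eta s <= 2^-1 by rewrite E2; lra.
have m1 : D * gk eta s <= D * 2^-1 by rewrite ler_wpM2l.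
have m0 : 0 <= D * gk eta s by rewrite mulr_ge0.
move: P; rewrite E1; move: m1 m0; rewrite E2.
set u := expR _ in a1 a2 *; set v := expR _ in b1 b2 *; set w := D * (2^-1 * v).
move=> m1 m0 P; split; rewrite ler_norml; apply/andP; split; rewrite ?mul1r -/w; lra.
Qed.

Variable M : R.
Hypothesis yM : forall x, `|y x - x| <= M.

(** The price of replacing [y] by the identity in the exponent, as [|y x - x| <= M]. *)
Definition C0 : R := expR (2 * M) * 2^-1.

Lemma C0_ge0 : 0 <= C0. Proof. by rewrite mulr_ge0 ?expR_ge0// invr_ge0. Qed.

Lemma dist_y eta xi : `|xi - eta| - 2 * M <= `|y xi - y eta|.
Proof.
have h1 := yM xi; have h2 := yM eta; rewrite distrC in h1.
have : `|xi - eta| <= `|xi - y xi| + `|y xi - y eta| + `|y eta - eta|.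
  rewrite (_ : xi - eta = (xi - y xi) + (y xi - y eta) + (y eta - eta)); last by ring.
  by apply: le_trans (ler_normD _ _) _; rewrite lerD2r ler_normD.
by lra.
Qed.

Lemma gk_wexp eta xi : gk eta xi <= C0 * wexp xi eta.
Proof.
rewrite /gk /C0 /wexp (mulrC (expR _)) -mulrA -expRD ler_wpM2l ?invr_ge0// ler_expR.
by have := dist_y eta xi; have := normr_ge0 (xi - eta); lra.
Qed.

Hypothesis yc : continuous y.

Lemma gk_meas xi : measurable_fun setT (gk ^~ xi).
Proof.
apply: continuous_measurable_fun => eta; apply: cvgM; first exact: cvg_cst.
apply: continuous_comp; last exact: continuous_expR.
apply: cvgN; apply: (@continuous_comp _ _ _ (fun e => y xi - y e) (fun z : R => `|z|)).
  by apply: cvgB; [exact: cvg_cst|exact: yc].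
exact: norm_continuous.
Qed.

Lemma sgn_meas xi : measurable_fun setT (sgn ^~ xi).
Proof.
rewrite (_ : sgn ^~ xi = fun eta => 1 - 2 * \1_(`]-oo, xi]) eta).
  apply: measurable_funB; first exact: measurable_cst.
  by apply: measurable_funM; [exact: measurable_cst|exact: measurable_indic].
apply/funext => eta; rewrite /sgn indicE mem_setE in_itv/=.
by case: ifP => _; rewrite ?mulr1 ?mulr0; lra.
Qed.

Lemma kk_meas xi : measurable_fun setT (kk ^~ xi).
Proof. by apply: measurable_funM; [exact: sgn_meas|exact: gk_meas]. Qed.

Lemma ind_J s t f : loc1 f -> L1 (fun eta => ind s t eta * f eta) /\
  \int[mu]_eta (ind s t eta * f eta) = J s t f.
Proof.
move=> fl.
have I : mu.-integrable `]s, t] (EFin \o f).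
  apply: integrableS (fl.2 s t) => //.
  by move=> x /=; rewrite !in_itv/= => /andP[/ltW -> ->].
have E x : ind s t x = (x \in `]s, t]%classic)%:R by rewrite /ind mem_setE in_itv.
have mi : measurable `]s, t]%classic by exact: measurable_itv.
split.
  have := (@integrable_mkcond _ _ _ mu _ (EFin \o f) mi).1 I.
  apply: eq_integrable => // x _; rewrite /= patchE E.
  by case: ifP => _; rewrite ?mul1r ?mul0r.
rewrite /J -Rintegral_itv_obnd_cbnd// [RHS]Rintegral_mkcond; apply: eq_Rintegral => x _.
by rewrite patchE E; case: ifP => _; rewrite ?mul1r ?mul0r.
Qed.

Variable f : R -> R.
Hypothesis f2 : in_L2 f.

Let fL := L2_loc1 f2.

Lemma kernel_L1 (k : R -> R) xi : measurable_fun setT k -> (forall eta, `|k eta| <= gk eta xi) ->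
  L1 (fun eta => k eta * f eta) /\ `|\int[mu]_eta (k eta * f eta)| <= C0 * kconv wexp f xi.
Proof.
move=> mk kg; have W := conv_L1 wexp_schur xi f2.
have H eta : `|k eta * f eta| <= `|C0 * (wexp xi eta * `|f eta|)|.
  rewrite [leRHS]ger0_norm; last by rewrite !mulr_ge0 ?C0_ge0 ?expR_ge0.
  by rewrite normrM mulrA ler_wpM2r// (le_trans (kg eta))// gk_wexp.
have W2 : L1 (fun eta => C0 * (wexp xi eta * `|f eta|)) := intgZ C0 measurableT W.
have L : L1 (fun eta => k eta * f eta).
  by apply: L1_le W2 H; apply: measurable_funM => //; exact: L2_measurable.
split=> //; apply: le_trans (le_normr_Rintegral measurableT L) _.
rewrite /kconv -(RintegralZl C0 measurableT W); apply: le_Rintegral => //.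
  exact: integrable_norm.
move=> eta _; apply: le_trans (H eta) _; rewrite ger0_norm//.
by rewrite !mulr_ge0 ?C0_ge0 ?expR_ge0.
Qed.

Definition Gf xi := \int[mu]_eta (gk eta xi * f eta).
Definition Kf xi := \int[mu]_eta (kk eta xi * f eta).

Lemma Gf_L1 xi : L1 (fun eta => gk eta xi * f eta) /\ `|Gf xi| <= C0 * kconv wexp f xi.
Proof.
apply: kernel_L1; first exact: gk_meas.
by move=> eta; rewrite ger0_norm ?gk_ge0.
Qed.

Lemma Kf_L1 xi : L1 (fun eta => kk eta xi * f eta) /\ `|Kf xi| <= C0 * kconv wexp f xi.
Proof.
apply: kernel_L1; first exact: kk_meas.
by move=> eta; rewrite kk_norm.
Qed.

(** The factor 2 is [sqrt (4 * 1)], from [conv_sup] with the constants of [wexp_schur]. *)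
Definition S0 := C0 * (2 * n2 f).

Lemma conv_S0 xi : C0 * kconv wexp f xi <= S0.
Proof.
rewrite /S0 ler_wpM2l ?C0_ge0//; apply: le_trans (conv_sup wexp_schur xi f2) _.
by rewrite mulr1 (_ : 4 = 2 ^+ 2) ?sqrtr_sqr ?ger0_norm//; ring.
Qed.

(** Stated for four kernels to cover both expansions of [kernel_step], with [k4] equal to 0 or to
    [ind s t]. The factor [D] in front of the bound is what lets [sewing] add up the errors. *)
Lemma step_bound s t k1 k2 k3 k4 D : s <= t -> D = y t - y s -> D <= 2^-1 ->
  L1 (fun eta => k1 eta * f eta) -> L1 (fun eta => k2 eta * f eta) ->
  L1 (fun eta => k3 eta * f eta) -> L1 (fun eta => k4 eta * f eta) ->
  (forall eta, `|k1 eta - k2 eta - D * k3 eta + k4 eta| <= 2 * D ^+ 2 * gk eta s + 2 * D * ind s t eta) ->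
  `|\int[mu]_eta (k1 eta * f eta) - \int[mu]_eta (k2 eta * f eta)
    - D * \int[mu]_eta (k3 eta * f eta) + \int[mu]_eta (k4 eta * f eta)| <=
  D * (2 * D * S0 + 2 * J s t (fun x => `|f x|)).
Proof.
move=> st DE D1 l1 l2 l3 l4 H.
have D0 : 0 <= D by rewrite DE subr_ge0; exact: y_mono.
have l3' := intgZ D measurableT l3.
have l12 := intgB measurableT l1 l2.
have l123 := intgB measurableT l12 l3'.
have l := intgD measurableT l123 l4.
rewrite -(RintegralZl D measurableT l3) -(RintegralB measurableT l1 l2)
  -(RintegralB measurableT l12 l3') -(RintegralD measurableT l123 l4).
apply: le_trans (le_normr_Rintegral measurableT l) _.
have gl : L1 (fun eta => gk eta s * `|f eta|).
  have := integrable_norm (Gf_L1 s).1; apply: eq_integrable => // x _ /=.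
  by rewrite normrM (ger0_norm (gk_ge0 _ _)).
have [il iE] := ind_J s t (loc1_abs fL).
have gl' := intgZ (2 * D ^+ 2) measurableT gl; have il' := intgZ (2 * D) measurableT il.
apply: le_trans (_ : \int[mu]_eta (2 * D ^+ 2 * (gk eta s * `|f eta|) +
   2 * D * (ind s t eta * `|f eta|)) <= _).
  apply: le_Rintegral => //; [exact: integrable_norm|exact: (intgD measurableT gl' il')|].
  move=> eta _; rewrite [X in `|X|](_ : _ = (k1 eta - k2 eta - D * k3 eta + k4 eta) * f eta); last by ring.
  by rewrite normrM [X in _ <= X](_ : _ = (2 * D ^+ 2 * gk eta s + 2 * D * ind s t eta) * `|f eta|);
    [rewrite ler_wpM2r|ring].
rewrite (RintegralD measurableT gl' il') (RintegralZl _ measurableT gl) (RintegralZl _ measurableT il) iE.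
have g1 : \int[mu]_eta (gk eta s * `|f eta|) <= S0.
  apply: le_trans (conv_S0 s); have W := conv_L1 wexp_schur s f2.
  rewrite /kconv -(RintegralZl C0 measurableT W); apply: le_Rintegral => //.
    exact: (intgZ C0 measurableT W).
  by move=> eta _; rewrite mulrA ler_wpM2r// gk_wexp.
rewrite (_ : D * _ = 2 * D ^+ 2 * S0 + 2 * D * J s t (fun x => `|f x|)); last by ring.
by rewrite lerD2r ler_wpM2l// mulr_ge0// sqr_ge0.
Qed.

Lemma zero_L1 : L1 (fun eta => 0 * f eta) /\ \int[mu]_eta (0 * f eta) = 0.
Proof.
have E : (fun eta => 0 * f eta) = fun eta => 0 by apply/funext => x; rewrite mul0r.
rewrite E; split; first exact: integrable0.
by rewrite (@Rintegral_cst _ _ R mu setT measurableT 0) mul0r.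
Qed.

Lemma Gf_step s t : s <= t -> y t - y s <= 2^-1 ->
  `|Gf t - Gf s - (y t - y s) * Kf s| <=
  (y t - y s) * (2 * (y t - y s) * S0 + 2 * J s t (fun x => `|f x|)).
Proof.
move=> st D1; have [z1 z2] := zero_L1.
have := @step_bound s t (gk ^~ t) (gk ^~ s) (kk ^~ s) (fun=> 0) _ st erefl D1 (Gf_L1 t).1
  (Gf_L1 s).1 (Kf_L1 s).1 z1.
rewrite z2 addr0; apply=> eta; rewrite addr0.
by have [] := kernel_step eta st D1.
Qed.

Lemma Kf_step s t : s <= t -> y t - y s <= 2^-1 ->
  `|Kf t - Kf s - (y t - y s) * Gf s + J s t f| <=
  (y t - y s) * (2 * (y t - y s) * S0 + 2 * J s t (fun x => `|f x|)).
Proof.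
move=> st D1; have [z1 z2] := ind_J s t fL.
have := @step_bound s t (kk ^~ t) (kk ^~ s) (gk ^~ s) (ind s t) _ st erefl D1 (Kf_L1 t).1
  (Kf_L1 s).1 (Gf_L1 s).1 z1.
rewrite z2; apply=> eta.
by have [] := kernel_step eta st D1.
Qed.

Variable yp : R -> R.
Hypothesis yP : is_primitive y yp.

Lemma increments_near x e : 0 < e -> exists2 d, 0 < d & forall s t, s <= x -> x <= t ->
  x - d < s -> t < x + d -> y t - y s <= e /\ J s t (fun z => `|f z|) <= e.
Proof.
move=> e0; have e2 : 0 < e / 2 by lra.
have [d1 d10 H1] : exists2 d, 0 < d & forall z, x - d < z < x + d -> `|y x - y z| <= e / 2.
  by apply: nearP; move/cvgrPdist_le: (@yc x) => /(_ _ e2).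
have n0 : 0 <= n2 f by exact: n2_ge0.
pose d2 := (e / (n2 f + 1)) ^+ 2 / 2.
have en : 0 < e / (n2 f + 1) by rewrite divr_gt0//; lra.
have d20 : 0 < d2 by rewrite divr_gt0// exprn_gt0.
exists (Num.min d1 d2) => [|s t sx xt]; first by rewrite lt_min d10.
have m1 : Num.min d1 d2 <= d1 by rewrite ge_min lexx.
have m2 : Num.min d1 d2 <= d2 by rewrite ge_min lexx orbT.
move=> xs tx; split.
  have h1 := H1 s ltac:(apply/andP; split; lra).
  have h2 := H1 t ltac:(apply/andP; split; lra).
  by move: h1 h2; rewrite !ler_norml => /andP[? ?] /andP[? ?]; lra.
have st : s <= t by exact: le_trans xt.
apply: le_trans (J_n2 f2 st) _.
apply: le_trans (_ : e / (n2 f + 1) * n2 f <= _).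
  rewrite ler_wpM2r// -[leRHS](ger0_norm (ltW en)) -sqrtr_sqr ler_wsqrtr//.
  by move: m2 tx xs; rewrite /d2; move: (_ ^+ 2) (Num.min _ _) => a b; lra.
by rewrite mulrAC ler_pdivrMr ?ler_wpM2l ?ltW//; lra.
Qed.

Variables (F L g : R -> R) (S : R).
Hypothesis S_ge0 : 0 <= S.
Hypothesis L_le : forall x, `|L x| <= S.
Hypothesis g_meas : measurable_fun setT g.
Hypothesis g_le : forall x, `|g x| <= `|f x|.
Hypothesis F_step : forall s t, s <= t -> y t - y s <= 2^-1 ->
  `|F t - F s - (y t - y s) * L s + J s t g| <=
  (y t - y s) * (2 * (y t - y s) * S + 2 * J s t (fun x => `|f x|)).

Let gL : loc1 g.
Proof. exact: loc1_le g_meas (loc1_abs fL) g_le. Qed.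

Let D0 s t : s <= t -> 0 <= y t - y s.
Proof. by move=> st; rewrite subr_ge0; exact: y_mono. Qed.

(** A bound on [L] suffices here, so this lemma can start the mutual derivation of the properties of
    [Gf] and [Kf]. *)
Lemma step_continuous : continuous F.
Proof.
move=> x; apply/cvgrPdist_le => e e0.
pose e' := Num.min 2^-1 (e / (2 * (S + 1))).
have S_0 := S_ge0; have S1 : 0 < 2 * (S + 1) by lra.
have e'0 : 0 < e' by rewrite lt_min divr_gt0// invr_gt0 ltr0n.
have e'1 : e' <= 2^-1 by rewrite ge_min lexx.
have e'2 : e' * (2 * (S + 1)) <= e by rewrite -ler_pdivlMr// ge_min lexx orbT.
have main s t : s <= t -> y t - y s <= e' -> J s t (fun z => `|f z|) <= e' -> `|F t - F s| <= e.
  move=> st h1 h2; have d0 := D0 st; have H := F_step st (le_trans h1 e'1).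
  have hg : `|J s t g| <= J s t (fun z => `|f z|).
    apply: le_trans (J_abs s t gL) _.
    by apply: J_le => [||z _]; [exact: loc1_abs|exact: loc1_abs|exact: g_le].
  have f0 : 0 <= J s t (fun z => `|f z|) by exact: J_ge0.
  move: H hg f0 h2; set D := y t - y s in h1 d0 *; set j := J s t g; set i := J s t _ => H hg i0 h2.
  have hL : `|D * L s| <= e' * S by rewrite normrM (ger0_norm d0) ler_pM.
  have h3 : D * (2 * D * S + 2 * i) <= e' * (S + 1).
    apply: ler_pM => //; first by rewrite addr_ge0 ?mulr_ge0.
    by apply: lerD; [rewrite ler_piMl//|]; lra.
  have : `|F t - F s| <= `|F t - F s - D * L s + j| + `|D * L s| + `|j|.
    rewrite {1}(_ : F t - F s = (F t - F s - D * L s + j) + D * L s - j); last by ring.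
    by apply: le_trans (ler_normB _ _) _; rewrite lerD2r ler_normD.
  by move: e'2; rewrite (_ : e' * (2 * (S + 1)) = e' * (S + 1) + (e' * S + e')); [lra|ring].
have [d d0 Hd] := increments_near x e'0.
apply/nbhs_ballP; exists d => // z; rewrite /ball/= => xz.
have [zx|xz'] := leP z x.
  have [] := Hd z x zx (lexx _); [by move: xz; rewrite ltr_norml; lra|lra|].
  exact: main.
have [] := Hd x z (lexx _) (ltW xz'); [lra|by move: xz; rewrite ltr_norml; lra|].
by rewrite distrC; apply: main; exact: ltW.
Qed.

(** Sewing against [|yp|]: freezing [L] at [s] costs its oscillation, and the remainder of [F_step]
    is a small multiple of [y t - y s], itself at most the integral of [|yp|]. *)
Lemma step_isP : continuous L -> is_primitive F (fun x => yp x * L x - g x).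
Proof.
move=> cL; have [ypl yE] := yP.
have yLl : loc1 (fun x => yp x * L x) by exact: loc1Mc.
have pl : loc1 (fun x => yp x * L x - g x) by exact: loc1B.
split=> // a b; apply: (sewing (q := fun x => `|yp x|)) => //; first exact: loc1_abs.
move=> x e _ e0.
pose e' := Num.min 2^-1 (e / (4 * (S + 1))).
have S_0 := S_ge0; have S1 : 0 < 4 * (S + 1) by lra.
have e'0 : 0 < e' by rewrite lt_min divr_gt0// invr_gt0 ltr0n.
have e'1 : e' <= 2^-1 by rewrite ge_min lexx.
have e'2 : e' * (4 * (S + 1)) <= e by rewrite -ler_pdivlMr// ge_min lexx orbT.
have [d1 d10 H1] := increments_near x e'0.
have e4 : 0 < e / 4 by lra.
have [d2 d20 H2] : exists2 d, 0 < d & forall z, x - d < z < x + d -> `|L x - L z| <= e / 4.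
  by apply: nearP; move/cvgrPdist_le: (@cL x) => /(_ _ e4).
exists (Num.min d1 d2) => [|s t _ sx xt _]; first by rewrite lt_min d10.
have m1 : Num.min d1 d2 <= d1 by rewrite ge_min lexx.
have m2 : Num.min d1 d2 <= d2 by rewrite ge_min lexx orbT.
move=> xs tx; have st : s <= t by exact: le_trans xt.
have [h1 h2] := H1 s t sx xt ltac:(lra) ltac:(lra).
have d0 := D0 st; have H := F_step st (le_trans h1 e'1).
have f0 : 0 <= J s t (fun z => `|f z|) by exact: J_ge0.
rewrite J_B//.
have E : (y t - y s) * L s - J s t (fun z => yp z * L z) = J s t (fun z => L s * yp z - yp z * L z).
  by rewrite J_B//; [rewrite J_Z// yE// mulrC|exact: loc1Z].
have B2 : `|(y t - y s) * L s - J s t (fun z => yp z * L z)| <= e / 2 * J s t (fun z => `|yp z|).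
  have l2 := loc1B (loc1Z (L s) ypl) yLl.
  rewrite E -J_Z; last exact: loc1_abs.
  apply: le_trans (J_abs s t l2) _; apply: J_le => [||z /andP[sz zt]].
  - exact: loc1_abs.
  - by apply: loc1Z; exact: loc1_abs.
  rewrite (mulrC (L s)) -mulrBr normrM mulrC ler_wpM2r//.
  have hs := H2 s ltac:(apply/andP; split; lra).
  have hz := H2 z ltac:(apply/andP; split; lra).
  have -> : L s - L z = (L x - L z) - (L x - L s) by ring.
  by apply: le_trans (ler_normB _ _) _; lra.
have B1 : (y t - y s) * (2 * (y t - y s) * S + 2 * J s t (fun z => `|f z|)) <=
    e / 2 * J s t (fun z => `|yp z|).
  rewrite mulrC; apply: ler_pM => //.
  - by rewrite addr_ge0 ?mulr_ge0.
  - clearbody e'; have : (y t - y s) * S <= e' * S by rewrite ler_wpM2r.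
    by move: e'2 h2; rewrite (_ : e' * (4 * (S + 1)) = 4 * (e' * S) + 4 * e');
      [rewrite -(mulrA 2); move: ((y t - y s) * S) (J s t _) (e' * S) => u v w; lra|ring].
  - by rewrite yE//; apply: le_trans (ler_norm _) (J_abs s t ypl).
rewrite (_ : _ - _ = (F t - F s - (y t - y s) * L s + J s t g)
  + ((y t - y s) * L s - J s t (fun z => yp z * L z))); last by ring.
apply: le_trans (ler_normD _ _) _; apply: le_trans (lerD (le_trans H B1) B2) _.
by rewrite -mulrDl (_ : e / 2 + e / 2 = e)//; lra.
Qed.

End line_kernels.

Section line_derivatives.
Context {R : realType}.
Variables (y yp f : R -> R) (M : R).
Hypothesis y_mono : {homo y : a b / a <= b}.
Hypothesis yM : forall x, `|y x - x| <= M.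
Hypothesis yP : is_primitive y yp.
Hypothesis f2 : in_L2 f.

Let yc : continuous y := isP_cont yP.
Let S_ge0 : 0 <= S0 M f.
Proof. by rewrite mulr_ge0 ?C0_ge0// mulr_ge0 ?n2_ge0. Qed.
Let G_le x : `|Gf y f x| <= S0 M f.
Proof. exact: le_trans (Gf_L1 yM yc f2 x).2 (conv_S0 M f2 x). Qed.
Let f_meas : measurable_fun setT f := L2_measurable f2.

Let G_step s t : s <= t -> y t - y s <= 2^-1 ->
  `|Gf y f t - Gf y f s - (y t - y s) * Kf y f s + J s t (fun=> 0)| <=
  (y t - y s) * (2 * (y t - y s) * S0 M f + 2 * J s t (fun x => `|f x|)).
Proof. by move=> st D1; rewrite J_cst// mul0r addr0; exact: Gf_step. Qed.

(** [step_isP] asks for continuity of the companion operator. That of [Kf] comes from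
    [step_continuous]; that of [Gf], used for [Kf_isP], then follows from this lemma. *)
Lemma Gf_isP : is_primitive (Gf y f) (fun x => yp x * Kf y f x).
Proof.
have cK : continuous (Kf y f).
  have st := @step_continuous R y y_mono yc f f2 (Kf y f) (Gf y f) f (S0 M f) S_ge0 G_le f_meas.
  by apply: st => // s t; exact: Kf_step.
have := @step_isP R y y_mono yc f f2 yp yP (Gf y f) (Kf y f) (fun=> 0) (S0 M f) S_ge0 _ _ G_step cK.
rewrite (_ : (fun x => _ - 0) = fun x => yp x * Kf y f x); last by apply/funext => x; rewrite subr0.
by apply=> // x; rewrite normr0.
Qed.

Lemma Kf_isP : is_primitive (Kf y f) (fun x => yp x * Gf y f x - f x).
Proof.
have cG : continuous (Gf y f) := isP_cont Gf_isP.
have st := @step_isP R y y_mono yc f f2 yp yP (Kf y f) (Gf y f) f (S0 M f) S_ge0 f_meas.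
by apply: st => // s t; exact: Kf_step.
Qed.

End line_derivatives.

(** * The fields Q and R on the line *)

Section line_state.
Context {R : realType}.
Notation mu := (@lebesgue_measure R).
Implicit Types (f g p q : R -> R) (x xi eta : R).

Lemma isP_D f p g q : is_primitive f p -> is_primitive g q -> is_primitive (fun x => f x + g x) (fun x => p x + q x).
Proof.
move=> [pl fE] [ql gE]; split; first exact: loc1D.
by move=> a b ab; rewrite J_D// -fE// -gE//; ring.
Qed.

Lemma isP_Z f p c : is_primitive f p -> is_primitive (fun x => c * f x) (fun x => c * p x).
Proof.
move=> [pl fE]; split; first exact: loc1Z.
by move=> a b ab; rewrite J_Z// -fE//; ring.
Qed.

Lemma isP_eq f p g q : is_primitive f p -> f =1 g -> p =1 q -> is_primitive g q.
Proof. by move=> H /funext <- /funext <-. Qed.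

Lemma isP_id : is_primitive (fun x => x : R) (fun=> 1).
Proof.
by split=> [|a b ab]; [exact: loc1_cst|rewrite J_cst// mul1r].
Qed.

Lemma En_parts (X : state R R) M : En X <= M ->
  [/\ nV (zeta_of X) <= M, nH (U_of X) <= M, nV (H_of X) <= M & n2 (rbar_of X) <= M].
Proof.
rewrite /En; have := nV_ge0 (zeta_of X); have := nH_ge0 (U_of X); have := nV_ge0 (H_of X).
have := n2_ge0 (rbar_of X); move: (nV _) (nH _) (nV _) (n2 _) => a b c d *.
by split; lra.
Qed.

Variables (rho M : R) (X : state R R).
Hypothesis XE : in_E X.
Hypothesis UV : in_V (U_of X).
Hypothesis XM : En X <= M.
Hypothesis y_mono : {homo y_of X : a b / a <= b}.

Definition yx x := 1 + wderiv (zeta_of X) x.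
Definition fx x := U_of X x * wderiv (U_of X) x.
Definition hx x := wderiv (H_of X) x + rho * rbar_of X x.

Lemma zeta_isD : is_L2_primitive (zeta_of X) (wderiv (zeta_of X)).
Proof. by case: XE => [[c _ w] _ _ _]; exact: isD_wderiv. Qed.

(** A function in H^1 is only determined almost everywhere; the continuity that makes [U] a
    pointwise primitive comes from [UV], which is later read off from [line_field] being in E. *)
Lemma U_isD : is_L2_primitive (U_of X) (wderiv (U_of X)).
Proof. by case: UV => c _ w; exact: isD_wderiv. Qed.

Lemma H_isD : is_L2_primitive (H_of X) (wderiv (H_of X)).
Proof. by case: XE => [_ _ [c _ w] _]; exact: isD_wderiv. Qed.

Lemma M_ge0 : 0 <= M. Proof. exact: le_trans (En_ge0 X) XM. Qed.

Lemma y_near x : `|y_of X x - x| <= M.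
Proof.
rewrite /y_of addrC addKr; have [zM _ _ _] := En_parts XM.
by case: XE => [zV _ _ _]; exact: le_trans (V_sup x zV) zM.
Qed.

Lemma y_isP : is_primitive (y_of X) yx.
Proof. exact: isP_D isP_id zeta_isD.1. Qed.

Lemma U_sup x : `|U_of X x| <= 2 * M.
Proof.
have [_ uM _ _] := En_parts XM; have [U2 _] : in_H1 (U_of X) by case: XE.
have h1 := sobolev x U_isD U2; have h2 := H_n2 (U_of X); have h3 := H_n2d U_isD.
by lra.
Qed.

Lemma U_L2 : in_L2 (U_of X) /\ n2 (U_of X) <= M.
Proof.
have [_ uM _ _] := En_parts XM; have [U2 _] : in_H1 (U_of X) by case: XE.
by split=> //; exact: le_trans (H_n2 _) uM.
Qed.

Lemma wderivs_L2 : [/\ n2 (wderiv (zeta_of X)) <= M, n2 (wderiv (U_of X)) <= M,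
  n2 (wderiv (H_of X)) <= M & n2 (rbar_of X) <= M].
Proof.
have [zM uM hM rM] := En_parts XM; have [zV _ hV _] := XE; split=> //.
- exact: le_trans (V_n2 zV zeta_isD) zM.
- exact: le_trans (H_n2d U_isD) uM.
- exact: le_trans (V_n2 hV H_isD) hM.
Qed.

Lemma fx_L2 : in_L2 fx /\ n2 fx <= 2 * M * M.
Proof.
have mU : measurable_fun setT (U_of X) by exact: (L2_measurable U_L2.1).
have [h1 h2] := L2_bmul mU U_sup U_isD.2; split; first exact: h1.
apply: le_trans h2 _; rewrite ler_wpM2l ?mulr_ge0 ?M_ge0//.
by have [] := wderivs_L2.
Qed.

Lemma hx_L2 : in_L2 hx /\ n2 hx <= M + `|rho| * M.
Proof.
have [_ _ _ r2] := XE; have [_ _ hM rM] := wderivs_L2.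
have z2 := L2Z rho r2; split; first exact: L2D H_isD.2 z2.
apply: le_trans (n2D H_isD.2 z2) _; apply: lerD => //.
by rewrite n2Z// ler_wpM2l.
Qed.

Lemma kappa_line_int f xi : measurable_fun setT f ->
  \int[mu]_eta (kappa_line X eta xi * f eta) = Kf (y_of X) f xi.
Proof.
move=> mf; have E eta : kappa_line X eta xi = kk (y_of X) eta xi * (1 - \1_[set xi] eta).
  rewrite /kappa_line -[g_line X eta xi]/(gk (y_of X) eta xi) /kk /sgn indicE.
  have [->|ne] := eqVneq eta xi.
    by rewrite subrr sgr0 oppr0 mul0r mem_set// subrr mulr0.
  rewrite memNset; last by apply/eqP.
  rewrite subr0 mulr1; congr (_ * _); have [le|lt] := leP eta xi.
    by rewrite gtr0_sg// subr_gt0 lt_neqAle ne.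
  by rewrite ltr0_sg ?subr_lt0// opprK.
have mk := kk_meas (isP_cont y_isP) xi.
rewrite /Rintegral; congr fine; apply: ae_eq_integral => //.
- apply/measurable_EFinP; rewrite (_ : (fun eta => _) = fun eta =>
    (kk (y_of X) eta xi * (1 - \1_[set xi] eta)) * f eta); last by apply/funext => eta; rewrite E.
  apply: measurable_funM => //; apply: measurable_funM => //.
  by apply: measurable_funB; [exact: measurable_cst|exact: measurable_indic].
- by apply/measurable_EFinP; exact: measurable_funM.
exists [set xi]; split => //; first exact: lebesgue_measure_set1.
move=> eta /= H; apply: contrapT => ne; apply: H => _; rewrite E indicE memNset//.
by rewrite subr0 mulr1.
Qed.

Lemma Q_lineE : Q_line rho X = fun x => Gf (y_of X) fx x + Kf (y_of X) hx x.
Proof.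
by apply/funext => x; congr (_ + _); apply: kappa_line_int; exact: L2_measurable hx_L2.1.
Qed.

Lemma R_lineE : R_line rho X = fun x => Kf (y_of X) fx x + Gf (y_of X) hx x.
Proof.
by apply/funext => x; congr (_ + _); apply: kappa_line_int; exact: L2_measurable fx_L2.1.
Qed.

Lemma Q_isP : is_primitive (Q_line rho X) (fun x => yx x * R_line rho X x - hx x).
Proof.
have h1 := Gf_isP y_mono y_near y_isP fx_L2.1.
have h2 := Kf_isP y_mono y_near y_isP hx_L2.1.
rewrite Q_lineE R_lineE; apply: isP_eq (isP_D h1 h2) _ _ => // x /=.
by ring.
Qed.

Lemma R_isP : is_primitive (R_line rho X) (fun x => yx x * Q_line rho X x - fx x).
Proof.
have h1 := Kf_isP y_mono y_near y_isP fx_L2.1.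
have h2 := Gf_isP y_mono y_near y_isP hx_L2.1.
rewrite Q_lineE R_lineE; apply: isP_eq (isP_D h1 h2) _ _ => // x /=.
by ring.
Qed.

Definition cN := 2 * M * M + (M + `|rho| * M).

(** The constant 4 serves twice: it is the Schur bound of [wexp] on L^2, and it exceeds
    [sqrt (4 * 1)], the bound from L^2 to L^oo. *)
Lemma kernel_sum_le (k1 k2 : R -> R) :
  (forall x, `|k1 x| <= C0 M * kconv (@wexp R) fx x) ->
  (forall x, `|k2 x| <= C0 M * kconv (@wexp R) hx x) ->
  measurable_fun setT k1 -> measurable_fun setT k2 ->
  [/\ forall x, `|k1 x + k2 x| <= C0 M * 4 * cN, in_L2 (fun x => k1 x + k2 x)
    & n2 (fun x => k1 x + k2 x) <= C0 M * 4 * cN].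
Proof.
move=> H1 H2 m1 m2; have [f2 fM] := fx_L2; have [h2 hM] := hx_L2.
have C0p : 0 <= C0 M by exact: C0_ge0.
have P (k g : R -> R) : (forall x, `|k x| <= C0 M * kconv (@wexp R) g x) -> measurable_fun setT k -> in_L2 g ->
    in_L2 k /\ n2 k <= C0 M * (4 * n2 g).
  move=> H m g2; have [c2 cM] := conv_L2 wexp_schur g2.
  have z2 := L2Z (C0 M) c2.
  have H' x : `|k x| <= `|C0 M * kconv (@wexp R) g x|.
    by apply: le_trans (H x) (ler_norm _).
  split; first exact: L2_le z2 H'.
  by apply: le_trans (n2_le m z2 H') _; rewrite n2Z// ger0_norm// ler_wpM2l.
have S (k g : R -> R) x : (forall x, `|k x| <= C0 M * kconv (@wexp R) g x) -> in_L2 g ->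
    `|k x| <= C0 M * (4 * n2 g).
  move=> H g2; apply: le_trans (H x) _; rewrite ler_wpM2l//.
  apply: le_trans (conv_sup wexp_schur x g2) _; rewrite ler_wpM2r ?n2_ge0// mulr1.
  by rewrite -[leRHS]ger0_norm// -sqrtr_sqr ler_wsqrtr//; lra.
have E : C0 M * (4 * n2 fx) + C0 M * (4 * n2 hx) <= C0 M * 4 * cN.
  rewrite -mulrDr -mulrA ler_wpM2l// -mulrDr ler_wpM2l//; exact: lerD.
have [a1 a2] := P _ _ H1 m1 f2; have [b1 b2] := P _ _ H2 m2 h2.
split.
- move=> x; apply: le_trans (ler_normD _ _) _; apply: le_trans (lerD _ _) E; exact: S.
- exact: L2D.
- by apply: le_trans (n2D a1 b1) _; apply: le_trans E; exact: lerD.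
Qed.

Lemma Q_bounds : [/\ forall x, `|Q_line rho X x| <= C0 M * 4 * cN, in_L2 (Q_line rho X)
    & n2 (Q_line rho X) <= C0 M * 4 * cN].
Proof.
have yc := isP_cont y_isP.
rewrite Q_lineE; apply: kernel_sum_le.
- by move=> x; exact: (Gf_L1 y_near yc fx_L2.1 x).2.
- by move=> x; exact: (Kf_L1 y_near yc hx_L2.1 x).2.
- apply: continuous_measurable_fun; apply: isP_cont (Gf_isP y_mono y_near y_isP fx_L2.1).
- apply: continuous_measurable_fun; apply: isP_cont (Kf_isP y_mono y_near y_isP hx_L2.1).
Qed.

Lemma R_bounds : [/\ forall x, `|R_line rho X x| <= C0 M * 4 * cN, in_L2 (R_line rho X)
    & n2 (R_line rho X) <= C0 M * 4 * cN].
Proof.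
have yc := isP_cont y_isP.
rewrite R_lineE; apply: kernel_sum_le.
- by move=> x; exact: (Kf_L1 y_near yc fx_L2.1 x).2.
- by move=> x; exact: (Gf_L1 y_near yc hx_L2.1 x).2.
- apply: continuous_measurable_fun; apply: isP_cont (Kf_isP y_mono y_near y_isP fx_L2.1).
- apply: continuous_measurable_fun; apply: isP_cont (Gf_isP y_mono y_near y_isP hx_L2.1).
Qed.

End line_state.

(** * Consistency of the two vector fields *)

Section kernel_comparison.
Context {R : realType}.
Variables (dx : R) (Y : state int R) (g k gam kap : int -> int -> R) (c : R).
Hypothesis dx0 : 0 < dx.
Hypothesis gb : lstar_bound dx g c.
Hypothesis kb : lstar_bound dx k c.
Hypothesis gamb : lstar_bound dx gam c.
Hypothesis kapb : lstar_bound dx kap c.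
Hypothesis rel : four_relations dx Y g k gam kap.
Let a j := dx * Dp dx (yd_of dx Y) j.
Variables (eps d M : R) (y : R -> R).
Hypothesis a0 : forall j, 0 <= a j.
Hypothesis aeps : forall j, a j <= eps.
Hypothesis eps8 : 8 * eps <= 1.
Hypothesis yM : forall x, `|y x - x| <= M.
Hypothesis yd_near : forall x, `|yd_of dx Y (idx dx x) - y x| <= d.
Hypothesis d1 : eps + d <= 2.
Implicit Types (i j : int) (x xi eta : R).

Lemma yd_step j : yd_of dx Y (j + 1) = yd_of dx Y j + a j.
Proof. exact: DpE. Qed.

Let tend a' i : lstar_bound dx a' c -> tend0 (a' i).
Proof. exact: row_tend0. Qed.

Lemma g_near i j : `|g i j - 2^-1 * expR (- `|yd_of dx Y j - yd_of dx Y i|)| <=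
  12 * eps * expR (- (`|yd_of dx Y j - yd_of dx Y i| / 2)).
Proof.
exact: (kernel_g a0 aeps eps8 (rel_g dx0 rel i) (rel_gam dx0 rel i) (tend i gb) (tend i gamb) yd_step).
Qed.

Lemma gam_near i j :
  `|gam i j - (if i <= j then -1 else 1) * (2^-1 * expR (- `|yd_of dx Y j - yd_of dx Y i|))| <=
  14 * eps * expR (- (`|yd_of dx Y j - yd_of dx Y i| / 2)).
Proof.
exact: (kernel_gam a0 aeps eps8 (rel_g dx0 rel i) (rel_gam dx0 rel i) (tend i gb) (tend i gamb) yd_step).
Qed.

Let tendN v : tend0 v -> tend0 (fun j : int => v (- j) : R).
Proof. by move=> v0 e e0; have [N HN] := v0 e e0; exists N => j jN; apply: HN; lia. Qed.

(* The reflection j -> -j turns (k, - kappa) into a solution of the relations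
   satisfied by (g, gamma), for the grid values - y_(1-j). *)
Let reflected i j :
  `|k i j - 2^-1 * expR (- `|yd_of dx Y (j + 1) - yd_of dx Y (i + 1)|)| <=
  12 * eps * expR (- (`|yd_of dx Y (j + 1) - yd_of dx Y (i + 1)| / 2)) /\
  `|- kap i j - (if j <= i then -1 else 1) * (2^-1 * expR (- `|yd_of dx Y (j + 1) - yd_of dx Y (i + 1)|))| <=
  14 * eps * expR (- (`|yd_of dx Y (j + 1) - yd_of dx Y (i + 1)| / 2)).
Proof.
pose a' l := a (- l); pose g' l := k i (- l); pose gam' l := - kap i (- l).
pose Y' l := - yd_of dx Y (- l + 1).
have Hg' l : g' (l + 1) = g' l + a' l * gam' l.
  rewrite /g' /a' /gam'; have := rel_k dx0 rel i (- l); rewrite -opprD => E.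
  by move: E; rewrite -/(a (- l)) => E; rewrite mulrN -E; ring.
have Hgam' l : gam' l - gam' (l - 1) = a' l * g' l - (l == - i)%:R.
  rewrite /g' /a' /gam'; have := rel_kap dx0 rel i (- l); rewrite -/(a (- l)) eqr_oppLR.
  by rewrite opprB (addrC 1) => E; rewrite -E; ring.
have HY' l : Y' (l + 1) = Y' l + a' l.
  rewrite /Y' /a' (_ : - (l + 1) + 1 = - l); last by ring.
  by rewrite yd_step; ring.
have t1 : tend0 g' := tendN (tend i kb).
have t2 : tend0 gam'.
  have := tendN (tend0Z (-1) (tend i kapb)).
  by congr tend0; apply/funext => l; rewrite mulN1r.
have a0' l : 0 <= a' l by exact: a0.
have aeps' l : a' l <= eps by exact: aeps.
have := kernel_g a0' aeps' eps8 Hg' Hgam' t1 t2 HY' (- j).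
have := kernel_gam a0' aeps' eps8 Hg' Hgam' t1 t2 HY' (- j).
rewrite /g' /gam' /Y' !opprK lerN2.
have -> : - yd_of dx Y (j + 1) + yd_of dx Y (i + 1) = - (yd_of dx Y (j + 1) - yd_of dx Y (i + 1)).
  by rewrite opprB addrC.
by rewrite normrN.
Qed.

(** 15 is 14 + 1: at most [14 eps] from the discrete kernels, and [eps + d] from moving the grid
    values to [y]. The exponential pays for [|y x - x| <= M] at two points and for displacements of
    total size at most 4. *)
Definition kdelta := 15 * (eps + d) * expR (2 * M + 4).

Let eps0 : 0 <= eps. Proof. exact: le_trans (a0 0) (aeps 0). Qed.
Let d0 : 0 <= d. Proof. exact: le_trans (normr_ge0 _) (yd_near 0). Qed.
Let M0 : 0 <= M. Proof. exact: le_trans (normr_ge0 _) (yM 0). Qed.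

Lemma kdelta_ge0 : 0 <= kdelta.
Proof. by rewrite /kdelta mulr_ge0 ?expR_ge0// mulr_ge0// addr_ge0. Qed.

Let exp_cmp (Yi Yj : R) xi eta : `|Yj - y xi| <= eps + d -> `|Yi - y eta| <= eps + d ->
  `|2^-1 * expR (- `|Yj - Yi|) - gk y eta xi| <= (eps + d) * expR (2 * M + 4) * wexp xi eta /\
  expR (- (`|Yj - Yi| / 2)) <= expR (2 * M + 4) * wexp xi eta.
Proof.
move=> hj hi.
have h1 : `| `|Yj - Yi| - `|y xi - y eta| | <= 2 * (eps + d).
  apply: le_trans (ler_dist_dist _ _) _.
  rewrite (_ : Yj - Yi - (y xi - y eta) = (Yj - y xi) - (Yi - y eta)); last by ring.
  by apply: le_trans (ler_normB _ _) _; lra.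
have h2 := dist_y yM eta xi; have n0 := normr_ge0 (xi - eta).
have lo : `|xi - eta| - 2 * M - 4 <= `|Yj - Yi|.
  by move: h1; rewrite ler_norml => /andP[? _]; have := d1; lra.
split; last first.
  rewrite /wexp -expRD ler_expR; have := M0; have := normr_ge0 (Yj - Yi).
  by move: lo n0; move: `|_| `|_| => u v; lra.
rewrite /gk -mulrBr normrM ger0_norm ?invr_ge0//.
have lo2 : `|xi - eta| - 2 * M - 4 <= `|y xi - y eta| by lra.
have := expR_diff lo lo2 => h3.
have h4 : expR (- (`|xi - eta| - 2 * M - 4)) <= expR (2 * M + 4) * wexp xi eta.
  by rewrite /wexp -expRD ler_expR; move: n0; move: `|_| => u; lra.
have h5 := ler_pM (normr_ge0 _) (expR_ge0 _) h1 h4.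
by move: h3 h5; rewrite -!mulrA; lra.
Qed.

(** [reflected] compares [k] and [kap] with the exponential at the values of index [j + 1], one step
    [a j <= eps] further. *)
Let yd_near1 x : `|yd_of dx Y (idx dx x + 1) - y x| <= eps + d.
Proof.
rewrite yd_step (_ : _ - _ = a (idx dx x) + (yd_of dx Y (idx dx x) - y x)); last by ring.
apply: le_trans (ler_normD _ _) (lerD _ (yd_near x)).
by rewrite ger0_norm.
Qed.

Let yd_near0 x : `|yd_of dx Y (idx dx x) - y x| <= eps + d.
Proof. by apply: le_trans (yd_near x) _; rewrite lerDr. Qed.

Let w0 xi eta : 0 <= @wexp R xi eta. Proof. exact: expR_ge0. Qed.

Let combine C (p u v w Z x : R) : 0 <= C -> C <= 14 -> `|p - u| <= C * eps * w -> w <= Z ->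
  0 <= Z -> `|u - v| <= (eps + d) * Z + x -> `|p - v| <= 15 * (eps + d) * Z + x.
Proof.
move=> C0 C14 h1 wZ Z0 h2.
have h3 : C * eps * w <= 14 * (eps + d) * Z.
  apply: le_trans (_ : C * eps * Z <= _); first by rewrite ler_wpM2l// mulr_ge0.
  by rewrite ler_wpM2r// ler_pM// lerDl.
have : `|p - v| <= `|p - u| + `|u - v|.
  by rewrite (_ : p - v = (p - u) + (u - v)) ?ler_normD//; ring.
by move: h1 h2 h3; rewrite -!mulrA; lra.
Qed.

Lemma idx_le xi eta : eta <= xi -> idx dx eta <= idx dx xi.
Proof.
move=> h; have /andP[h1 _] := idx_itv dx0 eta; have /andP[_ h2] := idx_itv dx0 xi.
have : gridpt dx (idx dx eta) < gridpt dx (idx dx xi + 1) by lra.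
by rewrite /gridpt ltr_pM2r// ltr_int ltzD1.
Qed.

Lemma idx_same xi eta : idx dx eta = idx dx xi -> wind dx xi eta = 1.
Proof.
move=> h; have /andP[h1 h2] := idx_itv dx0 eta; have /andP[h3 h4] := idx_itv dx0 xi.
move: h2 h4; rewrite h !gridptS => h2 h4; rewrite h in h1.
by rewrite /wind ler_norml; case: (_ <= _ <= _) / andP => // -[]; split; lra.
Qed.

Let Z0 xi eta : 0 <= expR (2 * M + 4) * @wexp R xi eta.
Proof. by rewrite mulr_ge0 ?expR_ge0. Qed.

Let kdE xi eta : kdelta * @wexp R xi eta = 15 * (eps + d) * (expR (2 * M + 4) * wexp xi eta).
Proof. by rewrite /kdelta mulrA. Qed.

Lemma g_line xi eta : `|g (idx dx eta) (idx dx xi) - gk y eta xi| <= kdelta * wexp xi eta.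
Proof.
have [h1 h2] := exp_cmp (yd_near0 xi) (yd_near0 eta).
rewrite kdE -[leRHS]addr0; apply: (combine _ _ (g_near _ _) h2) => //; first by lra.
by rewrite addr0 mulrA.
Qed.

Lemma k_line xi eta : `|k (idx dx eta) (idx dx xi) - gk y eta xi| <= kdelta * wexp xi eta.
Proof.
have [h1 h2] := exp_cmp (yd_near1 xi) (yd_near1 eta).
rewrite kdE -[leRHS]addr0; apply: (combine _ _ (reflected _ _).1 h2) => //; first by lra.
by rewrite addr0 mulrA.
Qed.

(** Where the signs differ, both values are at most one half, and the trivial bound 1 is paid by
    [x = 1], that is by [wind] inside a common cell. *)
Let sign_cmp (s1 s2 u v Z x : R) : `|s1| = 1 -> `|s2| = 1 -> 0 <= u -> u <= 2^-1 -> 0 <= v ->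
  v <= 2^-1 -> `|u - v| <= Z -> 0 <= x -> s1 = s2 \/ x = 1 -> `|s1 * u - s2 * v| <= Z + x.
Proof.
move=> n1 n2_ u0 u1 v0 v1 uv x0 [->|->].
  by rewrite -mulrBr normrM n2_ mul1r; lra.
apply: le_trans (ler_normB _ _) _; rewrite !normrM n1 n2_ !mul1r !ger0_norm//.
by have := le_trans (normr_ge0 _) uv; lra.
Qed.

Let half_exp (u : R) : 0 <= u -> 0 <= 2^-1 * expR (- u) /\ 2^-1 * expR (- u) <= 2^-1.
Proof.
move=> u0; split; first by rewrite mulr_ge0 ?expR_ge0// invr_ge0.
by rewrite ler_piMr ?invr_ge0// -[leRHS]expR0 ler_expR oppr_le0.
Qed.

Let sgn1 (b : bool) : `|(if b then -1 else 1) : R| = 1.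
Proof. by case: b; rewrite ?normrN normr1. Qed.

Lemma gam_line xi eta :
  `|gam (idx dx eta) (idx dx xi) - kk y eta xi| <= kdelta * wexp xi eta + wind dx xi eta.
Proof.
have [h1 h2] := exp_cmp (yd_near0 xi) (yd_near0 eta).
rewrite kdE; apply: (combine _ _ (gam_near _ _) h2) => //.
have [p1 p2] := half_exp (normr_ge0 (yd_of dx Y (idx dx xi) - yd_of dx Y (idx dx eta))).
have [q1 q2] := half_exp (normr_ge0 (y xi - y eta)).
rewrite mulrA; apply: sign_cmp => //; first exact: sgn1.
have [le|lt] := leP eta xi.
  by left; rewrite /sgn le (idx_le le).
have le' := idx_le (ltW lt); have [e|ne] := eqVneq (idx dx eta) (idx dx xi).
  by right; exact: idx_same.
by left; rewrite /sgn (leNgt eta) lt /= (leNgt (idx dx eta)) lt_neqAle eq_sym ne le'.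
Qed.

Lemma kap_line xi eta :
  `|kap (idx dx eta) (idx dx xi) - kk y eta xi| <= kdelta * wexp xi eta + wind dx xi eta.
Proof.
have [h1 h2] := exp_cmp (yd_near1 xi) (yd_near1 eta).
set kp := kap _ _; rewrite kdE (_ : kp - kk y eta xi = - (- kp - - kk y eta xi)); last by ring.
rewrite normrN; apply: (combine _ _ (reflected _ _).2 h2) => //.
have [p1 p2] := half_exp (normr_ge0 (yd_of dx Y (idx dx xi + 1) - yd_of dx Y (idx dx eta + 1))).
have [q1 q2] := half_exp (normr_ge0 (y xi - y eta)).
rewrite mulrA -[- kk y eta xi]/(- (sgn eta xi * gk y eta xi)) -mulNr; apply: sign_cmp => //; first by rewrite normrN; exact: sgn1.
rewrite /sgn; have [le|lt] := leP eta xi.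
  have le' := idx_le le; have [e|ne] := eqVneq (idx dx eta) (idx dx xi).
    by right; exact: idx_same.
  by left; rewrite opprK (leNgt (idx dx xi)) lt_neqAle ne le'.
by left; rewrite (idx_le (ltW lt)).
Qed.

End kernel_comparison.

Lemma interp_isD (R : realType) (dx : R) (v : int -> R) (F p : R -> R) : 0 < dx -> is_primitive F p ->
  in_L2 (st dx (Dp dx v)) -> in_L2 p ->
  is_L2_primitive (fun x => interp_affine dx v x - F x) (fun x => st dx (Dp dx v) x - p x).
Proof.
move=> dx0 FP h1 h2; split; last exact: L2B.
have H := isP_D (interp_isP dx0 v) (isP_Z (-1) FP).
by apply: isP_eq H _ _ => x; rewrite mulN1r.
Qed.

(** * Calculus of closeness for functions and integral operators *)

Section closeness.
Context {R : realType}.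
Notation mu := (@lebesgue_measure R).
Variable s : R.
Hypothesis s0 : 0 <= s.
Hypothesis s2 : s <= 2.
Implicit Types (a b f g : R -> R) (C c r : R).

(* Closeness with a constant proportional to the bound makes both notions stable
   under products; [s] stands for the error in [E] plus the square root of [dx]. *)
Record sup_close C a b : Prop := SupClose {
  sup_close_ma : measurable_fun [set: R] a;
  sup_close_mb : measurable_fun [set: R] b;
  sup_close_b : forall x, `|b x| <= C;
  sup_close_d : forall x, `|a x - b x| <= C * s }.

Record L2_close C a b : Prop := L2Close {
  L2_close_a2 : in_L2 a;
  L2_close_b2 : in_L2 b;
  L2_close_b : n2 b <= C;
  L2_close_d : n2 (fun x => a x - b x) <= C * s }.

Lemma sup_close_ge0 C a b : sup_close C a b -> 0 <= C.
Proof. by case=> _ _ + _ => /(_ 0); apply: le_trans. Qed.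

Lemma L2_close_ge0 C a b : L2_close C a b -> 0 <= C.
Proof. by case=> _ _ + _; apply: le_trans; exact: n2_ge0. Qed.

Let Cs C : 0 <= C -> C * s <= 2 * C.
Proof. by move=> C0; rewrite mulrC ler_wpM2r. Qed.

(** 3 is 1 + 2, as [s <= 2]. *)
Lemma sup_close_a C a b x : sup_close C a b -> `|a x| <= 3 * C.
Proof.
move=> H; have C0 := sup_close_ge0 H; case: H => _ _ /(_ x) h1 /(_ x) h2.
have := Cs C0; have : `|a x| <= `|a x - b x| + `|b x|.
  by rewrite -{1}(subrK (b x) (a x)) ler_normD.
by move: h1 h2; move: `|_| `|_| `|_| => *; lra.
Qed.

Lemma L2_close_a C a b : L2_close C a b -> n2 a <= 3 * C.
Proof.
move=> H; have C0 := L2_close_ge0 H; case: H => a2 b2 h1 h2.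
have D2 : in_L2 (fun x => a x - b x) by exact: (L2B a2 b2).
have := n2D D2 b2; rewrite (_ : _ \+ _ = a); last by apply/funext => x /=; rewrite subrK.
by have := Cs C0; move: h1 h2; move: (n2 _) (n2 _) (n2 _) => *; lra.
Qed.

(** The difference of products is [(a - b) f + b (f - g)]; 4 is 3 + 1, with [3 c] bounding [f]. *)
Lemma sup_close_mul_cl2 C c a b f g : sup_close C a b -> L2_close c f g ->
  L2_close (4 * C * c) (fun x => a x * f x) (fun x => b x * g x).
Proof.
move=> H H'; have C0 := sup_close_ge0 H; have c0 := L2_close_ge0 H'; have fa := L2_close_a H'.
have aC x := sup_close_a x H.
case: H => ma mb h1 h2; case: H' => f2 g2 k1 k2.
have [af2 _] := L2_bmul ma aC f2; have [bg2 bg] := L2_bmul mb h1 g2.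
have D2 : in_L2 (fun x => f x - g x) by exact: (L2B f2 g2).
have md : measurable_fun setT (fun x => a x - b x) by exact: measurable_funB.
have [d1 d2] := L2_bmul md h2 f2; have [d3 d4] := L2_bmul mb h1 D2.
have n1 : C * n2 g <= C * c by rewrite ler_wpM2l.
have Cc0 : 0 <= C * c by exact: mulr_ge0.
split=> //; first by apply: le_trans bg _; rewrite -mulrA; lra.
rewrite (_ : (fun x => _) = (fun x => a x - b x) \* f \+ b \* (fun x => f x - g x)); last first.
  by apply/funext => x /=; ring.
apply: le_trans (n2D d1 d3) _.
have e1 : C * s * n2 f <= C * s * (3 * c) by rewrite ler_wpM2l// mulr_ge0.
have e2 : C * n2 (fun x => f x - g x) <= C * (c * s) by rewrite ler_wpM2l.
have -> : 4 * C * c * s = C * s * (3 * c) + C * (c * s) by ring.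
exact: lerD (le_trans d2 e1) (le_trans d4 e2).
Qed.

Lemma sup_close_mul C c a b f g : sup_close C a b -> sup_close c f g ->
  sup_close (4 * C * c) (fun x => a x * f x) (fun x => b x * g x).
Proof.
move=> H H'; have C0 := sup_close_ge0 H; have c0 := sup_close_ge0 H'; have fa x := sup_close_a x H'.
case: H => ma mb h1 h2; case: H' => mf mg k1 k2.
have Cc0 : 0 <= C * c by exact: mulr_ge0.
split; [exact: measurable_funM|exact: measurable_funM| |] => x.
  rewrite normrM; apply: le_trans (ler_pM _ _ (h1 x) (k1 x)) _ => //.
  by rewrite -mulrA; lra.
rewrite (_ : _ - _ = (a x - b x) * f x + b x * (f x - g x)); last by ring.
apply: le_trans (ler_normD _ _) _; rewrite !normrM.
have -> : 4 * C * c * s = C * s * (3 * c) + C * (c * s) by ring.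
by apply: lerD; apply: ler_pM.
Qed.

Lemma L2_close_D C c a b f g : L2_close C a b -> L2_close c f g ->
  L2_close (C + c) (fun x => a x + f x) (fun x => b x + g x).
Proof.
case=> a2 b2 h1 h2 [f2 g2 k1 k2]; split.
- exact: L2D.
- exact: L2D.
- by apply: le_trans (n2D b2 g2) _; exact: lerD.
rewrite (_ : (fun x => _) = (fun x => a x - b x) \+ (fun x => f x - g x)); last first.
  by apply/funext => x /=; ring.
by rewrite mulrDl; apply: le_trans (n2D (L2B a2 b2) (L2B f2 g2)) _; exact: lerD.
Qed.

Lemma L2_close_Z r C a b : L2_close C a b -> L2_close (`|r| * C) (fun x => r * a x) (fun x => r * b x).
Proof.
case=> a2 b2 h1 h2; split.
- exact: L2Z.
- exact: L2Z.
- by rewrite n2Z// ler_wpM2l.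
rewrite (_ : (fun x => _) = fun x => r * (a x - b x)); last by apply/funext => x; ring.
have D2 : in_L2 (fun x => a x - b x) := L2B a2 b2.
by rewrite (n2Z r D2) -mulrA ler_wpM2l.
Qed.

Lemma L2_close_eq C a b a' b' : L2_close C a b -> a =1 a' -> b =1 b' -> L2_close C a' b'.
Proof. by move=> H /funext <- /funext <-. Qed.

Section integral_operators.
Variables (dx delta c0 cd : R).
Hypothesis dx0 : 0 <= dx.
Hypothesis delta0 : 0 <= delta.
Hypothesis c00 : 0 <= c0.
Hypothesis sqdx : Num.sqrt (2 * dx) <= 2 * s.
Hypothesis dxs : dx <= s.
Hypothesis deltas : delta <= cd * s.
Variables (Kd Kc : R -> R -> R) (C : R) (f g : R -> R).
Hypothesis mKd : forall x, measurable_fun setT (Kd ^~ x).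
Hypothesis mKc : forall x, measurable_fun setT (Kc ^~ x).
Hypothesis Kdc : forall x eta, `|Kd eta x - Kc eta x| <= delta * wexp x eta + wind dx x eta.
Hypothesis Kc0 : forall x eta, `|Kc eta x| <= c0 * wexp x eta.
Hypothesis fg : L2_close C f g.

Let Td x := \int[mu]_eta (Kd eta x * f eta).
Let Tc x := \int[mu]_eta (Kc eta x * g eta).
Hypothesis mTd : measurable_fun setT Td.
Hypothesis mTc : measurable_fun setT Tc.

Let f2 : in_L2 f := L2_close_a2 fg.
Let g2 : in_L2 g := L2_close_b2 fg.
Let fg2 : in_L2 (fun x => f x - g x). Proof. exact: L2B. Qed.

Let w0 (x eta : R) : 0 <= wexp x eta. Proof. exact: expR_ge0. Qed.
Let wi0 (x eta : R) : 0 <= wind dx x eta. Proof. by rewrite /wind. Qed.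

Let bnd x := delta * kconv (@wexp R) f x + kconv (wind dx) f x
  + c0 * kconv (@wexp R) (fun y => f y - g y) x.

(** The difference splits into [(Kd - Kc) f + Kc (f - g)]: the kernel error acts on the discrete
    source, the kernel of the line on the error of the source. *)
Let T_le x : `|Td x - Tc x| <= bnd x.
Proof.
have W1 := conv_L1 wexp_schur x f2; have W2 := conv_L1 (wind_schur dx0) x f2.
have W3 := conv_L1 wexp_schur x fg2.
have mf : measurable_fun setT f := L2_measurable f2.
have mg : measurable_fun setT g := L2_measurable g2.
have L1a : L1 (fun eta => delta * (wexp x eta * `|f eta|) + wind dx x eta * `|f eta|).
  exact: (intgD measurableT (intgZ delta measurableT W1) W2).
have W3' := intgZ c0 measurableT W3.
have La : L1 (fun eta => (Kd eta x - Kc eta x) * f eta).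
  apply: L1_le L1a _.
    by apply: measurable_funM => //; apply: measurable_funB; [exact: mKd|exact: mKc].
  move=> eta; rewrite normrM [leRHS]ger0_norm; last by rewrite addr_ge0 ?mulr_ge0.
  by rewrite mulrA -mulrDl ler_wpM2r.
have Lb : L1 (fun eta => Kc eta x * (f eta - g eta)).
  apply: L1_le W3' _.
    by apply: measurable_funM; [exact: mKc|exact: measurable_funB].
  move=> eta; rewrite normrM [leRHS]ger0_norm; last by rewrite !mulr_ge0.
  by rewrite mulrA ler_wpM2r.
have Lg : L1 (fun eta => Kc eta x * g eta).
  have W4 := intgZ c0 measurableT (conv_L1 wexp_schur x g2).
  apply: L1_le W4 _; first by apply: measurable_funM; [exact: mKc|].
  move=> eta; rewrite normrM [leRHS]ger0_norm; last by rewrite !mulr_ge0.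
  by rewrite mulrA ler_wpM2r.
have Lab := intgD measurableT La Lb.
have E : Td x - Tc x = \int[mu]_eta ((Kd eta x - Kc eta x) * f eta + Kc eta x * (f eta - g eta)).
  have -> : Td x = \int[mu]_eta (((Kd eta x - Kc eta x) * f eta + Kc eta x * (f eta - g eta))
      + Kc eta x * g eta).
    by apply: eq_Rintegral => eta _; ring.
  by rewrite (RintegralD measurableT Lab Lg) addrK.
rewrite E; apply: le_trans (le_normr_Rintegral measurableT Lab) _.
have L3 := intgD measurableT L1a W3'.
have -> : bnd x = \int[mu]_eta ((delta * (wexp x eta * `|f eta|) + wind dx x eta * `|f eta|)
    + c0 * (wexp x eta * `|f eta - g eta|)).
  rewrite (RintegralD measurableT L1a W3') (RintegralD measurableT (intgZ delta measurableT W1) W2).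
  by rewrite (RintegralZl delta measurableT W1) (RintegralZl c0 measurableT W3).
apply: le_Rintegral => //; first exact: integrable_norm.
move=> eta _; apply: le_trans (ler_normD _ _) _; rewrite !normrM; apply: lerD.
  by rewrite mulrA -mulrDl ler_wpM2r.
by rewrite mulrA ler_wpM2r.
Qed.

(** 12 is 4 * 3 and 6 is 2 * 3: the Schur bound 4 of [wexp], respectively [2 s] for [wind], times
    the bound [3 C] of [f]. One constant covers both the uniform and the L^2 estimate. *)
Definition opC := C * (12 * cd + 6 + 4 * c0).

Let C00 : 0 <= C := L2_close_ge0 fg.

Let collect (A B N F : R) : 0 <= A -> A <= 4 -> 0 <= B -> B <= 2 * s -> N <= C * s -> 0 <= F -> F <= 3 * C ->
  delta * (A * F) + B * F + c0 * (A * N) <= opC * s.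
Proof.
move=> A0 A4 B0 Bs Ns F0 FC.
have h1 : delta * (A * F) <= cd * s * (4 * (3 * C)).
  by apply: ler_pM => //; [rewrite mulr_ge0|apply: ler_pM].
have h2 : B * F <= 2 * s * (3 * C) by apply: ler_pM.
have h3 : c0 * (A * N) <= c0 * (4 * (C * s)).
  rewrite ler_wpM2l//; apply: le_trans (_ : A * (C * s) <= _); first by rewrite ler_wpM2l.
  by rewrite ler_wpM2r// mulr_ge0.
rewrite (_ : opC * s = cd * s * (4 * (3 * C)) + 2 * s * (3 * C) + c0 * (4 * (C * s))); last first.
  by rewrite /opC; ring.
by apply: lerD => //; exact: lerD.
Qed.

(** The band kernel maps L^2 to L^oo with norm at most [sqrt (2 * dx)]; with the size of the
    increments of [y] this is where the rate [sqrt dx] originates. *)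
Lemma op_sup x : `|Td x - Tc x| <= opC * s.
Proof.
have E4 : Num.sqrt (4 * 1) = 2 :> R.
  by rewrite mulr1 (_ : 4 = 2 ^+ 2) ?sqrtr_sqr ?ger0_norm//; ring.
apply: le_trans (T_le x) _; have h1 := conv_sup wexp_schur x f2.
have h2 := conv_sup (wind_schur dx0) x f2; have h3 := conv_sup wexp_schur x fg2.
rewrite E4 in h1 h3; rewrite mulr1 in h2.
apply: le_trans (_ : delta * (2 * n2 f) + Num.sqrt (2 * dx) * n2 f
    + c0 * (2 * n2 (fun y => f y - g y)) <= _).
  by apply: lerD; [apply: lerD => //|]; rewrite ler_wpM2l.
by apply: collect; rewrite ?n2_ge0 ?sqrtr_ge0 ?(L2_close_d fg) ?(L2_close_a fg)//; lra.
Qed.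

Lemma op_L2 : in_L2 (fun x => Td x - Tc x) /\ n2 (fun x => Td x - Tc x) <= opC * s.
Proof.
have [a1 a2] := conv_L2 wexp_schur f2; have [b1 b2] := conv_L2 (wind_schur dx0) f2.
have [c1 c2] := conv_L2 wexp_schur fg2.
have A1 := L2Z delta a1; have C1 := L2Z c0 c1.
have B1 := L2D A1 b1; have B2 : in_L2 bnd := L2D B1 C1.
have m : measurable_fun setT (fun x => Td x - Tc x) by exact: measurable_funB.
have H x : `|Td x - Tc x| <= `|bnd x| by apply: le_trans (T_le x) (ler_norm _).
split; first exact: L2_le m B2 H.
apply: le_trans (n2_le m B2 H) _.
apply: le_trans (n2D B1 C1) _; apply: le_trans (lerD (n2D A1 b1) (lexx _)) _.
rewrite !n2Z// !ger0_norm//.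
apply: le_trans (_ : delta * (4 * n2 f) + (2 * dx) * n2 f
    + c0 * (4 * n2 (fun y => f y - g y)) <= _).
  by apply: lerD; [apply: lerD => //|]; rewrite ler_wpM2l.
have h5 : 2 * dx <= 2 * s by rewrite ler_pM2l.
by apply: collect; rewrite ?n2_ge0 ?mulr_ge0 ?(L2_close_d fg) ?(L2_close_a fg).
Qed.

End integral_operators.

Section components.
Variables (dx : R).
Hypothesis dx0 : 0 < dx.
Hypothesis dxs : dx <= s.
Notation st := (st dx).
Implicit Type v : int -> R.

Lemma compV v F p C c : is_primitive F p -> L2_close C (st (Dp dx v)) p ->
  (forall x, `|interp_affine dx v x - F x| <= c) ->
  in_V (fun x => interp_affine dx v x - F x) /\
  nV (fun x => interp_affine dx v x - F x) <= c + C * s.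
Proof.
move=> FP H sup; have [h1 h2] := isD_V (interp_isD dx0 FP (L2_close_a2 H) (L2_close_b2 H)) sup.
by split=> //; apply: le_trans h2 _; rewrite lerD2l; exact: L2_close_d.
Qed.

(** The affine interpolation differs from the step function by at most [dx] times the slope, whose
    L^2 norm is at most [3 C]; adding the derivative gives 4. *)
Lemma compH v F p C c : is_primitive F p -> L2_close C (st (Dp dx v)) p -> L2_close c (st v) F ->
  in_H1 (fun x => interp_affine dx v x - F x) /\
  nH (fun x => interp_affine dx v x - F x) <= (c + 4 * C) * s.
Proof.
move=> FP H Hv; have C0 := L2_close_ge0 H; have D3 := L2_close_a H.
have D := interp_isD dx0 FP (L2_close_a2 H) (L2_close_b2 H); have [Dv2 _ _ dn] := H; have [v2 F2 _ vn] := Hv.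
have [i2 _] := interp_L2 dx0 v2 Dv2.
have mi : measurable_fun setT (fun x => interp_affine dx v x - st v x).
  by apply: measurable_funB; [exact: L2_measurable i2|exact: measurable_st].
have d2 := L2Z dx Dv2.
have H1 x : `|interp_affine dx v x - st v x| <= `|dx * st (Dp dx v) x|.
  exact: interp_affine_st.
have e2 := L2_le mi d2 H1; have en := n2_le mi d2 H1.
rewrite (n2Z dx Dv2) (ger0_norm (ltW dx0)) in en.
have w2 : in_L2 (fun x => st v x - F x) by exact: (L2B v2 F2).
have E : (fun x => interp_affine dx v x - F x) =
    (fun x => interp_affine dx v x - st v x) \+ (fun x => st v x - F x).
  by apply/funext => x /=; ring.
have t2 : in_L2 (fun x => interp_affine dx v x - F x) by rewrite E; exact: L2D.
have [h1 h2] := isD_H D t2; split=> //; apply: le_trans h2 _.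
have : n2 (fun x => interp_affine dx v x - F x) <= s * (3 * C) + c * s.
  rewrite E; apply: le_trans (n2D e2 w2) _; apply: lerD => //.
  by apply: le_trans en _; apply: ler_pM => //; [exact: ltW|exact: n2_ge0].
have -> : (c + 4 * C) * s = s * (3 * C) + c * s + C * s by ring.
by move=> h3; exact: lerD.
Qed.

End components.

End closeness.

(** * Comparison of the two vector fields *)

Section vector_fields_close.
Context {R : realType}.
Notation mu := (@lebesgue_measure R).
Variables (rho M : R).

(** The constants depend on [rho] and on the bound [M] of the solution on the line, never on [dx] or
    on the grid bound [c]. They belong to the kernel error ([cdel]), [U] ([CU]), the two sources
    ([Cf], [Ch]), [Q] and [R] ([CQ]), their derivatives ([CdQ], [CdR]), the increments of [R]
    ([CW]), and the derivative and supremum of the product [U R] ([CdW], [CsW]). *)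
Definition cdel : R := 15 * (2 * (M + 2)) * expR (2 * M + 4).
Definition CU : R := 2 * M + 3.
Definition Cf : R := 4 * CU * (M + 1).
Definition Ch : R := (M + 1) + `|rho| * (M + 1).
Definition CQ : R := (Cf + Ch) * (12 * cdel + 6 + 4 * C0 M) + C0 M * 4 * cN rho M.
Definition CyQ : R := CQ + 4 * CQ * (M + 1).
Definition CdQ : R := CyQ + `|-1| * Ch.
Definition CdR : R := CyQ + `|-1| * Cf.
Definition CdW : R := 4 * CQ * (M + 1) + 4 * CU * CdR.
Definition CW : R := (M + 2) * (3 * CQ) + 3 * CU * (M + 1).
Definition CsW : R := ((M + 1) * (3 * CQ) + 3 * CU * CW) + (4 * CU * CQ + 3 * CU * CW).
Definition C_lip : R := (2 + (M + 1)) + (`|-1| * CQ + 4 * (`|-1| * CdQ)) + (CsW + `|-1| * CdW)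
  + `|- rho| * (M + 1).

Variables (dx c : R) (Y : state int R) (g k gam kap : int -> int -> R) (X : state R R).
Hypothesis dx0 : 0 < dx.
Hypothesis YB : Ed_bound dx Y c.
Hypothesis gb : lstar_bound dx g c.
Hypothesis kb : lstar_bound dx k c.
Hypothesis gamb : lstar_bound dx gam c.
Hypothesis kapb : lstar_bound dx kap c.
Hypothesis rel : four_relations dx Y g k gam kap.
Hypothesis slopes : forall j, 0 <= Dp dx (yd_of dx Y) j.
Hypothesis XE : in_E X.
Hypothesis UV : in_V (U_of X).
Hypothesis XM : En X <= M.
Hypothesis y_mono : {homo y_of X : a b / a <= b}.
Notation e := (En (interp dx Y - X)).
Hypothesis e1 : e <= 1.
Notation sq := (Num.sqrt dx).
Hypothesis sq_small : 8 * ((M + 2) * sq) <= 1.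
Notation s := (e + sq).
Notation st := (st dx).
Notation W := (Y, (g, k, gam, kap)).
Implicit Types (x xi eta : R) (j m : int).

Let M0 : 0 <= M. Proof. exact: M_ge0 XM. Qed.
Let e0 : 0 <= e. Proof. exact: En_ge0. Qed.
Let sq0 : 0 <= sq. Proof. exact: sqrtr_ge0. Qed.
Let sqsq : sq * sq = dx. Proof. by rewrite -expr2 sqr_sqrtr// ltW. Qed.
Let sq1 : sq <= 1.
Proof.
have h : 1 * sq <= (M + 2) * sq by rewrite ler_wpM2r//; have := M0; lra.
by have := sq_small; lra.
Qed.
Let dxsq : dx <= sq. Proof. by rewrite -[leLHS]sqsq ler_piMr. Qed.
Let es : e <= s. Proof. by rewrite lerDl. Qed.
Let sqs : sq <= s. Proof. by rewrite lerDr. Qed.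
Let dxs : dx <= s. Proof. exact: le_trans dxsq sqs. Qed.
Let s0 : 0 <= s. Proof. exact: le_trans e0 es. Qed.
Let s2 : s <= 2. Proof. by have := lerD e1 sq1; rewrite -[X in _ <= X -> _]/(1 + 1). Qed.
Let C1s C : 1 <= C -> e <= C * s.
Proof. by move=> C1; apply: le_trans es _; rewrite ler_peMl. Qed.
Let Csq C : 0 <= C -> C * sq <= C * s. Proof. by move=> C0'; rewrite ler_wpM2l. Qed.
Let M1 : 1 <= M + 1. Proof. by rewrite lerDr. Qed.

Let DE : in_E (interp dx Y - X).
Proof. by apply: in_EB => //; have [] := interp_E dx0 YB. Qed.

Let L2_close_near C v p (f F : R -> R) : in_L2 (st v) -> in_L2 p -> n2 p <= M ->
  n2 (fun x => st v x - p x) <= e -> M + 1 <= C -> L2_close s C (st v) p.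
Proof.
move=> v2 p2 pM vp MC; split=> //; first by apply: le_trans pM _; lra.
by apply: le_trans vp (C1s _); have := M1; lra.
Qed.

Let parts := En_parts (lexx e).

Lemma close_dz : L2_close s (M + 1) (st (Dp dx (zeta_of Y))) (wderiv (zeta_of X)).
Proof.
have [h _ _ _] := parts; have [V _ _ _] := DE; have [zM _ _ _] := wderivs_L2 XE UV XM.
have [d2 _] := edb_dz YB; have D := zeta_isD XE.
apply: L2_close_near => //; [exact: D.2|].
by apply: le_trans (V_n2 V (interp_isD dx0 D.1 d2 D.2)) h.
Qed.

Lemma close_du : L2_close s (M + 1) (st (Dp dx (U_of Y))) (wderiv (U_of X)).
Proof.
have [_ h _ _] := parts; have [_ uM _ _] := wderivs_L2 XE UV XM.
have [d2 _] := edb_du YB; have D := U_isD UV.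
apply: L2_close_near => //; [exact: D.2|].
by apply: le_trans (H_n2d (interp_isD dx0 D.1 d2 D.2)) h.
Qed.

Lemma close_dh : L2_close s (M + 1) (st (Dp dx (H_of Y))) (wderiv (H_of X)).
Proof.
have [_ _ h _] := parts; have [_ _ V _] := DE; have [_ _ hM _] := wderivs_L2 XE UV XM.
have [d2 _] := edb_dh YB; have D := H_isD XE.
apply: L2_close_near => //; [exact: D.2|].
by apply: le_trans (V_n2 V (interp_isD dx0 D.1 d2 D.2)) h.
Qed.

Lemma close_r : L2_close s (M + 1) (st (rbar_of Y)) (rbar_of X).
Proof.
have [_ _ _ h] := parts; have [_ _ _ rM] := wderivs_L2 XE UV XM.
have [r2 _] := edb_r YB; have [_ _ _ R2] := XE.
apply: L2_close_near => //; apply: le_trans h; rewrite le_eqVlt; apply/orP; left; apply/eqP.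
congr n2; apply/funext => x.
rewrite -[RHS]/(rbar_of (interp dx Y) x - rbar_of X x); congr (_ - _).
exact: esym (congr1 (fun F => F x) (interp_constE dx0 (rbar_of Y))).
Qed.

Let sup_z x : `|interp_affine dx (zeta_of Y) x - zeta_of X x| <= e.
Proof. by have [h _ _ _] := parts; have [V _ _ _] := DE; exact: le_trans (V_sup x V) h. Qed.

Let sup_u x : `|interp_affine dx (U_of Y) x - U_of X x| <= 2 * e.
Proof.
have [_ h _ _] := parts; have [_ [u2 _] _ _] := DE; have D := U_isD UV.
have [d2 _] := edb_du YB; have DD := interp_isD dx0 D.1 d2 D.2.
apply: le_trans (sobolev x DD u2) _.
have h1 := H_n2 (U_of (interp dx Y - X)); have h2 := H_n2d DD.
apply: le_trans (lerD (le_trans h1 h) (le_trans h2 h)) _.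
by rewrite mulr_natl mulr2n.
Qed.

(** Being within [e <= 1] of [p], [v] has L^2 norm at most [M + 1] on every grid, so
    [l2_bound_pointwise] makes a single increment of order [sqrt dx]. *)
Let increment v p j : in_L2 p -> n2 p <= M -> L2_close s (M + 1) (st v) p ->
  n2 (fun x => st v x - p x) <= e -> dx * `|v j| <= (M + 1) * sq.
Proof.
move=> p2 pM [v2 _ _ _] ve.
have B : l2_bound dx v (M + 1).
  split=> //; have d2 : in_L2 (fun x => st v x - p x) := L2B v2 p2.
  have := n2D d2 p2; rewrite (_ : _ \+ _ = st v); last by apply/funext => x /=; rewrite subrK.
  by move=> h; apply: le_trans h _; rewrite addrC; apply: lerD => //; exact: le_trans e1.
have sqp : 0 < sq by rewrite sqrtr_gt0.
have := l2_bound_pointwise dx0 j B; rewrite ler_pdivlMr// => h.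
rewrite (_ : dx * `|v j| = `|v j| * sq * sq); first by rewrite ler_wpM2r.
by rewrite -mulrA sqsq mulrC.
Qed.

Lemma inc_z j : dx * `|Dp dx (zeta_of Y) j| <= (M + 1) * sq.
Proof.
have [h _ _ _] := parts; have [V _ _ _] := DE; have [zM _ _ _] := wderivs_L2 XE UV XM.
have D := zeta_isD XE; apply: increment close_dz _ => //; first exact: D.2.
by apply: le_trans (V_n2 V (interp_isD dx0 D.1 (edb_dz YB).1 D.2)) h.
Qed.

Lemma inc_u j : dx * `|Dp dx (U_of Y) j| <= (M + 1) * sq.
Proof.
have [_ h _ _] := parts; have [_ uM _ _] := wderivs_L2 XE UV XM.
have D := U_isD UV; apply: increment close_du _ => //; first exact: D.2.
by apply: le_trans (H_n2d (interp_isD dx0 D.1 (edb_du YB).1 D.2)) h.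
Qed.

Lemma close_U : sup_close s CU (st (U_of Y)) (U_of X).
Proof.
have U2 := U_L2 XE XM; split.
- exact: measurable_st.
- exact: L2_measurable U2.1.
- by move=> x; apply: le_trans (U_sup XE UV XM x) _; rewrite /CU; lra.
move=> x; have h1 := interp_affine_st dx0 (U_of Y) x; have h2 := sup_u x.
have h3 := inc_u (idx dx x); rewrite normrM (gtr0_norm dx0) in h1.
have h4 := le_trans h1 h3; rewrite distrC in h4.
rewrite (_ : _ - _ = (st (U_of Y) x - interp_affine dx (U_of Y) x)
  + (interp_affine dx (U_of Y) x - U_of X x)); last by ring.
apply: le_trans (ler_normD _ _) _; apply: le_trans (lerD h4 h2) _.
rewrite (_ : CU * s = CU * sq + CU * e); last by ring.
apply: lerD; rewrite /CU.
  by rewrite ler_wpM2r//; have := M0; lra.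
by rewrite ler_wpM2r//; have := M0; lra.
Qed.

Lemma close_f : L2_close s Cf (st (fun j => U_of Y j * Dp dx (U_of Y) j)) (fx X).
Proof. exact: (sup_close_mul_cl2 s0 s2 close_U close_du). Qed.

Lemma close_h : L2_close s Ch (st (fun j => Dp dx (H_of Y) j + rho * rbar_of Y j)) (hx rho X).
Proof. exact: (L2_close_D close_dh (L2_close_Z rho close_r)). Qed.

Let eps := (M + 2) * sq.
Let a j := dx * Dp dx (yd_of dx Y) j.

Lemma a_ge0 j : 0 <= a j.
Proof. by rewrite /a mulr_ge0// ltW. Qed.

Lemma a_le j : a j <= eps.
Proof.
rewrite /a /eps Dp_yd// mulrDr mulr1 (_ : M + 2 = 1 + (M + 1)); last by ring.
rewrite mulrDl mul1r; apply: lerD => //; apply: le_trans _ (inc_z j).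
by apply: ler_wpM2l; [exact: ltW|exact: ler_norm].
Qed.

(** Three displacements: from the grid point to [x], from the step function to the affine
    interpolation of [zeta], and from the latter to [zeta] on the line. *)
Lemma yd_dist x : `|yd_of dx Y (idx dx x) - y_of X x| <= eps + e.
Proof.
have /andP[x1 x2] := idx_itv dx0 x; rewrite gridptS in x2.
have h1 := interp_affine_st dx0 (zeta_of Y) x; rewrite normrM (gtr0_norm dx0) in h1.
have h2 := le_trans h1 (inc_z (idx dx x)); rewrite distrC in h2; have h3 := sup_z x.
have h4 : `|gridpt dx (idx dx x) - x| <= sq.
  by rewrite distrC ger0_norm ?subr_ge0//; have := dxsq; lra.
rewrite /yd_of /y_of (_ : _ - _ = (gridpt dx (idx dx x) - x)
  + (st (zeta_of Y) x - interp_affine dx (zeta_of Y) x)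
  + (interp_affine dx (zeta_of Y) x - zeta_of X x)); last by rewrite /st; ring.
apply: le_trans (ler_normD _ _) (lerD _ h3); apply: le_trans (ler_normD _ _) _.
rewrite /eps (_ : M + 2 = 1 + (M + 1)); last by ring.
by rewrite mulrDl mul1r; exact: lerD.
Qed.

Let epsd : eps + (eps + e) <= 2.
Proof. by move: sq_small e1; rewrite -/eps; move: (eps) (e) => u v; lra. Qed.

Let y := y_of X.
Let yM := y_near XE XM.
Let yP := y_isP XE.
Let yc : continuous y := isP_cont yP.
Let f := fx X.
Let h := hx rho X.
Let fd j := U_of Y j * Dp dx (U_of Y) j.
Let hd j := Dp dx (H_of Y) j + rho * rbar_of Y j.
Let f2 : in_L2 f := (fx_L2 XE UV XM).1.
Let h2 : in_L2 h := (hx_L2 rho XE UV XM).1.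
Let del := kdelta eps (eps + e) M.

Let del0 : 0 <= del.
Proof. exact: (kdelta_ge0 M a_ge0 a_le yd_dist). Qed.

Let del_le : del <= cdel * s.
Proof.
have h1 : eps + (eps + e) <= 2 * (M + 2) * s.
  rewrite (_ : eps + (eps + e) = e + 2 * (M + 2) * sq); last by rewrite /eps; ring.
  rewrite (_ : 2 * (M + 2) * s = 2 * (M + 2) * e + 2 * (M + 2) * sq); last by ring.
  by apply: lerD => //; rewrite ler_peMl//; have := M0; lra.
rewrite /del /kdelta (_ : cdel * s = 15 * (2 * (M + 2) * s) * expR (2 * M + 4)).
  by rewrite ler_wpM2r ?expR_ge0// ler_wpM2l.
by rewrite /cdel; ring.
Qed.

Let c00 : 0 <= C0 M. Proof. exact: C0_ge0. Qed.
Let sqdx : Num.sqrt (2 * dx) <= 2 * s.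
Proof.
apply: le_trans (_ : Num.sqrt (2 ^+ 2 * dx) <= _).
  by rewrite ler_wsqrtr// ler_wpM2r ?ltW//; lra.
by rewrite sqrtrM ?sqr_ge0// sqrtr_sqr ger0_norm// ler_wpM2l.
Qed.

Let wi0 (x eta : R) : 0 <= wind dx x eta. Proof. by rewrite /wind. Qed.

Let add_wind (u v x eta : R) : u <= v -> u <= v + wind dx x eta.
Proof. by move=> uv; apply: le_trans uv _; rewrite lerDl. Qed.

Let Gdc x eta : `|g (idx dx eta) (idx dx x) - gk y eta x| <= del * wexp x eta + wind dx x eta.
Proof. exact/add_wind/(g_line dx0 gb gamb rel a_ge0 a_le sq_small yM yd_dist epsd). Qed.
Let Kdc x eta : `|k (idx dx eta) (idx dx x) - gk y eta x| <= del * wexp x eta + wind dx x eta.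
Proof. exact/add_wind/(k_line dx0 kb kapb rel a_ge0 a_le sq_small yM yd_dist epsd). Qed.
Let GAdc x eta : `|gam (idx dx eta) (idx dx x) - kk y eta x| <= del * wexp x eta + wind dx x eta.
Proof. exact: (gam_line dx0 gb gamb rel a_ge0 a_le sq_small yM yd_dist epsd). Qed.
Let KAdc x eta : `|kap (idx dx eta) (idx dx x) - kk y eta x| <= del * wexp x eta + wind dx x eta.
Proof. exact: (kap_line dx0 kb kapb rel a_ge0 a_le sq_small yM yd_dist epsd). Qed.

Let gk0 x eta : `|gk y eta x| <= C0 M * wexp x eta.
Proof. by rewrite ger0_norm ?gk_ge0//; exact: gk_wexp. Qed.
Let kk0 x eta : `|kk y eta x| <= C0 M * wexp x eta.
Proof. by rewrite kk_norm; exact: gk_wexp. Qed.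

Let md (b : int -> int -> R) x : measurable_fun [set: R] (fun eta => b (idx dx eta) (idx dx x)).
Proof. exact: (measurable_st dx0 (fun i => b i (idx dx x))). Qed.

Let mTd (b : int -> int -> R) v :
  measurable_fun [set: R] (fun x => \int[mu]_eta (b (idx dx eta) (idx dx x) * st v eta)).
Proof. exact: (measurable_st dx0 (fun j => \int[mu]_eta (b (idx dx eta) j * st v eta))). Qed.

Let term (b : int -> int -> R) (Kc : R -> R -> R) v p C :
  (forall x, measurable_fun setT (Kc ^~ x)) ->
  (forall x eta, `|b (idx dx eta) (idx dx x) - Kc eta x| <= del * wexp x eta + wind dx x eta) ->
  (forall x eta, `|Kc eta x| <= C0 M * wexp x eta) -> L2_close s C (st v) p ->
  measurable_fun setT (fun x => \int[mu]_eta (Kc eta x * p eta)) ->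
  let D x := \int[mu]_eta (b (idx dx eta) (idx dx x) * st v eta) - \int[mu]_eta (Kc eta x * p eta) in
  [/\ forall x, `|D x| <= C * (12 * cdel + 6 + 4 * C0 M) * s, in_L2 D
    & n2 D <= C * (12 * cdel + 6 + 4 * C0 M) * s].
Proof.
move=> mK dK K0 vp mT D.
have H1 x := op_sup s0 s2 (ltW dx0) del0 c00 sqdx del_le (md b) mK dK K0 vp x.
have [H2 H3] := op_L2 s0 s2 (ltW dx0) del0 c00 dxs del_le (md b) mK dK K0 vp (@mTd b v) mT.
by split.
Qed.

Let K4 : R := 12 * cdel + 6 + 4 * C0 M.

(** Common assembly for [Q] and [R], each the sum of an operator acting on [fx] and one acting on
    [hx]. *)
Let pack (d1 d2 t1 t2 q qd : R -> R) C C' B : qd =1 (fun x => d1 x + d2 x) -> q =1 (fun x => t1 x + t2 x) ->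
  measurable_fun setT qd -> measurable_fun setT q ->
  let D1 x := d1 x - t1 x in let D2 x := d2 x - t2 x in
  [/\ forall x, `|D1 x| <= C * s, in_L2 D1 & n2 D1 <= C * s] ->
  [/\ forall x, `|D2 x| <= C' * s, in_L2 D2 & n2 D2 <= C' * s] ->
  [/\ forall x, `|q x| <= B, in_L2 q & n2 q <= B] -> 0 <= C -> 0 <= C' ->
  sup_close s (C + C' + B) qd q /\ L2_close s (C + C' + B) qd q.
Proof.
move=> /funext E1 /funext E2 mqd mq D1 D2 [a1 a2 a3] [b1 b2 b3] [q1 q2 q3] C_0 C'0.
have B0 : 0 <= B := le_trans (normr_ge0 _) (q1 0).
have BC : B <= C + C' + B by rewrite lerDr addr_ge0.
have CB : (C + C') * s <= (C + C' + B) * s by rewrite ler_wpM2r// lerDl.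
have E : (fun x => qd x - q x) = D1 \+ D2 by apply/funext => x; rewrite E1 E2 /D1 /D2 /=; ring.
have dq2 : in_L2 (fun x => qd x - q x) by rewrite E; exact: L2D.
split; split=> //.
- by move=> x; exact: le_trans BC.
- move=> x; have -> : qd x - q x = D1 x + D2 x by rewrite E1 E2 /D1 /D2; ring.
  by apply: le_trans (ler_normD _ _) _; apply: le_trans (lerD (a1 x) (b1 x)) _; rewrite -mulrDl.
- apply: L2_eq (L2D dq2 q2) _ => x /=; first by rewrite subrK.
- exact: le_trans BC.
- by rewrite E; apply: le_trans (n2D a2 b2) _; apply: le_trans (lerD a3 b3) _; rewrite -mulrDl.
Qed.

Let CfK : 0 <= Cf * K4.
Proof.
rewrite /K4 /Cf /CU /cdel !(mulr_ge0, addr_ge0) ?expR_ge0//; have := M0; lra.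
Qed.
Let ChK : 0 <= Ch * K4.
Proof.
rewrite /K4 /Ch /cdel !(mulr_ge0, addr_ge0) ?expR_ge0//; have := M0; lra.
Qed.

Let mG p : in_L2 p -> measurable_fun setT (fun x => \int[mu]_eta (gk y eta x * p eta)).
Proof.
move=> p2; apply: continuous_measurable_fun; exact: isP_cont (Gf_isP y_mono yM yP p2).
Qed.
Let mK p : in_L2 p -> measurable_fun setT (fun x => \int[mu]_eta (kk y eta x * p eta)).
Proof.
move=> p2; apply: continuous_measurable_fun; exact: isP_cont (Kf_isP y_mono yM yP p2).
Qed.

(** [zsum_st] writes the grid sums as integrals over the line, so [Q_grid] becomes an integral
    operator whose kernel is constant on products of cells. *)
Lemma close_Q : sup_close s CQ (st (Q_grid rho dx W)) (Q_line rho X) /\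
  L2_close s CQ (st (Q_grid rho dx W)) (Q_line rho X).
Proof.
have T1 := term (gk_meas yc) Gdc gk0 close_f (mG f2).
have T2 := term (kk_meas yc) KAdc kk0 close_h (mK h2).
have B := Q_bounds rho XE UV XM y_mono.
have mQ : measurable_fun setT (Q_line rho X).
  by apply: continuous_measurable_fun; exact: isP_cont (Q_isP rho XE UV XM y_mono).
have E : CQ = Cf * K4 + Ch * K4 + C0 M * 4 * cN rho M by rewrite /CQ mulrDl.
rewrite E; apply: pack T1 T2 B CfK ChK => //; [|by move=> x; rewrite (Q_lineE rho XE UV XM)|exact: measurable_st].
by move=> x; rewrite /Q_grid /st /= !zsum_st.
Qed.

Lemma close_R : sup_close s CQ (st (R_grid rho dx W)) (R_line rho X) /\
  L2_close s CQ (st (R_grid rho dx W)) (R_line rho X).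
Proof.
have T1 := term (kk_meas yc) GAdc kk0 close_f (mK f2).
have T2 := term (gk_meas yc) Kdc gk0 close_h (mG h2).
have B := R_bounds rho XE UV XM y_mono.
have mQ : measurable_fun setT (R_line rho X).
  by apply: continuous_measurable_fun; exact: isP_cont (R_isP rho XE UV XM y_mono).
have E : CQ = Cf * K4 + Ch * K4 + C0 M * 4 * cN rho M by rewrite /CQ mulrDl.
rewrite E; apply: pack T1 T2 B CfK ChK => //; [|by move=> x; rewrite (R_lineE rho XE UV XM)|exact: measurable_st].
by move=> x; rewrite /R_grid /st /= !zsum_st.
Qed.

Let slopeE j : Dp dx (yd_of dx Y) j = 1 + Dp dx (zeta_of Y) j.
Proof. exact: Dp_yd. Qed.

Let DpQ j : Dp dx (Q_grid rho dx W) j = (1 + Dp dx (zeta_of Y) j) * R_grid rho dx W j - hd j.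
Proof.
by have [hf hh] := sources_bounded rho dx0 YB; rewrite (Dp_Q dx0 gb kb gamb kapb rel hf hh) slopeE.
Qed.

Let DmR j : Dm dx (R_grid rho dx W) j = (1 + Dp dx (zeta_of Y) j) * Q_grid rho dx W j - fd j.
Proof.
by have [hf hh] := sources_bounded rho dx0 YB; rewrite (Dm_R dx0 gb kb gamb kapb rel hf hh) slopeE.
Qed.

Let weighted v q : sup_close s CQ (st v) q -> L2_close s CQ (st v) q ->
  L2_close s CyQ (st (fun j => (1 + Dp dx (zeta_of Y) j) * v j)) (fun x => yx X x * q x).
Proof.
move=> H1 H2; apply: L2_close_eq (L2_close_D H2 (sup_close_mul_cl2 s0 s2 H1 close_dz)) _ _ => x.
  by rewrite /st; ring.
by rewrite /yx; ring.
Qed.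

Lemma close_dQ : L2_close s CdQ (st (Dp dx (Q_grid rho dx W)))
  (fun x => yx X x * R_line rho X x - hx rho X x).
Proof.
have [H1 H2] := close_R.
apply: L2_close_eq (L2_close_D (weighted H1 H2) (L2_close_Z (-1) close_h)) _ _ => x; last by ring.
by rewrite /st DpQ /hd; ring.
Qed.

Lemma close_dR : L2_close s CdR (st (Dm dx (R_grid rho dx W)))
  (fun x => yx X x * Q_line rho X x - fx X x).
Proof.
have [H1 H2] := close_Q.
apply: L2_close_eq (L2_close_D (weighted H1 H2) (L2_close_Z (-1) close_f)) _ _ => x; last by ring.
by rewrite /st DmR /fd; ring.
Qed.

Let w j := U_of Y j * R_grid rho dx W (j - 1).

(** The index [j - 1] in the equation for [H] makes this Leibniz rule exact and brings in the
    backward difference of [R], the one that [Dm_R] computes. *)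
Let DpW j : Dp dx w j = R_grid rho dx W j * Dp dx (U_of Y) j + U_of Y j * Dm dx (R_grid rho dx W) j.
Proof. by rewrite /w /Dp /Dm addrK; ring. Qed.

Let dw x := R_line rho X x * wderiv (U_of X) x + U_of X x * (yx X x * Q_line rho X x - fx X x).

Lemma close_dw : L2_close s CdW (st (Dp dx w)) dw.
Proof.
have [H1 _] := close_R.
apply: L2_close_eq (L2_close_D (sup_close_mul_cl2 s0 s2 H1 close_du) (sup_close_mul_cl2 s0 s2 close_U close_dR)) _ _ => x //.
by rewrite /st DpW.
Qed.

Lemma UR_isP : is_primitive (fun x => U_of X x * R_line rho X x) dw.
Proof.
have := isP_mul (U_isD UV).1 (R_isP rho XE UV XM y_mono).
by move=> H; apply: isP_eq H _ _ => x //; rewrite /dw; ring.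
Qed.

Let CQ0 : 0 <= CQ. Proof. by have [H _] := close_Q; exact: sup_close_ge0 H. Qed.
Let CU0 : 0 <= CU. Proof. exact: sup_close_ge0 close_U. Qed.
Let CW0 : 0 <= CW.
Proof. by rewrite /CW addr_ge0// ?mulr_ge0//; have := M0; lra. Qed.

Let Us j : `|U_of Y j| <= 3 * CU.
Proof. by have := sup_close_a s2 (gridpt dx j) close_U; rewrite /st idx_gridpt. Qed.
Let Qs j : `|Q_grid rho dx W j| <= 3 * CQ.
Proof. by have [H _] := close_Q; have := sup_close_a s2 (gridpt dx j) H; rewrite /st idx_gridpt. Qed.
Let Rs j : `|R_grid rho dx W j| <= 3 * CQ.
Proof. by have [H _] := close_R; have := sup_close_a s2 (gridpt dx j) H; rewrite /st idx_gridpt. Qed.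

Let inc_du j : dx * `|Dp dx (U_of Y) j| <= (M + 1) * s.
Proof. by apply: le_trans (inc_u j) _; apply: Csq; rewrite addr_ge0. Qed.

(** Controls the discrepancy between [R] at [j - 1] and at [j]. *)
Let inc_R j : dx * `|Dm dx (R_grid rho dx W) j| <= CW * s.
Proof.
rewrite -{1}(gtr0_norm dx0) -normrM.
have -> : dx * Dm dx (R_grid rho dx W) j = a j * Q_grid rho dx W j - U_of Y j * (dx * Dp dx (U_of Y) j).
  by rewrite DmR /a slopeE /fd; ring.
rewrite (_ : CW * s = ((M + 2) * s) * (3 * CQ) + (3 * CU) * ((M + 1) * s)); last by rewrite /CW; ring.
apply: le_trans (ler_normB _ _) _; apply: lerD; rewrite normrM; apply: ler_pM => //.
  rewrite (ger0_norm (a_ge0 j)); apply: le_trans (a_le j) _; rewrite /eps.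
  by apply: Csq; have := M0; lra.
by rewrite normrM (gtr0_norm dx0).
Qed.

Lemma w_sup x : `|interp_affine dx w x - U_of X x * R_line rho X x| <= CsW * s.
Proof.
set j := idx dx x; have h1 := interp_affine_st dx0 w x.
have h3 : `|dx * st (Dp dx w) x| <= ((M + 1) * (3 * CQ) + 3 * CU * CW) * s.
  rewrite /st -/j DpW mulrDr; apply: le_trans (ler_normD _ _) _.
  rewrite [X in _ <= X]mulrDl; apply: lerD.
    rewrite mulrCA normrM (mulrC (M + 1)) -mulrA; apply: ler_pM => //.
    by rewrite normrM (gtr0_norm dx0).
  rewrite mulrCA normrM -mulrA; apply: ler_pM => //.
  by rewrite normrM (gtr0_norm dx0).
have [H1 _] := close_R; have h4 := sup_close_d (sup_close_mul s2 close_U H1) x.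
have h5 : `|U_of Y j * (dx * Dm dx (R_grid rho dx W) j)| <= 3 * CU * CW * s.
  by rewrite normrM -mulrA; apply: ler_pM => //; rewrite normrM (gtr0_norm dx0).
have E : st w x = st (U_of Y) x * st (R_grid rho dx W) x - U_of Y j * (dx * Dm dx (R_grid rho dx W) j).
  rewrite /st -/j /w /Dm; field; exact: lt0r_neq0.
rewrite (_ : _ - _ = (interp_affine dx w x - st w x)
  + ((st (U_of Y) x * st (R_grid rho dx W) x - U_of X x * R_line rho X x)
     - U_of Y j * (dx * Dm dx (R_grid rho dx W) j))); last by rewrite E; ring.
apply: le_trans (ler_normD _ _) _; rewrite /CsW [X in _ <= X]mulrDl.
apply: lerD; first exact: le_trans h1 h3.
rewrite mulrDl; apply: le_trans (ler_normB _ _) _; exact: lerD.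
Qed.

Lemma vector_fields_close : let D := interp dx (grid_field rho dx W).1 - line_field rho X in
  in_E D /\ En D <= C_lip * s.
Proof.
have N1 (v : int -> R) : Dp dx (fun j => - v j) = fun j => -1 * Dp dx v j.
  by apply/funext => j; rewrite /Dp; ring.
have NP (F p : R -> R) : is_primitive F p -> is_primitive (fun x => - F x) (fun x => -1 * p x).
  by move=> /(isP_Z (-1)) H; apply: isP_eq H _ _ => x //; rewrite mulN1r.
have c1 : L2_close s (M + 1) (st (Dp dx (U_of Y))) (wderiv (U_of X)) := close_du.
have [V1 n1] := compV dx0 (U_isD UV).1 c1 sup_u.
have cQ : L2_close s (`|-1| * CQ) (st (fun j => - Q_grid rho dx W j)) (fun x => - Q_line rho X x).
  have [_ H] := close_Q; apply: L2_close_eq (L2_close_Z (-1) H) _ _ => x; last by rewrite mulN1r.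
  by rewrite /st mulN1r.
have cdQ : L2_close s (`|-1| * CdQ) (st (Dp dx (fun j => - Q_grid rho dx W j)))
    (fun x => -1 * (yx X x * R_line rho X x - hx rho X x)).
  by rewrite N1; have H := L2_close_Z (-1) close_dQ; exact: H.
have [H2 n2_] := compH s2 dx0 dxs (NP _ _ (Q_isP rho XE UV XM y_mono)) cdQ cQ.
have cdw : L2_close s (`|-1| * CdW) (st (Dp dx (fun j => - w j))) (fun x => -1 * dw x).
  by rewrite N1; have H := L2_close_Z (-1) close_dw; exact: H.
have ws x : `|interp_affine dx (fun j => - w j) x - - (U_of X x * R_line rho X x)| <= CsW * s.
  have -> : (fun j => - w j) = (fun j => -1 * w j) by apply/funext => j; rewrite mulN1r.
  rewrite interp_affineZ// mulN1r -opprD normrN.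
  exact: w_sup.
have [V3 n3] := compV dx0 (NP _ _ UR_isP) cdw ws.
have cr : L2_close s (`|- rho| * (M + 1)) (st (fun j => - (rho * Dp dx (U_of Y) j)))
    (fun x => - (rho * wderiv (U_of X) x)).
  apply: L2_close_eq (L2_close_Z (- rho) close_du) _ _ => x; last by rewrite mulNr.
  by rewrite /st mulNr.
have r2 : in_L2 (fun x => st (fun j => - (rho * Dp dx (U_of Y) j)) x - - (rho * wderiv (U_of X) x)).
  exact: L2B (L2_close_a2 cr) (L2_close_b2 cr).
have Er : rbar_of (interp dx (grid_field rho dx W).1 - line_field rho X) =
    fun x => st (fun j => - (rho * Dp dx (U_of Y) j)) x - - (rho * wderiv (U_of X) x).
  apply/funext => x; rewrite -[LHS]/(interp_const dx (fun j => - (rho * Dp dx (U_of Y) j)) x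
    - - (rho * wderiv (U_of X) x)).
  by rewrite interp_constE.
move=> D; split; first by split=> //; rewrite Er.
have ED : En D = nV (fun x => interp_affine dx (U_of Y) x - U_of X x)
  + nH (fun x => interp_affine dx (fun j => - Q_grid rho dx W j) x - - Q_line rho X x)
  + nV (fun x => interp_affine dx (fun j => - w j) x - - (U_of X x * R_line rho X x))
  + n2 (fun x => st (fun j => - (rho * Dp dx (U_of Y) j)) x - - (rho * wderiv (U_of X) x)).
  by rewrite /En Er.
rewrite ED (_ : C_lip * s = (2 * s + (M + 1) * s) + (`|-1| * CQ + 4 * (`|-1| * CdQ)) * s
  + (CsW * s + `|-1| * CdW * s) + `|- rho| * (M + 1) * s); last by rewrite /C_lip; ring.
apply: lerD; last exact: L2_close_d cr.
apply: lerD; last exact: n3.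
apply: lerD; last exact: n2_.
by apply: le_trans n1 _; rewrite lerD2r ler_wpM2l.
Qed.

End vector_fields_close.

(** * Convergence *)

(** One Euler step for the difference of two curves: [a], [x] are the values at the later time, [b],
    [y] those at the earlier one, [F], [f] the fields; the remainders of both difference quotients
    are displayed. *)
Lemma euler_identity (R : realType) (V : lmodType R) (h : R) (a b x y F f : V) : h != 0 ->
  a - x = (b - y) + h *: ((F - f) + ((h^-1 *: (a - b) - F) - (h^-1 *: (x - y) - f))).
Proof.
move=> hn; set A := h^-1 *: (a - b); set B := h^-1 *: (x - y).
have -> : F - f + (A - F - (B - f)) = A - B.
  by rewrite [- (B - f)]opprD (addrACA A) -(opprD F) [LHS]addrC subrK.
rewrite scalerBr !scalerA divff// !scale1r opprD addrACA [b + _]addrC subrK; congr (_ + _).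
by rewrite opprK addrC addrK.
Qed.

Section Enorm_facts.
Context {R : realType}.
Implicit Types (A B X : state R R) (s t e c : R).

Lemma Enorm_ge0 X : (0 <= Enorm X)%E.
Proof. by rewrite /Enorm /Vnorm /H1norm !adde_ge0 ?Lnorm_ge0 ?poweR_ge0. Qed.

Lemma En_dist A B : in_E A -> in_E B -> `|En A - En B| <= En (A - B).
Proof.
move=> AE BE; have DE := in_EB AE BE.
have h1 := EnD DE BE; rewrite subrK in h1.
have h2 : En B <= En A + En (A - B).
  rewrite -{1}(subrK A B) addrC -(opprB A B) -scaleN1r.
  apply: le_trans (EnD AE (in_EZ (-1) DE)) _.
  by rewrite EnZ// normrN normr1 mul1r.
by move: h1 h2; rewrite ler_norml; move: (En _) (En _) (En _) => u v w *; apply/andP; split; lra.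
Qed.

Lemma Enorm_le X c : in_E X -> (Enorm X <= c%:E)%E -> En X <= c.
Proof. by move=> XE; rewrite EnormE// lee_fin. Qed.

(** Supplies the [M] on which all constants of the comparison depend; local bounds from continuity
    are glued by [cousin]. *)
Lemma curve_bounded T (X : R -> state R R) : 0 <= T -> in_CE T X ->
  exists2 M, 0 <= M & forall t, 0 <= t <= T -> En (X t) <= M.
Proof.
move=> T0 [XE Xc].
have I t : 0 <= t <= T -> `[0, T]%classic t by rewrite /= in_itv.
have [M HM] : exists M, forall t, 0 <= t <= T -> En (X t) <= M.
  apply: (@cousin R (fun a b => exists M, forall t, a <= t <= b -> En (X t) <= M) 0 T T0).
    move=> a b d _ _ _ _ [c1 H1] [c2 H2]; exists (Num.max c1 c2) => t /andP[at_ td].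
    rewrite le_max; have [tb|bt] := leP t b; first by rewrite H1// at_.
    by rewrite (H2 t) ?orbT// (ltW bt).
  move=> t tT; have [d d0 Hd] := (curve_continuousP _ _ Enorm_ge0).1 Xc t (I t tT) 1 ltr01.
  exists d => // a b a0 at_ tb bT ad bd; exists (1 + En (X t)) => s /andP[as_ sb].
  have sT : 0 <= s <= T by rewrite (le_trans a0 as_) (le_trans sb bT).
  have h1 := Hd s (I s sT) ltac:(by rewrite ltr_norml; apply/andP; split; lra).
  have h2 := Enorm_le (in_EB (XE s (I s sT)) (XE t (I t tT))) h1.
  have := En_dist (XE s (I s sT)) (XE t (I t tT)); rewrite ler_norml => /andP[_].
  by move: h2; move: (En _) (En _) (En _) => u v w *; lra.
exists M => //; apply: le_trans (En_ge0 (X 0)) (HM 0 _).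
by rewrite lexx.
Qed.

End Enorm_facts.

(** * The error on one grid *)

Section one_grid.
Context {R : realType}.
Variables (rho T : R) (X0 : state R R) (X : R -> state R R).
Hypothesis T0 : 0 <= T.
Hypothesis hX : line_solution rho T X0 X.
Variable M : R.
Hypothesis XM : forall t, 0 <= t <= T -> En (X t) <= M.
Variables (dx : R) (Y0 : state int R) (K0 : kernels R) (Z : R -> state int R * kernels R).
Hypothesis dx0 : 0 < dx.
Hypothesis HB : in_B dx (Y0, K0).
Hypothesis HZ : grid_solution rho dx (Y0, K0) Z.
Implicit Types (s t : R).

Let J0 : set R := `[0, +oo[%classic.
Let IT t : 0 <= t <= T -> `[0, T]%classic t. Proof. by rewrite /= in_itv. Qed.
Let IT' t : `[0, T]%classic t -> 0 <= t <= T. Proof. by rewrite /= in_itv. Qed.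

Let Zfin : forall t, J0 t -> in_Ed dx (Z t).1 /\ in_Kd dx (Z t).2. Proof. by case: HZ. Qed.
Let Zc : curve_continuous (fullnorm dx) J0 Z. Proof. by case: HZ. Qed.

Let dx9 : 0 < 9 + dx. Proof. exact: ltr_wpDl. Qed.

Lemma interp_in_E t : 0 <= t -> in_E (interp dx (Z t).1).
Proof. by move=> t0; have [c [B _]] := solution_bounded dx0 Zfin t0; have [] := interp_E dx0 B. Qed.

Let near_interp t e : 0 <= t -> 0 < e -> exists2 d, 0 < d & forall s, 0 <= s -> `|s - t| < d ->
  in_E (interp dx (Z s).1 - interp dx (Z t).1) /\
  En (interp dx (Z s).1 - interp dx (Z t).1) <= e.
Proof.
move=> t0 e0; have e9 : 0 < e / (9 + dx) by rewrite divr_gt0.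
have [d d0 Hd] := Z_near dx0 Zc t0 e9; exists d => // s ss st.
have [B _] := Hd s ss st; rewrite -interpB//; have [h1 h2] := interp_E dx0 B.
by split=> //; apply: le_trans h2 _; rewrite mulrC divfK// lt0r_neq0.
Qed.

Lemma interp_in_CE : in_CE T (fun t => interp dx (Z t).1).
Proof.
split; first by move=> t /IT' /andP[t0 _]; exact: interp_in_E.
apply/(curve_continuousP _ _ Enorm_ge0) => t /IT' /andP[t0 tT] e e0.
have [d d0 Hd] := near_interp t0 e0; exists d => // s /IT' /andP[ss _] st.
by have [h1 h2] := Hd s ss st; rewrite EnormE// lee_fin.
Qed.

Let XE t : 0 <= t <= T -> in_E (X t).
Proof. by case: hX => [[h _] _ _ _] tT; apply: h; exact: IT. Qed.

Let XC : curve_continuous Enorm `[0, T] X. Proof. by case: hX => [[_ h] _ _ _]. Qed.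

Let near_X t e : 0 <= t <= T -> 0 < e -> exists2 d, 0 < d & forall s, 0 <= s <= T -> `|s - t| < d ->
  En (X s - X t) <= e.
Proof.
move=> tT e0; have [d d0 Hd] := (curve_continuousP _ _ Enorm_ge0).1 XC t (IT tT) e e0.
exists d => // s sT st; apply: Enorm_le; first by apply: in_EB; exact: XE.
by apply: Hd => //; exact: IT.
Qed.

Definition err t := En (interp dx (Z t).1 - X t).

Lemma err_continuous t x : 0 <= t <= T -> 0 < x -> exists2 d, 0 < d &
  forall s, 0 <= s <= T -> `|s - t| < d -> `|err s - err t| <= x.
Proof.
move=> tT x0; have x2 : 0 < x / 2 by lra.
case/andP: (tT) => t0 _.
have [d1 d10 H1] := near_interp t0 x2; have [d2 d20 H2] := near_X tT x2.
exists (Num.min d1 d2) => [|s sT]; first by rewrite lt_min d10.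
rewrite lt_min => /andP[s1 s2]; case/andP: (sT) => s0 _.
have [D1 E1] := H1 s s0 s1; have E2 := H2 s sT s2.
have Ds := in_EB (interp_in_E s0) (XE sT); have Dt := in_EB (interp_in_E t0) (XE tT).
apply: le_trans (En_dist Ds Dt) _.
rewrite (_ : _ - _ = (interp dx (Z s).1 - interp dx (Z t).1) - (X s - X t)).
  by apply: le_trans (EnB D1 (in_EB (XE sT) (XE tT))) _; lra.
by rewrite !opprD addrACA.
Qed.

(** The absolute value supplies the nonnegativity that the Gronwall argument asks for. *)
Let L := `|C_lip rho M|.
Hypothesis small : 8 * ((M + 2) * Num.sqrt dx) <= 1.

Lemma field_close t : 0 <= t <= T -> err t <= 1 ->
  let D := interp dx (grid_field rho dx (Z t)).1 - line_field rho (X t) in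
  in_E D /\ En D <= L * (err t + Num.sqrt dx).
Proof.
move=> tT e1; case/andP: (tT) => t0 _.
have [c [B [gb kb gamb kapb]]] := solution_bounded dx0 Zfin t0.
have [_ mono _ lf] := hX; have [[UV _ _ _] _] := lf t (IT tT).
have rel := residuals_vanish dx0 T0 HB HZ tT.
have H := @vector_fields_close R rho M dx c (Z t).1 (g_of (Z t).2) (k_of (Z t).2) (gamma_of (Z t).2)
  (kappa_of (Z t).2) (X t) dx0 B gb kb gamb kapb rel
  (fun j => slopes_ge0 dx0 T0 HB HZ j tT) (XE tT) UV (XM tT) (mono t (IT tT)) e1 small.
rewrite -fullE in H; have [h1 h2] := H; split=> //.
apply: le_trans h2 _; rewrite ler_wpM2r ?ler_norm// addr_ge0 ?sqrtr_ge0//.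
exact: En_ge0.
Qed.

(** Both curves are differentiable in E, so over a short time the error is the old one plus [s - t]
    times the difference of the fields and two remainders; the triangle inequality concludes, and
    the norm is never differentiated. *)
Lemma err_dini t x : 0 <= t < T -> err t <= 1 -> 0 < x -> exists2 d, 0 < d &
  forall s, t < s -> s <= T -> s < t + d ->
    err s <= err t + (s - t) * (L * err t + L * Num.sqrt dx + x).
Proof.
move=> /andP[t0 tT] e1 x0; have tT' : 0 <= t <= T by rewrite t0 ltW.
(* Interpolation multiplies norms by at most [9 + dx], so the grid remainder is taken smaller by
   that factor. *)
have x1 : 0 < x / 2 / (9 + dx) by rewrite divr_gt0//; lra.
have x2 : 0 < x / 2 by lra.
have J0t : J0 t by rewrite /J0/= in_itv/= t0.
have [_ _ _ Zd] := HZ; have [_ _ _ lf] := hX; have [lfE Xd] := lf t (IT tT').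
have [d1 d10 H1] := curve_derivativeP (Zd t J0t) x1.
have [d2 d20 H2] := curve_derivativeP Xd x2.
exists (Num.min d1 d2) => [|s ts sT]; first by rewrite lt_min d10.
move=> sd; have s1 : `|s - t| < d1.
  by rewrite gtr0_norm ?subr_gt0// ltrBlDl (lt_le_trans sd)// lerD2l ge_min lexx.
have s2 : `|s - t| < d2.
  by rewrite gtr0_norm ?subr_gt0// ltrBlDl (lt_le_trans sd)// lerD2l ge_min lexx orbT.
have s0 : 0 <= s by exact: le_trans (ltW ts).
have sT' : 0 <= s <= T by rewrite s0.
have st : s != t by rewrite gt_eqF.
have J0s : J0 s by rewrite /J0/= in_itv/= s0.
have [B _] := fullnorm_le dx0 (H1 s J0s st s1).
have [r1E r1] := interp_E dx0 B.
have r2E : in_E ((s - t)^-1 *: (X s - X t) - line_field rho (X t)).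
  by apply: in_EB => //; apply: in_EZ; apply: in_EB; exact: XE.
have r2 := Enorm_le r2E (H2 s (IT sT') st s2).
have [FE F] := field_close tT' e1.
set h := s - t in r1E r1 r2E r2 *; have h0 : 0 < h by rewrite subr_gt0.
have hn : h != 0 by rewrite gt_eqF.
set F' := interp dx (grid_field rho dx (Z t)).1 - line_field rho (X t) in FE F.
set r1' := interp dx _ in r1E r1; set r2' := _ *: _ - _ in r2E r2.
have At := in_EB (interp_in_E t0) (XE tT').
have E : interp dx (Z s).1 - X s = (interp dx (Z t).1 - X t) + h *: (F' + (r1' - r2')).
  rewrite /F' /r1' /r2'.
  have -> : interp dx (h^-1 *: (Z s - Z t) - grid_field rho dx (Z t)).1 =
      h^-1 *: (interp dx (Z s).1 - interp dx (Z t).1) - interp dx (grid_field rho dx (Z t)).1.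
    rewrite -[(_ - _).1]/(h^-1 *: ((Z s).1 - (Z t).1) - (grid_field rho dx (Z t)).1).
    by rewrite interpB// interpZ// interpB.
  exact: euler_identity.
rewrite /err E; have rE := in_EB r1E r2E; have FrE := in_ED FE rE.
apply: le_trans (EnD At (in_EZ h FrE)) _; rewrite lerD2l EnZ// (gtr0_norm h0).
apply: ler_wpM2l; first exact: ltW.
apply: le_trans (EnD FE rE) _; rewrite -mulrDr; apply: lerD => //.
apply: le_trans (EnB r1E r2E) _.
have : (9 + dx) * (x / 2 / (9 + dx)) = x / 2 by rewrite mulrC divfK// lt0r_neq0.
by move: r1 r2; move: (En _) (En _) (_ / _ / _) => u v w; lra.
Qed.

Lemma err_bound eta t : 0 < eta ->
  (err 0 + L * Num.sqrt dx + eta) * expR ((L + 1) * T) <= 1 ->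
  0 <= t <= T -> err t <= (err 0 + L * Num.sqrt dx + eta) * expR ((L + 1) * T).
Proof.
move=> eta0 H tT.
have L0 : 0 <= L by exact: normr_ge0.
apply: (@dini_gronwall R err T L (L * Num.sqrt dx) eta T0 L0 _ eta0 (En_ge0 _)
  err_continuous err_dini H t tT).
by rewrite mulr_ge0// sqrtr_ge0.
Qed.

End one_grid.

Section convergence.
Context {R : realType}.

Lemma in_B_in_E (dx : R) Y K : 0 < dx -> in_B dx (Y, K) -> in_E (interp dx Y).
Proof.
move=> dx0 [[Yfin _] _ _ _ _].
have B : Ed_bound dx Y (fine (Ednorm dx Y)).
  by apply: (Ednorm_bound dx0); rewrite fineK// ge0_fin_numE ?Ednorm_ge0.
by have [] := interp_E dx0 B.
Qed.

End convergence.

Theorem theorem6p1 (R : realType) (rho T : R) (hrho : 0 <= rho) (hT : 0 < T)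
  (X0 : state R R) (X : R -> state R R)
  (hX0 : in_E X0) (hX : line_solution rho T X0 X)
  (dx : nat -> R) (dx_gt0 : forall n, 0 < dx n)
  (dx_cvg : dx n @[n --> \oo] --> (0 : R))
  (Y0 : nat -> state int R) (K0 : nat -> kernels R)
  (hB : forall n, in_B (dx n) (Y0 n, K0 n))
  (hH : forall n, H_normalized (dx n) (Y0 n))
  (hinit : Enorm (interp (dx n) (Y0 n) - X0) @[n --> \oo] --> 0%E)
  (Z : nat -> R -> state int R * kernels R)
  (hZ : forall n, grid_solution rho (dx n) (Y0 n, K0 n) (Z n)) :
  (forall n, in_CE T (fun t => interp (dx n) (Z n t).1)) /\
  ereal_sup [set Enorm (interp (dx n) (Z n t).1 - X t) | t in `[0, T]]
    @[n --> \oo] --> 0%E.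
Proof.
have T0 : 0 <= T := ltW hT.
split; first by move=> n; exact: (interp_in_CE T (dx_gt0 n) (hZ n)).
have [CE _ X00 _] := hX; have [XE _] := CE.
have [M M0 XM] := curve_bounded T0 CE.
have I t : 0 <= t <= T -> `[0, T]%classic t by rewrite /= in_itv.
have I0 : `[0, T]%classic (0 : R) by apply: I; rewrite lexx.
apply: le_cvg0.
  move=> n; apply: le_trans (Enorm_ge0 (interp (dx n) (Z n 0).1 - X 0)) _.
  by apply: ereal_sup_ubound; exists 0.
move=> x x0; pose L := `|C_lip rho M|; pose G := expR ((L + 1) * T).
have L0 : 0 <= L by exact: normr_ge0.
have G0 : 0 < G by exact: expR_gt0.
(* Three equal shares of the allowed error before amplification by [G]: initial error, [L * sqrt dx]
   and the slack of the Gronwall lemma. The minimum with 1 keeps the error in the range where the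
   fields are comparable. *)
pose del := Num.min x 1 / G / 3.
have del0 : 0 < del by rewrite !divr_gt0// lt_min x0 ltr01.
(* The first bound gives [L * sqrt dx <= del], the second the smallness of [dx] that the kernel
   estimates require. *)
pose sd := Num.min (del / (L + 1)) (8 * (M + 2))^-1.
have M2 : 0 < 8 * (M + 2) by lra.
have L1_ : 0 < L + 1 by lra.
have sd0 : 0 < sd by rewrite lt_min divr_gt0// invr_gt0.
have near1 : \forall n \near \oo, (Enorm (interp (dx n) (Y0 n) - X0)%R <= del%:E)%E.
  exact: cvg0_le hinit del0.
have near2 : \forall n \near \oo, `|dx n| <= sd ^+ 2.
  have sd2 : 0 < sd ^+ 2 by exact: exprn_gt0.
  by move/cvgrPdist_le: dx_cvg => /(_ _ sd2); apply: filterS => n; rewrite sub0r normrN.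
apply: filterS2 near1 near2 => n n1 n2.
have dx0 := dx_gt0 n; rewrite (gtr0_norm dx0) in n2.
have sq : Num.sqrt (dx n) <= sd.
  by rewrite -[leRHS](ger0_norm (ltW sd0)) -sqrtr_sqr ler_wsqrtr.
have sq0 : 0 <= Num.sqrt (dx n) by exact: sqrtr_ge0.
have small : 8 * ((M + 2) * Num.sqrt (dx n)) <= 1.
  rewrite mulrA; apply: le_trans (_ : 8 * (M + 2) * (8 * (M + 2))^-1 <= 1).
    by rewrite ler_pM2l//; apply: le_trans sq _; rewrite ge_min lexx orbT.
  by rewrite mulfV// lt0r_neq0.
have Lsq : L * Num.sqrt (dx n) <= del.
  apply: le_trans (_ : (L + 1) * (del / (L + 1)) <= _); last by rewrite mulrC divfK// lt0r_neq0.
  by apply: ler_pM => //; [lra|apply: le_trans sq _; rewrite ge_min lexx].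
have err0 : err X (dx n) (Z n) 0 <= del.
  have YE := in_B_in_E dx0 (hB n).
  have h1 := Enorm_le (in_EB YE hX0) n1.
  (* [X 0] and [X0] agree only as elements of E, so their distance enters the triangle inequality as
     0. *)
  have h2 : En (X 0 - X0) <= 0.
    by apply: Enorm_le; [apply: in_EB => //; exact: XE|rewrite X00].
  have [_ _ Z00 _] := hZ n.
  rewrite /err Z00 /= (_ : _ - _ = (interp (dx n) (Y0 n) - X0) - (X 0 - X0)).
    have D2 := in_EB (XE 0 I0) hX0.
    by apply: le_trans (EnB (in_EB YE hX0) D2) _; move: h1 h2; move: (En _) (En _) => u v; lra.
  by rewrite opprB addrA subrK.
have total : (err X (dx n) (Z n) 0 + L * Num.sqrt (dx n) + del) * G <= Num.min x 1.
  apply: le_trans (_ : (del + del + del) * G <= _).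
    by rewrite ler_pM2r// lerD2r; exact: lerD.
  rewrite (_ : del + del + del = Num.min x 1 / G); last by rewrite /del; move: (_ / G) => u; lra.
  by rewrite divfK// lt0r_neq0.
apply: ub_ereal_sup => _ [t /= tT <-]; rewrite in_itv/= in tT.
have YE : in_E (interp (dx n) (Z n t).1).
  by apply: (interp_in_E dx0 (hZ n)); case/andP: tT.
rewrite EnormE ?lee_fin; last by apply: in_EB => //; apply: XE; exact: I.
have h := @err_bound R rho T X0 X T0 hX M XM (dx n) (Y0 n) (K0 n) (Z n) dx0 (hB n) (hZ n) small del t del0.
apply: le_trans (h _ tT) _; first by apply: le_trans total _; rewrite ge_min lexx orbT.
by apply: le_trans total _; rewrite ge_min lexx.
Qed.
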